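(* Suppose that $\xi,\eta\in\mathbb{C}$ satisfy $|\Im\eta|<\Re\xi$ and $|\Im\xi|<\Re\eta$. Let $\sigma\in\mathbb{C}$ be such that $|\Re\sigma|<\frac14$. Then $$Y_0\left(\tfrac12(\xi^2+\eta^2)\right)=\frac{i}{2^{1/2}\pi^2}\int_{\sigma-i\infty}^{\sigma+i\infty}\Gamma\left(\tfrac14-s\right)\Gamma\left(\tfrac14+s\right)\left[D_{2s-\frac12}((1-i)\xi)D_{-2s-\frac12}((1-i)\eta)+D_{2s-\frac12}((1+i)\xi)D_{-2s-\frac12}((1+i)\eta)\right]ds .$$
   Context: $\Gamma$ is Euler's gamma function and $Y_\nu$ is the Bessel function of the second kind, $Y_\nu=-\frac{i}{2}\left(H_\nu^{(1)}-H_\nu^{(2)}\right)$ with $H_\nu^{(1)},H_\nu^{(2)}$ the Hankel functions. The assumptions on $\xi,\eta$ imply $\Re(\xi^2+\eta^2)>0$, and $Y_0(z)$ is evaluated in the sector $-\frac{\pi}{2}<\arg z<\frac{\pi}{2}$ (principal branch). The parabolic cylinder function is $D_\nu(z)=2^{\nu/2}e^{-z^2/4}U\left(-\frac{\nu}{2},\frac12,\frac12z^2\right)$ (with $\arg(z^2)=2\arg z$, extended analytically), which is analytic for all $\nu,z\in\mathbb{C}$; here $U(a,b,z)$ is the confluent hypergeometric function of the second kind, the solution of $z w''+(b-z)w'-aw=0$ with $U(a,b,z)\sim z^{-a}$ as $z\to\infty$ in $|\arg z|\le\frac32\pi-\delta$ ($\delta>0$). The integral is along the vertical line through $\sigma$.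 *)

(* Defs.v *)
(* Stdlib reals with Coquelicot's complex numbers [C] and improper integrals. *)
From Stdlib Require Import Reals ZArith ClassicalEpsilon.
From Coquelicot Require Import Coquelicot.

Open Scope C_scope.

Definition Cexp (z : C) : C :=
  ((exp (Re z) * cos (Im z))%R, (exp (Re z) * sin (Im z))%R).

Definition Csin (z : C) : C := (Cexp (Ci * z) - Cexp (- Ci * z)) / (2 * Ci).

(* Principal argument, in (-PI, PI]; the value at 0 is irrelevant. *)
Definition Carg (z : C) : R :=
  if Rle_dec 0 (Im z)
  then acos (Re z / Cmod z) else (- acos (Re z / Cmod z))%R.

Definition Clog (z : C) : C := (ln (Cmod z), Carg z).

Definition Cpower (z w : C) : C := Cexp (w * Clog z).

Definition CSeries (u : nat -> C) : C :=
  (Series (fun k => Re (u k)), Series (fun k => Im (u k))).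

Fixpoint pochhammer (z : C) (n : nat) : C :=
  match n with
  | O => 1
  | S m => pochhammer z m * (z + INR m)
  end.

(* Second Euler integral, convergent for Re z > 0. *)
Definition Euler_integral (z : C) : C :=
  let f (t : R) : C := Cpower t (z - 1) * exp (- t) in
  (RInt_gen (fun t => Re (f t)) (at_right 0) (Rbar_locally p_infty),
   RInt_gen (fun t => Im (f t)) (at_right 0) (Rbar_locally p_infty)).

(* Continued to the left by Gamma (z + n) = pochhammer z n * Gamma z, where
   n is 0 if Re z > 0, and otherwise the least n with Re z + n > 0.  At the
   poles 0, -1, -2, ... the denominator is 0 and the value is 0 (as / 0 = 0),
   so that / Gamma is everywhere the reciprocal gamma function. *)
Definition Gamma (z : C) : C :=
  let n := Z.to_nat (up (- Re z)) in
  Euler_integral (z + INR n) / pochhammer z n.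

(* The powers are principal: z ranges over the plane cut along (-oo, 0]. *)
Definition BesselJ (nu z : C) : C :=
  Cpower (z / 2) nu *
  CSeries (fun k => (- (z * z / 4)) ^ k
                    / (INR (fact k) * Gamma (nu + INR k + 1))).

(* H^(1) and H^(2).  The limit in the order is superfluous when nu is not an
   integer and is the usual definition when it is. *)
Definition Hankel1 (nu z : C) : C :=
  C_lim (fun mu => (BesselJ (- mu) z - Cexp (- Ci * PI * mu) * BesselJ mu z)
                   / (Ci * Csin (PI * mu))) nu.

Definition Hankel2 (nu z : C) : C :=
  C_lim (fun mu => (BesselJ (- mu) z - Cexp (Ci * PI * mu) * BesselJ mu z)
                   / (- Ci * Csin (PI * mu))) nu.

Definition BesselY (nu z : C) : C :=
  - (Ci / 2) * (Hankel1 nu z - Hankel2 nu z).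

(* U(a, b, .) lives on the Riemann surface of the logarithm, which is
   parametrised by l = log z in C: [u l] stands for U(a, b, e^l), with
   arg z = Im l.  Since d/dl = z d/dz, the functions u1 and u2 are the first
   and second derivatives with respect to z. *)
Definition is_TricomiU (a b : C) (u : C -> C) : Prop :=
  (exists u1 u2 : C -> C, forall l : C,
     is_derive (K := C_AbsRing) (V := C_NormedModule) u l (Cexp l * u1 l) /\
     is_derive (K := C_AbsRing) (V := C_NormedModule) u1 l (Cexp l * u2 l) /\
     Cexp l * u2 l + (b - Cexp l) * u1 l - a * u l = 0) /\
  (* U(a, b, z) / z^(-a) tends to 1, uniformly in each of the sectors *)
  (forall delta : R, (0 < delta)%R ->
   forall eps : R, (0 < eps)%R ->
   exists M : R, forall l : C,
     (Rabs (Im l) <= 3 / 2 * PI - delta)%R -> (M < Re l)%R ->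
     (Cmod (u l / Cexp (- a * l) - 1) < eps)%R).

Definition TricomiU (a b : C) : C -> C :=
  epsilon (inhabits (fun _ : C => RtoC 0)) (is_TricomiU a b).

(* For z <> 0: log (z^2 / 2) with arg (z^2) = 2 arg z. *)
Definition parabolic_cylinder_formula (nu z : C) : C :=
  Cpower 2 (nu / 2) * Cexp (- (z * z / 4))
  * TricomiU (- nu / 2) (1 / 2) (2 * Clog z - ln 2).

(* D_nu(z), entire in z; the formula does not make sense at z = 0, where D_nu
   is extended by continuity. *)
Definition parabolic_cylinder (nu z : C) : C :=
  if Ceq_dec z 0
  then C_lim (parabolic_cylinder_formula nu) 0
  else parabolic_cylinder_formula nu z.

(* The integral of f from sigma - i oo to sigma + i oo along the vertical line
   through sigma converges to I (both ends tending to infinity independently). *)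
Definition is_vertical_integral (f : C -> C) (sigma I : C) : Prop :=
  is_RInt_gen (V := C_R_NormedModule)
    (fun t : R => f (sigma + Ci * t) * Ci)
    (Rbar_locally m_infty) (Rbar_locally p_infty) I.

(* Main.v *)
Require Import Defs.
From Stdlib Require Import Reals ZArith Lra Lia FunctionalExtensionality ClassicalEpsilon.
From Coquelicot Require Import Coquelicot.

(** The idea is to collapse the contour integral to a one-variable Laplace integral in zeta =
    (xi^2 + eta^2) / 2, and to recognise the latter by its differential equation and its behaviour
    at zeta = 0. Throughout, S = 2 s, and Gamma-type integrals are written over the whole line,
    with t = e^p.

    The cylinder functions. For 0 < Re la < 1, D_(-la) (z) = e^(-z^2/4) mf la z / Gamma (la),
    where mf la z is the integral of e^(la p - e^(2p)/2 - z e^p) ([cylinder_eq]). As U is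
    specified by its equation and its asymptotics only, this rests on uniqueness
    ([Tricomi_unique]): the asymptotics hold beyond |arg z| = PI, and comparing them on the rays
    arg z = PI and arg z = -PI excludes the second solution. Rotating the path by PI/4 absorbs the
    factors 1 - i ([mf_rot]), and in the coordinates q - p and (p + q)/2 the product of the two
    rotated integrals becomes the bilateral Laplace transform [Ah] at S of a function [Amp] on the
    line ([Mf_prod]).

    The integral in s. By Beta integrals, Gamma (1/4 - s) Gamma (1/4 + s) divided by Gamma (1/2 -
    S) Gamma (1/2 + S) is a superposition of the exponentials e^(i S th y), where th y ranges over
    (-PI/2, PI/2) ([gamma_ratio]). The conditions on xi and eta are what makes [Amp] continue to
    the strip |Im z| < PI/2 with exponential decay ([kap_lower]). Moving the line of integration
    of [Ah] towards the edge of the strip and integrating by parts twice bounds [Ah] ([Ah_bound])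
    just well enough for the integral in s to converge absolutely. Multiplying [Ah] by e^(i S th
    y) amounts to translating [Amp] by - i th y, so Fourier inversion evaluates the integral in s
    ([kint_Ah]). What remains is the integral of Mf 1 along a branch of a hyperbola; it depends on
    zeta alone ([hyp_normal]), and undoing the change of coordinates turns it into a multiple of
    the Laplace integral Phi 0 zeta ([term_minus_Phi]).

    Identification. The function p |-> Phi 0 (zeta e^p) solves f'' = - zeta^2 e^(2p) f, which is
    Bessel's equation of order 0 ([Phi_ode]), and is affine in p up to O (e^(p/2)) at minus
    infinity ([Phi_asym]). Picard iteration from minus infinity therefore expands it in the powers
    of - zeta^2/4, the coefficients involving harmonic numbers ([Phi_series]). On the other hand,
    Y_0 = (2/PI) dJ_mu/dmu at mu = 0 has the classical expansion of the same shape ([BesselY_0]).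
    Comparison shows that the first of the two terms of the integrand contributes a multiple of
    the Hankel function J_0 + i Y_0. The second term is the complex conjugate of the first at
    conjugate arguments ([term_plus_conj]) and contributes the same multiple of - J_0 + i Y_0, so
    that J_0 cancels in the sum. *)

Open Scope R_scope.
Open Scope C_scope.

(** * Complex numbers and continuity *)

Lemma C_ext (z w : C) : Re z = Re w -> Im z = Im w -> z = w.
Proof. destruct z, w; unfold Re, Im; simpl; intros; subst; reflexivity. Qed.
Ltac c_ring := apply C_ext; unfold Re, Im; simpl; ring.
Ltac c_field := apply C_ext; unfold Re, Im; simpl; field.
Ltac triangle := eapply Rle_trans; [apply Cmod_triangle|].
Lemma Ci_sq : Ci * Ci = - (1).
Proof. c_ring. Qed.

Lemma im_le_Cmod (c : C) : (Rabs (Im c) <= Cmod c)%R.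
Proof. eapply Rle_trans; [|apply Rmax_Cmod]. apply Rmax_r. Qed.

Lemma Cmod_le_re_im (c : C) : (Cmod c <= Rabs (Re c) + Rabs (Im c))%R.
Proof.
  assert (H : c = RtoC (Re c) + Ci * RtoC (Im c)).
  { destruct c; c_ring. }
  rewrite H at 1. triangle.
  rewrite Cmod_mult, Cmod_Ci, !Cmod_R. lra.
Qed.

Lemma Cexp_plus (z w : C) : Cexp (z + w) = Cexp z * Cexp w.
Proof.
  apply C_ext; unfold Cexp, Re, Im; simpl; rewrite exp_plus, ?cos_plus, ?sin_plus; ring.
Qed.

Lemma Cmod_Cexp (z : C) : Cmod (Cexp z) = exp (Re z).
Proof.
  unfold Cexp, Cmod; simpl. set (a := Re z). set (b := Im z).
  replace (_ + _)%R with ((exp a)²).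
  - apply sqrt_Rsqr. left; apply exp_pos.
  - unfold Rsqr. transitivity (exp a * exp a * ((sin b)² + (cos b)²))%R.
    rewrite sin2_cos2; ring. unfold Rsqr; ring.
Qed.

Lemma Cexp_0 : Cexp 0 = 1.
Proof. apply C_ext; unfold Cexp, Re, Im; simpl; rewrite exp_0, ?cos_0, ?sin_0; ring. Qed.

Lemma Cexp_nz (z : C) : Cexp z <> 0.
Proof. intro H. apply (f_equal Cmod) in H. rewrite Cmod_Cexp, Cmod_0 in H.
  generalize (exp_pos (Re z)); lra. Qed.

Lemma Cexp_opp (z : C) : Cexp (- z) = / Cexp z.
Proof.
  assert (H : Cexp z * Cexp (- z) = 1). { rewrite <- Cexp_plus, <- Cexp_0. f_equal. ring. }
  rewrite <- (Cmult_1_r (/ Cexp z)), <- H. field. apply Cexp_nz.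
Qed.

Lemma Cexp_R (x : R) : Cexp x = RtoC (exp x).
Proof. apply C_ext; unfold Cexp, Re, Im; simpl; rewrite ?cos_0, ?sin_0; ring. Qed.

Lemma Cexp_conj (z : C) : Cexp (Cconj z) = Cconj (Cexp z).
Proof. apply C_ext; unfold Cexp, Cconj, Re, Im; simpl; rewrite ?cos_neg, ?sin_neg; ring. Qed.

Lemma RtoC_nz (x : R) : x <> 0%R -> RtoC x <> 0.
Proof. intros H E. apply RtoC_inj in E. auto. Qed.

Section Cont.
Context {U : UniformSpace}.
Implicit Types f g : U -> C.
Lemma ct_pair (f g : U -> R) x : continuous f x -> continuous g x ->
  continuous (fun y => (f y, g y) : C) x.
Proof.
  intros Hf Hg P [e He]. generalize (Hf _ (locally_ball (f x) e)) (Hg _ (locally_ball (g x) e)).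
  intros H1 H2. unfold filtermap in *. generalize (filter_and _ _ H1 H2). apply filter_imp.
  intros y [A B]. apply He. split; assumption.
Qed.
Lemma ct_re f x : continuous f x -> continuous (fun y => Re (f y)) x.
Proof. intros H. apply (continuous_comp f Re); auto. apply continuous_fst. Qed.
Lemma ct_im f x : continuous f x -> continuous (fun y => Im (f y)) x.
Proof. intros H. apply (continuous_comp f Im); auto. apply continuous_snd. Qed.
Lemma ct_R (f : U -> R) x : continuous f x -> continuous (fun y => RtoC (f y)) x.
Proof. intros; apply ct_pair; auto. apply continuous_const. Qed.
Lemma ct_plus f g x : continuous f x -> continuous g x -> continuous (fun y => f y + g y) x.
Proof. intros Hf Hg. apply ct_pair; apply (continuous_plus (V := R_NormedModule)).
  apply (ct_re f); auto. apply (ct_re g); auto. apply (ct_im f); auto. apply (ct_im g); auto. Qed.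
Lemma ct_opp f x : continuous f x -> continuous (fun y => - f y) x.
Proof. intros Hf. apply ct_pair; apply (continuous_opp (V := R_NormedModule)).
  apply (ct_re f); auto. apply (ct_im f); auto. Qed.
Lemma ct_minus f g x : continuous f x -> continuous g x -> continuous (fun y => f y - g y) x.
Proof. intros. apply ct_plus; auto. apply ct_opp; auto. Qed.
Lemma ct_Rmult (f g : U -> R) x : continuous f x -> continuous g x -> continuous (fun y => (f y * g y)%R) x.
Proof. apply (continuous_mult (K := R_AbsRing)). Qed.
Lemma ct_Rplus (f g : U -> R) x : continuous f x -> continuous g x -> continuous (fun y => (f y + g y)%R) x.
Proof. apply (continuous_plus (V := R_NormedModule)). Qed.
Lemma ct_Ropp (f : U -> R) x : continuous f x -> continuous (fun y => (- f y)%R) x.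
Proof. apply (continuous_opp (V := R_NormedModule)). Qed.
Lemma ct_Rminus (f g : U -> R) x : continuous f x -> continuous g x -> continuous (fun y => (f y - g y)%R) x.
Proof. apply (continuous_minus (V := R_NormedModule)). Qed.
Lemma ct_Rcomp (h : R -> R) (f : U -> R) x : continuous f x -> continuous h (f x) -> continuous (fun y => h (f y)) x.
Proof. intros. apply (continuous_comp f h); auto. Qed.
Lemma ct_Rinv (f : U -> R) x : continuous f x -> f x <> 0%R -> continuous (fun y => (/ f y)%R) x.
Proof. intros H N. apply (ct_Rcomp Rinv); auto. apply continuous_Rinv; auto. Qed.
Lemma ct_Rdiv (f g : U -> R) x : continuous f x -> continuous g x -> g x <> 0%R -> continuous (fun y => (f y / g y)%R) x.
Proof. intros. apply ct_Rmult; auto. apply ct_Rinv; auto. Qed.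
Lemma ct_exp (f : U -> R) x : continuous f x -> continuous (fun y => exp (f y)) x.
Proof. intros. apply (ct_Rcomp exp); auto. apply (ex_derive_continuous (V := R_NormedModule)). auto_derive; auto. Qed.
Lemma ct_mult f g x : continuous f x -> continuous g x -> continuous (fun y => f y * g y) x.
Proof.
  intros Hf Hg. generalize (ct_re _ _ Hf) (ct_im _ _ Hf) (ct_re _ _ Hg) (ct_im _ _ Hg). intros.
  apply (ct_pair (fun y => Re (f y) * Re (g y) - Im (f y) * Im (g y))%R (fun y => Re (f y) * Im (g y) + Im (f y) * Re (g y))%R);
  [apply ct_Rminus|apply ct_Rplus]; apply ct_Rmult; auto.
Qed.
Lemma ct_Cexp f x : continuous f x -> continuous (fun y => Cexp (f y)) x.
Proof.
  intros Hf. generalize (ct_re _ _ Hf) (ct_im _ _ Hf). intros A B.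
  apply ct_pair; apply ct_Rmult.
  - apply ct_exp; auto.
  - apply (ct_Rcomp cos); auto. apply (ex_derive_continuous (V := R_NormedModule)). auto_derive; auto.
  - apply ct_exp; auto.
  - apply (ct_Rcomp sin); auto. apply (ex_derive_continuous (V := R_NormedModule)). auto_derive; auto.
Qed.
Lemma Cinv_re_im (z : C) : / z = (Re z / (Re z ^ 2 + Im z ^ 2), - Im z / (Re z ^ 2 + Im z ^ 2))%R.
Proof. reflexivity. Qed.
Lemma re2im2_nz (z : C) : z <> 0 -> (Re z ^ 2 + Im z ^ 2 <> 0)%R.
Proof. intros N H. apply N. rewrite <- Cmod2_alt in H. apply Cmod_eq_0.
  apply Rsqr_0_uniq. unfold Rsqr. lra. Qed.
Lemma ct_inv f x : continuous f x -> f x <> 0 -> continuous (fun y => / f y) x.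
Proof.
  intros Hf N. generalize (ct_re _ _ Hf) (ct_im _ _ Hf) (re2im2_nz _ N). intros.
  apply (ct_pair (fun y => Re (f y) / (Re (f y) ^ 2 + Im (f y) ^ 2))%R (fun y => - Im (f y) / (Re (f y) ^ 2 + Im (f y) ^ 2))%R);
  apply ct_Rdiv; auto; try (apply ct_Ropp; auto);
  apply (ct_Rplus (fun y => Re (f y) ^ 2)%R (fun y => Im (f y) ^ 2)%R); simpl; repeat apply ct_Rmult; auto; apply continuous_const.
Qed.
Lemma ct_div f g x : continuous f x -> continuous g x -> g x <> 0 -> continuous (fun y => f y / g y) x.
Proof. intros. apply ct_mult; auto. apply ct_inv; auto. Qed.
Lemma ct_Cmod f x : continuous f x -> continuous (fun y => Cmod (f y)) x.
Proof.
  intros Hf. generalize (ct_re _ _ Hf) (ct_im _ _ Hf). intros.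
  apply (ct_Rcomp sqrt (fun y => (Re (f y) ^ 2 + Im (f y) ^ 2)%R)).
  apply (ct_Rplus (fun y => Re (f y) ^ 2)%R (fun y => Im (f y) ^ 2)%R); simpl; repeat apply ct_Rmult; auto; apply continuous_const.
  apply continuous_sqrt.
Qed.
End Cont.

Lemma ct_fst2 (x : R * R) : continuous (fun p : R * R => fst p) x.
Proof. apply continuous_fst. Qed.
Lemma ct_snd2 (x : R * R) : continuous (fun p : R * R => snd p) x.
Proof. apply continuous_snd. Qed.

(** A hook of the tactic [ct], redefined below when further functions are shown continuous. *)
Ltac ct_ext := fail.
Ltac ct1 := first [assumption | lazymatch goal with
 | |- continuous (fun y => y) _ => apply continuous_id
 | |- continuous (fun _ => ?c) _ => apply continuous_const
 | |- continuous (fun y => Cplus _ _) _ => apply ct_plus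
 | |- continuous (fun y => Cmult _ _) _ => apply ct_mult
 | |- continuous (fun y => Cminus _ _) _ => apply ct_minus
 | |- continuous (fun y => Copp _) _ => apply ct_opp
 | |- continuous (fun y => Cdiv _ _) _ => apply ct_div; [ | | try (apply RtoC_nz; lra) ]
 | |- continuous (fun y => Cinv _) _ => apply ct_inv
 | |- continuous (fun y => Cexp _) _ => apply ct_Cexp
 | |- continuous (fun y => RtoC _) _ => apply ct_R
 | |- continuous (fun y => Re _) _ => apply ct_re
 | |- continuous (fun y => Im _) _ => apply ct_im
 | |- continuous (fun y => Cmod _) _ => apply ct_Cmod
 | |- continuous (fun y => Rplus _ _) _ => apply ct_Rplus
 | |- continuous (fun y => Rmult _ _) _ => apply ct_Rmult
 | |- continuous (fun y => Rminus _ _) _ => apply ct_Rminus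
 | |- continuous (fun y => Ropp _) _ => apply ct_Ropp
 | |- continuous (fun y => Rdiv _ _) _ => apply ct_Rdiv; [ | | try lra ]
 | |- continuous (fun y => Rinv _) _ => apply ct_Rinv
 | |- continuous (fun y => exp _) _ => apply ct_exp
 | |- continuous (fun y => fst y) _ => apply ct_fst2
 | |- continuous (fun y => snd y) _ => apply ct_snd2
 | |- continuous RtoC _ => apply (ct_R (fun y => y))
 | |- continuous Cexp _ => apply (ct_Cexp (fun y => y))
 | |- continuous exp _ => apply (ct_exp (fun y => y))
 | |- continuous Ropp _ => apply (ct_Ropp (fun y => y))
 | |- continuous Copp _ => apply (ct_opp (fun y => y))
 | |- continuous (Rmult ?k) _ => apply (ct_Rmult (fun _ => k) (fun y => y))
 | |- continuous (Rplus ?k) _ => apply (ct_Rplus (fun _ => k) (fun y => y))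
 | |- continuous (Rminus ?k) _ => apply (ct_Rminus (fun _ => k) (fun y => y))
 | |- continuous (Cmult ?k) _ => apply (ct_mult (fun _ => k) (fun y => y))
 | |- continuous (Cplus ?k) _ => apply (ct_plus (fun _ => k) (fun y => y))
 | |- continuous (Cminus ?k) _ => apply (ct_minus (fun _ => k) (fun y => y))
 | |- continuous fst _ => apply continuous_fst
 | |- continuous snd _ => apply continuous_snd
 | |- _ => ct_ext
 end].
Ltac ct := repeat ct1.

Lemma ct_eps (f : R -> C) (x : R) : continuous f x <->
  (forall eps, 0 < eps -> exists d, 0 < d /\ forall y, Rabs (y - x) < d -> Cmod (f y - f x) < eps)%R.
Proof.
  split.
  - intros H eps He.
    assert (Hg : continuous (fun y => Cmod (f y - f x)) x) by (ct; apply continuous_const).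
    assert (E : (0 < eps)%R) by auto.
    destruct (Hg (ball (Cmod (f x - f x)) (mkposreal eps E)) (locally_ball _ _)) as [d Hd].
    exists d. split; [apply cond_pos|]. intros y Hy. specialize (Hd y Hy).
    unfold ball in Hd; simpl in Hd; unfold AbsRing_ball, abs, minus, plus, opp in Hd; simpl in Hd.
    replace (f x - f x) with (RtoC 0) in Hd by ring. rewrite Cmod_0 in Hd.
    apply Rabs_def2 in Hd. lra.
  - intros H P [e He]. destruct (H e (cond_pos e)) as [d [Hd0 Hd]].
    exists (mkposreal d Hd0). intros y Hy. apply He.
    specialize (Hd y Hy). split; unfold ball; simpl; unfold AbsRing_ball, abs, minus, plus, opp; simpl.
    + eapply Rle_lt_trans; [|exact Hd]. generalize (re_le_Cmod (f y - f x)). unfold Re; simpl; auto.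
    + eapply Rle_lt_trans; [|exact Hd]. generalize (im_le_Cmod (f y - f x)). unfold Im; simpl; auto.
Qed.

(** * Integrals of complex functions over an interval *)

Definition CInt (f : R -> C) (a b : R) : C := RInt (V := C_R_CompleteNormedModule) f a b.
Definition rcont (f : R -> C) := forall x, continuous f x.
Definition cont2 (f : R -> R -> C) := forall p : R * R, continuous (fun q : R * R => f (fst q) (snd q)) p.

Lemma ci_ex (f : R -> C) a b : rcont f -> ex_RInt (V := C_R_CompleteNormedModule) f a b.
Proof. intros H. apply ex_RInt_continuous. intros; apply H. Qed.
Lemma ci_correct (f : R -> C) a b : rcont f -> is_RInt (V := C_R_CompleteNormedModule) f a b (CInt f a b).
Proof. intros H. apply RInt_correct. apply ci_ex; auto. Qed.
Lemma is_ci (f : R -> C) a b (l : C) : is_RInt (fun x => Re (f x)) a b (Re l) -> is_RInt (fun x => Im (f x)) a b (Im l) ->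
  is_RInt (V := C_R_NormedModule) f a b l.
Proof.
  intros H1 H2. apply (is_RInt_ext (V := C_R_NormedModule) (fun x => (Re (f x), Im (f x)))).
  intros; destruct (f x); reflexivity.
  replace l with (Re l, Im l) by (destruct l; reflexivity).
  apply (is_RInt_fct_extend_pair (U := R_NormedModule) (V := R_NormedModule)); auto.
Qed.
Lemma ci_re (f : R -> C) a b : rcont f -> Re (CInt f a b) = RInt (fun x => Re (f x)) a b.
Proof. intros H. symmetry. apply is_RInt_unique.
  apply (is_RInt_fct_extend_fst (U := R_NormedModule) (V := R_NormedModule) f). apply (ci_correct f); auto. Qed.
Lemma ci_im (f : R -> C) a b : rcont f -> Im (CInt f a b) = RInt (fun x => Im (f x)) a b.
Proof. intros H. symmetry. apply is_RInt_unique.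
  apply (is_RInt_fct_extend_snd (U := R_NormedModule) (V := R_NormedModule) f). apply (ci_correct f); auto. Qed.
Lemma is_ci_unique (f : R -> C) a b (l : C) : is_RInt (V := C_R_NormedModule) f a b l -> CInt f a b = l.
Proof. intros; apply (is_RInt_unique (V := C_R_CompleteNormedModule)); auto. Qed.
Lemma is_ci_scal (c : C) (f : R -> C) a b (l : C) : is_RInt (V := C_R_NormedModule) f a b l ->
  is_RInt (V := C_R_NormedModule) (fun x => c * f x) a b (c * l).
Proof.
  intros H.
  generalize (is_RInt_fct_extend_fst (U := R_NormedModule) (V := R_NormedModule) f a b l H).
  generalize (is_RInt_fct_extend_snd (U := R_NormedModule) (V := R_NormedModule) f a b l H). intros H2 H1.
  apply is_ci.
  - apply (is_RInt_ext (fun x => minus (scal (Re c) (Re (f x))) (scal (Im c) (Im (f x))))).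
    intros; rewrite re_mult; reflexivity. rewrite re_mult. apply (is_RInt_minus (V := R_NormedModule)); apply (is_RInt_scal (V := R_NormedModule)); auto.
  - apply (is_RInt_ext (fun x => plus (scal (Re c) (Im (f x))) (scal (Im c) (Re (f x))))).
    intros; rewrite im_mult; reflexivity. rewrite im_mult. apply (is_RInt_plus (V := R_NormedModule)); apply (is_RInt_scal (V := R_NormedModule)); auto.
Qed.
Lemma ci_scal (c : C) (f : R -> C) a b : rcont f -> CInt (fun x => c * f x) a b = c * CInt f a b.
Proof. intros. apply is_ci_unique, is_ci_scal, ci_correct; auto. Qed.
Lemma ci_plus (f g : R -> C) a b : rcont f -> rcont g -> CInt (fun x => f x + g x) a b = CInt f a b + CInt g a b.
Proof. intros. apply is_ci_unique. apply (is_RInt_plus (V := C_R_NormedModule) f g); apply ci_correct; auto. Qed.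
Lemma ci_minus (f g : R -> C) a b : rcont f -> rcont g -> CInt (fun x => f x - g x) a b = CInt f a b - CInt g a b.
Proof. intros. apply is_ci_unique. apply (is_RInt_minus (V := C_R_NormedModule) f g); apply ci_correct; auto. Qed.
Lemma ci_norm (f : R -> C) (g : R -> R) a b : (a <= b)%R -> rcont f -> (forall x, continuous g x) ->
  (forall x, a <= x <= b -> Cmod (f x) <= g x)%R -> (Cmod (CInt f a b) <= RInt g a b)%R.
Proof.
  intros Hab Hf Hg H.
  rewrite Cmod_norm. apply (norm_RInt_le (V := C_R_NormedModule) f g a b); auto.
  intros x Hx. apply H in Hx. rewrite Cmod_norm in Hx. exact Hx.
  apply (ci_correct f); auto. apply (RInt_correct (V := R_CompleteNormedModule)). apply (ex_RInt_continuous (V := R_CompleteNormedModule)). intros; apply Hg.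
Qed.
Lemma ci_Chasles (f : R -> C) a b c : rcont f -> CInt f a b + CInt f b c = CInt f a c.
Proof. intros H. apply (RInt_Chasles (V := C_R_CompleteNormedModule) f); apply ci_ex; auto. Qed.
Lemma ci_ext (f g : R -> C) a b : (forall x, f x = g x) -> CInt f a b = CInt g a b.
Proof. intros H. apply (RInt_ext (V := C_R_CompleteNormedModule)). intros; apply H. Qed.
Lemma ci_const (c : C) a b : CInt (fun _ => c) a b = RtoC (b - a) * c.
Proof. unfold CInt. rewrite (RInt_const (V := C_R_CompleteNormedModule)). apply scal_R_Cmult. Qed.

(** Componentwise, so that real calculus applies to each part. *)
Definition rder (f : R -> C) (x : R) (l : C) :=
  is_derive (fun t => Re (f t)) x (Re l) /\ is_derive (fun t => Im (f t)) x (Im l).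
Lemma ci_FTC (f df : R -> C) a b : (forall x, (Rmin a b <= x <= Rmax a b)%R -> rder f x (df x)) -> rcont df -> CInt df a b = f b - f a.
Proof.
  intros H1 H2. apply is_ci_unique. apply is_ci.
  - replace (Re (f b - f a)) with (minus (Re (f b)) (Re (f a))) by (destruct (f a), (f b); reflexivity).
    apply (is_RInt_derive (V := R_CompleteNormedModule) (fun t => Re (f t))). intros; apply H1; auto. intros; apply ct_re, H2.
  - replace (Im (f b - f a)) with (minus (Im (f b)) (Im (f a))) by (destruct (f a), (f b); reflexivity).
    apply (is_RInt_derive (V := R_CompleteNormedModule) (fun t => Im (f t))). intros; apply H1; auto. intros; apply ct_im, H2.
Qed.

Lemma rcont_slice1 f x : cont2 f -> rcont (fun y => f x y).
Proof. intros H y. apply (continuous_comp_2 (fun _ : R => x) (fun y : R => y) f). apply continuous_const. apply continuous_id. apply (H (x, y)). Qed.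
Lemma rcont_slice2 f y : cont2 f -> rcont (fun x => f x y).
Proof. intros H x. apply (continuous_comp_2 (fun x : R => x) (fun _ : R => y) f). apply continuous_id. apply continuous_const. apply (H (x, y)). Qed.

Lemma slice2 (f : R -> R -> R) x y : (forall x y, continuity_2d_pt f x y) -> continuous (fun x => f x y) x.
Proof. intros Hf. apply continuity_pt_filterlim. intros e He. destruct (Hf x y (mkposreal e He)) as [d Hd].
  exists d. split. apply cond_pos. intros z [_ Hz]. apply Hd. exact Hz. rewrite Rminus_diag, Rabs_R0. apply cond_pos. Qed.
Lemma ex_sl2 (f : R -> R -> R) y a b : (forall x y, continuity_2d_pt f x y) -> ex_RInt (fun x => f x y) a b.
Proof. intros. apply (ex_RInt_continuous (V := R_CompleteNormedModule)). intros; apply slice2; auto. Qed.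
Lemma RInt_par_cont_le (f : R -> R -> R) a b : (forall x y, continuity_2d_pt f x y) -> (a <= b)%R -> forall y, continuous (fun y => RInt (fun x => f x y) a b) y.
Proof.
  intros Hf Hab y. apply continuity_pt_filterlim. intros e He.
  assert (He' : (0 < e / (b - a + 1))%R) by (apply Rdiv_lt_0_compat; lra).
  destruct (uniform_continuity_2d f a b (y - 1) (y + 1) (fun x y _ _ => Hf x y) (mkposreal _ He')) as [d Hd].
  simpl in Hd. exists (Rmin d (1/2)). split. apply Rmin_pos; [apply cond_pos|lra].
  intros z [_ Hz]. simpl in Hz. unfold Rdist in *. simpl. unfold Rdist.
  assert (Hz1 : (Rabs (z - y) < d)%R) by (eapply Rlt_le_trans; [exact Hz|apply Rmin_l]).
  assert (Hz2 : (Rabs (z - y) < 1/2)%R) by (eapply Rlt_le_trans; [exact Hz|apply Rmin_r]).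
  apply Rabs_def2 in Hz2.
  replace (RInt (fun x => f x z) a b - RInt (fun x => f x y) a b)%R with (RInt (fun x => minus (f x z) (f x y)) a b).
  2:{ apply (RInt_minus (V := R_CompleteNormedModule)); apply ex_sl2; auto. }
  apply Rle_lt_trans with ((b - a) * (e / (b - a + 1)))%R.
  - apply abs_RInt_le_const; auto.
    apply (ex_RInt_minus (V := R_CompleteNormedModule)); apply ex_sl2; auto.
    intros x Hx. left. apply Hd; try lra; try (rewrite Rminus_diag, Rabs_R0; apply cond_pos).
  - apply Rmult_lt_reg_r with (b - a + 1)%R; [lra|]. field_simplify; nra.
Qed.
Lemma RInt_par_cont (f : R -> R -> R) a b y : (forall x y, continuity_2d_pt f x y) -> continuous (fun y => RInt (fun x => f x y) a b) y.
Proof.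
  intros Hf. destruct (Rle_dec a b). apply RInt_par_cont_le; auto.
  apply (continuous_ext (fun y => opp (RInt (fun x => f x y) b a))).
  intros; apply (opp_RInt_swap (V := R_CompleteNormedModule)), ex_sl2; auto.
  apply (continuous_opp (V := R_NormedModule)). apply RInt_par_cont_le; auto; lra.
Qed.

(** As functions of b, both sides vanish at b = a and have the same derivative, by continuity of
    the inner integral in its parameter. *)
Lemma RInt_Fubini (f : R -> R -> R) a b c d : (forall x y, continuity_2d_pt f x y) ->
  RInt (fun y => RInt (fun x => f x y) a b) c d = RInt (fun x => RInt (fun y => f x y) c d) a b.
Proof.
  intros Hf.
  set (g := fun b => RInt (fun y => RInt (fun x => f x y) a b) c d).
  assert (Hg : forall x, is_derive g x (RInt (fun y => f x y) c d)).
  { intros x. unfold g.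
    assert (D : forall x y, is_derive (fun u => RInt (fun x => f x y) a u) x (f x y)).
    { intros x0 y0. apply (is_derive_RInt (V := R_NormedModule) (fun x => f x y0) _ a).
      apply filter_forall. intros z. apply (RInt_correct (V := R_CompleteNormedModule)), ex_sl2; auto. apply (slice2 f); auto. }
    rewrite (RInt_ext (fun y => f x y) (fun t => Derive (fun u => RInt (fun x => f x t) a u) x)).
    2: intros; symmetry; apply is_derive_unique, D.
    apply is_derive_RInt_param.
    - apply filter_forall. intros z t _. exists (f z t). apply D.
    - intros t _. apply (continuity_2d_pt_ext f). intros; symmetry; apply is_derive_unique, D. apply Hf.
    - apply filter_forall. intros z. apply (ex_RInt_continuous (V := R_CompleteNormedModule)). intros; apply (RInt_par_cont f); auto. }
  symmetry. change (RInt (fun y => RInt (fun x => f x y) a b) c d) with (g b). rewrite <- (Rminus_0_r (g b)).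
  replace 0%R with (g a).
  2:{ unfold g. rewrite (RInt_ext _ (fun _ => 0%R)). rewrite (RInt_const (V := R_CompleteNormedModule)). unfold scal; simpl; unfold mult; simpl; ring.
      intros. apply (RInt_point (V := R_CompleteNormedModule)). }
  apply is_RInt_unique. apply (is_RInt_derive (V := R_CompleteNormedModule) g).
  intros; apply Hg.
  intros x _. apply (RInt_par_cont (fun y x => f x y)).
  intros u v e. destruct (Hf v u e) as [dd Hd]. exists dd. intros; apply Hd; auto.
Qed.
Lemma cont2_2d (f : R -> R -> C) : cont2 f -> (forall x y, continuity_2d_pt (fun x y => Re (f x y)) x y) /\ (forall x y, continuity_2d_pt (fun x y => Im (f x y)) x y).
Proof.
  intros H. split; intros x y; apply continuity_2d_pt_filterlim.
  apply (ct_re (fun q : R * R => f (fst q) (snd q)) (x, y)), H.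
  apply (ct_im (fun q : R * R => f (fst q) (snd q)) (x, y)), H.
Qed.
Lemma ci_par_cont (f : R -> R -> C) a b : cont2 f -> rcont (fun y => CInt (fun x => f x y) a b).
Proof.
  intros H y. destruct (cont2_2d f H) as [H1 H2].
  apply (continuous_ext (fun y => (RInt (fun x => Re (f x y)) a b, RInt (fun x => Im (f x y)) a b) : C)).
  - intros z. rewrite <- ci_re, <- ci_im by (apply (rcont_slice2 f); auto). destruct (CInt _ a b); reflexivity.
  - apply ct_pair; apply (RInt_par_cont (fun x y => _ (f x y))); auto.
Qed.
Lemma cont2_swap f : cont2 f -> cont2 (fun x y => f y x).
Proof. intros H p. apply (continuous_comp_2 (fun q : R * R => snd q) (fun q => fst q) f). apply continuous_snd. apply continuous_fst. apply (H (snd p, fst p)). Qed.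
Lemma ci_Fubini (f : R -> R -> C) a b c d : cont2 f ->
  CInt (fun y => CInt (fun x => f x y) a b) c d = CInt (fun x => CInt (fun y => f x y) c d) a b.
Proof.
  intros H. destruct (cont2_2d f H) as [H1 H2].
  assert (A : rcont (fun y => CInt (fun x => f x y) a b)) by (apply ci_par_cont; auto).
  assert (B : rcont (fun x => CInt (fun y => f x y) c d)) by (apply (ci_par_cont (fun y x => f x y)), cont2_swap; auto).
  apply C_ext; rewrite ?ci_re, ?ci_im by auto.
  - rewrite (RInt_ext _ (fun y => RInt (fun x => Re (f x y)) a b)) by (intros; apply ci_re, (rcont_slice2 f); auto).
    rewrite (RInt_ext (fun x => Re (CInt _ c d)) (fun x => RInt (fun y => Re (f x y)) c d)) by (intros; apply ci_re, (rcont_slice1 f); auto).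
    apply (RInt_Fubini (fun x y => Re (f x y))); auto.
  - rewrite (RInt_ext _ (fun y => RInt (fun x => Im (f x y)) a b)) by (intros; apply ci_im, (rcont_slice2 f); auto).
    rewrite (RInt_ext (fun x => Im (CInt _ c d)) (fun x => RInt (fun y => Im (f x y)) c d)) by (intros; apply ci_im, (rcont_slice1 f); auto).
    apply (RInt_Fubini (fun x y => Im (f x y))); auto.
Qed.

(** * Complex derivatives *)

Ltac cring := match goal with |- @eq _ ?a ?b => let H := fresh in assert (H : @eq C a b); [ring | exact H] end.
Lemma Csub_nz (w z : C) : w <> z -> w - z <> 0.
Proof. intros H E. apply H. rewrite <- (Cplus_0_r z), <- E. ring. Qed.

(** Caratheodory's form of differentiability: the difference quotient extends continuously. The
    product and chain rules become statements about continuity, without any estimate. *)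
Definition cder (f : C -> C) (z l : C) := exists phi : C -> C,
  continuous phi z /\ phi z = l /\ locally z (fun w : C => f w - f z = phi w * (w - z)).

Lemma cder_cont (f : C -> C) z l : cder f z l -> continuous f z.
Proof.
  intros [p [Hp [_ H]]]. apply (continuous_ext_loc _ (fun w : C => f z + p w * (w - z))).
  revert H. apply filter_imp. intros w Hw. rewrite <- Hw. cring.
  ct; apply continuous_const.
Qed.
Lemma cder_const (c z : C) : cder (fun _ => c) z 0.
Proof. exists (fun _ => 0). split. apply continuous_const. split; auto. apply filter_forall. intros; ring. Qed.
Lemma cder_id z : cder (fun w => w) z 1.
Proof. exists (fun _ => 1). split. apply continuous_const. split; auto. apply filter_forall. intros; ring. Qed.
Lemma cder_plus (f g : C -> C) (z a b : C) : cder f z a -> cder g z b -> cder (fun w => f w + g w) z (a + b).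
Proof. intros [p [A [B D]]] [q [A' [B' D']]]. exists (fun w => p w + q w). split; [ct|]. split; [rewrite B, B'; auto|].
  generalize (filter_and _ _ D D'). apply filter_imp. intros w [H1 H2].
  replace (_ - _) with ((f w - f z) + (g w - g z)) by ring. rewrite H1, H2. ring. Qed.
Lemma cder_mult (f g : C -> C) (z a b : C) : cder f z a -> cder g z b -> cder (fun w => f w * g w) z (a * g z + f z * b).
Proof. intros Hf Hg. generalize (cder_cont _ _ _ Hg). destruct Hf as [p [A [B D]]], Hg as [q [A' [B' D']]]. intros Hg.
  exists (fun w => p w * g w + f z * q w). split; [ct; apply continuous_const|]. split; [rewrite B, B'; auto|].
  generalize (filter_and _ _ D D'). apply filter_imp. intros w [H1 H2].
  replace (_ - _) with ((f w - f z) * g w + f z * (g w - g z)) by ring. rewrite H1, H2. ring. Qed.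
Lemma cder_scal c f z a : cder f z a -> cder (fun w => c * f w) z (c * a).
Proof. intros H. replace (c * a) with (0 * f z + c * a) by ring. apply (cder_mult (fun _ => c)); auto. apply cder_const. Qed.
Lemma cder_opp (f : C -> C) z a : cder f z a -> cder (fun w => - f w) z (- a).
Proof. intros [p [A [B D]]]. exists (fun w => - p w). split; [ct|]. split; [rewrite B; auto|].
  revert D. apply filter_imp. intros w H1. replace (_ - _) with (- (f w - f z)) by ring. rewrite H1. ring. Qed.
Lemma cder_minus (f g : C -> C) (z a b : C) : cder f z a -> cder g z b -> cder (fun w => f w - g w) z (a - b).
Proof. intros. apply cder_plus; auto. apply cder_opp; auto. Qed.
Lemma cder_comp (f g : C -> C) (z a b : C) : cder f (g z) a -> cder g z b -> cder (fun w => f (g w)) z (a * b).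
Proof. intros Hf Hg. generalize (cder_cont _ _ _ Hg). destruct Hf as [p [A [B D]]], Hg as [q [A' [B' D']]]. intros Hg.
  exists (fun w => p (g w) * q w). split. ct. apply (continuous_comp g p); auto. split. rewrite B, B'; auto.
  assert (D2 : locally z (fun w => f (g w) - f (g z) = p (g w) * (g w - g z))) by (apply (Hg _ D)).
  generalize (filter_and _ _ D2 D'). apply filter_imp. intros w [H1 H2]. rewrite H1, H2. ring. Qed.
Lemma cder_ext (f g : C -> C) (z a : C) : (forall w, f w = g w) -> cder f z a -> cder g z a.
Proof. intros E [p [A [B D]]]. exists p. split; auto. split; auto. revert D. apply filter_imp. intros w Hw. rewrite <- !E; exact Hw. Qed.
Lemma cder_eq (f : C -> C) z a b : a = b -> cder f z a -> cder f z b.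
Proof. intros ->; auto. Qed.
Lemma cont_nz (f : C -> C) (z : C) : continuous f z -> f z <> 0 -> locally z (fun w : C => f w <> 0).
Proof.
  intros H N. assert (Hc : continuous (fun w => Cmod (f w)) z) by (ct).
  assert (P : (0 < Cmod (f z))%R) by (apply Cmod_gt_0; auto).
  specialize (Hc _ (locally_ball _ (mkposreal _ P))). unfold filtermap in Hc. revert Hc. apply filter_imp. intros w Hw E.
  unfold ball in Hw; simpl in Hw; unfold AbsRing_ball, abs, minus, plus, opp in Hw; simpl in Hw.
  rewrite E, Cmod_0, Rplus_0_l, Rabs_Ropp, Rabs_pos_eq in Hw; lra.
Qed.
Lemma cder_inv (f : C -> C) z a : cder f z a -> f z <> 0 -> cder (fun w => / f w) z (- a / (f z * f z)).
Proof. intros Hf N. generalize (cder_cont _ _ _ Hf). destruct Hf as [p [A [B D]]]. intros Hf.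
  exists (fun w => - p w / (f w * f z)). split. ct; try apply continuous_const. apply Cmult_neq_0; auto. split. rewrite B; auto.
  generalize (filter_and _ _ D (cont_nz _ _ Hf N)). apply filter_imp. intros w [H1 H2].
  replace (/ f w - / f z) with (- (f w - f z) / (f w * f z)) by (field; auto). rewrite H1. field; auto. Qed.
Lemma cder_div (f g : C -> C) (z a b : C) : cder f z a -> cder g z b -> g z <> 0 -> cder (fun w => f w / g w) z ((a * g z - f z * b) / (g z * g z)).
Proof. intros. apply (cder_eq _ _ (a * / g z + f z * (- b / (g z * g z)))). field; auto.
  apply (cder_mult f (fun w => / g w)); auto. apply cder_inv; auto. Qed.

Lemma carath_R (f h : R -> R) (x l : R) : continuous h x -> h x = l -> locally x (fun y => (f y - f x = h y * (y - x))%R) -> is_derive f x l.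
Proof.
  intros Hc Hl [d Hd]. apply is_derive_Reals. intros e He.
  destruct (Hc _ (locally_ball (h x) (mkposreal e He))) as [d2 Hd2].
  exists (mkposreal _ (Rmin_pos _ _ (cond_pos d) (cond_pos d2))). simpl. intros k Hk Hk2.
  assert (Hb : ball x d (x + k)%R). { unfold ball; simpl; unfold AbsRing_ball, abs, minus, plus, opp; simpl.
    replace (x + k + - x)%R with k by ring. eapply Rlt_le_trans; [exact Hk2|apply Rmin_l]. }
  assert (Hb2 : ball x d2 (x + k)%R). { unfold ball; simpl; unfold AbsRing_ball, abs, minus, plus, opp; simpl.
    replace (x + k + - x)%R with k by ring. eapply Rlt_le_trans; [exact Hk2|apply Rmin_r]. }
  rewrite (Hd _ Hb). specialize (Hd2 _ Hb2). unfold ball in Hd2; simpl in Hd2; unfold AbsRing_ball, abs, minus, plus, opp in Hd2; simpl in Hd2.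
  replace (h (x + k) * (x + k - x) / k - l)%R with (h (x + k) + - h x)%R; auto. rewrite Hl. field; auto.
Qed.
Lemma cder_rder f (a b : C) (t : R) l : cder f (a + t * b) l -> rder (fun t => f (a + t * b)) t (b * l).
Proof.
  intros [p [A [B D]]].
  assert (Hc : continuous (fun s : R => a + s * b) t) by ct.
  assert (Hp : continuous (fun s : R => p (a + s * b) * b) t).
  { apply ct_mult; [apply (continuous_comp (fun s : R => a + s * b) p); auto | ct]. }
  assert (E : locally t (fun s : R => f (a + s * b) - f (a + t * b) = p (a + s * b) * b * (s - t)%R)).
  { generalize (Hc _ D). unfold filtermap. apply filter_imp. intros s Hs. rewrite Hs. rewrite RtoC_minus. ring. }
  split.
  - apply (carath_R _ (fun s => Re (p (a + s * b) * b))). ct. rewrite B, Cmult_comm; auto.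
    revert E; apply filter_imp; intros s Hs. apply (f_equal Re) in Hs. rewrite re_scal_r in Hs. rewrite <- Hs. reflexivity.
  - apply (carath_R _ (fun s => Im (p (a + s * b) * b))). ct. rewrite B, Cmult_comm; auto.
    revert E; apply filter_imp; intros s Hs. apply (f_equal Im) in Hs. rewrite im_scal_r in Hs. rewrite <- Hs. reflexivity.
Qed.
Lemma rder_eq f x a b : a = b -> rder f x a -> rder f x b.
Proof. intros ->; auto. Qed.
Lemma rder_ext f g x a : (forall t, f t = g t) -> rder f x a -> rder g x a.
Proof. intros E [H1 H2]. split; eapply is_derive_ext; try eassumption; intros; simpl; rewrite E; auto. Qed.

Lemma locally_Cmod (z : C) (P : C -> Prop) : locally z P <-> exists d, (0 < d)%R /\ forall w, (Cmod (w - z) < d)%R -> P w.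
Proof.
  split.
  - intros [d Hd]. exists d. split. apply cond_pos. intros w Hw. apply Hd. apply C_NormedModule_mixin_compat1. exact Hw.
  - intros [d [H0 Hd]]. assert (H1 : (0 < d / sqrt 2)%R) by (apply Rdiv_lt_0_compat; auto; apply sqrt_lt_R0; lra).
    exists (mkposreal _ H1). intros w Hw. apply Hd. apply C_NormedModule_mixin_compat2 in Hw.
    eapply Rlt_le_trans; [exact Hw|]. simpl. right. field. apply Rgt_not_eq, sqrt_lt_R0; lra.
Qed.
Lemma ct_epsC (f : C -> C) (z : C) : continuous f z <->
  (forall eps, 0 < eps -> exists d, 0 < d /\ forall w, Cmod (w - z) < d -> Cmod (f w - f z) < eps)%R.
Proof.
  split.
  - intros H eps He. assert (H1 : locally (f z) (fun y => (Cmod (y - f z) < eps)%R)) by (apply locally_Cmod; exists eps; auto).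
    apply H in H1. apply locally_Cmod in H1. exact H1.
  - intros H P HP. apply locally_Cmod in HP. destruct HP as [e [He HP]]. apply locally_Cmod.
    destruct (H e He) as [d [Hd Hd2]]. exists d; split; auto.
Qed.
Lemma cder_eps (f : C -> C) (z l : C) : (forall eps, 0 < eps -> exists d, 0 < d /\ forall h, Cmod h < d -> Cmod (f (z + h)%C - f z - l * h) <= eps * Cmod h)%R -> cder f z l.
Proof.
  intros H. exists (fun w => if Ceq_dec w z then l else (f w - f z) / (w - z)).
  assert (E : (if Ceq_dec z z then l else (f z - f z) / (z - z)) = l) by (destruct (Ceq_dec z z); congruence).
  split; [|split; auto].
  - apply ct_epsC. intros eps He. rewrite E. destruct (H (eps / 2)%R ltac:(lra)) as [d [Hd H']].
    exists d. split; auto. intros w Hw. destruct (Ceq_dec w z). replace (l - l) with (RtoC 0) by ring. rewrite Cmod_0; lra.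
    assert (N : w - z <> 0) by (apply Csub_nz, n).
    replace ((f w - f z) / (w - z) - l) with ((f (z + (w - z)) - f z - l * (w - z)) / (w - z)).
    2:{ replace (z + (w - z)) with w by ring. field; auto. }
    rewrite Cmod_div by auto. specialize (H' _ Hw).
    apply Rmult_lt_reg_r with (Cmod (w - z)). apply Cmod_gt_0; auto. unfold Rdiv. rewrite Rmult_assoc, Rinv_l, Rmult_1_r.
    2: intro A; apply N, Cmod_eq_0; auto.
    eapply Rle_lt_trans; [exact H'|]. apply Rmult_lt_compat_r. apply Cmod_gt_0; auto. lra.
  - apply filter_forall. intros w. destruct (Ceq_dec w z). subst w; cring. match goal with |- @eq _ ?a ?b => change (@eq C a b) end; field.
    apply Csub_nz, n.
Qed.
Lemma eps_cder (f : C -> C) (z l : C) : cder f z l -> (forall eps, 0 < eps -> exists d, 0 < d /\ forall h, Cmod h < d -> Cmod (f (z + h)%C - f z - l * h) <= eps * Cmod h)%R.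
Proof.
  intros [p [A [B D]]] eps He. apply locally_Cmod in D. destruct D as [d1 [Hd1 D]].
  destruct (proj1 (ct_epsC p z) A eps He) as [d2 [Hd2 D2]].
  exists (Rmin d1 d2). split. apply Rmin_pos; auto. intros h Hh.
  assert (E : z + h - z = h) by ring.
  rewrite (D (z + h)). 2: rewrite E; eapply Rlt_le_trans; [exact Hh|apply Rmin_l].
  rewrite E. replace (p (z + h) * h - l * h) with ((p (z + h) - p z) * h) by (rewrite B; ring).
  rewrite Cmod_mult. apply Rmult_le_compat_r. apply Cmod_ge_0. left; apply D2. rewrite E. eapply Rlt_le_trans; [exact Hh|apply Rmin_r].
Qed.

(** The form in which derivatives of parametric integrals are obtained below. *)
Lemma cder_quad (f : C -> C) (z l : C) K d : (0 < d)%R -> (forall h, Cmod h < d -> Cmod (f (z + h)%C - f z - l * h) <= K * (Cmod h * Cmod h))%R -> cder f z l.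
Proof.
  intros Hd H. apply cder_eps. intros eps He.
  assert (HK : (0 < Rabs K + 1)%R) by (generalize (Rabs_pos K); lra).
  exists (Rmin d (eps / (Rabs K + 1))). split. apply Rmin_pos; auto. apply Rdiv_lt_0_compat; auto.
  intros h Hh. eapply Rle_trans; [apply H; eapply Rlt_le_trans; [exact Hh|apply Rmin_l]|].
  rewrite <- Rmult_assoc. apply Rmult_le_compat_r. apply Cmod_ge_0.
  assert (Cmod h <= eps / (Rabs K + 1))%R by (left; eapply Rlt_le_trans; [exact Hh|apply Rmin_r]).
  apply Rle_trans with ((Rabs K + 1) * (eps / (Rabs K + 1)))%R.
  apply Rle_trans with ((Rabs K + 1) * Cmod h)%R. apply Rmult_le_compat_r. apply Cmod_ge_0. generalize (Rle_abs K); lra.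
  apply Rmult_le_compat_l; lra. right; field; lra.
Qed.
Lemma is_derive_cder f (z l : C) : is_derive (K := C_AbsRing) (V := C_NormedModule) f z l <-> cder f z l.
Proof.
  split.
  - intros [_ H]. apply cder_eps. intros eps He. specialize (H z (fun P HP => HP) (mkposreal eps He)).
    assert (H' : locally (T := C_UniformSpace) z (fun y : C => (Cmod (f y - f z - (y - z) * l) <= eps * Cmod (y - z))%R)).
    { apply locally_C. exact H. }
    apply locally_Cmod in H'. destruct H' as [d [Hd H']]. exists d. split; auto. intros h Hh.
    specialize (H' (z + h)). replace (z + h - z) with h in H' by ring. rewrite (Cmult_comm l). auto.
  - intros H. split. apply (is_linear_scal_l (K := C_AbsRing) (V := C_NormedModule)).
    intros x Hx. assert (E : z = x). { exact (is_filter_lim_locally_unique (K := C_AbsRing) (V := AbsRing_NormedModule C_AbsRing) z x Hx). } subst x.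
    intros [eps He]. destruct (eps_cder _ _ _ H eps He) as [d [Hd H']].
    assert (L : locally (T := C_UniformSpace) z (fun y : C => (Cmod (f y - f z - (y - z) * l) <= eps * Cmod (y - z))%R)).
    { apply locally_Cmod. exists d. split; auto. intros w Hw. specialize (H' _ Hw).
      replace (z + (w - z)) with w in H' by ring. rewrite (Cmult_comm (w - z)). auto. }
    apply locally_C in L. exact L.
Qed.

Lemma rder_Cexp_line (z : C) (t : R) : rder (fun t => Cexp (t * z)) t (z * Cexp (t * z)).
Proof.
  split; unfold Cexp, Re, Im; destruct z as [x y]; simpl; auto_derive; auto; unfold Rminus; ring.
Qed.
Lemma unit_exp_le (z : C) (t : R) : (0 <= t <= 1)%R -> (Cmod (Cexp (t * z)) <= exp (Cmod z))%R.
Proof.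
  intros Ht. rewrite Cmod_Cexp, re_scal_l. assert (t * Re z <= Cmod z)%R.
  { generalize (re_le_Cmod z) (Rle_abs (Re z)) (Cmod_ge_0 z). intros.
    apply Rle_trans with (t * Cmod z)%R. apply Rmult_le_compat_l; lra. nra. }
  destruct H. left; apply exp_increasing; auto. rewrite H; lra.
Qed.
Lemma ci_01_bound (f : R -> C) K : rcont f -> (forall t, (0 <= t <= 1)%R -> (Cmod (f t) <= K)%R) -> (Cmod (CInt f 0 1) <= K)%R.
Proof.
  intros Hf H. eapply Rle_trans. apply (ci_norm f (fun _ => K)); auto. lra. intros; apply continuous_const.
  rewrite (RInt_const (V := R_CompleteNormedModule)). unfold scal; simpl; unfold mult; simpl. lra.
Qed.

(** Cexp z - 1 is the integral of z Cexp (t z) over [0, 1]. *)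
Lemma Cexp_taylor0 (z : C) : (Cmod (Cexp z - 1) <= Cmod z * exp (Cmod z))%R.
Proof.
  assert (E : CInt (fun t => z * Cexp (t * z)) 0 1 = Cexp z - 1).
  { rewrite (ci_FTC (fun t => Cexp (t * z))). rewrite Cmult_1_l, Cmult_0_l, Cexp_0; auto.
    intros; apply rder_Cexp_line. intros t; ct. }
  rewrite <- E. apply ci_01_bound. intros t; ct.
  intros t Ht. rewrite Cmod_mult. apply Rmult_le_compat_l. apply Cmod_ge_0. apply unit_exp_le; auto.
Qed.
Lemma Cexp_taylor1 (z : C) : (Cmod (Cexp z - 1 - z) <= Cmod z * Cmod z * exp (Cmod z))%R.
Proof.
  assert (E : CInt (fun t => z * (Cexp (t * z) - 1)) 0 1 = Cexp z - 1 - z).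
  { rewrite (ci_FTC (fun t => Cexp (t * z) - t * z)); [rewrite !Cmult_1_l, !Cmult_0_l, Cexp_0; cring | |].
    - intros t _. destruct (rder_Cexp_line z t) as [A B]. split.
    + replace (Re (z * (Cexp (t * z) - 1))) with (minus (Re (z * Cexp (t * z))) (Re z)).
      apply (is_derive_minus (fun t : R => Re (Cexp (t * z))) (fun t : R => Re (t * z))); auto. unfold Re; destruct z as [zx zy]; simpl; auto_derive; [auto | unfold Rminus; ring].
      unfold minus, plus, opp; simpl; unfold Re, Im; destruct z as [zx zy]; destruct (Cexp _); simpl; ring.
    + replace (Im (z * (Cexp (t * z) - 1))) with (minus (Im (z * Cexp (t * z))) (Im z)).
      apply (is_derive_minus (fun t : R => Im (Cexp (t * z))) (fun t : R => Im (t * z))); auto. unfold Im; destruct z as [zx zy]; simpl; auto_derive; [auto | unfold Rminus; ring].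
      unfold minus, plus, opp; simpl; unfold Re, Im; destruct z as [zx zy]; destruct (Cexp _); simpl; ring.
    - intros t; ct. }
  rewrite <- E. apply ci_01_bound. intros t; ct.
  intros t Ht. rewrite Cmod_mult, Rmult_assoc. apply Rmult_le_compat_l. apply Cmod_ge_0.
  eapply Rle_trans; [apply Cexp_taylor0|].
  assert (Cmod (t * z) <= Cmod z)%R. { rewrite Cmod_mult, Cmod_R, Rabs_pos_eq by lra. generalize (Cmod_ge_0 z); nra. }
  apply Rmult_le_compat; auto. apply Cmod_ge_0. left; apply exp_pos. destruct H. left; apply exp_increasing; auto. rewrite H; lra.
Qed.
Lemma cder_Cexp0 z : cder Cexp z (Cexp z).
Proof.
  apply (cder_quad _ _ _ (Cmod (Cexp z) * exp 1)%R 1). lra. intros h Hh.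
  rewrite Cexp_plus. replace (_ - _) with (Cexp z * (Cexp h - 1 - h)) by ring. rewrite Cmod_mult, Rmult_assoc.
  apply Rmult_le_compat_l. apply Cmod_ge_0. eapply Rle_trans; [apply Cexp_taylor1|]. rewrite Rmult_comm.
  apply Rmult_le_compat_r. apply Rmult_le_pos; apply Cmod_ge_0. left; apply exp_increasing; auto.
Qed.
Lemma cder_Cexp (f : C -> C) z a : cder f z a -> cder (fun w => Cexp (f w)) z (a * Cexp (f z)).
Proof. intros. rewrite Cmult_comm. apply (cder_comp Cexp f); auto. apply cder_Cexp0. Qed.

Lemma rder_R (g : R -> R) (x l : R) : is_derive g x l -> rder (fun t => RtoC (g t)) x l.
Proof. intros H. split; simpl; auto. apply (is_derive_const (K := R_AbsRing) (V := R_NormedModule)). Qed.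
Lemma rder_plus f g x a b : rder f x a -> rder g x b -> rder (fun t => f t + g t) x (a + b).
Proof. intros [A B] [A' B']. split.
  apply (is_derive_plus (K := R_AbsRing) (V := R_NormedModule) (fun t => Re (f t)) (fun t => Re (g t))); auto.
  apply (is_derive_plus (K := R_AbsRing) (V := R_NormedModule) (fun t => Im (f t)) (fun t => Im (g t))); auto. Qed.
Lemma rder_mult f g x a b : rder f x a -> rder g x b -> rder (fun t => f t * g t) x (a * g x + f x * b).
Proof.
  intros [A B] [A' B']. split.
  - replace (Re (a * g x + f x * b)) with (minus (plus (mult (Re a) (Re (g x))) (mult (Re (f x)) (Re b))) (plus (mult (Im a) (Im (g x))) (mult (Im (f x)) (Im b)))).
    apply (is_derive_minus (K := R_AbsRing) (V := R_NormedModule) (fun t => Re (f t) * Re (g t))%R (fun t => Im (f t) * Im (g t))%R);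
    apply (is_derive_mult (K := R_AbsRing)); auto; intros; apply Rmult_comm.
    unfold minus, plus, opp, mult; simpl. unfold Re, Im. destruct a, b, (f x), (g x); simpl; ring.
  - replace (Im (a * g x + f x * b)) with (plus (plus (mult (Re a) (Im (g x))) (mult (Re (f x)) (Im b))) (plus (mult (Im a) (Re (g x))) (mult (Im (f x)) (Re b)))).
    apply (is_derive_plus (K := R_AbsRing) (V := R_NormedModule) (fun t => Re (f t) * Im (g t))%R (fun t => Im (f t) * Re (g t))%R);
    apply (is_derive_mult (K := R_AbsRing)); auto; intros; apply Rmult_comm.
    unfold minus, plus, opp, mult; simpl. unfold Re, Im. destruct a, b, (f x), (g x); simpl; ring.
Qed.
Lemma rder_const c x : rder (fun _ => c) x 0.
Proof. split; apply (is_derive_const (K := R_AbsRing) (V := R_NormedModule)). Qed.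
Lemma rder_scal c f x a : rder f x a -> rder (fun t => c * f t) x (c * a).
Proof. intros H. apply (rder_eq _ _ (0 * f x + c * a)). ring. apply (rder_mult (fun _ => c)); auto. apply rder_const. Qed.
Lemma rder_opp f x a : rder f x a -> rder (fun t => - f t) x (- a).
Proof. intros H. apply (rder_ext (fun t => (-(1)) * f t)). intros; ring. apply (rder_eq _ _ ((-(1)) * a)). ring. apply rder_scal; auto. Qed.
Lemma rder_minus f g x a b : rder f x a -> rder g x b -> rder (fun t => f t - g t) x (a - b).
Proof. intros; apply rder_plus; auto. apply rder_opp; auto. Qed.
Lemma der_expcos (u v : R -> R) (x du dv : R) : is_derive u x du -> is_derive v x dv ->
  is_derive (fun t => exp (u t) * cos (v t))%R x (du * exp (u x) * cos (v x) + exp (u x) * (dv * - sin (v x)))%R /\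
  is_derive (fun t => exp (u t) * sin (v t))%R x (du * exp (u x) * sin (v x) + exp (u x) * (dv * cos (v x)))%R.
Proof.
  intros A B. assert (Ex : ex_derive u x) by (eexists; eauto). assert (Ey : ex_derive v x) by (eexists; eauto).
  split; auto_derive; auto; rewrite ?(is_derive_unique (fun t : R => u t) _ _ A), ?(is_derive_unique (fun t : R => v t) _ _ B); ring.
Qed.
Lemma rder_Cexp f x a : rder f x a -> rder (fun t => Cexp (f t)) x (a * Cexp (f x)).
Proof.
  intros [A B]. destruct (der_expcos _ _ _ _ _ A B) as [D1 D2]. split.
  - refine (eq_rect _ (fun l => is_derive _ x l) D1 _ _). unfold Cexp, Re, Im. destruct a. simpl. ring.
  - refine (eq_rect _ (fun l => is_derive _ x l) D2 _ _). unfold Cexp, Re, Im. destruct a. simpl. ring.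
Qed.
Lemma rder_id x : rder (fun t => RtoC t) x 1.
Proof. apply rder_R. apply (is_derive_id (K := R_AbsRing)). Qed.
Lemma rder_exp (x : R) : rder (fun t => RtoC (exp t)) x (exp x).
Proof. apply rder_R. auto_derive; auto. ring. Qed.
Lemma rder_R_comp (F : R -> C) (h : R -> R) (x k : R) (l : C) : rder F (h x) l -> is_derive h x k -> rder (fun t => F (h t)) x (k * l).
Proof.
  intros [A B] H. split. replace (Re (k * l)) with (k * Re l)%R by (rewrite re_scal_l; auto). apply (is_derive_comp (fun t => Re (F t)) h); auto.
  replace (Im (k * l)) with (k * Im l)%R by (rewrite im_scal_l; auto). apply (is_derive_comp (fun t => Im (F t)) h); auto.
Qed.
Lemma rder_neg (G : R -> C) (x : R) (l : C) : rder G (- x)%R l -> rder (fun t => G (- t)%R) x (- l).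
Proof. intros H. apply (rder_eq _ _ (RtoC (-1) * l)). c_ring. apply (rder_R_comp G Ropp); auto. auto_derive; auto. Qed.
Lemma derive_carath (u : R -> R) (x l : R) : is_derive u x l -> exists h : R -> R, continuous h x /\ h x = l /\ forall y, (u y - u x = h y * (y - x))%R.
Proof.
  intros H. apply is_derive_Reals in H.
  set (h := fun y => if Req_EM_T y x then l else ((u y - u x) / (y - x))%R). exists h.
  assert (Hx : h x = l) by (unfold h; destruct (Req_EM_T x x); [auto | congruence]). split; [|split]; auto.
  - intros P [e He]. rewrite Hx in He. destruct (H e (cond_pos e)) as [d Hd]. exists d. intros y Hy. apply He.
    unfold ball in *; simpl in *; unfold AbsRing_ball, abs, minus, plus, opp in *; simpl in *. unfold h. destruct (Req_EM_T y x) as [E|N].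
    rewrite Rplus_opp_r, Rabs_R0. apply cond_pos. specialize (Hd (y - x)%R ltac:(lra) Hy). replace (x + (y - x))%R with y in Hd by ring. exact Hd.
  - intros y. unfold h. destruct (Req_EM_T y x) as [E|N]. rewrite E; ring. field. lra.
Qed.
Lemma rder_cont (g : R -> C) x b : rder g x b -> continuous g x.
Proof.
  intros [A B]. apply (continuous_ext (fun t => ((Re (g t), Im (g t)) : C))). intros t; destruct (g t); reflexivity.
  apply ct_pair; apply (ex_derive_continuous (V := R_NormedModule)); eexists; eauto.
Qed.
Lemma rder_comp (f : C -> C) (g : R -> C) (x : R) (a b : C) : cder f (g x) a -> rder g x b -> rder (fun t => f (g t)) x (a * b).
Proof.
  intros [phi [Cp [Ep Lp]]] Hg. assert (Cg := rder_cont g x b Hg). destruct Hg as [A B].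
  destruct (derive_carath _ _ _ A) as [h1 [C1 [E1 L1]]]. destruct (derive_carath _ _ _ B) as [h2 [C2 [E2 L2]]].
  set (Th := fun y => phi (g y) * (h1 y, h2 y)).
  assert (CT : continuous Th x) by (apply ct_mult; [apply (continuous_comp g phi); auto | apply ct_pair; auto]).
  assert (ET : Th x = a * b) by (unfold Th; rewrite Ep, E1, E2; destruct b; reflexivity).
  apply Cg in Lp. unfold filtermap in Lp.
  assert (L : locally x (fun y : R => f (g y) - f (g x) = Th y * RtoC (y - x))).
  { revert Lp. apply filter_imp. intros y Hy. rewrite Hy. unfold Th. rewrite <- Cmult_assoc. f_equal. apply C_ext; unfold Re, Im; simpl; unfold Re, Im in *; rewrite ?L1, ?L2; [replace (fst (g y) + - fst (g x))%R with (h1 y * (y - x))%R by (rewrite <- L1; ring) | replace (snd (g y) + - snd (g x))%R with (h2 y * (y - x))%R by (rewrite <- L2; ring)]; ring. }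
  split.
  - apply (carath_R _ (fun y => Re (Th y))). apply ct_re; auto. rewrite ET; auto. revert L. apply filter_imp. intros y Hy. apply (f_equal Re) in Hy. rewrite re_scal_r in Hy. rewrite <- Hy. unfold Re; simpl; ring.
  - apply (carath_R _ (fun y => Im (Th y))). apply ct_im; auto. rewrite ET; auto. revert L. apply filter_imp. intros y Hy. apply (f_equal Im) in Hy. rewrite im_scal_r in Hy. rewrite <- Hy. unfold Im; simpl; ring.
Qed.

(** * Absolutely convergent integrals over the line *)

(** All integrals over the line converge by comparison with M / (1 + x^2), whose integral over [a,
    b] is M (atan b - atan a); M is kept explicit because it has to be uniform in parameters. *)
Definition quad (M : R) (f : R -> C) := rcont f /\ forall x, (Cmod (f x) <= M / (1 + x ^ 2))%R.
Definition LI (f : R -> C) : C := RInt_gen (V := C_R_CompleteNormedModule) f (Rbar_locally m_infty) (Rbar_locally p_infty).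
Definition is_LI (f : R -> C) (l : C) := is_RInt_gen (V := C_R_NormedModule) f (Rbar_locally m_infty) (Rbar_locally p_infty) l.
Lemma is_LI_unique f (l : C) : is_LI f l -> LI f = l.
Proof. intros H. refine (@is_RInt_gen_unique C_R_CompleteNormedModule (Rbar_locally m_infty) (Rbar_locally p_infty) _ _ f l H). Qed.

(** The mass of 1 / (1 + x^2) beyond x. *)
Definition atan_tail (x : R) : R := (PI / 2 - atan x)%R.

Lemma atan_tail_pos x : (0 < atan_tail x)%R.
Proof. unfold atan_tail. generalize (atan_bound x); lra. Qed.
Lemma atan_tail_small eps : (0 < eps)%R -> exists N, (0 < N)%R /\ forall x, (N <= x -> atan_tail x < eps)%R.
Proof.
  intros He. set (e := Rmin eps 1). assert (0 < e <= 1)%R by (unfold e; split; [apply Rmin_pos; lra | apply Rmin_r]).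
  assert (e <= eps)%R by apply Rmin_l.
  exists (tan (PI / 2 - e / 2) + Rabs (tan (PI / 2 - e/2)) + 1)%R. split. generalize (Rle_abs (- tan (PI / 2 - e / 2))); rewrite Rabs_Ropp; generalize (Rabs_pos (tan (PI / 2 - e / 2))); lra.
  intros x Hx. unfold atan_tail. assert (A : (tan (PI / 2 - e / 2) < x)%R) by (generalize (Rabs_pos (tan (PI / 2 - e / 2))); lra).
  apply atan_increasing in A. rewrite atan_tan in A. lra. generalize PI2_1; lra.
Qed.

Lemma den_pos x : (0 < 1 + x ^ 2)%R. Proof. nra. Qed.
Lemma ct_den M x : continuous (fun x => M / (1 + x ^ 2))%R x.
Proof. apply (ex_derive_continuous (V := R_NormedModule)). auto_derive. generalize (den_pos x); simpl; lra. Qed.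
Lemma RInt_den M a b : RInt (fun x => M / (1 + x ^ 2))%R a b = (M * (atan b - atan a))%R.
Proof.
  apply is_RInt_unique. replace (M * (atan b - atan a))%R with (minus (M * atan b) (M * atan a))%R by (unfold minus, plus, opp; simpl; ring).
  apply (is_RInt_derive (V := R_CompleteNormedModule) (fun x => (M * atan x)%R)).
  intros x _. auto_derive; auto. generalize (den_pos x); intros; field; simpl in *; nra.
  intros; apply ct_den.
Qed.
Lemma quad_M M f : quad M f -> (0 <= M)%R.
Proof. intros [_ H]. specialize (H 0%R). generalize (Cmod_ge_0 (f 0%R)). replace (M / (1 + 0 ^ 2))%R with M in H by field. lra. Qed.
Lemma quad_ci M f a b : quad M f -> (a <= b)%R -> (Cmod (CInt f a b) <= M * (atan b - atan a))%R.
Proof.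
  intros [Hc H] Hab. rewrite <- RInt_den. apply ci_norm; auto. intros; apply ct_den.
Qed.
Lemma ci_swap f a b : rcont f -> CInt f b a = - CInt f a b.
Proof. intros H. symmetry. apply (opp_RInt_swap (V := C_R_CompleteNormedModule) f). apply ci_ex; auto. Qed.
Lemma Cmod_minus_sym (z w : C) : Cmod (z - w) = Cmod (w - z).
Proof. rewrite <- Cmod_opp. f_equal. ring. Qed.

Lemma half_limit M f : quad M f -> exists l : C, forall a, (Cmod (l - CInt f 0 a) <= M * atan_tail a)%R.
Proof.
  intros H. assert (HM := quad_M _ _ H). assert (Hc := proj1 H).
  assert (D : forall u v, (u <= v)%R -> (Cmod (CInt f 0 v - CInt f 0 u) <= M * (atan v - atan u))%R).
  { intros u v Huv. replace (CInt f 0 v - CInt f 0 u) with (CInt f u v). apply quad_ci; auto.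
    rewrite <- (ci_Chasles f 0 u v) by auto. ring. }
  destruct (proj1 (filterlim_locally_cauchy (U := C_R_CompleteNormedModule) (F := Rbar_locally p_infty) (fun x => CInt f 0 x))) as [l Hl].
  { intros eps. destruct (atan_tail_small (eps / (M + 1))) as [N [_ HN]]. apply Rdiv_lt_0_compat; [apply cond_pos|lra].
    exists (fun x => N < x)%R. split. exists N; auto. intros u v Hu Hv.
    assert (B : (Cmod (CInt f 0 v - CInt f 0 u) < eps)%R).
    { assert (X : forall u v, (N < u)%R -> (u <= v)%R -> (Cmod (CInt f 0 v - CInt f 0 u) < eps)%R).
      { clear u v Hu Hv. intros u v Hu Huv. eapply Rle_lt_trans; [apply D; auto|].
        specialize (HN u (Rlt_le _ _ Hu)). apply Rle_lt_trans with (M * atan_tail u)%R.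
        apply Rmult_le_compat_l; auto. unfold atan_tail; generalize (atan_bound v); lra.
        apply Rle_lt_trans with (M * (eps / (M + 1)))%R. apply Rmult_le_compat_l; lra.
        apply Rmult_lt_reg_r with (M + 1)%R. lra. field_simplify; [|lra]. generalize (cond_pos eps); nra. }
      destruct (Rle_dec u v). apply X; auto. rewrite Cmod_minus_sym. apply X; auto; lra. }
    apply C_NormedModule_mixin_compat1. exact B. }
  exists l. intros a. apply le_epsilon. intros e He.
  assert (Hl' : Rbar_locally p_infty (fun x => Cmod (CInt f 0 x - l) < e)%R).
  { refine (Hl (fun z : C => (Cmod (z - l) < e)%R) _). apply (locally_Cmod l). exists e; auto. }
  destruct Hl' as [N HN]. set (b := (Rmax N a + 1)%R).
  assert (N < b)%R by (unfold b; generalize (Rmax_l N a); lra). assert (a < b)%R by (unfold b; generalize (Rmax_r N a); lra).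
  replace (l - CInt f 0 a) with ((CInt f 0 b - CInt f 0 a) - (CInt f 0 b - l)) by ring.
  triangle. rewrite Cmod_opp. specialize (HN b H0).
  assert (X := D a b ltac:(lra)). assert (M * (atan b - atan a) <= M * atan_tail a)%R. { apply Rmult_le_compat_l; auto. unfold atan_tail; generalize (atan_bound b); lra. }
  lra.
Qed.
Lemma CInt_opp_arg f a b : rcont f -> CInt (fun x => f (- x)%R) a b = CInt f (-b) (-a).
Proof.
  intros H. rewrite (ci_swap f (-a)%R (-b)%R) by auto.
  assert (E : CInt f (-a) (-b) = CInt (fun x => (-(1)) * f (- x)%R) a b).
  { symmetry. etransitivity; [|apply (RInt_comp (V := C_R_CompleteNormedModule) f (fun x => - x)%R (fun _ => -1)%R a b)].
    apply ci_ext. intros. symmetry. etransitivity; [apply scal_R_Cmult|]. f_equal. apply C_ext; simpl; ring.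
    intros; apply H. intros; split. auto_derive; auto; ring. apply continuous_const. }
  rewrite E, ci_scal. ring. intros x. apply (continuous_comp Ropp f). ct. apply H.
Qed.
Lemma quad_opp_arg M f : quad M f -> quad M (fun x => f (- x)%R).
Proof. intros [A B]. split. intros x. apply (continuous_comp Ropp f). ct. apply A.
  intros x. specialize (B (-x)%R). replace ((-x)^2)%R with (x^2)%R in B by ring. auto. Qed.
Lemma LI_all M f : quad M f -> is_LI f (LI f) /\ forall a b, (Cmod (LI f - CInt f a b) <= M * (atan_tail b + atan_tail (- a)))%R.
Proof.
  intros H. destruct (half_limit _ _ H) as [lp Hp]. destruct (half_limit _ _ (quad_opp_arg _ _ H)) as [lm Hm].
  assert (Hc := proj1 H). assert (HM := quad_M _ _ H).
  assert (K : forall a b, (Cmod (lp + lm - CInt f a b) <= M * (atan_tail b + atan_tail (- a)))%R).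
  { intros a b. specialize (Hp b). specialize (Hm (-a)%R). rewrite CInt_opp_arg in Hm by auto.
    rewrite Ropp_involutive, Ropp_0 in Hm. rewrite <- (ci_Chasles f a 0 b) by auto.
    replace (_ - _) with ((lp - CInt f 0 b) + (lm - CInt f a 0)) by ring.
    triangle. lra. }
  assert (L : is_LI f (lp + lm)).
  { intros P HP. assert (HP' : locally (T := C_UniformSpace) (lp + lm) P) by exact HP. apply locally_Cmod in HP'. destruct HP' as [e [He HP']].
    destruct (atan_tail_small (e / (2 * (M + 1)))) as [N [HN0 HN]]. apply Rdiv_lt_0_compat; lra.
    apply (Filter_prod _ _ _ (fun x => x < - N)%R (fun x => N < x)%R). exists (-N)%R; auto. exists N; auto.
    intros a b Ha Hb. exists (CInt f a b). split. apply ci_correct; auto. apply HP'.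
    rewrite Cmod_minus_sym. eapply Rle_lt_trans; [apply K|].
    assert (atan_tail b < e / (2 * (M+1)))%R by (apply HN; lra). assert (atan_tail (-a) < e / (2 * (M+1)))%R by (apply HN; lra).
    apply Rle_lt_trans with (M * (e / (M + 1)))%R. apply Rmult_le_compat_l; auto.
    replace (e / (M + 1))%R with (e / (2 * (M + 1)) + e / (2 * (M + 1)))%R by (field; lra). lra.
    apply Rmult_lt_reg_r with (M + 1)%R. lra. field_simplify; [|lra]. nra. }
  assert (E : LI f = lp + lm) by (apply is_LI_unique; exact L).
  rewrite E. auto.
Qed.
Lemma LI_is M f : quad M f -> is_LI f (LI f).
Proof. intros H; apply (LI_all _ _ H). Qed.
Lemma LI_tail M f a b : quad M f -> (Cmod (LI f - CInt f a b) <= M * (atan_tail b + atan_tail (- a)))%R.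
Proof. intros H; apply (LI_all _ _ H). Qed.
Lemma C_small (z : C) : (forall e, 0 < e -> Cmod z <= e)%R -> z = 0.
Proof. intros H. apply Cmod_eq_0. apply Rle_antisym; [|apply Cmod_ge_0]. apply le_epsilon. intros e He. rewrite Rplus_0_l. auto. Qed.
Lemma C_eq_small (z w : C) : (forall e, 0 < e -> Cmod (z - w) <= e)%R -> z = w.
Proof. intros H. apply C_small in H. rewrite <- (Cplus_0_r w), <- H. ring. Qed.
Lemma LI_approx M f : quad M f -> forall e, (0 < e)%R -> exists N, (0 < N)%R /\ forall a b, (a <= - N)%R -> (N <= b)%R -> (Cmod (LI f - CInt f a b) <= e)%R.
Proof.
  intros H e He. assert (HM := quad_M _ _ H). destruct (atan_tail_small (e / (2 * (M + 1)))) as [N [HN0 HN]]. apply Rdiv_lt_0_compat; lra.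
  exists N. split; auto. intros a b Ha Hb. eapply Rle_trans; [apply (LI_tail M); auto|].
  assert (atan_tail b < e / (2 * (M+1)))%R by (apply HN; lra). assert (atan_tail (-a) < e / (2 * (M+1)))%R by (apply HN; lra).
  apply Rle_trans with (M * (e / (M + 1)))%R. apply Rmult_le_compat_l; auto.
  replace (e / (M + 1))%R with (e / (2 * (M + 1)) + e / (2 * (M + 1)))%R by (field; lra). lra.
  apply Rmult_le_reg_r with (M + 1)%R. lra. field_simplify; [|lra]. nra.
Qed.
Lemma LI_unique M f (l : C) : quad M f -> (forall e, (0 < e)%R -> exists N, forall n, (N < n)%R -> (Cmod (CInt f (- n) n - l) <= e)%R) -> LI f = l.
Proof.
  intros H HL. apply C_eq_small. intros e He. destruct (LI_approx _ _ H (e/2)%R ltac:(lra)) as [N1 [HN1 H1]].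
  destruct (HL (e/2)%R ltac:(lra)) as [N2 H2]. set (n := (Rmax N1 N2 + 1)%R).
  assert (N1 < n)%R by (unfold n; generalize (Rmax_l N1 N2); lra). assert (N2 < n)%R by (unfold n; generalize (Rmax_r N1 N2); lra).
  replace (LI f - l) with ((LI f - CInt f (-n) n) + (CInt f (-n) n - l)) by ring.
  triangle. specialize (H1 (-n)%R n ltac:(lra) ltac:(lra)). specialize (H2 n H3). lra.
Qed.
Lemma quad_ext M f g : (forall x, f x = g x) -> quad M f -> quad M g.
Proof. intros E [A B]. split. intros x. apply (continuous_ext f); auto. intros; rewrite <- E; auto. Qed.
Lemma LI_ext f g : (forall x, f x = g x) -> LI f = LI g.
Proof. intros H. f_equal. apply functional_extensionality, H. Qed.
Lemma quad_plus M N f g : quad M f -> quad N g -> quad (M + N) (fun x => f x + g x).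
Proof. intros [A B] [A' B']. split. intros x. apply ct_plus; auto. intros x. triangle.
  specialize (B x). specialize (B' x). replace ((M + N) / (1 + x^2))%R with (M / (1 + x^2) + N / (1 + x^2))%R by (field; generalize (den_pos x); lra). lra. Qed.
Lemma quad_scal M c f : quad M f -> quad (Cmod c * M) (fun x => c * f x).
Proof. intros [A B]. split. intros x. apply ct_mult; auto. apply continuous_const. intros x. rewrite Cmod_mult. unfold Rdiv. rewrite Rmult_assoc.
  apply Rmult_le_compat_l. apply Cmod_ge_0. apply B. Qed.
Lemma quad_weak M N f : (M <= N)%R -> quad M f -> quad N f.
Proof. intros H [A B]. split; auto. intros x. eapply Rle_trans; [apply B|]. apply Rmult_le_compat_r; auto. left; apply Rinv_0_lt_compat, den_pos. Qed.
Lemma LI_scal M c f : quad M f -> LI (fun x => c * f x) = c * LI f.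
Proof.
  intros H. apply (LI_unique (Cmod c * M)). apply quad_scal; auto. intros e He.
  destruct (LI_approx _ _ H (e / (Cmod c + 1))%R) as [N [HN HH]]. apply Rdiv_lt_0_compat; auto. generalize (Cmod_ge_0 c); lra.
  exists N. intros n Hn. rewrite ci_scal by apply H. rewrite Cmod_minus_sym.
  replace (c * LI f - c * CInt f (-n) n) with (c * (LI f - CInt f (-n) n)) by ring. rewrite Cmod_mult.
  apply Rle_trans with (Cmod c * (e / (Cmod c + 1)))%R. apply Rmult_le_compat_l. apply Cmod_ge_0. apply HH; lra.
  generalize (Cmod_ge_0 c). intros. apply Rmult_le_reg_r with (Cmod c + 1)%R. lra. field_simplify; [|lra]. nra.
Qed.
Lemma LI_plus M N f g : quad M f -> quad N g -> LI (fun x => f x + g x) = LI f + LI g.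
Proof.
  intros Hf Hg. apply (LI_unique (M + N)). apply quad_plus; auto. intros e He.
  destruct (LI_approx _ _ Hf (e/2)%R ltac:(lra)) as [N1 [HN1 H1]]. destruct (LI_approx _ _ Hg (e/2)%R ltac:(lra)) as [N2 [HN2 H2]].
  exists (Rmax N1 N2). intros n Hn. assert (N1 < n)%R by (generalize (Rmax_l N1 N2); lra). assert (N2 < n)%R by (generalize (Rmax_r N1 N2); lra).
  rewrite ci_plus by (apply Hf || apply Hg). rewrite Cmod_minus_sym.
  replace (_ - _) with ((LI f - CInt f (-n) n) + (LI g - CInt g (-n) n)) by ring.
  triangle. specialize (H1 (-n)%R n ltac:(lra) ltac:(lra)). specialize (H2 (-n)%R n ltac:(lra) ltac:(lra)). lra.
Qed.
Lemma quad_minus M N f g : quad M f -> quad N g -> quad (M + N) (fun x => f x - g x).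
Proof. intros Hf Hg. apply (quad_ext _ (fun x => f x + (-(1)) * g x)). intros; ring. apply quad_plus; auto.
  apply (quad_weak (Cmod (-(1)) * N)). rewrite Cmod_opp, Cmod_1; lra. apply quad_scal; auto. Qed.
Lemma LI_minus M N f g : quad M f -> quad N g -> LI (fun x => f x - g x) = LI f - LI g.
Proof. intros Hf Hg. rewrite (LI_ext _ (fun x => f x + (-(1)) * g x)) by (intros; ring).
  rewrite (LI_plus M (Cmod (-(1)) * N)); auto. rewrite (LI_scal N); auto. ring. apply quad_scal; auto. Qed.
Lemma ci_point f a : CInt f a a = 0.
Proof. apply (RInt_point (V := C_R_CompleteNormedModule)). Qed.
Lemma LI_bound M f : quad M f -> (Cmod (LI f) <= PI * M)%R.
Proof. intros H. generalize (LI_tail M f 0 0 H). rewrite ci_point.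
  replace (LI f - 0) with (LI f) by ring. rewrite Ropp_0. unfold atan_tail. rewrite atan_0. lra. Qed.

(** For a majorant g whose integral is known; the plain bound PI M is too crude there. *)
Lemma LI_mono M (f : R -> C) (g : R -> R) : rcont f -> quad M (fun x => RtoC (g x)) -> (forall x, Cmod (f x) <= g x)%R -> quad M f /\ (Cmod (LI f) <= Re (LI (fun x => RtoC (g x))))%R.
Proof.
  intros Hf Hg H. assert (Hq : quad M f). { split; auto. intros x. eapply Rle_trans; [apply H|]. eapply Rle_trans; [|apply (proj2 Hg)].
    rewrite Cmod_R. apply Rle_abs. }
  split; auto. apply le_epsilon. intros e He.
  destruct (LI_approx _ _ Hq (e/2)%R ltac:(lra)) as [N1 [HN1 H1]]. destruct (LI_approx _ _ Hg (e/2)%R ltac:(lra)) as [N2 [HN2 H2]].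
  set (n := (Rmax N1 N2 + 1)%R).
  assert (N1 < n)%R by (unfold n; generalize (Rmax_l N1 N2); lra). assert (N2 < n)%R by (unfold n; generalize (Rmax_r N1 N2); lra).
  specialize (H1 (-n)%R n ltac:(lra) ltac:(lra)). specialize (H2 (-n)%R n ltac:(lra) ltac:(lra)).
  assert (B : (Cmod (CInt f (-n) n) <= Re (CInt (fun x => RtoC (g x)) (-n) n))%R).
  { rewrite ci_re by apply Hg. simpl. apply ci_norm; auto. lra. intros x. apply (ct_re (fun x => RtoC (g x))). apply Hg. }
  replace (LI f) with ((LI f - CInt f (-n) n) + CInt f (-n) n) by ring. triangle.
  generalize (re_le_Cmod (LI (fun x => RtoC (g x)) - CInt (fun x => RtoC (g x)) (-n) n)). unfold Cminus at 1. rewrite re_plus, re_opp. intros Hr.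
  apply Rabs_le_between in Hr. lra.
Qed.
Definition lim_p (f : R -> C) (l : C) := forall e, (0 < e)%R -> exists N, forall x, (N < x)%R -> (Cmod (f x - l) <= e)%R.
Definition lim_m (f : R -> C) (l : C) := forall e, (0 < e)%R -> exists N, forall x, (x < N)%R -> (Cmod (f x - l) <= e)%R.
Lemma LI_FTC M (F f : R -> C) lp lm : quad M f -> (forall x, rder F x (f x)) -> lim_p F lp -> lim_m F lm -> LI f = lp - lm.
Proof.
  intros H HF Hp Hm. apply (LI_unique M); auto. intros e He. destruct (Hp (e/2)%R ltac:(lra)) as [N1 H1]. destruct (Hm (e/2)%R ltac:(lra)) as [N2 H2].
  exists (Rmax N1 (-N2)). intros n Hn. assert (N1 < n)%R by (generalize (Rmax_l N1 (-N2)); lra). assert (-N2 < n)%R by (generalize (Rmax_r N1 (-N2)); lra).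
  rewrite (ci_FTC F); auto. 2: apply H. replace (_ - _) with ((F n - lp) - (F (-n)%R - lm)) by ring.
  triangle. rewrite Cmod_opp. specialize (H1 n H0). specialize (H2 (-n)%R ltac:(lra)). lra.
Qed.
Lemma ci_lin_arg (f : R -> C) (k c a b : R) : rcont f -> RtoC k * CInt (fun x => f (k * x + c)%R) a b = CInt f (k * a + c) (k * b + c).
Proof.
  intros H. rewrite <- ci_scal. 2: intros x; apply (continuous_comp (fun x => k * x + c)%R f); [ct | apply H].
  etransitivity; [|apply (RInt_comp (V := C_R_CompleteNormedModule) f (fun x => k * x + c)%R (fun _ => k)%R a b)].
  apply ci_ext. intros. symmetry; apply scal_R_Cmult.
  intros; apply H. intros; split. auto_derive; auto; ring. apply continuous_const.
Qed.
Lemma quad_shift M f c : quad M f -> quad (M * (2 * (1 + c ^ 2))) (fun x => f (x + c)%R).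
Proof.
  intros H. assert (HM := quad_M _ _ H). destruct H as [A B]. split. intros x. apply (continuous_comp (fun x => x + c)%R f). ct. apply A.
  intros x. eapply Rle_trans; [apply B|]. unfold Rdiv. rewrite Rmult_assoc. apply Rmult_le_compat_l; auto.
  apply Rmult_le_reg_r with ((1 + (x + c)^2) * (1 + x^2))%R. apply Rmult_lt_0_compat; apply den_pos. field_simplify; try (generalize (den_pos x) (den_pos (x + c)); simpl; lra).
  assert (0 <= (x + 2 * c)^2)%R by (apply pow2_ge_0). assert (0 <= c^2 * (x+c)^2)%R by (apply Rmult_le_pos; apply pow2_ge_0). nra.
Qed.
Lemma LI_shift M f c : quad M f -> LI (fun x => f (x + c)%R) = LI f.
Proof.
  intros H. apply (LI_unique _ _ _ (quad_shift _ _ c H)). intros e He. destruct (LI_approx _ _ H e He) as [N [HN HH]].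
  exists (N + Rabs c)%R. intros n Hn. rewrite Cmod_minus_sym.
  assert (E : CInt (fun x => f (x + c)%R) (-n) n = CInt f (1 * -n + c) (1 * n + c)).
  { rewrite <- ci_lin_arg by apply H. rewrite Cmult_1_l. apply ci_ext. intros; f_equal; ring. }
  rewrite E. apply HH; generalize (Rle_abs c) (Rle_abs (-c)); rewrite Rabs_Ropp; lra.
Qed.
Lemma LI_opp M f : quad M f -> LI (fun x => f (- x)%R) = LI f.
Proof.
  intros H. apply (LI_unique _ _ _ (quad_opp_arg _ _ H)). intros e He. destruct (LI_approx _ _ H e He) as [N [HN HH]].
  exists N. intros n Hn. rewrite Cmod_minus_sym, CInt_opp_arg by apply H. rewrite Ropp_involutive. apply HH; lra.
Qed.
Lemma quad_scale M f k : (0 < k)%R -> quad M f -> quad (M * (1 + / k ^ 2)) (fun x => f (k * x)%R).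
Proof.
  intros Hk H. assert (HM := quad_M _ _ H). destruct H as [A B]. split. intros x. apply (continuous_comp (fun x => k * x)%R f). ct. apply A.
  intros x. eapply Rle_trans; [apply B|]. unfold Rdiv. rewrite Rmult_assoc. apply Rmult_le_compat_l; auto.
  apply Rmult_le_reg_r with ((1 + (k * x)^2) * (1 + x^2))%R. apply Rmult_lt_0_compat; apply den_pos.
  assert (0 < / k^2)%R by (apply Rinv_0_lt_compat; nra).
  replace (/ (1 + (k * x) ^ 2) * ((1 + (k * x) ^ 2) * (1 + x ^ 2)))%R with (1 + x^2)%R by (field; generalize (den_pos (k*x)); lra).
  replace ((1 + / k^2) * / (1 + x^2) * ((1 + (k * x) ^ 2) * (1 + x ^ 2)))%R with (1 + k^2*x^2 + / k^2 + x^2)%R by (field; generalize (den_pos x); nra).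
  assert (0 <= k^2*x^2)%R by (apply Rmult_le_pos; apply pow2_ge_0). lra.
Qed.
Lemma LI_scale M f k : (0 < k)%R -> quad M f -> k * LI (fun x => f (k * x)%R) = LI f.
Proof.
  intros Hk H. rewrite <- (LI_scal _ k _ (quad_scale _ _ _ Hk H)). apply (LI_unique _ _ _ (quad_scal _ k _ (quad_scale _ _ _ Hk H))).
  intros e He. destruct (LI_approx _ _ H e He) as [N [HN HH]]. exists (N / k)%R. intros n Hn. rewrite Cmod_minus_sym.
  assert (E : CInt (fun x => k * f (k * x)%R) (-n) n = CInt f (k * -n + 0) (k * n + 0)).
  { rewrite <- ci_lin_arg by apply H. rewrite <- ci_scal. apply ci_ext. intros; do 2 f_equal; ring.
    intros x. apply (continuous_comp (fun x => k * x + 0)%R f). ct. apply H. }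
  rewrite E. assert (N < k * n)%R. { apply Rmult_lt_compat_r with (r := k) in Hn; auto. unfold Rdiv in Hn. rewrite Rmult_assoc, Rinv_l, Rmult_1_r in Hn; lra. }
  apply HH; lra.
Qed.

(** Dominated convergence for uniform convergence on compact intervals: outside such an interval
    the common majorant leaves only the mass [atan_tail]. *)
Lemma LI_DCT M (F : R -> R -> C) (f : R -> C) : (forall e, (0 < e)%R -> quad M (F e)) -> quad M f ->
  (forall K d, (0 < d)%R -> exists e0, (0 < e0)%R /\ forall e x, (0 < e < e0)%R -> (-K <= x <= K)%R -> (Cmod (F e x - f x) <= d)%R) ->
  forall d, (0 < d)%R -> exists e0, (0 < e0)%R /\ forall e, (0 < e < e0)%R -> (Cmod (LI (F e) - LI f) <= d)%R.
Proof.
  intros HF Hf H d Hd. assert (HM := quad_M _ _ Hf).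
  destruct (atan_tail_small (d / (8 * (M + 1)))) as [N [HN0 HN]]. apply Rdiv_lt_0_compat; lra.
  destruct (H N (d / (2 * (2 * N + 1)))%R) as [e0 [He0 HH]]. apply Rdiv_lt_0_compat; lra.
  exists e0. split; auto. intros e He.
  assert (T : forall g, quad M g -> (Cmod (LI g - CInt g (-N) N) <= d / 4)%R).
  { intros g Hg. eapply Rle_trans; [apply (LI_tail M); auto|]. rewrite Ropp_involutive.
    assert (atan_tail N < d / (8 * (M+1)))%R by (apply HN; lra).
    apply Rle_trans with (M * (d / (4 * (M + 1))))%R. apply Rmult_le_compat_l; auto.
    replace (d / (4 * (M + 1)))%R with (d / (8 * (M + 1)) + d / (8 * (M + 1)))%R by (field; lra). lra.
    apply Rmult_le_reg_r with (4 * (M + 1))%R. lra. field_simplify; [|lra]. nra. }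
  assert (T1 := T _ (HF e (proj1 He))). assert (T2 := T _ Hf).
  replace (LI (F e) - LI f) with ((LI (F e) - CInt (F e) (-N) N) + (CInt (F e) (-N) N - CInt f (-N) N) - (LI f - CInt f (-N) N)) by ring.
  triangle. rewrite Cmod_opp. assert (X := Cmod_triangle (LI (F e) - CInt (F e) (-N) N) (CInt (F e) (-N) N - CInt f (-N) N)).
  assert (Y : (Cmod (CInt (F e) (-N) N - CInt f (-N) N) <= d / 2)%R).
  { rewrite <- ci_minus by (apply (HF e (proj1 He)) || apply Hf).
    eapply Rle_trans. apply (ci_norm _ (fun _ => d / (2 * (2 * N + 1)))%R). lra. intros x; apply ct_minus; [apply (HF e (proj1 He))|apply Hf].
    intros; apply continuous_const. intros x Hx. apply HH; auto.
    rewrite (RInt_const (V := R_CompleteNormedModule)). unfold scal; simpl; unfold mult; simpl.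
    apply Rmult_le_reg_r with (2 * (2 * N + 1))%R. lra. field_simplify; [|lra]. nra. }
  lra.
Qed.
Lemma LI_cont (f : R -> R -> C) (M : R -> R) : cont2 f -> (forall x y, Cmod (f x y) <= M y / (1 + x ^ 2))%R ->
  (forall y, exists K d, 0 < d /\ forall z, Rabs (z - y) < d -> M z <= K)%R -> rcont (fun y => LI (fun x => f x y)).
Proof.
  intros Hf HB HM y. apply ct_eps. intros eps He. destruct (HM y) as [K [d0 [Hd0 HK]]].
  assert (Q : forall z, quad (M z) (fun x => f x z)). { intros z. split; auto. apply (rcont_slice2 f); auto. }
  assert (K0 : (0 <= K)%R). { eapply Rle_trans; [apply (quad_M _ _ (Q y))|]. apply HK. rewrite Rminus_diag, Rabs_R0; auto. }
  destruct (atan_tail_small (eps / (8 * (K + 1)))) as [N [HN0 HN]]. apply Rdiv_lt_0_compat; lra.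
  destruct (proj1 (ct_eps _ y) (ci_par_cont f (-N) N Hf y) (eps / 2)%R ltac:(lra)) as [d1 [Hd1 HH]].
  exists (Rmin d0 d1). split. apply Rmin_pos; auto. intros z Hz.
  assert (Z0 : (Rabs (z - y) < d0)%R) by (eapply Rlt_le_trans; [exact Hz|apply Rmin_l]).
  assert (Z1 : (Rabs (z - y) < d1)%R) by (eapply Rlt_le_trans; [exact Hz|apply Rmin_r]).
  specialize (HH z Z1).
  assert (T : forall z, (Rabs (z - y) < d0)%R -> (Cmod (LI (fun x => f x z) - CInt (fun x => f x z) (-N) N) <= eps / 4)%R).
  { intros w Hw. eapply Rle_trans; [apply (LI_tail K); auto|]. apply (quad_weak (M w)); auto. rewrite Ropp_involutive.
    assert (atan_tail N < eps / (8 * (K+1)))%R by (apply HN; lra).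
    apply Rle_trans with (K * (eps / (4 * (K + 1))))%R. apply Rmult_le_compat_l; auto.
    replace (eps / (4 * (K + 1)))%R with (eps / (8 * (K + 1)) + eps / (8 * (K + 1)))%R by (field; lra). lra.
    apply Rmult_le_reg_r with (4 * (K + 1))%R. lra. field_simplify; [|lra]. nra. }
  assert (T1 := T z Z0). assert (T2 := T y ltac:(rewrite Rminus_diag, Rabs_R0; auto)).
  replace (_ - _) with ((LI (fun x => f x z) - CInt (fun x => f x z) (-N) N) + (CInt (fun x => f x z) (-N) N - CInt (fun x => f x y) (-N) N) - (LI (fun x => f x y) - CInt (fun x => f x y) (-N) N)) by ring.
  eapply Rle_lt_trans; [apply Cmod_triangle|]. rewrite Cmod_opp.
  assert (X := Cmod_triangle (LI (fun x => f x z) - CInt (fun x => f x z) (-N) N) (CInt (fun x => f x z) (-N) N - CInt (fun x => f x y) (-N) N)). lra.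
Qed.
Definition quad2 M (f : R -> R -> C) := cont2 f /\ forall x y, (Cmod (f x y) <= M / (1 + x ^ 2) / (1 + y ^ 2))%R.
Lemma quad2_swap M f : quad2 M f -> quad2 M (fun x y => f y x).
Proof. intros [A B]. split. apply cont2_swap; auto. intros x y. eapply Rle_trans; [apply B|]. right. field. generalize (den_pos x) (den_pos y); lra. Qed.
Lemma quad2_M M f : quad2 M f -> (0 <= M)%R.
Proof. intros [_ H]. specialize (H 0 0)%R. generalize (Cmod_ge_0 (f 0 0)%R). replace (M / (1 + 0 ^ 2) / (1 + 0 ^ 2))%R with M in H by field. lra. Qed.
Lemma quad2_slice M f y : quad2 M f -> quad (M / (1 + y ^ 2)) (fun x => f x y).
Proof. intros [A B]. split. apply (rcont_slice2 f); auto. intros x. eapply Rle_trans; [apply B|]. right. field. generalize (den_pos x) (den_pos y); lra. Qed.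
Lemma quad2_inner M f : quad2 M f -> quad (PI * M) (fun y => LI (fun x => f x y)).
Proof.
  intros H. assert (HM := quad2_M _ _ H). split.
  - apply (LI_cont f (fun y => M / (1 + y ^ 2))%R). apply H. intros x y. apply (quad2_slice M f y H).
    intros y. exists M, 1%R. split. lra. intros z _. unfold Rdiv. rewrite <- (Rmult_1_r M) at 2. apply Rmult_le_compat_l; auto.
    rewrite <- Rinv_1. apply Rinv_le_contravar. lra. nra.
  - intros y. eapply Rle_trans; [apply (LI_bound _ _ (quad2_slice M f y H))|]. right. unfold Rdiv; ring.
Qed.
Lemma LI_Fubini M f : quad2 M f -> LI (fun y => LI (fun x => f x y)) = LI (fun x => LI (fun y => f x y)).
Proof.
  intros H. assert (HM := quad2_M _ _ H). assert (PP := PI_RGT_0).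
  (* Both sides are limits of the integral over the square [-n, n]^2. *)
  assert (G : forall f, quad2 M f -> forall n, (0 < n)%R -> (Cmod (LI (fun y => LI (fun x => f x y)) - CInt (fun y => CInt (fun x => f x y) (-n) n) (-n) n) <= 4 * PI * M * atan_tail n)%R).
  { clear f H. intros f H n Hn.
    assert (Q := quad2_inner _ _ H). assert (A := LI_tail _ _ (-n) n Q). rewrite Ropp_involutive in A.
    assert (Cc : rcont (fun y => CInt (fun x => f x y) (-n) n)) by (apply ci_par_cont, H).
    assert (B : (Cmod (CInt (fun y => LI (fun x => f x y)) (-n) n - CInt (fun y => CInt (fun x => f x y) (-n) n) (-n) n) <= 2 * atan_tail n * M * PI)%R).
    { rewrite <- ci_minus; auto. 2: apply Q.
      eapply Rle_trans. apply (ci_norm _ (fun y => 2 * atan_tail n * M / (1 + y^2))%R). lra. intros x. apply ct_minus; auto. apply Q.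
      intros; apply ct_den. intros y _. eapply Rle_trans; [apply (LI_tail _ _ (-n) n (quad2_slice M f y H))|]. rewrite Ropp_involutive. right. field. generalize (den_pos y); lra.
      rewrite RInt_den. apply Rmult_le_compat_l. generalize (atan_tail_pos n); nra. generalize (atan_bound n) (atan_bound (-n)); lra. }
    replace (_ - _) with ((LI (fun y => LI (fun x => f x y)) - CInt (fun y => LI (fun x => f x y)) (-n) n) + (CInt (fun y => LI (fun x => f x y)) (-n) n - CInt (fun y => CInt (fun x => f x y) (-n) n) (-n) n)) by ring.
    triangle. lra. }
  apply C_eq_small. intros e He.
  destruct (atan_tail_small (e / (8 * PI * (M + 1)))) as [N [HN0 HN]]. apply Rdiv_lt_0_compat; auto. apply Rmult_lt_0_compat; lra.
  assert (A := G f H N HN0). assert (B := G _ (quad2_swap _ _ H) N HN0). simpl in B. rewrite <- (ci_Fubini f) in B by apply H.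
  specialize (HN N ltac:(lra)).
  assert (X : (4 * PI * M * atan_tail N <= e / 2)%R).
  { apply Rle_trans with (4 * PI * M * (e / (8 * PI * (M + 1))))%R. apply Rmult_le_compat_l. nra. lra.
    apply Rmult_le_reg_r with (8 * PI * (M + 1))%R. apply Rmult_lt_0_compat; lra. field_simplify; [|nra]. assert (0 < PI * e)%R by (apply Rmult_lt_0_compat; auto). nra. }
  set (I := CInt (fun y => CInt (fun x => f x y) (-N) N) (-N) N) in *.
  replace (_ - _) with ((LI (fun y => LI (fun x => f x y)) - I) - (LI (fun x => LI (fun y => f x y)) - I)) by ring.
  triangle. rewrite Cmod_opp. lra.
Qed.

(** Cauchy's theorem for a horizontal strip. Integrating f' over a rectangle in the two orders, by
    the fundamental theorem of calculus and Fubini, compares the integrals of f over the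
    horizontal sides with those over the vertical sides, which tend to 0. *)
Lemma LI_cauchy (f f' : C -> C) (M t1 t2 : R) : (t1 <= t2)%R ->
  (forall x t, (t1 <= t <= t2)%R -> cder f (x, t) (f' (x, t)) /\ continuous f' ((x, t) : C)) ->
  (forall x t, (t1 <= t <= t2)%R -> Cmod (f (x, t)) <= M / (1 + x ^ 2))%R ->
  LI (fun x => f (x, t1)) = LI (fun x => f (x, t2)).
Proof.
  (* Clamping t to [t1, t2] makes the integrands continuous everywhere. *)
  intros Ht HD HB. set (cl := fun t : R => Rmax t1 (Rmin t2 t)).
  assert (CLr : forall t, (t1 <= cl t <= t2)%R). { intros t. unfold cl. split. apply Rmax_l. apply Rmax_lub; auto. apply Rmin_l. }
  assert (CLi : forall t, (t1 <= t <= t2)%R -> cl t = t). { intros t [A B]. unfold cl, Rmax, Rmin. repeat destruct (Rle_dec _ _); lra. }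
  assert (CLc : forall t, continuous cl t). { intros t. apply continuity_pt_filterlim. intros e He. exists e. split; auto. intros s [_ Hs]. simpl in *. unfold Rdist in *. eapply Rle_lt_trans; [|exact Hs].
    unfold cl, Rmax, Rmin. apply Rabs_le_between. unfold Rabs in *; destruct (Rcase_abs (s - t)); repeat destruct (Rle_dec _ _); lra. }
  assert (Cc : forall t, (t1 <= t <= t2)%R -> rcont (fun x => f (x, t))).
  { intros t Htt x. apply (continuous_comp (fun x : R => (x, t) : C) f). apply ct_pair. ct. ct. apply (cder_cont f (x,t) (f' (x,t))). apply HD; auto. }
  assert (Q : forall t, (t1 <= t <= t2)%R -> quad M (fun x => f (x, t))). { intros t Htt; split; auto. }
  set (G := fun x t => f' (x, cl t)).
  assert (HG : cont2 G). { intros [x t]. apply (continuous_comp (fun q : R * R => (fst q, cl (snd q)) : C) f'). apply ct_pair. ct. apply (ct_Rcomp cl). ct. apply CLc. apply HD. apply CLr. }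
  assert (HM := quad_M _ _ (Q t1 ltac:(lra))).
  assert (D1 : forall x t, (t1 <= t <= t2)%R -> rder (fun x => f (x, t)) x (G x t)).
  { intros x t Htt. apply (rder_ext (fun x : R => f ((0, t) + x * 1))). intros; f_equal; c_ring.
    apply (rder_eq _ _ (1 * f' (x, t))). unfold G. rewrite CLi; auto. ring.
    apply cder_rder. replace ((0, t) + x * 1) with ((x, t) : C) by (c_ring). apply HD; auto. }
  assert (D2 : forall x t, (t1 <= t <= t2)%R -> rder (fun t => f (x, t)) t (Ci * G x t)).
  { intros x t Htt. apply (rder_ext (fun t : R => f ((x, 0) + t * Ci))). intros; f_equal; c_ring.
    apply (rder_eq _ _ (Ci * f' (x, t))). unfold G. rewrite CLi; auto.
    apply cder_rder. replace ((x, 0) + t * Ci) with ((x, t) : C) by (c_ring). apply HD; auto. }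
  apply C_eq_small. intros e He.
  assert (exists N, (0 < N)%R /\ forall n, (N <= n)%R -> (2 * (t2 - t1) * M / (1 + n ^ 2) <= e / 3)%R) as [N0 [HN0 HN]].
  { exists (6 * (t2 - t1) * M / e + 1)%R. assert (0 <= 6 * (t2 - t1) * M / e)%R. { apply Rmult_le_pos. apply Rmult_le_pos; lra. left; apply Rinv_0_lt_compat; auto. }
    split. lra. intros n Hn. apply Rmult_le_reg_r with (1 + n^2)%R. apply den_pos. unfold Rdiv at 1. rewrite Rmult_assoc, Rinv_l, Rmult_1_r by (generalize (den_pos n); lra).
    assert (6 * (t2 - t1) * M / e <= n ^ 2)%R by nra. apply Rmult_le_compat_l with (r := (e/3)%R) in H0; [|lra].
    replace (e / 3 * (6 * (t2 - t1) * M / e))%R with (2 * (t2 - t1) * M)%R in H0 by (field; lra). nra. }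
  destruct (LI_approx _ _ (Q t1 ltac:(lra)) (e/3)%R ltac:(lra)) as [N1 [_ H1]].
  destruct (LI_approx _ _ (Q t2 ltac:(lra)) (e/3)%R ltac:(lra)) as [N2 [_ H2]].
  set (n := (Rmax N0 (Rmax N1 N2))%R).
  assert (N0 <= n)%R by apply Rmax_l. assert (N1 <= n)%R by (eapply Rle_trans; [apply Rmax_l|apply Rmax_r]). assert (N2 <= n)%R by (eapply Rle_trans; [apply Rmax_r|apply Rmax_r]).
  assert (E : CInt (fun x => f (x, t1)) (-n) n - CInt (fun x => f (x, t2)) (-n) n = - (Ci * CInt (fun t => f (n, cl t) - f (-n, cl t)%R) t1 t2)).
  { rewrite <- ci_scal. 2:{ intros t. apply ct_minus; [apply (continuous_comp (fun t : R => (n, cl t) : C) f)|apply (continuous_comp (fun t : R => (- n, cl t)%R : C) f)].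
      apply ct_pair; [ct|apply CLc]. apply (cder_cont f _ (f' (n, cl t))), HD, CLr. apply ct_pair; [ct|apply CLc]. apply (cder_cont f _ (f' (-n, cl t)%R)), HD, CLr. }
    rewrite <- ci_minus by (apply Cc; lra).
    rewrite (ci_ext _ (fun x => - (1) * CInt (fun t => Ci * G x t) t1 t2)).
    2:{ intros x. rewrite (ci_FTC (fun t => f (x, t))). ring. intros t Hx; apply D2. rewrite Rmin_left, Rmax_right in Hx; auto. intros t; apply ct_mult; [ct|apply (rcont_slice1 G); auto]. }
    rewrite ci_scal. 2:{ intros x. apply (ci_par_cont (fun t x => Ci * G x t)). intros q. apply ct_mult; [ct|]. apply (cont2_swap G); auto. }
    rewrite <- (ci_Fubini (fun x t => Ci * G x t)). 2:{ intros q. apply ct_mult; [ct|]. apply HG. }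
    replace (- (1) * CInt (fun y => CInt (fun x => Ci * G x y) (-n) n) t1 t2) with (- CInt (fun y => CInt (fun x => Ci * G x y) (-n) n) t1 t2) by ring.
    f_equal. apply (RInt_ext (V := C_R_CompleteNormedModule)). intros t Htt. rewrite Rmin_left, Rmax_right in Htt by auto.
    rewrite ci_scal by (apply (rcont_slice2 G); auto). rewrite (ci_FTC (fun x => f (x, t))). rewrite CLi by lra. auto. intros; apply D1; lra. apply (rcont_slice2 G); auto. }
  replace (_ - _) with ((LI (fun x => f (x, t1)) - CInt (fun x => f (x, t1)) (-n) n) + (CInt (fun x => f (x, t1)) (-n) n - CInt (fun x => f (x, t2)) (-n) n) - (LI (fun x => f (x, t2)) - CInt (fun x => f (x, t2)) (-n) n)) by ring.
  triangle. rewrite Cmod_opp.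
  assert (X := Cmod_triangle (LI (fun x => f (x, t1)) - CInt (fun x => f (x, t1)) (-n) n) (CInt (fun x => f (x, t1)) (-n) n - CInt (fun x => f (x, t2)) (-n) n)).
  specialize (H1 (-n)%R n ltac:(lra) ltac:(lra)). specialize (H2 (-n)%R n ltac:(lra) ltac:(lra)).
  assert (Y : (Cmod (CInt (fun x => f (x, t1)) (-n) n - CInt (fun x => f (x, t2)) (-n) n) <= e / 3)%R).
  { rewrite E, Cmod_opp, Cmod_mult, Cmod_Ci, Rmult_1_l. eapply Rle_trans; [|apply (HN n H)].
    eapply Rle_trans. apply (ci_norm _ (fun _ => 2 * M / (1 + n^2))%R); auto.
    { intros t. apply ct_minus; [apply (continuous_comp (fun t : R => (n, cl t) : C) f)|apply (continuous_comp (fun t : R => (- n, cl t)%R : C) f)].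
      apply ct_pair; [ct|apply CLc]. apply (cder_cont f _ (f' (n, cl t))), HD, CLr. apply ct_pair; [ct|apply CLc]. apply (cder_cont f _ (f' (-n, cl t)%R)), HD, CLr. }
    intros; apply continuous_const.
    intros t _. triangle. rewrite Cmod_opp.
    assert (A1 := HB n (cl t) (CLr t)). assert (A2 := HB (-n)%R (cl t) (CLr t)). replace ((-n)^2)%R with (n^2)%R in A2 by ring.
    unfold Rdiv in *. lra.
    rewrite (RInt_const (V := R_CompleteNormedModule)). unfold scal; simpl; unfold mult; simpl. right. field. generalize (den_pos n); simpl; lra. }
  lra.
Qed.

Lemma LI_lin3 M1 M2 M3 (f1 f2 f3 : R -> C) (c1 c2 c3 : C) : quad M1 f1 -> quad M2 f2 -> quad M3 f3 ->
  (exists M, quad M (fun x => c1 * f1 x + c2 * f2 x + c3 * f3 x)) /\ LI (fun x => c1 * f1 x + c2 * f2 x + c3 * f3 x) = c1 * LI f1 + c2 * LI f2 + c3 * LI f3.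
Proof.
  intros H1 H2 H3. assert (A1 := quad_scal _ c1 _ H1). assert (A2 := quad_scal _ c2 _ H2). assert (A3 := quad_scal _ c3 _ H3). split.
  - eexists. apply (quad_plus _ _ _ _ (quad_plus _ _ _ _ A1 A2) A3).
  - rewrite (LI_plus _ _ _ _ (quad_plus _ _ _ _ A1 A2) A3), (LI_plus _ _ _ _ A1 A2), (LI_scal _ _ _ H1), (LI_scal _ _ _ H2), (LI_scal _ _ _ H3). reflexivity.
Qed.

(** * Euler's integral in the logarithmic variable *)

Lemma exp_le (x y : R) : (x <= y)%R -> (exp x <= exp y)%R.
Proof. intros [H| ->]. left; apply exp_increasing; auto. lra. Qed.
Lemma exp_sq y : (0 <= y)%R -> (1 + y + y ^ 2 / 4 <= exp y)%R.
Proof. intros H. replace (exp y) with (exp (y/2) * exp (y/2))%R by (rewrite <- exp_plus; f_equal; field).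
  assert (1 + y / 2 <= exp (y / 2))%R by (apply exp_ineq1_le). nra. Qed.

(** This and the next three lemmas reduce the growth of all integrands below, of the type exp (A x
    - k e^x) or exp (- c |x|), to the majorants of [quad]. *)
Lemma expabs_den c x : (0 < c)%R -> (exp (- c * Rabs x) <= (1 + 4 / c ^ 2) / (1 + x ^ 2))%R.
Proof.
  intros Hc. assert (Hc2 : (0 < c ^ 2)%R) by nra. assert (Hx := Rabs_pos x).
  assert (E : (exp (- c * Rabs x) * exp (c * Rabs x) = 1)%R). { rewrite <- exp_plus. rewrite <- exp_0. f_equal. ring. }
  assert (H := exp_sq (c * Rabs x) ltac:(nra)).
  assert (X : (x ^ 2 = Rabs x ^ 2)%R) by (rewrite RPow_abs, Rabs_pos_eq; auto; apply pow2_ge_0).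
  rewrite X. set (t := Rabs x) in *. assert (Hp := exp_pos (- c * t)).
  apply Rmult_le_reg_r with (1 + t ^ 2)%R. nra. replace ((1 + 4 / c ^ 2) / (1 + t ^ 2) * (1 + t ^ 2))%R with (1 + 4 / c ^ 2)%R by (field; split; nra).
  assert (D : (0 < 4 / c ^ 2)%R) by (apply Rdiv_lt_0_compat; lra).
  assert (1 + t ^ 2 <= (1 + 4 / c ^ 2) * exp (c * t))%R.
  { apply Rle_trans with ((1 + 4 / c ^ 2) * (1 + c * t + (c * t) ^ 2 / 4))%R. 2: apply Rmult_le_compat_l; lra.
    replace ((1 + 4 / c ^ 2) * (1 + c * t + (c * t) ^ 2 / 4))%R with (1 + c * t + (c * t)^2 / 4 + 4 / c^2 * (1 + c * t) + t^2)%R by (field; lra).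
    assert (0 <= c * t)%R by nra. assert (0 <= 4 / c ^ 2 * (1 + c * t))%R by (apply Rmult_le_pos; lra). nra. }
  apply Rmult_le_compat_l with (r := exp (- c * t)) in H0; [|lra].
  replace (exp (- c * t) * ((1 + 4 / c ^ 2) * exp (c * t)))%R with (1 + 4 / c^2)%R in H0. lra.
  rewrite (Rmult_comm (1 + _)), <- Rmult_assoc, E. ring.
Qed.

(** For x < 0 the linear term decays by itself; for x > 0 it is dominated by the quadratic term in
    the expansion of e^x. *)
Lemma dexp_le A k x : (0 < A)%R -> (0 < k)%R -> (exp (A * x - k * exp x) <= exp (4 * A ^ 2 / k) * exp (- A * Rabs x))%R.
Proof.
  intros HA Hk. rewrite <- exp_plus. apply exp_le.
  assert (Q : (0 <= 4 * A ^ 2 / k)%R) by (apply Rmult_le_pos; [nra | left; apply Rinv_0_lt_compat; auto]).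
  assert (P := exp_pos x). destruct (Rle_dec 0 x).
  - rewrite Rabs_pos_eq by auto. assert (H := exp_sq x r).
    assert (k * x ^ 2 / 4 - 2 * A * x + 4 * A ^ 2 / k = k / 4 * (x - 4 * A / k) ^ 2)%R by (field; lra).
    assert (0 <= k / 4 * (x - 4 * A / k) ^ 2)%R by (apply Rmult_le_pos; [lra | apply pow2_ge_0]). nra.
  - rewrite Rabs_left by lra. nra.
Qed.
Lemma kexp_ge k r u : (0 < k)%R -> (0 <= r)%R -> (r * u - r ^ 2 / k <= k * exp u)%R.
Proof.
  intros Hk Hr. assert (P := exp_pos u). assert (Q : (0 <= r ^ 2 / k)%R) by (apply Rmult_le_pos; [nra | left; apply Rinv_0_lt_compat; auto]).
  destruct (Rle_dec 0 u).
  - assert (H := exp_sq u r0). assert (k * u ^ 2 / 4 - r * u + r ^ 2 / k = k / 4 * (u - 2 * r / k) ^ 2)%R by (field; lra).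
    assert (0 <= k / 4 * (u - 2 * r / k) ^ 2)%R by (apply Rmult_le_pos; [lra | apply pow2_ge_0]). nra.
  - nra.
Qed.

(** Completing the square in e^x. *)
Lemma gauss_le A k L x : (0 < k)%R -> (A * x - k * exp (2 * x) + L * exp x <= (L + 1) ^ 2 / (4 * k) + (A * x - 1 * exp x))%R.
Proof.
  intros Hk. replace (2 * x)%R with (x + x)%R by ring. rewrite exp_plus. set (e := exp x).
  assert (H : (k * (e * e) - (L + 1) * e + (L + 1) ^ 2 / (4 * k) = k * (e - (L + 1) / (2 * k)) ^ 2)%R) by (field; lra).
  assert (0 <= k * (e - (L + 1) / (2 * k)) ^ 2)%R by (apply Rmult_le_pos; [lra | apply pow2_ge_0]). lra.
Qed.
Definition Mexp (c : R) : R := (1 + 4 / c ^ 2)%R.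
Definition Mdexp (A k : R) : R := (exp (4 * A ^ 2 / k) * Mexp A)%R.
Lemma dexp_den (A k x : R) : (0 < A)%R -> (0 < k)%R -> (exp (A * x - k * exp x) <= Mdexp A k / (1 + x ^ 2))%R.
Proof.
  intros HA Hk. unfold Mdexp, Rdiv. eapply Rle_trans; [apply dexp_le; auto|]. rewrite Rmult_assoc. apply Rmult_le_compat_l; [left; apply exp_pos | apply expabs_den; auto].
Qed.
Lemma Mexp_pos c : (0 < c)%R -> (0 < Mexp c)%R.
Proof. intros. unfold Mexp. assert (0 < 4 / c ^ 2)%R by (apply Rdiv_lt_0_compat; nra). lra. Qed.
Lemma quad_exp K c f : (0 < c)%R -> rcont f -> (forall x, Cmod (f x) <= K * exp (- c * Rabs x))%R -> quad (K * Mexp c) f.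
Proof.
  intros Hc Hf H. assert (0 <= K)%R. { specialize (H 0%R). rewrite Rabs_R0, Rmult_0_r, exp_0 in H. generalize (Cmod_ge_0 (f 0%R)); lra. }
  split; auto. intros x. eapply Rle_trans; [apply H|]. unfold Rdiv; rewrite Rmult_assoc. apply Rmult_le_compat_l; auto. apply expabs_den; auto.
Qed.
Lemma quad_dexp K A k f : (0 < A)%R -> (0 < k)%R -> rcont f -> (forall x, Cmod (f x) <= K * exp (A * x - k * exp x))%R -> quad (K * Mdexp A k) f.
Proof.
  intros HA Hk Hf H. assert (0 <= K)%R. { specialize (H 0%R). generalize (Cmod_ge_0 (f 0%R)) (exp_pos (A * 0 - k * exp 0)). nra. }
  unfold Mdexp. rewrite <- Rmult_assoc. apply quad_exp; auto. intros x. eapply Rle_trans; [apply H|]. rewrite Rmult_assoc. apply Rmult_le_compat_l; auto. apply dexp_le; auto.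
Qed.
Lemma quad_lim_p M (f : R -> C) : (forall x, Cmod (f x) <= M / (1 + x ^ 2))%R -> lim_p f 0.
Proof.
  intros H e He. exists (Rabs M / e + 1)%R. intros x Hx. replace (f x - 0) with (f x) by ring. eapply Rle_trans; [apply H|].
  assert (0 <= Rabs M / e)%R by (apply Rmult_le_pos; [apply Rabs_pos | left; apply Rinv_0_lt_compat; auto]).
  apply Rmult_le_reg_r with (1 + x ^ 2)%R. apply den_pos. unfold Rdiv. rewrite Rmult_assoc, Rinv_l, Rmult_1_r by (generalize (den_pos x); lra).
  assert (Rabs M / e * e <= x * e)%R by (apply Rmult_le_compat_r; lra). replace (Rabs M / e * e)%R with (Rabs M) in H1 by (field; lra).
  generalize (Rle_abs M). assert (x <= x^2)%R by nra. assert (x * e <= e * x^2)%R by nra. lra.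
Qed.
Lemma lim_opp (f : R -> C) l : lim_p (fun x => f (- x)%R) l -> lim_m f l.
Proof. intros H e He. destruct (H e He) as [N HN]. exists (- N)%R. intros x Hx. specialize (HN (-x)%R ltac:(lra)). rewrite Ropp_involutive in HN. auto. Qed.
Lemma LI_FTC0 M N (F f : R -> C) : quad M f -> (forall x, rder F x (f x)) -> (forall x, Cmod (F x) <= N / (1 + x ^ 2))%R -> LI f = 0.
Proof.
  intros H HF HN. rewrite (LI_FTC M F f 0 0); auto. ring. apply (quad_lim_p N); auto. apply lim_opp, (quad_lim_p N).
  intros x. specialize (HN (-x)%R). replace ((-x)^2)%R with (x^2)%R in HN by ring. auto.
Qed.
Lemma LI_pos M (g : R -> R) : quad M (fun x => RtoC (g x)) -> (forall x, 0 < g x)%R -> (0 < Re (LI (fun x => RtoC (g x))))%R.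
Proof.
  intros H Hg. assert (Hc : forall x, continuous g x). { intros x. apply (ct_re (fun x => RtoC (g x))), H. }
  assert (D : (0 < RInt g (-1) 1)%R). { apply RInt_gt_0; auto. lra. }
  set (d := RInt g (-1) 1) in *. destruct (LI_approx _ _ H (d/2)%R ltac:(lra)) as [N [HN HH]].
  set (n := (N + 1)%R). specialize (HH (-n)%R n ltac:(unfold n; lra) ltac:(unfold n; lra)).
  assert (E : (d <= Re (CInt (fun x => RtoC (g x)) (-n) n))%R).
  { rewrite ci_re by apply H. change (d <= RInt g (-n) n)%R.
    assert (X : forall a b, ex_RInt g a b) by (intros; apply (ex_RInt_continuous (V := R_CompleteNormedModule)); auto).
    assert (P : forall a b, (a <= b)%R -> (0 <= RInt g a b)%R). { intros. apply RInt_ge_0; auto. intros; left; auto. }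
    rewrite <- (RInt_Chasles (V := R_CompleteNormedModule) g (-n) (-1) n), <- (RInt_Chasles (V := R_CompleteNormedModule) g (-1) 1 n) by auto.
    unfold plus; simpl. generalize (P (-n)%R (-1)%R ltac:(unfold n; lra)) (P 1%R n ltac:(unfold n; lra)). fold d. lra. }
  generalize (re_le_Cmod (LI (fun x => RtoC (g x)) - CInt (fun x => RtoC (g x)) (-n) n)). unfold Cminus at 1. rewrite re_plus, re_opp. intros Hr.
  apply Rabs_le_between in Hr. lra.
Qed.

(** The coordinates X = q - p and x = (p + q)/2. After the substitution q = p + X the integrand is
    dominated in p and X separately, hence Fubini applies; the midpoint is reached by a
    translation in p. *)
Lemma LI_diff_mid (f : R -> R -> C) K A B k : (0 < A)%R -> (0 < B)%R -> (0 < k)%R -> cont2 f ->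
  (forall p q, Cmod (f p q) <= K * (exp (A * p - k * exp p) * exp (B * q - k * exp q)))%R ->
  (exists M, quad M (fun X => LI (fun x => f (x - X / 2) (x + X / 2))%R)) /\
  LI (fun p => LI (fun q => f p q)) = LI (fun X => LI (fun x => f (x - X / 2) (x + X / 2))%R).
Proof.
  intros HA HB Hk Hf H.
  assert (HK : (0 <= K)%R). { specialize (H 0 0)%R. generalize (Cmod_ge_0 (f 0 0)%R) (Rmult_lt_0_compat _ _ (exp_pos (A * 0 - k * exp 0)) (exp_pos (B * 0 - k * exp 0))). nra. }
  set (r := (B + A / 2)%R). set (c := Rmin (A / 2) B).
  assert (Hc : (0 < c)%R) by (unfold c; apply Rmin_pos; lra). assert (Hc1 : (c <= A / 2)%R) by apply Rmin_l. assert (Hc2 : (c <= B)%R) by apply Rmin_r.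
  set (K' := (K * (exp (4 * (A + B) ^ 2 / k) * exp (r ^ 2 / k)))%R).
  assert (Q1 : (0 <= r ^ 2 / k)%R) by (apply Rmult_le_pos; [apply pow2_ge_0 | left; apply Rinv_0_lt_compat; auto]).
  assert (Q2 : (4 * (A / 2) ^ 2 / k <= 4 * (A + B) ^ 2 / k)%R) by (apply Rmult_le_compat_r; [left; apply Rinv_0_lt_compat; auto | nra]).
  assert (Bd : forall p X, (Cmod (f p (p + X)) <= K' * (exp (- (A / 2) * Rabs p) * exp (- c * Rabs X)))%R).
  { intros p X. eapply Rle_trans; [apply H|]. unfold K'. rewrite Rmult_assoc. apply Rmult_le_compat_l; auto.
    rewrite <- !exp_plus. apply exp_le. assert (P := exp_pos (p + X)).
    destruct (Rle_dec 0 X).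
    - rewrite (Rabs_pos_eq X) by auto. assert (D := dexp_le (A / 2) k p ltac:(lra) Hk). rewrite <- exp_plus in D.
      assert (D' : (A / 2 * p - k * exp p <= 4 * (A / 2) ^ 2 / k + - (A / 2) * Rabs p)%R). { destruct (Rle_dec (A / 2 * p - k * exp p) (4 * (A / 2) ^ 2 / k + - (A / 2) * Rabs p)); auto. exfalso. apply Rnot_le_lt, exp_increasing in n. lra. }
      assert (G := kexp_ge k r (p + X) Hk ltac:(unfold r; lra)). unfold r in *. nra.
    - rewrite (Rabs_left X) by lra. assert (D := dexp_le (A + B) k p ltac:(lra) Hk). rewrite <- exp_plus in D.
      assert (D' : ((A + B) * p - k * exp p <= 4 * (A + B) ^ 2 / k + - (A + B) * Rabs p)%R). { destruct (Rle_dec ((A + B) * p - k * exp p) (4 * (A + B) ^ 2 / k + - (A + B) * Rabs p)); auto. exfalso. apply Rnot_le_lt, exp_increasing in n0. lra. }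
      assert (R0 := Rabs_pos p). nra. }
  assert (HK' : (0 <= K')%R). { unfold K'. generalize (exp_pos (4 * (A + B) ^ 2 / k)) (exp_pos (r ^ 2 / k)). intros. apply Rmult_le_pos; nra. }
  set (g := fun p X => f p (p + X)%R).
  assert (G2 : quad2 (K' * Mexp (A / 2) * Mexp c) g).
  { split. intros q. apply (continuous_comp_2 (fun q : R * R => fst q) (fun q => (fst q + snd q)%R) f). ct. ct. apply (Hf (fst q, (fst q + snd q)%R)).
    intros p X. eapply Rle_trans; [apply Bd|]. unfold Rdiv. rewrite !Rmult_assoc. apply Rmult_le_compat_l; auto.
    generalize (expabs_den (A / 2) p ltac:(lra)) (expabs_den c X Hc) (exp_pos (- (A / 2) * Rabs p)) (exp_pos (- c * Rabs X)). fold (Mexp (A / 2)) (Mexp c). intros.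
    apply Rle_trans with (Mexp (A / 2) / (1 + p ^ 2) * (Mexp c / (1 + X ^ 2)))%R. apply Rmult_le_compat; lra. right; unfold Rdiv; ring. }
  assert (SH : forall X, LI (fun p => g p X) = LI (fun x => f (x - X / 2) (x + X / 2))%R).
  { intros X. rewrite <- (LI_shift _ (fun p => g p X) (- X / 2) (quad2_slice _ _ X G2)). apply LI_ext. intros x. unfold g. f_equal; field. }
  split.
  - eexists. apply (quad_ext _ (fun X => LI (fun p => g p X))). apply SH. apply (quad2_inner _ _ G2).
  - rewrite (LI_ext _ _ (fun X => eq_sym (SH X))). rewrite (LI_Fubini _ _ G2). apply LI_ext. intros p.
    assert (Qf : quad (K * exp (A * p - k * exp p) * Mdexp B k) (fun q => f p q)).
    { apply quad_dexp; auto. apply (rcont_slice1 f); auto. intros q. rewrite Rmult_assoc. apply H. }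
    rewrite <- (LI_shift _ _ p Qf). apply LI_ext. intros X. unfold g. f_equal; ring.
Qed.

(** Euler's integral of t^(z-1) e^(-t) after t = e^x. *)
Definition Ga (z : C) : C := LI (fun x => Cexp (z * x - exp x)).
Lemma Ga_bd (z : C) (x : R) : Cmod (Cexp (z * x - exp x)) = exp (Re z * x - 1 * exp x).
Proof. rewrite Cmod_Cexp. f_equal. unfold Cminus. rewrite re_plus, re_opp, re_scal_r, re_RtoC. ring. Qed.
Lemma Ga_quad z : (0 < Re z)%R -> quad (1 * Mdexp (Re z) 1) (fun x => Cexp (z * x - exp x)).
Proof. intros H. apply (quad_dexp 1 (Re z) 1). auto. lra. intros x; ct. intros x. rewrite Ga_bd. lra. Qed.

Lemma Ga_fe z : (0 < Re z)%R -> Ga (z + 1) = z * Ga z.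
Proof.
  intros H. assert (H1 : (0 < Re (z + 1))%R) by (rewrite re_plus, re_RtoC; lra).
  assert (Q0 := Ga_quad z H). assert (Q1 := Ga_quad (z + 1) H1).
  assert (E : LI (fun x => z * Cexp (z * x - exp x) - Cexp ((z + 1) * x - exp x)) = 0).
  { eapply LI_FTC0 with (F := fun x : R => Cexp (z * x - exp x)).
    - apply quad_minus. apply quad_scal. exact Q0. exact Q1.
    - intros x. apply (rder_eq _ _ ((z * 1 - exp x) * Cexp (z * x - exp x))).
      2: apply rder_Cexp, rder_minus; [apply rder_scal, rder_id | apply rder_exp].
      replace ((z + 1) * x - exp x) with (RtoC x + (z * x - exp x)) by ring. rewrite (Cexp_plus x), Cexp_R. ring.
    - apply (proj2 Q0). }
  rewrite (LI_minus _ _ _ _ (quad_scal _ z _ Q0) Q1), (LI_scal _ _ _ Q0) in E. unfold Ga.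
  rewrite <- (Cplus_0_r (LI (fun x => Cexp ((z + 1) * x - exp x)))), <- E. ring.
Qed.
Lemma Ga_1 : Ga 1 = 1.
Proof.
  assert (Q := Ga_quad 1 ltac:(rewrite re_RtoC; lra)). unfold Ga.
  rewrite (LI_FTC _ (fun x : R => - Cexp (- exp x)) _ 0 (-(1)) Q). ring.
  - intros x. apply (rder_eq _ _ (- (- exp x * Cexp (- exp x)))). replace (1 * x - exp x) with (x + - exp x) by ring. rewrite Cexp_plus, Cexp_R. ring.
    apply rder_opp, rder_Cexp, rder_opp, rder_exp.
  - intros e He. exists (/ e)%R. intros x Hx. replace (- Cexp (- exp x) - 0) with (- Cexp (- exp x)) by ring. rewrite Cmod_opp, Cmod_Cexp, re_opp, re_RtoC, exp_Ropp.
    assert (0 < / e)%R by (apply Rinv_0_lt_compat; auto). rewrite <- (Rinv_inv e). apply Rinv_le_contravar; auto.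
    assert (A := exp_ineq1_le x). assert (B := exp_ineq1_le (exp x)). lra.
  - intros e He. exists (ln e). intros x Hx. replace (- Cexp (- exp x) - - (1)) with (- (Cexp (- exp x) - 1)) by ring. rewrite Cmod_opp.
    rewrite <- RtoC_opp, Cexp_R, <- RtoC_minus, Cmod_R. apply exp_increasing in Hx. rewrite exp_ln in Hx by auto. assert (P := exp_pos x).
    assert (A := exp_ineq1_le (- exp x)). assert (exp (- exp x) <= 1)%R by (rewrite <- exp_0; apply exp_le; lra). rewrite Rabs_left1; lra.
Qed.
Lemma Ga_real_pos (X : R) : (0 < X)%R -> (0 < Re (Ga X))%R.
Proof.
  intros H. assert (Q := Ga_quad X H). unfold Ga.
  assert (E : forall x : R, Cexp (X * x - exp x) = RtoC (exp (X * x - exp x))). { intros. rewrite <- RtoC_mult, <- RtoC_minus. apply Cexp_R. }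
  rewrite (LI_ext _ _ E). eapply LI_pos. apply (quad_ext _ _ _ E Q). intros; apply exp_pos.
Qed.
Lemma sinh_sq u : (u ^ 2 <= 4 * (exp u - 2 + exp (- u)))%R.
Proof.
  assert (W : forall v, (0 <= v)%R -> (v ^ 2 <= exp (2 * v) - 2 + exp (- (2 * v)))%R).
  { intros v Hv. replace (2 * v)%R with (v + v)%R by ring. replace (- (v + v))%R with (-v + -v)%R by ring. rewrite !exp_plus.
    assert (E : (exp v * exp (- v) = 1)%R) by (rewrite <- exp_plus, Rplus_opp_r; apply exp_0).
    assert (A := exp_ineq1_le v). assert (exp (-v) <= 1)%R by (rewrite <- exp_0; apply exp_le; lra).
    replace (exp v * exp v - 2 + exp (- v) * exp (- v))%R with ((exp v - exp (-v)) ^ 2)%R by (simpl; nra).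
    apply pow_incr. lra. }
  destruct (Rle_dec 0 u).
  - specialize (W (u/2)%R ltac:(lra)). replace (2 * (u / 2))%R with u in W by field. nra.
  - specialize (W (-u/2)%R ltac:(lra)). replace (2 * (- u / 2))%R with (-u)%R in W by field. rewrite Ropp_involutive in W. nra.
Qed.
Lemma Cexp_im_lip (a b : R) : (Cmod (Cexp (Ci * a) - Cexp (Ci * b)) <= Rabs (a - b))%R.
Proof.
  replace (Cexp (Ci * a) - Cexp (Ci * b)) with (Cexp (Ci * b) * (Cexp (Ci * (a - b)%R) - 1)).
  2:{ replace (Ci * a) with (Ci * b + Ci * (a - b)%R) by (rewrite RtoC_minus; ring). rewrite Cexp_plus. ring. }
  rewrite Cmod_mult, Cmod_Cexp. replace (Re (Ci * b)) with 0%R by (unfold Re; simpl; ring). rewrite exp_0, Rmult_1_l.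
  set (w := (a - b)%R).
  assert (E : CInt (fun t => (Ci * w) * Cexp (t * (Ci * w))) 0 1 = Cexp (Ci * w) - 1).
  { rewrite (ci_FTC (fun t => Cexp (t * (Ci * w)))). rewrite Cmult_1_l, Cmult_0_l, Cexp_0; auto.
    intros; apply rder_Cexp_line. intros t; ct. }
  rewrite <- E. apply ci_01_bound. intros t; ct.
  intros t Ht. rewrite Cmod_mult, Cmod_Cexp. replace (Re (t * (Ci * w))) with 0%R by (unfold Re; simpl; ring). rewrite exp_0, Cmod_mult, Cmod_Ci, Cmod_R. lra.
Qed.

(** The mass of t^(X-1) e^(-t) concentrates near t = X, where t^(i y) is nearly constant: the
    factor Cexp (i y x) differs from its value at x = ln X by at most |y| |u| with u = x - ln X,
    and |u| is at most 1/(2N) + (N/2) u^2, where u^2 is bounded by a combination of e^u and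
    e^(-u). So only Ga X, Ga (X + 1) and Ga (X - 1) enter the estimate. *)
Lemma Ga_far_nz (X y : R) : (1 < X)%R -> (9 * y ^ 2 < X - 1)%R -> Ga (X, y) <> 0.
Proof.
  intros HX Hy H0.
  set (N := sqrt (X - 1)). assert (HN : (N * N = X - 1)%R) by (apply sqrt_sqrt; lra). assert (HN0 : (0 < N)%R) by (apply sqrt_lt_R0; lra).
  set (L := ln X). assert (EL : exp L = X) by (apply exp_ln; lra).
  assert (Q := Ga_quad (X, y) ltac:(unfold Re; simpl; lra)). assert (QX := Ga_quad X ltac:(rewrite re_RtoC; lra)).
  assert (QX1 := Ga_quad (X + 1)%R ltac:(rewrite re_RtoC; lra)). assert (QXm := Ga_quad (X - 1)%R ltac:(rewrite re_RtoC; lra)).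
  set (h := fun (Z x : R) => exp (Z * x - exp x)).
  assert (EZ : forall Z x : R, Cexp (RtoC Z * x - exp x) = RtoC (h Z x)). { intros. unfold h. rewrite <- RtoC_mult, <- RtoC_minus. apply Cexp_R. }
  (* The majorant; h (X + 1) x / X and X h (X - 1) x are h X x times e^u and e^(-u). *)
  set (g := fun x => (Rabs y * (/ (2 * N) * h X x + 2 * N * (/ X * h (X + 1)%R x - 2 * h X x + X * h (X - 1)%R x)))%R).
  set (c0 := (Rabs y * (/ (2 * N) - 4 * N))%R). set (c1 := (Rabs y * (2 * N * / X))%R). set (c2 := (Rabs y * (2 * N * X))%R).
  assert (Eg : forall x : R, RtoC c0 * Cexp (RtoC X * x - exp x) + RtoC c1 * Cexp ((X + 1)%R * x - exp x) + RtoC c2 * Cexp ((X - 1)%R * x - exp x) = RtoC (g x)).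
  { intros x. rewrite !EZ, <- !RtoC_mult, <- !RtoC_plus. f_equal. unfold g, c0, c1, c2. ring. }
  destruct (LI_lin3 _ _ _ _ _ _ (RtoC c0) (RtoC c1) (RtoC c2) QX QX1 QXm) as [[Mg Qg] EG].
  apply (quad_ext _ _ _ Eg) in Qg. rewrite (LI_ext _ _ Eg) in EG.
  fold (Ga X) (Ga (X + 1)%R) (Ga (X - 1)%R) in EG.
  assert (Bd : forall x : R, (Cmod (Cexp ((X, y) * x - exp x) - Cexp (Ci * (y * L)%R) * Cexp (RtoC X * x - exp x)) <= g x)%R).
  { intros x. replace ((X, y) * x - exp x) with (Ci * (y * x)%R + (RtoC X * x - exp x)) by (c_ring).
    rewrite Cexp_plus. replace (_ - _) with ((Cexp (Ci * (y * x)%R) - Cexp (Ci * (y * L)%R)) * Cexp (RtoC X * x - exp x)) by ring.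
    rewrite Cmod_mult, EZ, Cmod_R. assert (hp : (0 < h X x)%R) by apply exp_pos. rewrite (Rabs_pos_eq (h X x)) by lra.
    eapply Rle_trans. apply Rmult_le_compat_r. lra. apply Cexp_im_lip.
    replace (y * x - y * L)%R with (y * (x - L))%R by ring. rewrite Rabs_mult. unfold g. rewrite !Rmult_assoc. apply Rmult_le_compat_l. apply Rabs_pos.
    assert (E1 : (/ X * h (X + 1)%R x = exp (x - L) * h X x)%R).
    { unfold h. rewrite <- EL at 1. rewrite <- exp_Ropp, <- !exp_plus. f_equal. ring. }
    assert (E2 : (X * h (X - 1)%R x = exp (- (x - L)) * h X x)%R).
    { unfold h. rewrite <- EL at 1. rewrite <- !exp_plus. f_equal. ring. }
    rewrite E1, E2. assert (S := sinh_sq (x - L)). set (u := (x - L)%R) in *.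
    assert (T : (Rabs u <= / (2 * N) + 2 * N * (exp u - 2 + exp (- u)))%R).
    { assert (Rabs u <= / (2 * N) + N / 2 * u ^ 2)%R.
      { assert (U : (u ^ 2 = Rabs u ^ 2)%R) by (rewrite RPow_abs, Rabs_pos_eq; auto; apply pow2_ge_0). rewrite U.
        assert (0 <= N / 2 * (Rabs u - / N) ^ 2)%R by (apply Rmult_le_pos; [lra | apply pow2_ge_0]).
        replace (N / 2 * (Rabs u - / N) ^ 2)%R with (N / 2 * Rabs u ^ 2 - Rabs u + / (2 * N))%R in H by (field; lra). lra. }
      nra. }
    apply Rmult_le_compat_r with (r := h X x) in T; [|lra]. lra. }
  assert (Cc : rcont (fun x : R => Cexp ((X, y) * x - exp x) - Cexp (Ci * (y * L)%R) * Cexp (RtoC X * x - exp x))) by (intros x; ct).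
  destruct (LI_mono _ _ _ Cc Qg Bd) as [_ I].
  rewrite (LI_minus _ _ _ _ Q (quad_scal _ _ _ QX)), (LI_scal _ _ _ QX) in I. fold (Ga (X, y)) (Ga (RtoC X)) in I. rewrite H0 in I.
  assert (F1 : Ga (RtoC (X + 1)) = RtoC X * Ga X). { rewrite RtoC_plus. apply Ga_fe. rewrite re_RtoC; lra. }
  assert (F2 : Ga (RtoC X) = RtoC (X - 1) * Ga (RtoC (X - 1))). { rewrite <- Ga_fe. f_equal. rewrite RtoC_minus. ring. rewrite re_RtoC; lra. }
  assert (PX := Ga_real_pos X ltac:(lra)).
  assert (EG2 : LI (fun x => RtoC (g x)) = RtoC (Rabs y * (/ (2 * N) + 2 * N * / (X - 1))) * Ga X).
  { assert (E3 : Ga (RtoC (X - 1)) = RtoC (/ (X - 1)) * Ga X). { rewrite F2. rewrite Cmult_assoc, <- RtoC_mult, Rinv_l by lra. ring. }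
    rewrite EG, F1, E3. rewrite !Cmult_assoc, <- !RtoC_mult, <- !Cmult_plus_distr_r, <- !RtoC_plus. f_equal. f_equal. unfold c0, c1, c2. field; lra. }
  rewrite EG2, re_scal_l in I. replace (0 - Cexp (Ci * (y * L)%R) * Ga X) with (- (Cexp (Ci * (y * L)%R) * Ga X)) in I by ring.
  rewrite Cmod_opp, Cmod_mult, Cmod_Cexp in I. replace (Re (Ci * (y * L)%R)) with 0%R in I by (unfold Re; simpl; ring). rewrite exp_0, Rmult_1_l in I.
  assert (J : (Re (Ga X) <= Cmod (Ga X))%R) by (eapply Rle_trans; [apply Rle_abs | apply re_le_Cmod]).
  assert (1 <= Rabs y * (/ (2 * N) + 2 * N * / (X - 1)))%R. { apply Rmult_le_reg_r with (Re (Ga X)); auto. lra. }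
  rewrite <- HN in H. replace (/ (2 * N) + 2 * N * / (N * N))%R with (5 / (2 * N))%R in H by (field; lra).
  assert (2 * N <= 5 * Rabs y)%R. { apply Rmult_le_compat_r with (r := (2 * N)%R) in H; [|lra]. replace (Rabs y * (5 / (2 * N)) * (2 * N))%R with (5 * Rabs y)%R in H by (field; lra). lra. }
  assert (U : (y ^ 2 = Rabs y ^ 2)%R) by (rewrite RPow_abs, Rabs_pos_eq; auto; apply pow2_ge_0). rewrite U in Hy. assert (A := Rabs_pos y). nra.
Qed.

(** The functional equation moves a zero to the right, until |Im z|^2 is small compared with Re z. *)
Lemma Ga_nz z : (0 < Re z)%R -> Ga z <> 0.
Proof.
  intros H. assert (S : forall n : nat, Ga z = 0 -> Ga (z + INR n) = 0 /\ (0 < Re (z + INR n))%R).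
  { induction n as [|n IHn]; intros E.
    - replace (INR 0) with 0%R by reflexivity. replace (z + 0) with z by ring. auto.
    - destruct (IHn E) as [A B]. rewrite S_INR, RtoC_plus, Cplus_assoc. split. rewrite Ga_fe by auto. rewrite A; ring. rewrite re_plus, re_RtoC; lra. }
  intros E. destruct (INR_unbounded (9 * (Im z) ^ 2 + 2)) as [n Hn]. destruct (S n E) as [A _].
  replace (z + INR n) with ((Re z + INR n)%R, Im z) in A by (c_ring).
  revert A. apply Ga_far_nz. generalize (pow2_ge_0 (Im z)); lra. lra.
Qed.

(** * Beta integrals *)

Lemma Clog_R (t : R) : (0 < t)%R -> Clog t = RtoC (ln t).
Proof.
  intros H. unfold Clog, Carg. rewrite Cmod_R, Rabs_pos_eq by lra.
  replace (Im t) with 0%R by reflexivity. replace (Re t) with t by reflexivity.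
  destruct (Rle_dec 0 0); [|lra]. replace (t / t)%R with 1%R by (field; lra). rewrite acos_1. reflexivity.
Qed.
Lemma Euler_is_Ga (z : C) : (0 < Re z)%R -> Euler_integral z = Ga z.
Proof.
  intros Hz. set (g := fun x : R => Cexp (z * x - exp x)). assert (Q := Ga_quad z Hz). fold g in Q.
  set (f := fun t : R => (Cpower t (z - 1) * exp (- t))%C).
  assert (HI : forall a b, (0 < a)%R -> (0 < b)%R -> is_RInt (V := C_R_NormedModule) f a b (CInt g (ln a) (ln b))).
  { intros a b Ha Hb.
    assert (Hpos : forall t, (Rmin a b <= t)%R -> (0 < t)%R). { intros t Ht. unfold Rmin in Ht. destruct (Rle_dec a b); lra. }
    apply (is_RInt_ext (V := C_R_NormedModule) (fun t => scal (/ t)%R (g (ln t)))).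
    - intros t [Ht _]. assert (T := Hpos t (Rlt_le _ _ Ht)). etransitivity; [apply scal_R_Cmult|]. unfold f, g, Cpower.
      rewrite Clog_R by auto. rewrite exp_ln by auto.
      assert (E : RtoC t = Cexp (ln t)) by (rewrite Cexp_R, exp_ln; auto).
      rewrite RtoC_inv by lra. rewrite E at 1. rewrite <- Cexp_opp, <- Cexp_R, <- !Cexp_plus. f_equal. rewrite RtoC_opp. ring.
    - apply (is_RInt_comp (V := C_R_CompleteNormedModule) g ln (fun t => / t)%R a b).
      intros; apply Q. intros t [Ht _]. assert (T := Hpos t Ht). split. apply is_derive_Reals. apply derivable_pt_lim_ln; auto.
      apply continuous_Rinv; lra. }
  assert (HL : is_RInt_gen (V := C_R_NormedModule) f (at_right 0) (Rbar_locally p_infty) (Ga z)).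
  { intros P HP. assert (HP' : locally (T := C_UniformSpace) (Ga z) P) by exact HP. apply locally_Cmod in HP'. destruct HP' as [e [He HP']].
    destruct (LI_approx _ _ Q (e/2)%R ltac:(lra)) as [N [HN HH]].
    apply (Filter_prod _ _ _ (fun a => 0 < a /\ ln a <= - N)%R (fun b => 0 < b /\ N <= ln b)%R).
    - exists (mkposreal _ (exp_pos (- N))). intros a Ha Ha0. split; auto.
      assert (a < exp (- N))%R. { unfold ball in Ha; simpl in Ha; unfold AbsRing_ball, abs, minus, plus, opp in Ha; simpl in Ha. apply Rabs_def2 in Ha. lra. }
      left. rewrite <- (ln_exp (-N)). apply ln_increasing; auto.
    - exists (exp N). intros b Hb. assert (P0 := exp_pos N). split. lra. left. rewrite <- (ln_exp N). apply ln_increasing; auto.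
    - intros a b [Ha0 Ha] [Hb0 Hb]. exists (CInt g (ln a) (ln b)). split. apply HI; auto. apply HP'. rewrite Cmod_minus_sym. specialize (HH _ _ Ha Hb). unfold Ga; fold g. lra. }
  unfold Euler_integral. fold f. apply C_ext; simpl.
  - apply (@is_RInt_gen_unique R_CompleteNormedModule _ _ _ _ (fun t => Re (f t))).
    intros P HP. assert (HP' : locally (Ga z) (fun w : C => P (Re w))). { apply (continuous_fst (U := R_UniformSpace) (V := R_UniformSpace) (Re (Ga z)) (Im (Ga z))). exact HP. }
    specialize (HL _ HP'). revert HL. unfold filtermapi. apply filter_imp. intros [a b] [y [Hy1 Hy2]]. exists (Re y). split; auto.
    apply (is_RInt_fct_extend_fst (U := R_NormedModule) (V := R_NormedModule) f); auto.
  - apply (@is_RInt_gen_unique R_CompleteNormedModule _ _ _ _ (fun t => Im (f t))).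
    intros P HP. assert (HP' : locally (Ga z) (fun w : C => P (Im w))). { apply (continuous_snd (U := R_UniformSpace) (V := R_UniformSpace) (Re (Ga z)) (Im (Ga z))). exact HP. }
    specialize (HL _ HP'). revert HL. unfold filtermapi. apply filter_imp. intros [a b] [y [Hy1 Hy2]]. exists (Im y). split; auto.
    apply (is_RInt_fct_extend_snd (U := R_NormedModule) (V := R_NormedModule) f); auto.
Qed.

(** Where Re z > 0 no shift takes place in the definition of Gamma. *)
Lemma Gamma_Ga (z : C) : (0 < Re z)%R -> Gamma z = Ga z.
Proof.
  intros H. unfold Gamma. replace (Z.to_nat (up (- Re z))) with 0%nat.
  - change (INR 0) with 0%R. simpl pochhammer. rewrite Cplus_0_r. rewrite Euler_is_Ga by auto. unfold Cdiv. rewrite <- RtoC_inv by lra. rewrite Rinv_1. ring.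
  - destruct (archimed (- Re z)) as [_ A]. assert (IZR (up (- Re z)) < 1)%R by lra. apply lt_IZR in H0.
    symmetry. destruct (up (- Re z)); simpl; auto; lia.
Qed.

Definition ch2 (X : R) : R := (exp (X / 2) + exp (- X / 2))%R.
Lemma ch2_pos X : (0 < ch2 X)%R.
Proof. unfold ch2. generalize (exp_pos (X/2)) (exp_pos (-X/2)); lra. Qed.
Lemma ch2_ge X : (exp (Rabs X / 2) <= ch2 X)%R.
Proof. unfold ch2. generalize (exp_pos (X/2)) (exp_pos (-X/2)). intros. unfold Rabs. destruct (Rcase_abs X); lra. Qed.
Lemma Ga_dilate (w : C) (c : R) : (0 < Re w)%R -> (0 < c)%R -> LI (fun x => Cexp (w * x - (c * exp x)%R)) = Cexp (- w * ln c) * Ga w.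
Proof.
  intros Hw Hc. unfold Ga. rewrite <- (LI_shift _ _ (ln c) (Ga_quad w Hw)).
  rewrite <- (LI_scal _ (Cexp (- w * ln c)) _ (quad_shift _ _ (ln c) (Ga_quad w Hw))). apply LI_ext. intros x.
  rewrite <- Cexp_plus. f_equal. rewrite exp_plus, exp_ln by auto. rewrite !RtoC_mult, !RtoC_plus. ring.
Qed.
Lemma Cmod_Cexp_R (z : C) (x : R) : Cmod (Cexp (z * x)) = exp (Re z * x).
Proof. rewrite Cmod_Cexp, re_scal_r; auto. Qed.
Lemma Beta_quad (a b : C) : (0 < Re a)%R -> (0 < Re b)%R ->
  quad (1 * Mexp (Rmin (Re a) (Re b))) (fun X => Cexp ((b - a) * (X / 2)%R - (a + b) * ln (ch2 X))).
Proof.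
  intros Ha Hb.
  set (m := Rmin (Re a) (Re b)). assert (0 < m)%R by (apply Rmin_pos; auto). assert (m <= Re a)%R by apply Rmin_l. assert (m <= Re b)%R by apply Rmin_r.
  apply quad_exp; auto.
  - intros X. ct. apply (ct_Rcomp ln). unfold ch2. unfold Rdiv. ct.
    apply continuity_pt_filterlim. apply derivable_continuous_pt. exists (/ ch2 X)%R. apply derivable_pt_lim_ln, ch2_pos.
  - intros X. rewrite Cmod_Cexp, Rmult_1_l. apply exp_le. unfold Cminus. rewrite !re_plus, !re_opp, !re_scal_r, !re_plus, re_opp.
    assert (L : (Rabs X / 2 <= ln (ch2 X))%R). { rewrite <- (ln_exp (Rabs X / 2)). destruct (ch2_ge X) as [G|G]. left; apply ln_increasing; auto. apply exp_pos. rewrite G; lra. }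
    assert (D : (- (Re a + Re b) * ln (ch2 X) <= - (Re a + Re b) * (Rabs X / 2))%R) by nra.
    assert (Rabs X = X \/ Rabs X = - X)%R by (unfold Rabs; destruct (Rcase_abs X); lra). assert (P := Rabs_pos X). destruct H2 as [E1|E1]; nra.
Qed.

(** The double integral Ga a Ga b in the coordinates of [LI_diff_mid]; the inner integral is
    Euler's integral dilated by ch2 X = 2 cosh (X/2). *)
Lemma Beta_integral (a b : C) : (0 < Re a)%R -> (0 < Re b)%R ->
  Ga a * Ga b = Ga (a + b) * LI (fun X => Cexp ((b - a) * (X / 2)%R - (a + b) * ln (ch2 X))).
Proof.
  intros Ha Hb.
  set (f := fun p q : R => Cexp (a * p - exp p) * Cexp (b * q - exp q)).
  assert (Hf : cont2 f). { intros q. unfold f. ct. }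
  destruct (LI_diff_mid f 1 (Re a) (Re b) 1 Ha Hb ltac:(lra) Hf) as [_ E].
  { intros p q. unfold f. rewrite Cmod_mult, !Ga_bd. lra. }
  assert (Hab : (0 < Re (a + b))%R) by (rewrite re_plus; lra).
  assert (Qa := Ga_quad a Ha). assert (Qb := Ga_quad b Hb).
  transitivity (LI (fun p => LI (fun q => f p q))).
  { symmetry. unfold f. rewrite (LI_ext _ (fun p => Ga b * Cexp (a * p - exp p))). rewrite (LI_scal _ _ _ Qa). apply Cmult_comm.
    intros p. rewrite (LI_scal _ _ _ Qb). apply Cmult_comm. }
  rewrite E.
  assert (EX : forall X, LI (fun x => f (x - X / 2) (x + X / 2))%R = Ga (a + b) * Cexp ((b - a) * (X / 2)%R - (a + b) * ln (ch2 X))).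
  { intros X. transitivity (Cexp ((b - a) * (X / 2)%R) * LI (fun x => Cexp ((a + b) * x - (ch2 X * exp x)%R))).
    - assert (Qc : quad (1 * Mdexp (Re (a + b)) (ch2 X)) (fun x => Cexp ((a + b) * x - (ch2 X * exp x)%R))).
      { apply (quad_dexp 1 (Re (a + b)) (ch2 X)); auto. apply ch2_pos. intros x; ct. intros x. rewrite Cmod_Cexp. right. rewrite Rmult_1_l. f_equal. unfold Cminus. rewrite re_plus, re_opp, re_scal_r, re_RtoC. ring. }
      rewrite <- (LI_scal _ _ _ Qc). apply LI_ext. intros x. unfold f. rewrite <- !Cexp_plus. f_equal.
      replace (x - X / 2)%R with (x + - X / 2)%R by field. unfold ch2. rewrite !exp_plus.
      replace (RtoC (- X / 2)) with (- RtoC (X / 2)) by (rewrite <- RtoC_opp; f_equal; field).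
      rewrite !RtoC_plus, !RtoC_mult, !RtoC_plus. replace (RtoC (- X / 2)) with (- RtoC (X / 2)) by (rewrite <- RtoC_opp; f_equal; field). ring.
    - rewrite Ga_dilate by (auto; apply ch2_pos). rewrite (Cmult_comm _ (Ga _)), Cmult_assoc, (Cmult_comm _ (Ga _)), <- Cmult_assoc, <- Cexp_plus. do 2 f_equal. ring. }
  rewrite (LI_ext _ _ EX).
  apply (LI_scal _ _ _ (Beta_quad a b Ha Hb)).
Qed.
Lemma Cexp_ln (x : R) : (0 < x)%R -> Cexp (ln x) = RtoC x.
Proof. intros. rewrite Cexp_R, exp_ln; auto. Qed.

(** Ga (1/2 - S) Ga (1/2 + S) as a Beta integral: the bilateral Laplace transform at S of 1 / (2
    cosh (X/2)). *)
Definition Rker (S : C) (X : R) : C := Cexp (S * X) / ch2 X.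
Lemma half_pos (S : C) : (Rabs (Re S) < 1 / 2)%R -> (0 < Re (1 / 2 - S))%R /\ (0 < Re (1 / 2 + S))%R.
Proof. intros H. apply Rabs_def2 in H. unfold Re in *; simpl in *. lra. Qed.
Lemma Ga_prod_R (S : C) : (Rabs (Re S) < 1 / 2)%R -> Ga (1 / 2 - S) * Ga (1 / 2 + S) = LI (Rker S).
Proof.
  intros H. destruct (half_pos S H). rewrite Beta_integral by auto. replace (1 / 2 - S + (1 / 2 + S)) with (RtoC 1) by field.
  rewrite Ga_1, Cmult_1_l. apply LI_ext. intros X. unfold Rker.
  replace ((1 / 2 + S - (1 / 2 - S)) * (X / 2)%R - 1 * ln (ch2 X)) with (S * X + - ln (ch2 X)). 2:{ rewrite RtoC_div by lra. field. }
  rewrite Cexp_plus, Cexp_opp, Cexp_ln by apply ch2_pos. reflexivity.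
Qed.

(** Likewise Ga (1/4 - s) Ga (1/4 + s) is 2 Ga (1/2) times the transform of 1 / sqrt (2 cosh X) at
    S = 2 s. *)
Definition Nr (X : R) : R := (/ sqrt (exp X + exp (- X)))%R.
Lemma eX_pos X : (0 < exp X + exp (- X))%R.
Proof. generalize (exp_pos X) (exp_pos (-X)); lra. Qed.
Lemma ln_sqrt x : (0 < x)%R -> ln (sqrt x) = (ln x / 2)%R.
Proof. intros H. assert (0 < sqrt x)%R by (apply sqrt_lt_R0; auto). rewrite <- (sqrt_sqrt x) at 2 by lra. rewrite ln_mult by auto. field. Qed.
Lemma Ga_prod_B (s : C) : (Rabs (Re s) < 1 / 4)%R ->
  Ga (1 / 4 - s) * Ga (1 / 4 + s) = 2 * Ga (1 / 2) * LI (fun X => Cexp (2 * s * X) * Nr X).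
Proof.
  intros H. apply Rabs_def2 in H. assert (A : (0 < Re (1 / 4 - s))%R) by (unfold Re in *; simpl in *; lra). assert (B : (0 < Re (1 / 4 + s))%R) by (unfold Re in *; simpl in *; lra).
  rewrite Beta_integral by auto. assert (Q := Beta_quad _ _ A B).
  rewrite <- (LI_scale _ _ 2 ltac:(lra) Q). replace (1 / 4 - s + (1 / 4 + s)) with (RtoC 1 / 2) by field.
  rewrite (LI_ext _ (fun X => Cexp (2 * s * X) * Nr X)). ring. intros X.
  replace ((1 / 4 + s - (1 / 4 - s)) * (2 * X / 2)%R - 1 / 2 * ln (ch2 (2 * X))) with (2 * s * X + - RtoC (ln (sqrt (ch2 (2 * X))))).
  2:{ rewrite ln_sqrt by apply ch2_pos. replace (2 * X / 2)%R with X by field. rewrite RtoC_div by lra. field. }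
  rewrite Cexp_plus. f_equal. assert (0 < sqrt (ch2 (2 * X)))%R by (apply sqrt_lt_R0, ch2_pos).
  rewrite Cexp_opp, Cexp_ln, <- RtoC_inv by (auto; lra). unfold Nr, ch2. replace (2 * X / 2)%R with X by field. replace (- (2 * X) / 2)%R with (- X)%R by field. reflexivity.
Qed.
Lemma Nr_pos X : (0 < Nr X)%R.
Proof. unfold Nr. apply Rinv_0_lt_compat, sqrt_lt_R0, eX_pos. Qed.
Lemma Nr_le X : (Nr X <= exp (- (1 / 2) * Rabs X))%R.
Proof.
  unfold Nr. replace (- (1 / 2) * Rabs X)%R with (- (Rabs X / 2))%R by field. rewrite (exp_Ropp (Rabs X / 2)). apply Rinv_le_contravar. apply exp_pos.
  replace (exp (Rabs X / 2)) with (sqrt (exp (Rabs X))). apply sqrt_le_1_alt. generalize (exp_pos X) (exp_pos (-X)). unfold Rabs; destruct (Rcase_abs X); lra.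
  rewrite <- (sqrt_Rsqr (exp (Rabs X / 2))) by (left; apply exp_pos). f_equal. unfold Rsqr. rewrite <- exp_plus. f_equal. field.
Qed.
Lemma ct_sqrt {U : UniformSpace} (f : U -> R) x : continuous f x -> continuous (fun y => sqrt (f y)) x.
Proof. intros. apply (ct_Rcomp sqrt); auto. apply continuous_sqrt. Qed.
Lemma ct_Nr X : continuous Nr X.
Proof. unfold Nr. apply ct_Rinv. apply ct_sqrt. ct. apply Rgt_not_eq, sqrt_lt_R0, eX_pos. Qed.
Lemma Re_mul_abs (S : C) (x : R) : (Re S * x <= Rabs (Re S) * Rabs x)%R.
Proof. rewrite <- Rabs_mult. apply Rle_abs. Qed.
Lemma Nr_quad (S : C) : (Rabs (Re S) < 1 / 2)%R -> quad (1 * Mexp (1 / 2 - Rabs (Re S))) (fun X => Cexp (S * X) * Nr X).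
Proof.
  intros H. apply quad_exp. lra. intros X. ct. apply ct_Nr.
  intros X. rewrite Cmod_mult, Cmod_Cexp_R, Cmod_R, Rabs_pos_eq by (left; apply Nr_pos).
  apply Rle_trans with (exp (Rabs (Re S) * Rabs X) * exp (- (1 / 2) * Rabs X))%R.
  apply Rmult_le_compat. left; apply exp_pos. left; apply Nr_pos. apply exp_le, Re_mul_abs. apply Nr_le.
  right. rewrite <- exp_plus, Rmult_1_l. f_equal. ring.
Qed.
Lemma Rker_0 : LI (Rker 0) = RtoC PI.
Proof.
  assert (E : forall X, Rker 0 X = RtoC (/ ch2 X)). { intros X. unfold Rker. rewrite Cmult_0_l, Cexp_0, RtoC_inv by (apply Rgt_not_eq, ch2_pos). field. intro A. apply RtoC_inj in A. generalize (ch2_pos X); lra. }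
  rewrite (LI_ext _ _ E).
  assert (Cc : forall X, continuous (fun X => / ch2 X)%R X). { intros X. unfold ch2, Rdiv. ct. apply (Rgt_not_eq _ _ (ch2_pos X)). }
  assert (Q : quad (1 * Mexp (1/2)) (fun X => RtoC (/ ch2 X))).
  { apply quad_exp. lra. intros X. apply ct_R, Cc. intros X. rewrite Cmod_R, Rabs_pos_eq by (left; apply Rinv_0_lt_compat, ch2_pos).
    rewrite Rmult_1_l. replace (- (1 / 2) * Rabs X)%R with (- (Rabs X / 2))%R by field. rewrite exp_Ropp. apply Rinv_le_contravar. apply exp_pos. apply ch2_ge. }
  rewrite (LI_FTC _ (fun X => RtoC (2 * atan (exp (X / 2)))) _ (RtoC PI) 0 Q). ring.
  - intros X. apply rder_R. auto_derive; auto. unfold ch2. replace (- X / 2)%R with (- (X / 2))%R by field. rewrite exp_Ropp. set (e := exp (X / 2)). assert (0 < e)%R by apply exp_pos. replace (X * / 2)%R with (X / 2)%R by reflexivity. fold e. field. split; nra.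
  - intros e He. destruct (atan_tail_small (e / 2) ltac:(lra)) as [N [HN0 HN]]. exists (2 * N)%R. intros x Hx.
    rewrite <- RtoC_minus, Cmod_R. assert (A := HN (exp (x / 2))). unfold atan_tail in A. assert (B := atan_bound (exp (x / 2))).
    assert (N <= exp (x / 2))%R. { generalize (exp_ineq1_le (x / 2)); lra. } specialize (A H). rewrite Rabs_left; lra.
  - intros e He. exists (2 * ln (e / 2))%R. intros x Hx. replace (RtoC (2 * atan (exp (x / 2))) - 0) with (RtoC (2 * atan (exp (x / 2)))) by ring. rewrite Cmod_R.
    assert (P := exp_pos (x / 2)). assert (A : (0 < atan (exp (x / 2)))%R) by (rewrite <- atan_0; apply atan_increasing; auto).
    assert (exp (x / 2) < e / 2)%R. { rewrite <- (exp_ln (e / 2)) by lra. apply exp_increasing. lra. }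
    assert (atan (exp (x / 2)) <= exp (x / 2))%R.
    { destruct (MVT_gen atan 0 (exp (x / 2)) (fun t => / (1 + t ^ 2))%R) as [c [_ Hc]].
      intros t _. auto_derive; auto. field. generalize (den_pos t); simpl; lra. intros t _. apply derivable_continuous_pt, derivable_pt_atan.
      rewrite atan_0 in Hc. assert (/ (1 + c ^ 2) <= 1)%R. { rewrite <- Rinv_1. apply Rinv_le_contravar. lra. generalize (pow2_ge_0 c); lra. } nra. }
    rewrite Rabs_pos_eq; lra.
Qed.
Lemma Ga_half : Ga (1 / 2) = RtoC (sqrt PI).
Proof.
  assert (E : Ga (1 / 2) * Ga (1 / 2) = RtoC PI).
  { rewrite <- Rker_0, <- Ga_prod_R. f_equal; f_equal; ring. rewrite re_RtoC, Rabs_R0; lra. }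
  assert (P : (0 < Re (Ga (1 / 2)))%R). { replace (RtoC 1 / 2) with (RtoC (1 / 2)) by (rewrite RtoC_div by lra; reflexivity). apply Ga_real_pos; lra. }
  assert (I := f_equal Im E). rewrite im_mult, im_RtoC in I. assert (I0 : Im (Ga (1 / 2)) = 0%R) by nra.
  apply (f_equal Re) in E. rewrite re_mult, I0, re_RtoC in E.
  apply C_ext; rewrite ?re_RtoC, ?im_RtoC; auto. rewrite <- (sqrt_Rsqr (Re (Ga (1/2)))) by lra. f_equal. unfold Rsqr. lra.
Qed.

(** * Hyperbolic functions and a Poisson type integral *)

(** [LI_cauchy] without an order between the two heights. *)
Lemma LI_cauchy2 (f f' : C -> C) (M T t1 t2 : R) : (Rabs t1 <= T)%R -> (Rabs t2 <= T)%R ->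
  (forall x t, (Rabs t <= T)%R -> cder f (x, t) (f' (x, t)) /\ continuous f' ((x, t) : C)) ->
  (forall x t, (Rabs t <= T)%R -> Cmod (f (x, t)) <= M / (1 + x ^ 2))%R ->
  LI (fun x => f (x, t1)) = LI (fun x => f (x, t2)).
Proof.
  intros H1 H2 D B. apply Rabs_le_between in H1, H2.
  destruct (Rle_dec t1 t2); [|symmetry]; apply (LI_cauchy f f' M); try lra; intros x t Ht; (apply D || apply B); apply Rabs_le_between; lra.
Qed.
Lemma cosh_pos y : (0 < cosh y)%R.
Proof. unfold cosh. generalize (exp_pos y) (exp_pos (-y)); lra. Qed.
Lemma cosh_ge y : (exp (Rabs y) / 2 <= cosh y)%R.
Proof. unfold cosh. generalize (exp_pos y) (exp_pos (-y)). unfold Rabs; destruct (Rcase_abs y); lra. Qed.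
Lemma cosh_sinh y : (cosh y ^ 2 - sinh y ^ 2 = 1)%R.
Proof. unfold cosh, sinh. assert (E : (exp y * exp (- y) = 1)%R) by (rewrite <- exp_plus, Rplus_opp_r; apply exp_0). simpl; nra. Qed.
Lemma ct_cosh {U : UniformSpace} (f : U -> R) x : continuous f x -> continuous (fun y => cosh (f y)) x.
Proof. intros. unfold cosh. ct. Qed.
Lemma ct_sinh {U : UniformSpace} (f : U -> R) x : continuous f x -> continuous (fun y => sinh (f y)) x.
Proof. intros. unfold sinh. ct. Qed.
Lemma ct_atan {U : UniformSpace} (f : U -> R) x : continuous f x -> continuous (fun y => atan (f y)) x.
Proof. intros. apply (ct_Rcomp atan); auto. apply (ex_derive_continuous (V := R_NormedModule)). auto_derive; auto. Qed.
Lemma sinh_opp y : sinh (- y) = (- sinh y)%R.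
Proof. unfold sinh. rewrite Ropp_involutive. field. Qed.
Lemma cosh_opp y : cosh (- y) = cosh y.
Proof. unfold cosh. rewrite Ropp_involutive. field. Qed.
Lemma atan_inf : lim_p (fun y => RtoC (atan y)) (RtoC (PI / 2)).
Proof. intros e He. destruct (atan_tail_small e He) as [N [_ HN]]. exists N. intros x Hx. specialize (HN x ltac:(lra)). unfold atan_tail in HN. assert (B := atan_bound x). rewrite <- RtoC_minus, Cmod_R, Rabs_left; lra. Qed.

(** Adding the values at y and - y leaves a real integrand whose antiderivative is an arctangent
    of sinh y. *)
Lemma poisson (p q : R) : (0 < p)%R ->
  quad (2 / p * Mexp 1) (fun y => / (p * cosh y - Ci * (q * sinh y)%R)) /\
  LI (fun y => / (p * cosh y - Ci * (q * sinh y)%R)) = RtoC (PI / sqrt (p ^ 2 + q ^ 2)).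
Proof.
  intros Hp. set (w := sqrt (p ^ 2 + q ^ 2)). assert (Hw2 : (0 < p ^ 2 + q ^ 2)%R) by nra. assert (Hw : (0 < w)%R) by (apply sqrt_lt_R0; auto).
  assert (Ew : (w * w = p ^ 2 + q ^ 2)%R) by (apply sqrt_sqrt; lra).
  set (d := fun y : R => RtoC p * cosh y - Ci * (q * sinh y)%R).
  assert (Rd : forall y, Re (d y) = (p * cosh y)%R). { intros y. unfold d, Re; simpl. ring. }
  assert (Nd : forall y, d y <> 0). { intros y E. apply (f_equal Re) in E. rewrite Rd, re_RtoC in E. generalize (cosh_pos y); nra. }
  assert (Q : quad (2 / p * Mexp 1) (fun y => / d y)).
  { apply quad_exp. lra. intros y. unfold d. ct. apply (ct_cosh (fun y => y)); ct. apply (ct_sinh (fun y => y)); ct. apply Nd.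
    intros y. rewrite Cmod_inv by auto. replace (2 / p * exp (- (1) * Rabs y))%R with (/ (p * (exp (Rabs y) / 2)))%R.
    apply Rinv_le_contravar. generalize (exp_pos (Rabs y)); nra. eapply Rle_trans; [|apply re_le_Cmod]. rewrite Rd, (Rabs_pos_eq (p * cosh y)). apply Rmult_le_compat_l. lra. apply cosh_ge. generalize (cosh_pos y); nra.
    replace (- (1) * Rabs y)%R with (- Rabs y)%R by ring. rewrite exp_Ropp. field. generalize (exp_pos (Rabs y)); split; lra. }
  split. exact Q.
  set (fr := fun y => (p * cosh y / (p ^ 2 * cosh y ^ 2 + q ^ 2 * sinh y ^ 2))%R).
  assert (Den : forall y, (0 < p ^ 2 * cosh y ^ 2 + q ^ 2 * sinh y ^ 2)%R). { intros y. assert (A := cosh_pos y). assert (0 < p * cosh y)%R by nra. assert (0 <= (q * sinh y) ^ 2)%R by apply pow2_ge_0. nra. }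
  assert (E2 : forall y, / d y + / d (- y)%R = 2 * RtoC (fr y)).
  { intros y. assert (N1 := Nd y). assert (N2 := Nd (-y)%R).
    assert (E : d y * d (- y)%R = RtoC (p ^ 2 * cosh y ^ 2 + q ^ 2 * sinh y ^ 2)). { unfold d. rewrite cosh_opp, sinh_opp. c_ring. }
    assert (Es : d y + d (- y)%R = 2 * RtoC (p * cosh y)). { unfold d. rewrite cosh_opp, sinh_opp. c_ring. }
    transitivity ((d y + d (- y)%R) / (d y * d (- y)%R)). field; auto. rewrite E, Es. unfold fr. rewrite RtoC_div. unfold Cdiv. ring. apply Rgt_not_eq, Den. }
  assert (Qf := quad_plus _ _ _ _ Q (quad_opp_arg _ _ Q)).
  assert (L : lim_p (fun y => 2 * RtoC (/ w * atan (w * sinh y / p))) (2 * RtoC (/ w * (PI / 2)))).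
      { intros e He. destruct (atan_inf (e * w / 2)%R) as [N HN]. apply Rdiv_lt_0_compat; nra.
        exists (2 * (Rabs N * p / w) + 2)%R. intros y Hy. specialize (HN (w * sinh y / p)%R).
        assert (P0 : (0 <= Rabs N * p / w)%R) by (apply Rmult_le_pos; [apply Rmult_le_pos; [apply Rabs_pos|lra] | left; apply Rinv_0_lt_compat; auto]).
        assert (S : (y / 2 - 1/2 < sinh y)%R). { unfold sinh. assert (A := exp_ineq1_le y). assert (exp (- y) <= 1)%R by (rewrite <- exp_0; apply exp_le; lra). lra. }
        assert (N < w * sinh y / p)%R. { apply Rle_lt_trans with (Rabs N). apply Rle_abs. apply Rmult_lt_reg_r with (p / w)%R. apply Rdiv_lt_0_compat; auto.
          replace (w * sinh y / p * (p / w))%R with (sinh y) by (field; lra). unfold Rdiv in *. rewrite <- Rmult_assoc. lra. }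
        specialize (HN H). replace (_ - _) with (2 * RtoC (/ w) * (RtoC (atan (w * sinh y / p)) - RtoC (PI / 2))). 2:{ rewrite !RtoC_mult. ring. }
        rewrite !Cmod_mult, !Cmod_R, (Rabs_pos_eq 2), (Rabs_pos_eq (/ w)) by (try lra; left; apply Rinv_0_lt_compat; auto).
        apply Rmult_le_compat_l with (r := (2 * / w)%R) in HN. 2: assert (0 < / w)%R by (apply Rinv_0_lt_compat; auto); lra.
        eapply Rle_trans; [exact HN|]. right; field; lra. }
  assert (L2 : 2 * LI (fun y => / d y) = 2 * RtoC (PI / w)).
  { replace (2 * LI (fun y => / d y)) with (LI (fun y => / d y) + LI (fun y => / d (- y)%R)). 2:{ rewrite (LI_opp _ (fun y => / d y) Q). ring. }
    rewrite <- (LI_plus _ _ _ _ Q (quad_opp_arg _ _ Q)). rewrite (LI_ext _ _ E2). apply (quad_ext _ _ _ E2) in Qf.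
    rewrite (LI_FTC _ (fun y : R => 2 * RtoC (/ w * atan (w * sinh y / p))) _ (2 * RtoC (/ w * (PI / 2))) (- (2 * RtoC (/ w * (PI / 2)))) Qf).
    c_field; lra.
    - intros y. apply rder_scal, rder_R. auto_derive. auto.
      unfold fr. assert (A := cosh_sinh y). assert (DD := Den y).
      replace (cosh y ^ 2)%R with (1 + sinh y ^ 2)%R in * by lra.
      assert (0 < 1 + w * sinh y * / p * (w * sinh y * / p * 1))%R. { generalize (pow2_ge_0 (w * sinh y * / p)); simpl; lra. }
      replace (q ^ 2)%R with (w * w - p ^ 2)%R in * by lra. field. repeat split; try lra; nra.
    - exact L.
    - apply lim_opp. intros e He.
      destruct (L e He) as [N HN]. exists N. intros y Hy. specialize (HN y Hy). rewrite <- Cmod_opp. eapply Rle_trans; [|exact HN]. right. f_equal.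
      rewrite sinh_opp. replace (w * - sinh y / p)%R with (- (w * sinh y / p))%R by (field; lra). rewrite atan_opp. rewrite !RtoC_mult, !RtoC_opp. ring. }
  apply (f_equal (fun z => / 2 * z)) in L2. rewrite !Cmult_assoc, Cinv_l, !Cmult_1_l in L2. exact L2. intro A; apply RtoC_inj in A; lra.
Qed.

(** * The product Gamma (1/4 - s) Gamma (1/4 + s) *)

Ltac ct_ext ::= lazymatch goal with
 | |- continuous (fun y => sqrt _) _ => apply ct_sqrt
 | |- continuous (fun y => cosh _) _ => apply ct_cosh
 | |- continuous cosh _ => apply (ct_cosh (fun y => y))
 | |- continuous (fun y => sinh _) _ => apply ct_sinh
 | |- continuous sinh _ => apply (ct_sinh (fun y => y))
 | |- continuous (fun y => atan _) _ => apply ct_atan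
 end.

(** cosh (2 y). *)
Definition Dn (y : R) : R := (cosh y ^ 2 + sinh y ^ 2)%R.

(** The angle in (-PI/2, PI/2) with e^(i th/2) = (cosh y + i sinh y) / sqrt (cosh 2y). *)
Definition th (y : R) : R := (2 * atan (sinh y / cosh y))%R.
Lemma Dn_ge y : (1 <= Dn y)%R.
Proof. unfold Dn. generalize (cosh_sinh y) (pow2_ge_0 (sinh y)); lra. Qed.
Lemma sqDn_pos y : (0 < sqrt (Dn y))%R.
Proof. apply sqrt_lt_R0. generalize (Dn_ge y); lra. Qed.
Lemma Cexp_Ci (a : R) : Cexp (Ci * a) = (cos a, sin a).
Proof. unfold Cexp. replace (Re (Ci * a)) with 0%R by (unfold Re; simpl; ring). replace (Im (Ci * a)) with a by (unfold Im; simpl; ring). rewrite exp_0. c_ring. Qed.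
Lemma Cexp_th2 y : Cexp (Ci * (th y / 2)%R) = (RtoC (cosh y) + Ci * sinh y) / RtoC (sqrt (Dn y)).
Proof.
  assert (Hc := cosh_pos y). assert (Hs := sqDn_pos y).
  assert (E : (sqrt (1 + (sinh y / cosh y)²) = sqrt (Dn y) / cosh y)%R).
  { replace (1 + (sinh y / cosh y)²)%R with (Dn y / (cosh y * cosh y))%R by (unfold Dn, Rsqr; field; lra).
    rewrite sqrt_div_alt by nra. rewrite sqrt_square by lra. auto. }
  unfold Cdiv. rewrite <- RtoC_inv by lra.
  unfold th. replace (2 * atan (sinh y / cosh y) / 2)%R with (atan (sinh y / cosh y)) by field.
  rewrite Cexp_Ci, cos_atan, sin_atan, E. c_field; lra.
Qed.
Lemma th_bound y : (Rabs (th y) <= PI / 2)%R.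
Proof.
  assert (Hc := cosh_pos y). assert (A := cosh_sinh y). assert (-1 <= sinh y / cosh y <= 1)%R.
  { assert (- cosh y <= sinh y <= cosh y)%R by nra. split; apply Rmult_le_reg_r with (cosh y); auto; unfold Rdiv; rewrite Rmult_assoc, Rinv_l, Rmult_1_r by lra; lra. }
  unfold th. assert (M : forall a b, (a <= b -> atan a <= atan b)%R) by (intros a b [G| ->]; [left; apply atan_increasing; auto | lra]).
  assert (B1 := M _ _ (proj1 H)). assert (B2 := M _ _ (proj2 H)). replace (-1)%R with (- (1))%R in B1 by lra. rewrite atan_opp in B1. rewrite atan_1 in B1, B2. apply Rabs_le_between. lra.
Qed.
Lemma th_bound_strict y : (Rabs (th y) < PI / 2)%R.
Proof.
  assert (Hc := cosh_pos y). assert (A := cosh_sinh y). assert (-1 < sinh y / cosh y < 1)%R.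
  { assert (- cosh y < sinh y < cosh y)%R by nra. split; apply Rmult_lt_reg_r with (cosh y); auto; unfold Rdiv; rewrite Rmult_assoc, Rinv_l, Rmult_1_r by lra; lra. }
  unfold th. assert (B1 := atan_increasing _ _ (proj1 H)). assert (B2 := atan_increasing _ _ (proj2 H)). replace (-1)%R with (- (1))%R in B1 by lra. rewrite atan_opp in B1. rewrite atan_1 in B1, B2. apply Rabs_def1; lra.
Qed.
Lemma ct_th {U : UniformSpace} (f : U -> R) x : continuous f x -> continuous (fun y => th (f y)) x.
Proof. intros. unfold th. ct. apply Rgt_not_eq, cosh_pos. Qed.
Lemma ct_Dn {U : UniformSpace} (f : U -> R) x : continuous f x -> continuous (fun y => Dn (f y)) x.
Proof. intros. unfold Dn. simpl. ct. Qed.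
Ltac ct_ext ::= lazymatch goal with
 | |- continuous (fun y => sqrt _) _ => apply ct_sqrt
 | |- continuous (fun y => cosh _) _ => apply ct_cosh
 | |- continuous (fun y => sinh _) _ => apply ct_sinh
 | |- continuous (fun y => atan _) _ => apply ct_atan
 | |- continuous (fun y => th _) _ => apply ct_th
 | |- continuous th _ => apply (ct_th (fun y => y))
 | |- continuous (fun y => Dn _) _ => apply ct_Dn
 | |- continuous Dn _ => apply (ct_Dn (fun y => y))
 end.
Lemma invDn_le y : (/ sqrt (Dn y) <= 2 * exp (- (1) * Rabs y))%R.
Proof.
  replace (2 * exp (- (1) * Rabs y))%R with (/ (exp (Rabs y) / 2))%R.
  - apply Rinv_le_contravar. generalize (exp_pos (Rabs y)); lra. eapply Rle_trans; [apply cosh_ge|].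
    rewrite <- (sqrt_pow2 (cosh y)) by (left; apply cosh_pos). apply sqrt_le_1_alt. unfold Dn. generalize (pow2_ge_0 (sinh y)); lra.
  - replace (- (1) * Rabs y)%R with (- Rabs y)%R by ring. rewrite exp_Ropp. field. apply Rgt_not_eq, exp_pos.
Qed.

(** 2 cosh (z/2), the continuation of ch2 to the strip |Im z| <= PI/2, where it has no zeros. *)
Definition c2 (z : C) : C := Cexp (z / 2) + Cexp (- (z / 2)).
Lemma c2_re (x t : R) : Re (c2 (x, t)) = (ch2 x * cos (t / 2))%R.
Proof.
  unfold c2. replace ((x, t) / 2) with ((x / 2, t / 2)%R : C) by (c_field).
  replace (- ((x / 2, t / 2)%R : C)) with ((- x / 2, - (t / 2))%R : C) by (c_field).
  rewrite re_plus. unfold Cexp, Re, Im, ch2; simpl. rewrite cos_neg. ring.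
Qed.
Lemma c2_R (x : R) : c2 x = RtoC (ch2 x).
Proof.
  unfold c2, ch2. replace (- (RtoC x / 2)) with (RtoC (- x / 2)) by (c_field).
  replace (RtoC x / 2) with (RtoC (x / 2)) by (c_field). rewrite !Cexp_R, RtoC_plus. reflexivity.
Qed.
Lemma cos_quarter t : (Rabs t <= PI / 2)%R -> (1 / 2 <= cos (t / 2))%R.
Proof.
  intros H. apply Rabs_le_between in H. assert (P := PI_RGT_0). rewrite <- cos_PI3.
  destruct (Rle_dec 0 t). apply cos_decr_1; lra. rewrite <- (cos_neg (t / 2)). apply cos_decr_1; lra.
Qed.
Lemma c2_ge (x t : R) : (Rabs t <= PI / 2)%R -> (exp (Rabs x / 2) / 2 <= Cmod (c2 (x, t)))%R.
Proof.
  intros H. eapply Rle_trans; [|apply re_le_Cmod]. rewrite c2_re. assert (A := cos_quarter t H). assert (B := ch2_ge x). assert (P := exp_pos (Rabs x / 2)).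
  eapply Rle_trans; [|apply Rle_abs]. nra.
Qed.
Lemma c2_nz (x t : R) : (Rabs t <= PI / 2)%R -> c2 (x, t) <> 0.
Proof. intros H E. assert (A := c2_ge x t H). rewrite E, Cmod_0 in A. generalize (exp_pos (Rabs x / 2)); lra. Qed.
Lemma c2_inv_le (x t : R) : (Rabs t <= PI / 2)%R -> (Cmod (/ c2 (x, t)) <= 2 * exp (- (1 / 2) * Rabs x))%R.
Proof.
  intros H. rewrite Cmod_inv by (apply c2_nz; auto). replace (2 * exp (- (1 / 2) * Rabs x))%R with (/ (exp (Rabs x / 2) / 2))%R.
  apply Rinv_le_contravar. generalize (exp_pos (Rabs x / 2)); lra. apply c2_ge; auto.
  replace (- (1 / 2) * Rabs x)%R with (- (Rabs x / 2))%R by field. rewrite exp_Ropp. field. apply Rgt_not_eq, exp_pos.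
Qed.
Lemma cder_lin (c z : C) : cder (fun w => c * w) z c.
Proof. apply (cder_eq _ _ (c * 1)). ring. apply cder_scal, cder_id. Qed.
Lemma cder_half z : cder (fun w => w / 2) z (/ 2).
Proof. apply (cder_ext (fun w => / 2 * w)). intros; unfold Cdiv; ring. apply cder_lin. Qed.
Lemma ct_c2 {U : UniformSpace} (f : U -> C) x : continuous f x -> continuous (fun y => c2 (f y)) x.
Proof. intros. unfold c2. ct; apply RtoC_nz; lra. Qed.
Lemma cder_c2 z : cder c2 z (/ 2 * (Cexp (z / 2) - Cexp (- (z / 2)))).
Proof.
  apply (cder_eq _ _ (/ 2 * Cexp (z / 2) + - (/ 2) * Cexp (- (z / 2)))). ring.
  apply (cder_plus (fun z => Cexp (z / 2)) (fun z => Cexp (- (z / 2)))).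
  apply (cder_Cexp (fun z => z / 2)), cder_half. apply (cder_Cexp (fun z => - (z / 2))), cder_opp, cder_half.
Qed.
Lemma exp_bd_strip (S : C) (x t : R) : (Rabs t <= PI / 2)%R -> (Cmod (Cexp (S * (x, t))) <= exp (PI / 2 * Rabs (Im S)) * exp (Rabs (Re S) * Rabs x))%R.
Proof.
  intros H. rewrite Cmod_Cexp, <- exp_plus. apply exp_le. rewrite re_mult. unfold Re at 2, Im at 2; simpl.
  assert (A := Re_mul_abs S x). assert (- (Im S * t) <= Rabs (Im S) * Rabs t)%R. { rewrite <- Rabs_mult, <- Rabs_Ropp. apply Rle_abs. }
  assert (B := Rabs_pos (Im S)). nra.
Qed.
Lemma expabs_den_scal K c x : (0 <= K)%R -> (0 < c)%R -> (K * exp (- c * Rabs x) <= K * Mexp c / (1 + x ^ 2))%R.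
Proof. intros HK Hc. unfold Rdiv. rewrite Rmult_assoc. apply Rmult_le_compat_l; auto. apply expabs_den; auto. Qed.

(** The factor Cexp (i S t) is absorbed by moving the line of integration to height - t. *)
Lemma Rker_shift (S : C) (t : R) : (Rabs (Re S) < 1 / 2)%R -> (Rabs t <= PI / 2)%R ->
  quad (exp (PI / 2 * Rabs (Im S)) * 2 * Mexp (1 / 2 - Rabs (Re S))) (fun x => Cexp (S * x) / c2 (x, (- t)%R)) /\
  Cexp (Ci * S * t) * LI (Rker S) = LI (fun x => Cexp (S * x) / c2 (x, (- t)%R)).
Proof.
  intros HS Ht. set (f := fun z => Cexp (S * z) / c2 z).
  assert (F0 : forall x : R, f (x, 0)%R = Rker S x).
  { intros x. unfold f, Rker. change ((x, 0)%R : C) with (RtoC x). rewrite c2_R. reflexivity. }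
  assert (BdF : forall x s, (Rabs s <= PI / 2)%R -> (Cmod (f (x, s)) <= exp (PI / 2 * Rabs (Im S)) * 2 * exp (- (1 / 2 - Rabs (Re S)) * Rabs x))%R).
  { intros x s Hs. unfold f, Cdiv. rewrite Cmod_mult. assert (A := exp_bd_strip S x s Hs). assert (B := c2_inv_le x s Hs).
    eapply Rle_trans. apply Rmult_le_compat; try apply Cmod_ge_0; eassumption. right.
    replace (- (1 / 2 - Rabs (Re S)) * Rabs x)%R with (Rabs (Re S) * Rabs x + - (1 / 2) * Rabs x)%R by ring. rewrite exp_plus. ring. }
  assert (Q : quad (exp (PI / 2 * Rabs (Im S)) * 2 * Mexp (1 / 2 - Rabs (Re S))) (fun x => f (x, (- t)%R))).
  { apply quad_exp. lra. intros x. unfold f. apply ct_div. ct. apply ct_pair; ct. apply ct_c2, ct_pair; ct. apply c2_nz; rewrite Rabs_Ropp; auto. intros x; apply BdF; rewrite Rabs_Ropp; auto. }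
  assert (EE : forall x : R, Cexp (Ci * S * t) * f (x, (- t)%R) = Cexp (S * x) / c2 (x, (- t)%R)).
  { intros x. unfold f. unfold Cdiv. rewrite Cmult_assoc, <- Cexp_plus. do 2 f_equal. c_ring. }
  assert (E : LI (Rker S) = LI (fun x => f (x, (- t)%R))).
  { rewrite <- (LI_ext _ _ F0).
    apply (LI_cauchy2 f (fun z => ((S * Cexp (S * z)) * c2 z - Cexp (S * z) * (/ 2 * (Cexp (z / 2) - Cexp (- (z / 2))))) / (c2 z * c2 z)) (exp (PI / 2 * Rabs (Im S)) * 2 * Mexp (1 / 2 - Rabs (Re S))) (PI / 2)).
    rewrite Rabs_R0. generalize PI_RGT_0; lra. rewrite Rabs_Ropp; auto.
    - intros x s Hs. assert (N := c2_nz x s Hs). split.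
      + apply (cder_div (fun z => Cexp (S * z)) c2). apply cder_Cexp, cder_lin. apply cder_c2. auto.
      + ct; try (apply ct_c2; ct); try (apply RtoC_nz; lra); try apply Cmult_neq_0; auto.
    - intros x s Hs. eapply Rle_trans; [apply BdF; auto|]. apply expabs_den_scal. generalize (exp_pos (PI / 2 * Rabs (Im S))); lra. lra. }
  split. 2: rewrite E, <- (LI_scal _ _ _ Q); apply LI_ext, EE.
  apply quad_exp. lra. intros x. apply ct_div. ct. apply ct_c2, ct_pair; ct. apply c2_nz; rewrite Rabs_Ropp; auto.
  intros x. unfold Cdiv. rewrite Cmod_mult, Cmod_Cexp_R. assert (B := c2_inv_le x (-t)%R ltac:(rewrite Rabs_Ropp; auto)).
  assert (D := exp_le _ _ (Re_mul_abs S x)). assert (1 <= exp (PI / 2 * Rabs (Im S)))%R.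
  { rewrite <- exp_0. apply exp_le. apply Rmult_le_pos. generalize PI_RGT_0; lra. apply Rabs_pos. }
  replace (- (1 / 2 - Rabs (Re S)) * Rabs x)%R with (Rabs (Re S) * Rabs x + - (1 / 2) * Rabs x)%R by ring. rewrite exp_plus.
  apply Rle_trans with (exp (Rabs (Re S) * Rabs x) * (2 * exp (- (1 / 2) * Rabs x)))%R. apply Rmult_le_compat; auto. left; apply exp_pos. apply Cmod_ge_0.
  assert (0 < exp (Rabs (Re S) * Rabs x) * exp (- (1 / 2) * Rabs x))%R by (apply Rmult_lt_0_compat; apply exp_pos). nra.
Qed.

(** The transform of a measure on (-PI/2, PI/2), parametrised by y through the angle th y. *)
Definition kint (S : C) : C := LI (fun y => Cexp (Ci * S * th y) * RtoC (/ sqrt (Dn y))).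
Lemma kint_quad (S : C) : quad (exp (PI / 2 * Rabs (Im S)) * 2 * Mexp 1) (fun y => Cexp (Ci * S * th y) * RtoC (/ sqrt (Dn y))).
Proof.
  apply quad_exp. lra.
  - intros y. ct. apply Rgt_not_eq, sqDn_pos.
  - intros y. rewrite Cmod_mult, Cmod_Cexp_R, Cmod_R, Rabs_pos_eq by (left; apply Rinv_0_lt_compat, sqDn_pos).
    rewrite Rmult_assoc. apply Rmult_le_compat. left; apply exp_pos. left; apply Rinv_0_lt_compat, sqDn_pos. 2: apply invDn_le.
    apply exp_le. replace (Re (Ci * S)) with (- Im S)%R by (unfold Re, Im; simpl; ring).
    eapply Rle_trans; [apply Rle_abs|]. rewrite Rabs_mult, Rabs_Ropp, Rmult_comm. apply Rmult_le_compat_r. apply Rabs_pos. apply th_bound.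
Qed.

(** The shifts of [Rker_shift] with t = th y turn the left side into a double integral, whose
    integral in y is [poisson]. *)
Lemma kint_R (S : C) : (Rabs (Re S) < 1 / 2)%R -> RtoC (sqrt 2) * kint S * LI (Rker S) = RtoC PI * LI (fun X => Cexp (S * X) * Nr X).
Proof.
  intros HS. assert (P2 := PI_RGT_0).
  set (F := fun x y : R => (RtoC (/ sqrt (Dn y)) * (Cexp (S * x) / c2 (x, (- th y)%R)))).
  assert (TB : forall y, (Rabs (- th y) <= PI / 2)%R) by (intros; rewrite Rabs_Ropp; apply th_bound).
  assert (FB : forall x y, (Cmod (F x y) <= 4 * exp (- (1 / 2 - Rabs (Re S)) * Rabs x) * exp (- (1) * Rabs y))%R).
  { intros x y. unfold F, Cdiv. rewrite !Cmod_mult, Cmod_R, Rabs_pos_eq by (left; apply Rinv_0_lt_compat, sqDn_pos). rewrite Cmod_Cexp_R.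
    assert (A := invDn_le y). assert (B := c2_inv_le x _ (TB y)). assert (D := exp_le _ _ (Re_mul_abs S x)).
    replace (- (1 / 2 - Rabs (Re S)) * Rabs x)%R with (Rabs (Re S) * Rabs x + - (1 / 2) * Rabs x)%R by ring. rewrite exp_plus.
    apply Rle_trans with ((2 * exp (- (1) * Rabs y)) * (exp (Rabs (Re S) * Rabs x) * (2 * exp (- (1 / 2) * Rabs x))))%R.
    apply Rmult_le_compat; auto. left; apply Rinv_0_lt_compat, sqDn_pos. apply Rmult_le_pos. left; apply exp_pos. apply Cmod_ge_0.
    apply Rmult_le_compat; auto. left; apply exp_pos. apply Cmod_ge_0. right; ring. }
  assert (Q2 : quad2 (4 * Mexp (1 / 2 - Rabs (Re S)) * Mexp 1) F).
  { split.
    - intros q. unfold F. apply ct_mult. ct. apply Rgt_not_eq, sqDn_pos. apply ct_div. ct. apply ct_c2, ct_pair; ct. apply c2_nz; auto.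
    - intros x y. eapply Rle_trans; [apply FB|]. assert (A := expabs_den (1 / 2 - Rabs (Re S)) x ltac:(lra)). assert (B := expabs_den 1 y ltac:(lra)).
      fold (Mexp (1 / 2 - Rabs (Re S))) in A. fold (Mexp 1) in B.
      apply Rle_trans with (4 * (Mexp (1 / 2 - Rabs (Re S)) / (1 + x ^ 2)) * (Mexp 1 / (1 + y ^ 2)))%R.
      rewrite !Rmult_assoc. apply Rmult_le_compat_l. lra. apply Rmult_le_compat; auto; left; apply exp_pos. right; unfold Rdiv; ring. }
  assert (FU := LI_Fubini _ _ Q2).
  assert (E1 : LI (fun y => LI (fun x => F x y)) = kint S * LI (Rker S)).
  { unfold kint. rewrite Cmult_comm, <- (LI_scal _ (LI (Rker S)) _ (kint_quad S)). apply LI_ext. intros y. unfold F.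
    destruct (Rker_shift S (th y) HS (th_bound y)) as [Qy Ey].
    rewrite (LI_scal _ _ _ Qy), <- Ey. ring. }
  assert (E2 : forall x, LI (fun y => F x y) = Cexp (S * x) * RtoC (PI / (sqrt 2 * sqrt (exp x + exp (- x))))).
  { intros x. set (p := ch2 x). set (q := (exp (x / 2) - exp (- x / 2))%R). destruct (poisson p q (ch2_pos x)) as [Qp Ep].
    replace (sqrt 2 * sqrt (exp x + exp (- x)))%R with (sqrt (p ^ 2 + q ^ 2)).
    2:{ rewrite <- sqrt_mult by (generalize (eX_pos x); lra). f_equal. unfold p, q, ch2.
        replace (exp x) with (exp (x / 2) * exp (x / 2))%R by (rewrite <- exp_plus; f_equal; field).
        replace (exp (- x)) with (exp (- x / 2) * exp (- x / 2))%R by (rewrite <- exp_plus; f_equal; field). ring. }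
    rewrite <- Ep, <- (LI_scal _ _ _ Qp). apply LI_ext. intros y. unfold F.
    assert (Ec : c2 (x, (- th y)%R) = (p * cosh y - Ci * (q * sinh y)%R) / RtoC (sqrt (Dn y))).
    { unfold c2. replace ((x, (- th y)%R) / 2) with (RtoC (x / 2) + - (Ci * (th y / 2)%R)) by (c_field).
      replace (- (RtoC (x / 2) + - (Ci * (th y / 2)%R))) with (RtoC (- x / 2) + Ci * (th y / 2)%R). 2:{ c_field. }
      replace (- (Ci * (th y / 2)%R)) with (Cconj (Ci * (th y / 2)%R)). 2:{ c_ring. }
      rewrite !Cexp_plus, Cexp_conj, !Cexp_th2, !Cexp_R. rewrite Cdiv_conj by (apply RtoC_nz, Rgt_not_eq, sqDn_pos).
      replace (Cconj (RtoC (sqrt (Dn y)))) with (RtoC (sqrt (Dn y))) by (c_ring).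
      replace (Cconj (cosh y + Ci * sinh y)) with (RtoC (cosh y) - Ci * sinh y) by (c_ring).
      unfold p, q, ch2. rewrite !RtoC_mult, RtoC_plus, RtoC_minus. field. apply RtoC_nz, Rgt_not_eq, sqDn_pos. }
    assert (N := c2_nz x _ (TB y)). rewrite Ec in *. assert (Ns : RtoC (sqrt (Dn y)) <> 0) by (apply RtoC_nz, Rgt_not_eq, sqDn_pos).
    rewrite RtoC_inv by (apply Rgt_not_eq, sqDn_pos). field. repeat split; auto. intro A. apply N. rewrite A. unfold Cdiv; ring. }
  rewrite E1, (LI_ext _ _ E2) in FU. rewrite <- Cmult_assoc, FU.
  assert (Q3 := Nr_quad S HS).
  rewrite <- (LI_scal _ (RtoC PI) _ Q3).
  rewrite (LI_ext (fun x => Cexp (S * x) * _) (fun x => RtoC (PI / sqrt 2) * (Cexp (S * x) * Nr x))).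
  2:{ intros x. unfold Nr. assert (0 < sqrt 2)%R by (apply sqrt_lt_R0; lra). assert (0 < sqrt (exp x + exp (-x)))%R by (apply sqrt_lt_R0, eX_pos).
      replace (PI / (sqrt 2 * sqrt (exp x + exp (- x))))%R with (PI / sqrt 2 * / sqrt (exp x + exp (- x)))%R by (field; lra). rewrite RtoC_mult. ring. }
  rewrite (LI_scal _ _ _ Q3), (LI_scal _ _ _ Q3). rewrite Cmult_assoc, <- RtoC_mult. do 2 f_equal. field. apply Rgt_not_eq, sqrt_lt_R0; lra.
Qed.

(** Dividing the two Beta integrals of the Gamma products is carried out by [kint_R]: the quotient
    of the two transforms is itself a transform. *)
Lemma gamma_ratio (s : C) : (Rabs (Re s) < 1 / 4)%R ->
  Gamma (1 / 4 - s) * Gamma (1 / 4 + s) = RtoC (2 * sqrt 2 / sqrt PI) * kint (2 * s) * (Ga (1 / 2 - 2 * s) * Ga (1 / 2 + 2 * s)).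
Proof.
  intros H. assert (H' := H). apply Rabs_def2 in H'.
  assert (H2 : (Rabs (Re (2 * s)) < 1 / 2)%R). { rewrite (re_scal_l 2). apply Rabs_def1; lra. }
  rewrite !Gamma_Ga by (unfold Re in *; simpl in *; lra). rewrite Ga_prod_B, Ga_half, Ga_prod_R by auto.
  assert (K := kint_R _ H2). set (k := kint (2 * s)) in *. set (r := LI (Rker (2 * s))) in *. set (b := LI _) in *.
  assert (PP := PI_RGT_0). assert (SP : (0 < sqrt PI)%R) by (apply sqrt_lt_R0; auto). assert (ES : (sqrt PI * sqrt PI = PI)%R) by (apply sqrt_sqrt; lra).
  replace (RtoC (2 * sqrt 2 / sqrt PI) * k * r) with (RtoC (2 / sqrt PI) * (RtoC (sqrt 2) * k * r)).
  2:{ replace (2 * sqrt 2 / sqrt PI)%R with (2 / sqrt PI * sqrt 2)%R by (field; lra). rewrite RtoC_mult. ring. }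
  rewrite K. rewrite Cmult_assoc, <- !RtoC_mult. do 2 f_equal. transitivity (2 / sqrt PI * (sqrt PI * sqrt PI))%R; [field; lra | rewrite ES; reflexivity].
Qed.

(** * The integral of the parabolic cylinder function *)

(** Differentiation under the integral: the remainder of the integrand in h is quadratic by
    [Cexp_taylor1]. *)
Lemma LI_cder (g phi : R -> C) (w : C) (d M M1 M2 : R) : (0 < d)%R -> rcont g -> rcont phi ->
  quad M1 (fun p => g p * Cexp (w * phi p)) -> quad M2 (fun p => g p * phi p * Cexp (w * phi p)) ->
  (forall p, Cmod (g p) * (Cmod (phi p) * Cmod (phi p)) * (Cmod (Cexp (w * phi p)) * exp (d * Cmod (phi p))) <= M / (1 + p ^ 2))%R ->
  cder (fun w => LI (fun p => g p * Cexp (w * phi p))) w (LI (fun p => g p * phi p * Cexp (w * phi p))).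
Proof.
  intros Hd Hg Hphi Q1 Q2 B. apply (cder_quad _ _ _ (PI * M) d Hd). intros h Hh.
  set (r := fun p => g p * Cexp (w * phi p) * (Cexp (h * phi p) - 1 - h * phi p)).
  assert (Qr : quad (Cmod h * Cmod h * M) r).
  { split. intros p. unfold r. ct; auto. intros p. unfold r. rewrite !Cmod_mult.
    eapply Rle_trans. apply Rmult_le_compat_l. apply Rmult_le_pos; apply Cmod_ge_0. apply Cexp_taylor1. rewrite Cmod_mult.
    replace (Cmod h * Cmod h * M / (1 + p ^ 2))%R with (Cmod h * Cmod h * (M / (1 + p ^ 2)))%R by (unfold Rdiv; ring).
    apply Rle_trans with (Cmod h * Cmod h * (Cmod (g p) * (Cmod (phi p) * Cmod (phi p)) * (Cmod (Cexp (w * phi p)) * exp (d * Cmod (phi p)))))%R.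
    2: apply Rmult_le_compat_l; [apply Rmult_le_pos; apply Cmod_ge_0 | apply B].
    assert (E : (exp (Cmod h * Cmod (phi p)) <= exp (d * Cmod (phi p)))%R). { apply exp_le. apply Rmult_le_compat_r. apply Cmod_ge_0. lra. }
    assert (P : (0 <= Cmod h * Cmod h * (Cmod (g p) * (Cmod (phi p) * Cmod (phi p)) * Cmod (Cexp (w * phi p))))%R) by (repeat apply Rmult_le_pos; apply Cmod_ge_0).
    apply Rmult_le_compat_l with (r := (Cmod h * Cmod h * (Cmod (g p) * (Cmod (phi p) * Cmod (phi p)) * Cmod (Cexp (w * phi p))))%R) in E; auto. lra. }
  assert (Qh := quad_scal _ h _ Q2).
  rewrite (LI_ext (fun p => g p * Cexp ((w + h) * phi p)) (fun p => (g p * Cexp (w * phi p) + h * (g p * phi p * Cexp (w * phi p))) + r p)).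
  2:{ intros p. unfold r. rewrite Cmult_plus_distr_r, Cexp_plus. ring. }
  rewrite (LI_plus _ _ _ _ (quad_plus _ _ _ _ Q1 Qh) Qr), (LI_plus _ _ _ _ Q1 Qh), (LI_scal _ _ _ Q2).
  replace (_ - _ - _) with (LI r) by ring. eapply Rle_trans; [apply (LI_bound _ _ Qr)|]. right; ring.
Qed.

Definition mker (la x : C) (p : R) : C := Cexp (la * p - RtoC (exp (2 * p) / 2)) * Cexp (x * - RtoC (exp p)).

(** Gamma (la) e^(x^2/4) D_(-la) (x), for Re la > 0; differentiation in x raises la by 1. *)
Definition mf (la x : C) : C := LI (mker la x).
Lemma mker_mod la x p : Cmod (mker la x p) = exp (Re la * p - / 2 * exp (2 * p) + - Re x * exp p).
Proof.
  unfold mker. rewrite Cmod_mult, !Cmod_Cexp, <- exp_plus. f_equal. unfold Cminus. rewrite re_plus, re_opp, re_scal_r, re_RtoC, <- RtoC_opp, re_scal_r. field.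
Qed.
Lemma mker_bd la x p L : (Cmod x <= L)%R -> (Cmod (mker la x p) <= exp ((L + 1) ^ 2 / 2) * exp (Re la * p - 1 * exp p))%R.
Proof.
  intros H. rewrite mker_mod, <- exp_plus. apply exp_le. assert (A := re_le_Cmod x). assert (B := Rle_abs (- Re x)). rewrite Rabs_Ropp in B.
  assert (G := gauss_le (Re la) (/ 2) L p ltac:(lra)). replace ((L + 1) ^ 2 / (4 * / 2))%R with ((L + 1) ^ 2 / 2)%R in G by field.
  assert (P := exp_pos p). assert (- Re x * exp p <= L * exp p)%R by (apply Rmult_le_compat_r; lra). lra.
Qed.
Lemma ct_mker la x : rcont (mker la x).
Proof. intros p. unfold mker. ct. Qed.
Definition Mmf (la x : C) : R := (exp ((Cmod x + 1) ^ 2 / 2) * Mdexp (Re la) 1)%R.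
Lemma mf_quad la x : (0 < Re la)%R -> quad (Mmf la x) (mker la x).
Proof. intros H. apply quad_dexp; auto. lra. apply ct_mker. intros p. apply mker_bd. lra. Qed.
Lemma Re_S (la : C) (r : R) : Re (la + r) = (Re la + r)%R.
Proof. rewrite re_plus, re_RtoC; auto. Qed.
Lemma mker_S la x (p : R) : Cexp (la * p - RtoC (exp (2 * p) / 2)) * - RtoC (exp p) * Cexp (x * - RtoC (exp p)) = (-(1)) * mker (la + 1) x p.
Proof.
  unfold mker. replace ((la + 1) * p - RtoC (exp (2 * p) / 2)) with (RtoC p + (la * p - RtoC (exp (2 * p) / 2))) by ring.
  rewrite Cexp_plus, Cexp_R. ring.
Qed.
Lemma mf_cder la x : (0 < Re la)%R -> cder (mf la) x (- mf (la + 1) x).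
Proof.
  intros H. assert (H1 : (0 < Re (la + 1))%R) by (rewrite Re_S; lra). assert (H2 : (0 < Re (la + 2))%R) by (rewrite Re_S; lra).
  assert (Q1 := mf_quad (la + 1) x H1).
  apply (cder_eq _ _ (LI (fun p => Cexp (la * p - RtoC (exp (2 * p) / 2)) * - RtoC (exp p) * Cexp (x * - RtoC (exp p))))).
  { rewrite (LI_ext _ _ (mker_S la x)), (LI_scal _ _ _ Q1). unfold mf. ring. }
  apply (LI_cder (fun p : R => Cexp (la * p - RtoC (exp (2 * p) / 2))) (fun p : R => - RtoC (exp p)) x 1 (exp ((Cmod x + 1 + 1) ^ 2 / 2) * Mdexp (Re (la + 2)) 1)%R (Mmf la x) (Cmod (-(1)) * Mmf (la + 1) x)%R).
  lra. intros p; ct. intros p; ct. apply (mf_quad la x H).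
  apply (quad_ext _ _ _ (fun p => eq_sym (mker_S la x p))), quad_scal, Q1.
  intros p. rewrite Cmod_opp, Cmod_R, (Rabs_pos_eq (exp p)) by (left; apply exp_pos). rewrite Rmult_1_l.
  assert (D := dexp_le (Re (la + 2)) 1 p H2 ltac:(lra)).
  assert (G := expabs_den (Re (la + 2)) p H2).
  apply Rle_trans with (exp ((Cmod x + 1 + 1) ^ 2 / 2) * exp (Re (la + 2) * p - 1 * exp p))%R.
  - rewrite !Cmod_Cexp, <- !exp_plus. apply exp_le.
    replace (Re (la * p - RtoC (exp (2 * p) / 2))) with (Re la * p - / 2 * exp (2 * p))%R by (unfold Cminus; rewrite re_plus, re_opp, re_scal_r, re_RtoC; field).
    replace (Re (x * - RtoC (exp p))) with (- Re x * exp p)%R by (rewrite <- RtoC_opp, re_scal_r; ring).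
    assert (G2 := gauss_le (Re la) (/ 2) (Cmod x + 1) p ltac:(lra)). replace ((Cmod x + 1 + 1) ^ 2 / (4 * / 2))%R with ((Cmod x + 1 + 1) ^ 2 / 2)%R in G2 by field.
    assert (A := re_le_Cmod x). assert (B := Rle_abs (- Re x)). rewrite Rabs_Ropp in B. assert (P := exp_pos p).
    assert (- Re x * exp p <= Cmod x * exp p)%R by (apply Rmult_le_compat_r; lra). rewrite Re_S. lra.
  - unfold Rdiv. rewrite Rmult_assoc. apply Rmult_le_compat_l. left; apply exp_pos. unfold Mdexp. rewrite Rmult_assoc. eapply Rle_trans; [exact D|].
    apply Rmult_le_compat_l. left; apply exp_pos. exact G.
Qed.

(** The integral of the derivative of e^(la p - e^(2p)/2 - x e^p) vanishes. With [mf_cder] this is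
    the differential equation of mf la. *)
Lemma mf_rec la x : (0 < Re la)%R -> la * mf la x = mf (la + 2) x + x * mf (la + 1) x.
Proof.
  intros H. assert (H1 : (0 < Re (la + 1))%R) by (rewrite Re_S; lra). assert (H2 : (0 < Re (la + 2))%R) by (rewrite Re_S; lra).
  destruct (LI_lin3 _ _ _ _ _ _ la (-(1)) (- x) (mf_quad la x H) (mf_quad (la + 2) x H2) (mf_quad (la + 1) x H1)) as [[M Q] E].
  rewrite (LI_FTC0 _ (Mmf la x) (mker la x) _ Q) in E.
  - fold (mf la x) (mf (la + 2) x) (mf (la + 1) x) in E. rewrite <- (Cplus_0_r (mf (la + 2) x + x * mf (la + 1) x)), E. ring.
  - intros p. unfold mker.
    assert (D1 : rder (fun p : R => Cexp (la * p - RtoC (exp (2 * p) / 2))) p ((la * 1 - RtoC (exp (2 * p))) * Cexp (la * p - RtoC (exp (2 * p) / 2)))).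
    { apply rder_Cexp, rder_minus. apply rder_scal, rder_id. apply rder_R. auto_derive; auto. field. }
    assert (D2 : rder (fun p : R => Cexp (x * - RtoC (exp p))) p ((x * - RtoC (exp p)) * Cexp (x * - RtoC (exp p)))).
    { apply rder_Cexp, rder_scal, rder_opp, rder_exp. }
    refine (rder_eq _ _ _ _ _ (rder_mult _ _ _ _ _ D1 D2)).
    replace ((la + 1) * p - RtoC (exp (2 * p) / 2)) with (RtoC p + (la * p - RtoC (exp (2 * p) / 2))) by ring.
    replace ((la + 2) * p - RtoC (exp (2 * p) / 2)) with (RtoC (2 * p) + (la * p - RtoC (exp (2 * p) / 2))) by (rewrite RtoC_mult; ring).
    rewrite !(Cexp_plus (RtoC _)), !Cexp_R. ring.
  - apply (proj2 (mf_quad la x H)).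
Qed.
Lemma mf_0 la : (0 < Re la)%R -> mf la 0 = / 2 * Cexp (la / 2 * ln 2) * Ga (la / 2).
Proof.
  intros H. assert (H2 : (0 < Re (la / 2))%R). { replace (la / 2) with (la * RtoC (/ 2)). rewrite re_scal_r. lra. unfold Cdiv. rewrite RtoC_inv by lra; auto. }
  assert (Q := mf_quad la 0 H).
  assert (E0 : forall p, mker la 0 p = Cexp (la * p - RtoC (exp (2 * p) / 2))). { intros. unfold mker. rewrite Cmult_0_l, Cexp_0. ring. }
  apply (quad_ext _ _ _ E0) in Q. unfold mf. rewrite (LI_ext _ _ E0).
  assert (D := Ga_dilate (la / 2) (/ 2) H2 ltac:(lra)).
  assert (Qd : quad (1 * Mdexp (Re (la / 2)) (/ 2)) (fun x : R => Cexp (la / 2 * x - (/ 2 * exp x)%R))).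
  { apply quad_dexp; auto. lra. intros x. ct. intros x. rewrite Cmod_Cexp. unfold Cminus. rewrite re_plus, re_opp, re_scal_r, re_RtoC. right. rewrite Rmult_1_l. f_equal. }
  rewrite <- (LI_scale _ _ 2 ltac:(lra) Qd) in D.
  rewrite ln_Rinv in D by lra. replace (- (la / 2) * (- ln 2)%R) with (la / 2 * ln 2) in D by (rewrite RtoC_opp; ring).
  rewrite <- Cmult_assoc, <- D. rewrite Cmult_assoc, Cinv_l, Cmult_1_l by (apply RtoC_nz; lra). apply LI_ext. intros p. f_equal. rewrite RtoC_mult.
  replace (exp (2 * p) / 2)%R with (/ 2 * exp (2 * p))%R by field. field.
Qed.
Lemma mf_0_nz la : (0 < Re la)%R -> mf la 0 <> 0.
Proof.
  intros H. rewrite mf_0 by auto. assert (H2 : (0 < Re (la / 2))%R). { replace (la / 2) with (la * RtoC (/ 2)). rewrite re_scal_r. lra. unfold Cdiv. rewrite RtoC_inv by lra; auto. }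
  repeat apply Cmult_neq_0. rewrite <- RtoC_inv by lra. apply RtoC_nz; lra. apply Cexp_nz. apply Ga_nz; auto.
Qed.
Lemma Cexp_pair (x t : R) : Cexp (x, t) = ((exp x * cos t)%R, (exp x * sin t)%R).
Proof. reflexivity. Qed.
Lemma cos_lower T t : (Rabs t <= T)%R -> (T < PI / 2)%R -> (0 < cos T <= cos t)%R.
Proof.
  intros H HT. assert (P := PI_RGT_0). assert (0 <= T)%R by (generalize (Rabs_pos t); lra). apply Rabs_le_between in H. split. apply cos_gt_0; lra.
  destruct (Rle_dec 0 t). apply cos_decr_1; lra. rewrite <- (cos_neg t). apply cos_decr_1; lra.
Qed.

(** Rotation of the ray of integration in Euler's integral. *)
Lemma Ga_rot (la : C) (t : R) : (0 < Re la)%R -> (Rabs t < PI / 2)%R -> LI (fun x => Cexp (la * (x, t) - Cexp (x, t))) = Ga la.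
Proof.
  intros H Ht. unfold Ga.
  rewrite (LI_ext (fun x : R => Cexp (la * x - exp x)) (fun x => Cexp (la * (x, 0)%R - Cexp (x, 0)%R))).
  2:{ intros x. change ((x, 0)%R : C) with (RtoC x). rewrite Cexp_R. reflexivity. }
  assert (CT := cos_lower (Rabs t) t ltac:(lra) Ht).
  symmetry. apply (LI_cauchy2 (fun z => Cexp (la * z - Cexp z)) (fun z => (la - Cexp z) * Cexp (la * z - Cexp z)) (exp (Rabs (Im la) * Rabs t) * Mdexp (Re la) (cos (Rabs t))) (Rabs t)).
  rewrite Rabs_R0; apply Rabs_pos. lra.
  - intros x s Hs. split; [|ct]. apply (cder_Cexp (fun z => la * z - Cexp z)), (cder_minus (fun z => la * z) Cexp). apply cder_lin. apply cder_Cexp0.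
  - intros x s Hs. assert (CS := cos_lower (Rabs t) s Hs Ht).
    rewrite Cmod_Cexp. apply Rle_trans with (exp (Rabs (Im la) * Rabs t) * exp (Re la * x - cos (Rabs t) * exp x))%R.
    + rewrite <- exp_plus. apply exp_le. replace (Re (la * (x, s) - Cexp (x, s))) with (Re la * x - Im la * s - exp x * cos s)%R by (unfold Cexp, Re, Im; simpl; ring).
      assert (- (Im la * s) <= Rabs (Im la) * Rabs t)%R. { eapply Rle_trans; [apply Rle_abs|]. rewrite Rabs_Ropp, Rabs_mult. apply Rmult_le_compat_l; auto. apply Rabs_pos. }
      assert (P := exp_pos x). assert (cos (Rabs t) * exp x <= exp x * cos s)%R by (rewrite Rmult_comm; apply Rmult_le_compat_l; lra). lra.
    + unfold Rdiv. rewrite Rmult_assoc. apply Rmult_le_compat_l. left; apply exp_pos. apply dexp_den; auto; lra.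
Qed.

(** * Behaviour of the cylinder integral at infinity *)

Lemma exp_m1_le (w : C) : (0 <= Re w)%R -> (Cmod (Cexp (- w) - 1) <= Cmod w)%R.
Proof.
  intros H. assert (E : CInt (fun t => (- w) * Cexp (t * - w)) 0 1 = Cexp (- w) - 1).
  { rewrite (ci_FTC (fun t => Cexp (t * - w))). rewrite Cmult_1_l, Cmult_0_l, Cexp_0; auto.
    intros; apply rder_Cexp_line. intros t; ct. }
  rewrite <- E. apply ci_01_bound. intros t; ct.
  intros t Ht. rewrite Cmod_mult, Cmod_Cexp, re_scal_l, re_opp, Cmod_opp. rewrite <- (Rmult_1_r (Cmod w)) at 2. apply Rmult_le_compat_l. apply Cmod_ge_0.
  rewrite <- exp_0. apply exp_le. nra.
Qed.

(** sqrt (2 z) at z = e^l, single-valued in l. *)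
Definition xl (l : C) : C := Cexp ((l + ln 2) / 2).

(** For large Re l a substitution gives the integral of Cexp (la w - e^w - E e^(2z)) with w = z +
    i phi/2 and a small E > 0. On the line of height - phi/6 the arguments of e^w and of e^(2z)
    are phi/3 and - phi/3, both less than PI/2 in absolute value in the whole range |phi| < 3
    PI/2, so that the term with E is a perturbation of Euler's integral. *)
Lemma mf_asym (la : C) (delta : R) : (0 < Re la)%R -> (0 < delta)%R -> exists K, forall X phi : R, (Rabs phi <= 3 / 2 * PI - delta)%R ->
  (Cmod (Cexp (la / 2 * ((X, phi) + ln 2)) * mf la (xl (X, phi)) - Ga la) <= K * exp (- X))%R.
Proof.
  (* The angle phi/3 of the shifted line stays below T. *)
  intros Hla Hd. assert (PP := PI_RGT_0). set (T := (PI / 2 - delta / 3)%R).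
  exists (PI * (exp (Rabs (Im la) * PI) * / 4 * Mdexp (Re la + 2) (cos T)))%R. intros X phi Hphi.
  assert (Hphi' := Hphi). apply Rabs_le_between in Hphi'.
  assert (CT := cos_lower T (phi / 3) ltac:(unfold T; apply Rabs_le_between; lra) ltac:(unfold T; lra)).
  set (E := (exp (- X) / 4)%R). assert (HE : (0 < E)%R) by (unfold E; generalize (exp_pos (- X)); lra).
  set (h := ((0, phi / 2)%R : C)).
  set (g := fun z : C => Cexp (la * (z + h) - E * Cexp (2 * z) - Cexp (z + h))).
  assert (Q := mf_quad la (xl (X, phi)) Hla).
  assert (S1 : Cexp (la / 2 * ((X, phi) + ln 2)) * mf la (xl (X, phi)) = LI (fun P => g (P, 0)%R)).
  { unfold mf. set (c := (- (X + ln 2) / 2)%R). rewrite <- (LI_shift _ _ c Q). rewrite <- (LI_scal _ _ _ (quad_shift _ _ c Q)). apply LI_ext. intros P.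
    unfold mker, g. change ((P, 0)%R : C) with (RtoC P).
    replace (xl (X, phi) * - RtoC (exp (P + c))) with (- Cexp (RtoC P + h)).
    2:{ unfold xl. rewrite <- Cexp_R. replace (RtoC P + h) with ((((X, phi) : C) + ln 2) / 2 + RtoC (P + c)). rewrite Cexp_plus. ring.
        unfold c, h. c_field. }
    replace (exp (2 * (P + c)) / 2)%R with (E * exp (2 * P))%R.
    2:{ unfold E, c. replace (2 * (P + - (X + ln 2) / 2))%R with (2 * P + - X + - ln 2)%R by field. rewrite !exp_plus, (exp_Ropp (ln 2)), exp_ln by lra. field. }
    rewrite <- !Cexp_plus. f_equal. rewrite <- (RtoC_mult 2), Cexp_R. rewrite (RtoC_mult E).
    replace (la * (RtoC P + h)) with (la / 2 * (((X, phi) : C) + ln 2) + la * RtoC (P + c)). ring.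
    unfold c, h. c_field. }
  assert (S2 : LI (fun P => g (P, 0)%R) = LI (fun P => g (P, (- phi / 6)%R))).
  { set (T2 := (Rabs phi / 6)%R). assert (P0 := Rabs_pos phi). assert (T2b : (2 * T2 < PI / 2)%R) by (unfold T2; lra).
    set (ka := cos (2 * T2)). assert (ka0 : (0 < ka)%R). { unfold ka. apply cos_gt_0; unfold T2 in *; lra. }
    apply (LI_cauchy2 g (fun z => (la - 2 * E * Cexp (2 * z) - Cexp (z + h)) * g z) (exp (Rabs (Im la) * PI + (1 + 1) ^ 2 / (4 * (E * ka))) * Mdexp (Re la) 1) T2).
    - rewrite Rabs_R0. unfold T2; lra.
    - unfold T2. replace (- phi / 6)%R with (- (phi / 6))%R by field. rewrite Rabs_Ropp. unfold Rdiv. rewrite Rabs_mult, (Rabs_pos_eq (/ 6)); lra.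
    - intros x t Ht. split; [|unfold g; ct]. unfold g.
      apply (cder_Cexp (fun z => la * (z + h) - E * Cexp (2 * z) - Cexp (z + h))).
      assert (Dh : forall z, cder (fun z => z + h) z 1). { intros z. apply (cder_eq _ _ (1 + 0)). ring. apply (cder_plus (fun z => z) (fun _ => h)). apply cder_id. apply cder_const. }
      apply (cder_minus (fun z => la * (z + h) - E * Cexp (2 * z)) (fun z => Cexp (z + h))).
      apply (cder_minus (fun z => la * (z + h)) (fun z => E * Cexp (2 * z))).
      apply (cder_eq _ _ (la * 1)). ring. apply (cder_scal la (fun z => z + h)), Dh.
      apply (cder_eq _ _ (RtoC E * (2 * Cexp (2 * (x, t))))). ring. apply (cder_scal (RtoC E) (fun z => Cexp (2 * z))), (cder_Cexp (fun z => 2 * z)), cder_lin.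
      apply (cder_eq _ _ (1 * Cexp ((x, t) + h))). ring. apply (cder_Cexp (fun z => z + h)), Dh.
    - intros x t Ht. unfold g. rewrite Cmod_Cexp.
      replace (Re (la * ((x, t) + h) - E * Cexp (2 * (x, t)) - Cexp ((x, t) + h))) with (Re la * x - Im la * (t + phi / 2) - E * (exp (2 * x) * cos (2 * t)) - exp x * cos (t + phi / 2))%R.
      2:{ unfold h. replace (2 * (x, t)) with ((2 * x, 2 * t)%R : C) by (c_ring). replace ((x, t) + (0, (phi / 2)%R)) with ((x, t + phi / 2)%R : C) by (c_ring).
          unfold Cexp, Re, Im; simpl. ring. }
      assert (CS := cos_lower (2 * T2) (2 * t) ltac:(rewrite Rabs_mult, (Rabs_pos_eq 2) by lra; lra) T2b). fold ka in CS.
      apply Rle_trans with (exp (Rabs (Im la) * PI + (1 + 1) ^ 2 / (4 * (E * ka))) * exp (Re la * x - 1 * exp x))%R.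
      + rewrite <- exp_plus. apply exp_le.
        assert (G := gauss_le (Re la) (E * ka) 1 x ltac:(apply Rmult_lt_0_compat; auto)).
        assert (B1 : (- (Im la * (t + phi / 2)) <= Rabs (Im la) * PI)%R).
        { eapply Rle_trans; [apply Rle_abs|]. rewrite Rabs_Ropp, Rabs_mult. apply Rmult_le_compat_l. apply Rabs_pos. apply Rabs_le_between in Ht. unfold T2 in Ht. apply Rabs_le_between. lra. }
        assert (B2 : (- (exp x * cos (t + phi / 2)) <= 1 * exp x)%R). { generalize (COS_bound (t + phi / 2)) (exp_pos x). nra. }
        assert (B3 : (E * ka * exp (2 * x) <= E * (exp (2 * x) * cos (2 * t)))%R). { rewrite Rmult_assoc. apply Rmult_le_compat_l. lra. rewrite Rmult_comm. apply Rmult_le_compat_l. left; apply exp_pos. lra. }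
        lra.
      + unfold Rdiv. rewrite Rmult_assoc. apply Rmult_le_compat_l. left; apply exp_pos. apply dexp_den; auto; lra. }
  rewrite S1, S2, <- (Ga_rot la (phi / 3)) by (auto; apply Rabs_def1; lra).
  set (f0 := fun P : R => Cexp (la * (P, (phi / 3)%R) - Cexp (P, (phi / 3)%R))).
  set (w := fun P : R => RtoC E * Cexp (2 * P, (- (phi / 3)))%R).
  assert (Eg : forall P : R, g (P, (- phi / 6)%R) = f0 P * Cexp (- w P)).
  { intros P. unfold g, f0, w, h. rewrite <- Cexp_plus. replace ((P, (- phi / 6)%R) + (0, (phi / 2)%R)) with ((P, phi / 3)%R : C) by (c_field).
    replace (2 * (P, (- phi / 6)%R)) with ((2 * P, - (phi / 3))%R : C) by (c_field). f_equal. ring. }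
  assert (M0 : forall P, (Cmod (f0 P) <= exp (Rabs (Im la) * PI) * exp (Re la * P - cos T * exp P))%R).
  { intros P. unfold f0. rewrite Cmod_Cexp, <- exp_plus. apply exp_le.
    replace (Re (la * (P, (phi / 3)%R) - Cexp (P, (phi / 3)%R))) with (Re la * P - Im la * (phi / 3) - exp P * cos (phi / 3))%R by (unfold Cexp, Re, Im; simpl; ring).
    assert (B1 : (- (Im la * (phi / 3)) <= Rabs (Im la) * PI)%R). { eapply Rle_trans; [apply Rle_abs|]. rewrite Rabs_Ropp, Rabs_mult. apply Rmult_le_compat_l. apply Rabs_pos. apply Rabs_le_between. lra. }
    assert (P1 := exp_pos P). assert (cos T * exp P <= exp P * cos (phi / 3))%R by (rewrite Rmult_comm; apply Rmult_le_compat_l; lra). lra. }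
  assert (Q0 : quad (exp (Rabs (Im la) * PI) * Mdexp (Re la) (cos T)) f0). { apply quad_dexp; auto. lra. intros P. unfold f0. ct; apply ct_pair; ct. }
  assert (Qd : quad (exp (Rabs (Im la) * PI) * E * Mdexp (Re la + 2) (cos T)) (fun P => f0 P * (Cexp (- w P) - 1))).
  { apply quad_dexp; auto. lra. lra. intros P. unfold f0, w. ct; apply ct_pair; ct.
    intros P. rewrite Cmod_mult.
    assert (W : (Cmod (Cexp (- w P) - 1) <= E * exp (2 * P))%R).
    { eapply Rle_trans; [apply exp_m1_le|]. unfold w. rewrite re_scal_l, Cexp_pair. unfold Re; simpl. rewrite cos_neg. apply Rmult_le_pos; [lra|]. apply Rmult_le_pos; [left; apply exp_pos | lra].
      unfold w. rewrite Cmod_mult, Cmod_R, Cmod_Cexp, Rabs_pos_eq by lra. right; reflexivity. }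
    apply Rle_trans with ((exp (Rabs (Im la) * PI) * exp (Re la * P - cos T * exp P)) * (E * exp (2 * P)))%R. apply Rmult_le_compat; auto; apply Cmod_ge_0.
    right. replace ((Re la + 2) * P - cos T * exp P)%R with ((Re la * P - cos T * exp P) + 2 * P)%R by ring. rewrite exp_plus. ring. }
  assert (D : LI (fun P => g (P, (- phi / 6)%R)) - LI f0 = LI (fun P => f0 P * (Cexp (- w P) - 1))).
  { rewrite (LI_ext _ (fun P => f0 P + f0 P * (Cexp (- w P) - 1))) by (intros; rewrite Eg; ring). rewrite (LI_plus _ _ _ _ Q0 Qd). ring. }
  fold f0. rewrite D. eapply Rle_trans; [apply (LI_bound _ _ Qd)|]. right. unfold E. field.
Qed.

(** A determinant in [Tricomi_unique]; it does not vanish because 2 a is not an integer. *)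
Lemma Csinh_nz (a : C) : (0 < Re a < 1 / 2)%R -> Cexp (2 * PI * Ci * a) - Cexp (- (2 * PI * Ci * a)) <> 0.
Proof.
  intros Ha E. assert (P := PI_RGT_0). assert (N := Cexp_nz (2 * PI * Ci * a)).
  assert (E2 : Cexp (2 * PI * Ci * a) = Cexp (- (2 * PI * Ci * a))). { rewrite <- (Cplus_0_r (Cexp (- _))), <- E. ring. }
  assert (A : Re (2 * PI * Ci * a) = (- 2 * PI * Im a)%R) by (unfold Re, Im; simpl; ring). assert (B : Im (2 * PI * Ci * a) = (2 * PI * Re a)%R) by (unfold Re, Im; simpl; ring).
  assert (M := f_equal Cmod E2). rewrite !Cmod_Cexp, re_opp, A in M. apply exp_inv in M. assert (Im a = 0)%R by nra.
  assert (I := f_equal Im E2). unfold Cexp in I. rewrite re_opp, im_opp, A, B, H in I. simpl in I. rewrite sin_neg in I.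
  replace (-2 * PI * 0)%R with 0%R in I by ring. rewrite Ropp_0, exp_0 in I.
  assert (0 < sin (2 * PI * Re a))%R by (apply sin_gt_0; nra). lra.
Qed.
Lemma cder_zero_const (f : C -> C) : (forall z, cder f z 0) -> forall z w, f z = f w.
Proof.
  intros H z w. assert (E : CInt (fun _ => 0) 0 1 = f z - f w).
  { rewrite (ci_FTC (fun t => f (w + t * (z - w)))).
    replace (w + RtoC 1 * (z - w)) with z by ring. replace (w + RtoC 0 * (z - w)) with w by ring. auto.
    intros t _. apply (rder_eq _ _ ((z - w) * 0)). ring. apply cder_rder. apply H. intros t; ct. }
  rewrite ci_const in E. rewrite <- (Cplus_0_r (f w)). replace (RtoC 0) with (f z - f w) by (rewrite <- E; ring). ring.
Qed.

(** * Uniqueness of the confluent hypergeometric function *)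

Lemma two_nz : RtoC 2 <> 0. Proof. apply RtoC_nz; lra. Qed.
Lemma xl_sq l : xl l * xl l = 2 * Cexp l.
Proof. unfold xl. rewrite <- Cexp_plus. transitivity (Cexp (ln 2) * Cexp l). rewrite <- Cexp_plus. f_equal. field. rewrite Cexp_ln by lra. reflexivity. Qed.
Lemma xl_nz l : xl l <> 0. Proof. apply Cexp_nz. Qed.
Lemma cder_xl l : cder xl l (/ 2 * xl l).
Proof.
  unfold xl. apply (cder_Cexp (fun l => (l + ln 2) / 2)). apply (cder_eq _ _ (1 * / 2)). ring.
  apply (cder_ext (fun l => (l + ln 2) * / 2)). reflexivity. apply (cder_eq _ _ ((1 + 0) * / 2 + (l + ln 2) * 0)). ring.
  apply (cder_mult (fun l => l + ln 2) (fun _ => / 2)). apply (cder_plus (fun l => l) (fun _ => RtoC (ln 2))). apply cder_id. apply cder_const. apply cder_const.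
Qed.
Lemma xl_opp l : xl (l + 2 * PI * Ci) = - xl l.
Proof.
  unfold xl. replace ((l + 2 * PI * Ci + ln 2) / 2) with ((l + ln 2) / 2 + Ci * PI) by (field; apply two_nz). rewrite Cexp_plus, Cexp_Ci, cos_PI, sin_PI.
  replace ((-1, 0)%R : C) with (- RtoC 1) by (c_ring). ring.
Qed.

(** The basic solutions of the equation of U (a, 1/2, .) are mf la (xl l) and mf la (- xl l), for
    la = 2 a. *)
Lemma cder_v1 la l : (0 < Re la)%R -> cder (fun l => mf la (xl l)) l (- (/ 2 * xl l) * mf (la + 1) (xl l)).
Proof. intros H. apply (cder_eq _ _ (- mf (la + 1) (xl l) * (/ 2 * xl l))). ring. apply (cder_comp (mf la) xl). apply mf_cder; auto. apply cder_xl. Qed.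
Lemma cder_v2 la l : (0 < Re la)%R -> cder (fun l => mf la (- xl l)) l (/ 2 * xl l * mf (la + 1) (- xl l)).
Proof. intros H. apply (cder_eq _ _ (- mf (la + 1) (- xl l) * - (/ 2 * xl l))). ring. apply (cder_comp (mf la) (fun l => - xl l)). apply mf_cder; auto. apply cder_opp, cder_xl. Qed.

(** The candidate for U (a, 1/2, e^l). *)
Definition u0 (a l : C) : C := Cexp (a * ln 2) / Ga (2 * a) * mf (2 * a) (xl l).
Lemma re_2a a : Re (2 * a) = (2 * Re a)%R.
Proof. apply (re_scal_l 2). Qed.
Lemma exp_small K e : (0 < e)%R -> exists M, forall X, (M < X)%R -> (K * exp (- X) < e)%R.
Proof.
  intros He. exists (Rabs K / e)%R. intros X HX. assert (A := Rabs_pos K). assert (B := exp_ineq1_le X). assert (P := exp_pos X).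
  rewrite exp_Ropp. apply Rmult_lt_reg_r with (exp X); auto. rewrite Rmult_assoc, Rinv_l, Rmult_1_r by lra.
  apply Rle_lt_trans with (Rabs K). apply Rle_abs. apply Rmult_lt_compat_l with (r := e) in HX; auto. replace (e * (Rabs K / e))%R with (Rabs K) in HX by (field; lra). nra.
Qed.
Lemma u0_asym a : (0 < Re a)%R -> forall delta eps, (0 < delta)%R -> (0 < eps)%R -> exists M, forall l, (Rabs (Im l) <= 3 / 2 * PI - delta)%R -> (M < Re l)%R ->
  (Cmod (u0 a l / Cexp (- a * l) - 1) < eps)%R.
Proof.
  intros Ha delta eps Hd He. assert (H : (0 < Re (2 * a))%R) by (rewrite re_2a; lra).
  assert (N := Ga_nz _ H). assert (GP : (0 < Cmod (Ga (2 * a)))%R) by (apply Cmod_gt_0; auto).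
  destruct (mf_asym (2 * a) delta H Hd) as [K HK]. destruct (exp_small K (eps * Cmod (Ga (2 * a)))) as [M HM]. apply Rmult_lt_0_compat; auto.
  exists M. intros l Hl HX. destruct l as [X phi]. simpl in Hl, HX. specialize (HK X phi Hl). specialize (HM X HX).
  replace (u0 a (X, phi) / Cexp (- a * (X, phi)) - 1) with ((Cexp (2 * a / 2 * ((X, phi) + ln 2)) * mf (2 * a) (xl (X, phi)) - Ga (2 * a)) / Ga (2 * a)).
  2:{ unfold u0. replace (- a * (X, phi)) with (- (a * (X, phi))) by ring. rewrite Cexp_opp. replace (2 * a / 2 * ((X, phi) + ln 2)) with (a * ln 2 + a * (X, phi)) by (field; apply two_nz). rewrite Cexp_plus.
      field. split; auto. apply Cexp_nz. }
  rewrite Cmod_div by auto. apply Rmult_lt_reg_r with (Cmod (Ga (2 * a))); auto. unfold Rdiv. rewrite Rmult_assoc, Rinv_l, Rmult_1_r by lra. lra.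
Qed.
Lemma u0_is a : (0 < Re a)%R -> is_TricomiU a (1 / 2) (u0 a).
Proof.
  intros Ha. assert (H : (0 < Re (2 * a))%R) by (rewrite re_2a; lra). split.
  2:{ intros delta Hd eps He. apply (u0_asym a Ha delta eps Hd He). }
  set (c := Cexp (a * ln 2) / Ga (2 * a)).
  assert (H1 : (0 < Re (2 * a + 1))%R) by (rewrite Re_S; lra).
  exists (fun l => c * (- mf (2 * a + 1) (xl l) / xl l)), (fun l => c * (mf (2 * a + 2) (xl l) / (xl l * xl l) + mf (2 * a + 1) (xl l) / (xl l * xl l * xl l))).
  intros l. assert (N := xl_nz l). assert (E := xl_sq l). assert (E' : Cexp l = xl l * xl l / 2) by (rewrite E; field; apply two_nz).
  split; [|split].
  - apply is_derive_cder. unfold u0. fold c. apply (cder_eq _ _ (c * (- (/ 2 * xl l) * mf (2 * a + 1) (xl l)))). rewrite E'. field. auto.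
    apply (cder_scal c (fun l => mf (2 * a) (xl l))), cder_v1; auto.
  - apply is_derive_cder.
    assert (D := cder_div (fun l => - mf (2 * a + 1) (xl l)) xl l _ _ (cder_opp _ _ _ (cder_v1 _ l H1)) (cder_xl l) N).
    apply (cder_scal c) in D. refine (cder_eq _ _ _ _ _ D). rewrite E'. replace (2 * a + 1 + 1) with (2 * a + 2) by ring. field. auto.
  - rewrite E'. unfold u0. fold c. assert (R := mf_rec (2 * a) (xl l) H).
    assert (R' : a * mf (2 * a) (xl l) = (mf (2 * a + 2) (xl l) + xl l * mf (2 * a + 1) (xl l)) / 2). { rewrite <- R. field. }
    replace (a * (c * mf (2 * a) (xl l))) with (c * (a * mf (2 * a) (xl l))) by ring. rewrite R'. field. auto.
Qed.

(** The Wronskian of mf la x and mf la (- x); its derivative vanishes by [mf_rec]. *)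
Lemma wronskian_basic la x : (0 < Re la)%R ->
  Cexp (- (x * x / 2)) * (mf la x * mf (la + 1) (- x) + mf (la + 1) x * mf la (- x)) = 2 * mf la 0 * mf (la + 1) 0.
Proof.
  intros H. assert (H1 : (0 < Re (la + 1))%R) by (rewrite Re_S; lra).
  set (G := fun x => Cexp (- (x * x / 2)) * (mf la x * mf (la + 1) (- x) + mf (la + 1) x * mf la (- x))).
  assert (D : forall z, cder G z 0).
  { intros z. unfold G.
    assert (D0 : cder (fun x => Cexp (- (x * x / 2))) z (- z * Cexp (- (z * z / 2)))).
    { apply (cder_Cexp (fun x => - (x * x / 2))). apply cder_opp. apply (cder_eq _ _ ((1 * z + z * 1) * / 2 + z * z * 0)). field; apply two_nz.
      apply (cder_mult (fun x => x * x) (fun _ => / 2)). apply (cder_mult (fun x => x) (fun x => x)); apply cder_id. apply cder_const. }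
    assert (Dm : forall la, (0 < Re la)%R -> cder (fun x => mf la (- x)) z (mf (la + 1) (- z))).
    { intros l0 H0. apply (cder_eq _ _ (- mf (l0 + 1) (- z) * - (1))). ring. apply (cder_comp (mf l0) (fun x => - x)). apply mf_cder; auto. apply cder_opp, cder_id. }
    assert (D1 := cder_mult _ _ _ _ _ D0 (cder_plus _ _ _ _ _ (cder_mult _ _ _ _ _ (mf_cder la z H) (Dm _ H1)) (cder_mult _ _ _ _ _ (mf_cder _ z H1) (Dm _ H)))).
    refine (cder_eq _ _ _ _ _ D1). replace (la + 1 + 1) with (la + 2) by ring.
    assert (R1 := mf_rec la z H). assert (R2 := mf_rec la (- z) H).
    assert (R1' : mf (la + 2) z = la * mf la z - z * mf (la + 1) z) by (rewrite R1; ring).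
    assert (R2' : mf (la + 2) (- z) = la * mf la (- z) + z * mf (la + 1) (- z)) by (rewrite R2; ring).
    rewrite R1', R2'. ring. }
  assert (E := cder_zero_const G D x 0). unfold G in E. rewrite E. replace (- (RtoC 0 * 0 / 2)) with (RtoC 0) by (field; apply two_nz). rewrite Cexp_0. replace (- RtoC 0) with (RtoC 0) by ring. ring.
Qed.

(** By constant Wronskians u is a combination of the two basic solutions. Passing from Im l = - PI
    to Im l = PI exchanges xl l and - xl l, so the asymptotics of u and u0 on these two rays give
    two linear relations between the coefficients, which determine u up to a factor by [Csinh_nz]
    and then normalise it. *)
Lemma Tricomi_unique a u : (0 < Re a < 1 / 2)%R -> is_TricomiU a (1 / 2) u -> forall l, u l = u0 a l.
Proof.
  intros Ha [[u1 [u2 HU]] HA] l. set (la := 2 * a). assert (H : (0 < Re la)%R) by (unfold la; rewrite re_2a; lra). assert (H1 : (0 < Re (la + 1))%R) by (rewrite Re_S; lra).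
  assert (P := PI_RGT_0).
  set (du := fun l => Cexp l * u1 l).
  assert (Du : forall l, cder u l (du l)). { intros z. apply is_derive_cder. apply HU. }
  assert (Ddu : forall l, cder du l ((/ 2 + Cexp l) * du l + a * Cexp l * u l)).
  { intros z. destruct (HU z) as [_ [B D]]. apply is_derive_cder in B. unfold du.
    assert (D1 := cder_mult _ _ _ _ _ (cder_Cexp0 z) B). refine (cder_eq _ _ _ _ _ D1).
    replace (a * Cexp z * u z) with (Cexp z * (Cexp z * u2 z + (1 / 2 - Cexp z) * u1 z - (Cexp z * u2 z + (1 / 2 - Cexp z) * u1 z - a * u z))) by ring.
    rewrite D. field. }
  set (E := fun l => Cexp (- (l / 2 + Cexp l))).
  assert (DE : forall l, cder E l (- (/ 2 + Cexp l) * E l)).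
  { intros z. unfold E. apply (cder_Cexp (fun l => - (l / 2 + Cexp l))), cder_opp, (cder_plus (fun l => l / 2) Cexp). apply cder_half. apply cder_Cexp0. }
  assert (X2 : forall l, Cexp l = xl l * xl l / 2). { intros z. rewrite xl_sq. field; apply two_nz. }
  (* Wronskians of u with the two basic solutions; E is the integrating factor of the equation. *)
  set (W1 := fun l => E l * (mf la (xl l) * du l - (- (/ 2 * xl l) * mf (la + 1) (xl l)) * u l)).
  set (W2 := fun l => E l * (mf la (- xl l) * du l - (/ 2 * xl l * mf (la + 1) (- xl l)) * u l)).
  assert (DW1 : forall z, cder W1 z 0).
  { intros z. unfold W1.
    assert (Dx := cder_scal (/ 2) _ _ _ (cder_xl z)).
    assert (D1 := cder_mult _ _ _ _ _ (DE z) (cder_minus _ _ _ _ _ (cder_mult _ _ _ _ _ (cder_v1 la z H) (Ddu z)) (cder_mult _ _ _ _ _ (cder_mult _ _ _ _ _ (cder_opp _ _ _ Dx) (cder_v1 (la + 1) z H1)) (Du z)))).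
    refine (cder_eq _ _ _ _ _ D1). rewrite X2. replace (la + 1 + 1) with (la + 2) by ring.
    assert (R' : mf (la + 2) (xl z) = 2 * a * mf la (xl z) - xl z * mf (la + 1) (xl z)) by (fold la; rewrite (mf_rec la (xl z) H); ring).
    rewrite R'. field. }
  assert (DW2 : forall z, cder W2 z 0).
  { intros z. unfold W2.
    assert (Dx := cder_scal (/ 2) _ _ _ (cder_xl z)).
    assert (D1 := cder_mult _ _ _ _ _ (DE z) (cder_minus _ _ _ _ _ (cder_mult _ _ _ _ _ (cder_v2 la z H) (Ddu z)) (cder_mult _ _ _ _ _ (cder_mult _ _ _ _ _ Dx (cder_v2 (la + 1) z H1)) (Du z)))).
    refine (cder_eq _ _ _ _ _ D1). rewrite X2. replace (la + 1 + 1) with (la + 2) by ring.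
    assert (R' : mf (la + 2) (- xl z) = 2 * a * mf la (- xl z) + xl z * mf (la + 1) (- xl z)) by (fold la; rewrite (mf_rec la (- xl z) H); ring).
    rewrite R'. field. }
  set (k1 := W1 0). set (k2 := W2 0).
  assert (C1 : forall l, W1 l = k1) by (intros; apply cder_zero_const; auto). assert (C2 : forall l, W2 l = k2) by (intros; apply cder_zero_const; auto).
  set (K := Cexp (ln 2 / 2) * mf la 0 * mf (la + 1) 0).
  assert (KN : K <> 0). { unfold K. repeat apply Cmult_neq_0. apply Cexp_nz. apply mf_0_nz; auto. apply mf_0_nz; auto. }
  assert (KU : forall l, K * u l = k1 * mf la (- xl l) - k2 * mf la (xl l)).
  { intros z. rewrite <- (C1 z), <- (C2 z). unfold W1, W2.
    transitivity (E z * (/ 2 * xl z) * (mf la (xl z) * mf (la + 1) (- xl z) + mf (la + 1) (xl z) * mf la (- xl z)) * u z). 2: ring.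
    f_equal. unfold K. assert (B := wronskian_basic la (xl z) H). replace (xl z * xl z / 2) with (Cexp z) in B by apply X2.
    assert (EX : E z * (/ 2 * xl z) = Cexp (- Cexp z) * (Cexp (ln 2 / 2) / 2)).
    { unfold E, xl. replace (- (z / 2 + Cexp z)) with (- (z / 2) + - Cexp z) by ring. rewrite Cexp_plus.
      replace ((z + ln 2) / 2) with (z / 2 + ln 2 / 2) by (field; apply two_nz). rewrite Cexp_plus, Cexp_opp. field. apply Cexp_nz. }
    rewrite EX. transitivity (Cexp (ln 2 / 2) / 2 * (2 * mf la 0 * mf (la + 1) 0)). field; apply two_nz. rewrite <- B. ring. }
  (* Both u and u0 are close to e^(-a l) far out on the rays Im l = s PI and Im l = - s PI. *)
  set (g := fun l => u0 a l / Cexp (- a * l)). set (c := Cexp (a * ln 2) / Ga la).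
  assert (cN : c <> 0). { unfold c. apply Cmult_neq_0. apply Cexp_nz. intro Z. assert (GN := Ga_nz la H). apply (f_equal (Cmult (Ga la))) in Z. rewrite Cinv_r, Cmult_0_r in Z by auto. apply RtoC_inj in Z; lra. }
  assert (V1 : forall l, mf la (xl l) = / c * Cexp (- a * l) * g l). { intros z. unfold g, u0. fold la. fold c. field. split; auto. apply Cexp_nz. }
  assert (RAY : forall s : R, (s = 1 \/ s = -1)%R -> K = / c * (k1 * Cexp (2 * PI * Ci * a * s) - k2)).
  { intros s Hs. apply C_eq_small. intros eps He.
    set (B := (Cmod K + Cmod (/ c) * (Cmod k1 * Cmod (Cexp (2 * PI * Ci * a * s)) + Cmod k2) + 1)%R).
    assert (HB : (0 < B)%R). { unfold B. assert (Q1 := Cmod_ge_0 K). assert (Q2 : (0 <= Cmod (/ c) * (Cmod k1 * Cmod (Cexp (2 * PI * Ci * a * s)) + Cmod k2))%R). { apply Rmult_le_pos. apply Cmod_ge_0. apply Rplus_le_le_0_compat. apply Rmult_le_pos; apply Cmod_ge_0. apply Cmod_ge_0. } lra. }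
    assert (HeB : (0 < eps / B)%R) by (apply Rdiv_lt_0_compat; auto).
    destruct (HA (PI / 2)%R ltac:(lra) (eps / B)%R HeB) as [M1 HM1].
    destruct (u0_asym a (proj1 Ha) (PI / 2)%R (eps / B)%R ltac:(lra) HeB) as [M2 HM2].
    set (X := (Rmax M1 M2 + 1)%R). assert (X1 : (M1 < X)%R) by (unfold X; generalize (Rmax_l M1 M2); lra). assert (X2' : (M2 < X)%R) by (unfold X; generalize (Rmax_r M1 M2); lra).
    set (l1 := ((X, s * PI)%R : C)). set (l2 := ((X, - s * PI)%R : C)).
    assert (I1 : (Rabs (Im l1) <= 3 / 2 * PI - PI / 2)%R). { unfold l1; simpl. apply Rabs_le_between. destruct Hs; subst s; lra. }
    assert (I3 : (Rabs (Im l2) <= 3 / 2 * PI - PI / 2)%R). { unfold l2; simpl. apply Rabs_le_between. destruct Hs; subst s; lra. }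
    assert (A1 := HM1 l1 I1 X1). assert (A2 := HM2 l1 I1 X2'). assert (A3 := HM2 l2 I3 X2'). fold (g l1) in A2. fold (g l2) in A3.
    set (ug := u l1 / Cexp (- a * l1)) in *.
    assert (XO : - xl l1 = xl l2). { destruct Hs; subst s.
      - replace l1 with (l2 + 2 * PI * Ci) by (unfold l1, l2; c_ring). rewrite xl_opp. ring.
      - replace l2 with (l1 + 2 * PI * Ci) by (unfold l1, l2; c_ring). rewrite xl_opp. ring. }
    assert (EQ : K * ug = / c * (k1 * Cexp (2 * PI * Ci * a * s) * g l2 - k2 * g l1)).
    { unfold ug. transitivity ((K * u l1) / Cexp (- a * l1)). unfold Cdiv; ring. rewrite KU, XO, !V1.
      replace (- a * l2) with (- a * l1 + 2 * PI * Ci * a * s) by (unfold l1, l2; c_ring). rewrite Cexp_plus. field. split; auto. apply Cexp_nz. }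
    replace (K - / c * (k1 * Cexp (2 * PI * Ci * a * s) - k2)) with (/ c * (k1 * Cexp (2 * PI * Ci * a * s) * (g l2 - 1) - k2 * (g l1 - 1)) - K * (ug - 1)).
    2:{ replace (K * (ug - 1)) with (K * ug - K) by ring. rewrite EQ. ring. }
    unfold Cminus at 1. triangle. rewrite Cmod_opp, !Cmod_mult.
    assert (T : (Cmod (k1 * Cexp (2 * PI * Ci * a * s) * (g l2 - 1) - k2 * (g l1 - 1)) <= (Cmod k1 * Cmod (Cexp (2 * PI * Ci * a * s)) + Cmod k2) * (eps / B))%R).
    { triangle. rewrite Cmod_opp, !Cmod_mult, Rmult_plus_distr_r. apply Rplus_le_compat. apply Rmult_le_compat_l. apply Rmult_le_pos; apply Cmod_ge_0. lra. apply Rmult_le_compat_l. apply Cmod_ge_0. lra. }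
    apply Rle_trans with (Cmod (/ c) * ((Cmod k1 * Cmod (Cexp (2 * PI * Ci * a * s)) + Cmod k2) * (eps / B)) + Cmod K * (eps / B))%R.
    apply Rplus_le_compat. apply Rmult_le_compat_l; auto. apply Cmod_ge_0. apply Rmult_le_compat_l. apply Cmod_ge_0. lra.
    apply Rle_trans with (B * (eps / B))%R. unfold B at 3. nra. right. field. lra. }
  assert (R1 := RAY 1%R (or_introl eq_refl)). assert (R2 := RAY (-1)%R (or_intror eq_refl)).
  assert (K1 : k1 = 0).
  { assert (S := Csinh_nz a Ha). replace (2 * PI * Ci * a * 1) with (2 * PI * Ci * a) in R1 by ring. replace (2 * PI * Ci * a * (-1)%R) with (- (2 * PI * Ci * a)) in R2 by (c_ring).
    assert (Z : k1 * (Cexp (2 * PI * Ci * a) - Cexp (- (2 * PI * Ci * a))) = 0).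
    { transitivity (c * (/ c * (k1 * Cexp (2 * PI * Ci * a) - k2) - / c * (k1 * Cexp (- (2 * PI * Ci * a)) - k2))). field; auto. rewrite <- R1, <- R2. ring. }
    destruct (Ceq_dec k1 0); auto. exfalso. apply (Cmult_neq_0 _ _ n S). exact Z. }
  assert (K2 : K = - / c * k2). { rewrite R1, K1. ring. }
  assert (U := KU l). rewrite K1 in U. rewrite <- (Cmult_1_l (u l)), <- (Cinv_l K KN), <- Cmult_assoc, U. unfold u0. fold la. fold c. rewrite K2.
  field. split; auto. intro Z. apply KN. rewrite K2, Z. ring.
Qed.
Lemma TricomiU_eq a l : (0 < Re a < 1 / 2)%R -> TricomiU a (1 / 2) l = u0 a l.
Proof.
  intros Ha. apply Tricomi_unique; auto. unfold TricomiU. apply epsilon_spec. exists (u0 a). apply u0_is; lra.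
Qed.
Lemma Cexp_Clog (z : C) : z <> 0 -> Cexp (Clog z) = z.
Proof.
  intros Hz. assert (P : (0 < Cmod z)%R) by (apply Cmod_gt_0; auto). set (r := Cmod z) in *.
  assert (E2 := Cmod2_alt z). fold r in E2. assert (B : (-1 <= Re z / r <= 1)%R).
  { assert (A := re_le_Cmod z). fold r in A. apply Rabs_le_between in A. split; apply Rmult_le_reg_r with r; auto; unfold Rdiv; rewrite Rmult_assoc, Rinv_l, Rmult_1_r; lra. }
  assert (S : (sin (acos (Re z / r)) = Rabs (Im z) / r)%R).
  { rewrite sin_acos by auto. replace (1 - (Re z / r)²)%R with ((Im z / r) ^ 2)%R. rewrite <- (Rabs_pos_eq r) at 2 by lra. rewrite <- Rabs_div by lra. rewrite <- sqrt_Rsqr_abs. f_equal. unfold Rsqr. ring.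
    assert ((Im z)^2 = r ^ 2 - Re z ^ 2)%R by lra. unfold Rsqr. replace ((Im z / r) ^ 2)%R with (Im z ^ 2 / r ^ 2)%R by (field; lra). rewrite H. field. lra. }
  unfold Clog, Cexp. fold r. replace (Re (ln r, Carg z)) with (ln r) by reflexivity. replace (Im (ln r, Carg z)) with (Carg z) by reflexivity. rewrite exp_ln by auto.
  unfold Carg. fold r. destruct (Rle_dec 0 (Im z)); rewrite ?cos_neg, ?sin_neg, cos_acos, S by auto; apply C_ext; unfold Re at 1, Im at 1; simpl.
  field; lra. rewrite Rabs_pos_eq by auto. field; lra. field; lra. rewrite Rabs_left by lra. field; lra.
Qed.
Lemma cylinder_eq (nu z : C) : (0 < Re (- nu) < 1)%R -> z <> 0 -> parabolic_cylinder nu z = Cexp (- (z * z / 4)) * mf (- nu) z / Ga (- nu).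
Proof.
  intros Hn Hz. unfold parabolic_cylinder. destruct (Ceq_dec z 0); [contradiction|]. unfold parabolic_cylinder_formula.
  assert (Ea : 2 * (- nu / 2) = - nu) by (field; apply two_nz).
  assert (Ha : (0 < Re (- nu / 2) < 1 / 2)%R). { assert (Z := re_2a (- nu / 2)). rewrite Ea in Z. lra. }
  rewrite TricomiU_eq by auto. unfold u0. rewrite Ea. unfold xl. replace ((2 * Clog z - ln 2 + ln 2) / 2) with (Clog z) by (field; apply two_nz). rewrite Cexp_Clog by auto.
  unfold Cpower. rewrite Clog_R by lra. unfold Cdiv.
  transitivity ((Cexp (nu * / 2 * ln 2) * Cexp (- nu * / 2 * ln 2)) * (Cexp (- (z * z * / 4)) * mf (- nu) z * / Ga (- nu))). ring.
  rewrite <- Cexp_plus. replace (nu * / 2 * ln 2 + - nu * / 2 * ln 2) with (RtoC 0) by ring. rewrite Cexp_0. ring.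
Qed.

(** * Rotation of the path by PI/4 *)

Lemma sqrt2_pos : (0 < sqrt 2)%R. Proof. apply sqrt_lt_R0; lra. Qed.
Lemma sqrt2_sq : (sqrt 2 * sqrt 2 = 2)%R. Proof. apply sqrt_sqrt; lra. Qed.
Lemma sqrt2_ge1 : (1 <= sqrt 2)%R. Proof. rewrite <- sqrt_1 at 1. apply sqrt_le_1_alt; lra. Qed.

Definition Mker (la w : C) (p : R) : C := Cexp (la * p - Ci * RtoC (exp (2 * p) / 2)) * Cexp (w * - RtoC (sqrt 2 * exp p)).

(** The integral defining mf, along the ray arg t = PI/4; w stands for the cylinder argument
    divided by 1 - i. *)
Definition Mf (la w : C) : C := LI (Mker la w).
Lemma Mker_mod la w p : Cmod (Mker la w p) = exp (Re la * p - sqrt 2 * Re w * exp p).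
Proof.
  unfold Mker. rewrite Cmod_mult, !Cmod_Cexp, <- exp_plus. f_equal. unfold Re, Im; simpl. ring.
Qed.
Lemma ct_Mker la w : rcont (Mker la w).
Proof. intros p. unfold Mker. ct. Qed.
Definition MMf (la w : C) : R := Mdexp (Re la) (sqrt 2 * Re w).
Lemma Mf_quad la w : (0 < Re la)%R -> (0 < Re w)%R -> quad (MMf la w) (Mker la w).
Proof. intros H Hw. unfold MMf. rewrite <- (Rmult_1_l (Mdexp _ _)). apply quad_dexp; auto. apply Rmult_lt_0_compat; auto. apply sqrt2_pos. apply ct_Mker. intros p. rewrite Mker_mod. lra. Qed.
Lemma Mker_S la w (p : R) : Cexp (la * p - Ci * RtoC (exp (2 * p) / 2)) * - RtoC (sqrt 2 * exp p) * Cexp (w * - RtoC (sqrt 2 * exp p)) = - RtoC (sqrt 2) * Mker (la + 1) w p.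
Proof.
  unfold Mker. replace ((la + 1) * p - Ci * RtoC (exp (2 * p) / 2)) with (RtoC p + (la * p - Ci * RtoC (exp (2 * p) / 2))) by ring.
  rewrite Cexp_plus, Cexp_R, RtoC_mult. ring.
Qed.
Lemma Mf_cder la w : (0 < Re la)%R -> (0 < Re w)%R -> cder (Mf la) w (- RtoC (sqrt 2) * Mf (la + 1) w).
Proof.
  intros H Hw. assert (H1 : (0 < Re (la + 1))%R) by (rewrite Re_S; lra). assert (H2 : (0 < Re (la + 2))%R) by (rewrite Re_S; lra).
  assert (Q1 := Mf_quad (la + 1) w H1 Hw). assert (S2 := sqrt2_pos).
  apply (cder_eq _ _ (LI (fun p => Cexp (la * p - Ci * RtoC (exp (2 * p) / 2)) * - RtoC (sqrt 2 * exp p) * Cexp (w * - RtoC (sqrt 2 * exp p))))).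
  { rewrite (LI_ext _ _ (Mker_S la w)), (LI_scal _ _ _ Q1). reflexivity. }
  set (k := (sqrt 2 * Re w / 2)%R). assert (Hk : (0 < k)%R) by (unfold k; apply Rmult_lt_0_compat; [apply Rmult_lt_0_compat; auto | lra]).
  apply (LI_cder (fun p : R => Cexp (la * p - Ci * RtoC (exp (2 * p) / 2))) (fun p : R => - RtoC (sqrt 2 * exp p)) w (Re w / 2)%R (2 * Mdexp (Re (la + 2)) k)%R (MMf la w) (Cmod (- RtoC (sqrt 2)) * MMf (la + 1) w)%R).
  lra. intros p; ct. intros p; ct. apply (Mf_quad la w H Hw).
  apply (quad_ext _ _ _ (fun p => eq_sym (Mker_S la w p))), quad_scal, Q1.
  intros p. assert (P := exp_pos p). rewrite Cmod_opp, Cmod_R, (Rabs_pos_eq (sqrt 2 * exp p)) by (apply Rmult_le_pos; lra).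
  apply Rle_trans with (2 * exp (Re (la + 2) * p - k * exp p))%R.
  - replace (sqrt 2 * exp p * (sqrt 2 * exp p))%R with (2 * exp (2 * p))%R.
    2:{ replace (2 * p)%R with (p + p)%R by ring. rewrite exp_plus. rewrite <- sqrt2_sq at 1. ring. }
    rewrite !Cmod_Cexp.
    replace (Re (la * p - Ci * RtoC (exp (2 * p) / 2))) with (Re la * p)%R by (unfold Re, Im; simpl; ring).
    replace (Re (w * - RtoC (sqrt 2 * exp p))) with (- (sqrt 2 * Re w * exp p))%R by (unfold Re, Im; simpl; ring).
    replace (exp (Re la * p) * (2 * exp (2 * p)) * (exp (- (sqrt 2 * Re w * exp p)) * exp (Re w / 2 * (sqrt 2 * exp p))))%R with (2 * (exp (Re la * p) * exp (2 * p) * exp (- (sqrt 2 * Re w * exp p)) * exp (Re w / 2 * (sqrt 2 * exp p))))%R by ring.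
    rewrite <- !exp_plus. apply Rmult_le_compat_l. lra. apply exp_le. rewrite Re_S. unfold k. lra.
  - unfold Rdiv. rewrite Rmult_assoc. apply Rmult_le_compat_l. lra. apply dexp_den; auto; lra.
Qed.
Lemma Mf_rec la w : (0 < Re la)%R -> (0 < Re w)%R -> la * Mf la w = Ci * Mf (la + 2) w + RtoC (sqrt 2) * w * Mf (la + 1) w.
Proof.
  intros H Hw. assert (H1 : (0 < Re (la + 1))%R) by (rewrite Re_S; lra). assert (H2 : (0 < Re (la + 2))%R) by (rewrite Re_S; lra).
  destruct (LI_lin3 _ _ _ _ _ _ la (- Ci) (- (RtoC (sqrt 2) * w)) (Mf_quad la w H Hw) (Mf_quad (la + 2) w H2 Hw) (Mf_quad (la + 1) w H1 Hw)) as [[M Q] E].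
  rewrite (LI_FTC0 _ (MMf la w) (Mker la w) _ Q) in E.
  - fold (Mf la w) (Mf (la + 2) w) (Mf (la + 1) w) in E. rewrite <- (Cplus_0_r (Ci * Mf (la + 2) w + _)), E. ring.
  - intros p. unfold Mker.
    assert (D1 : rder (fun p : R => Cexp (la * p - Ci * RtoC (exp (2 * p) / 2))) p ((la * 1 - Ci * RtoC (exp (2 * p))) * Cexp (la * p - Ci * RtoC (exp (2 * p) / 2)))).
    { apply rder_Cexp, rder_minus. apply rder_scal, rder_id. apply rder_scal, rder_R. auto_derive; auto. field. }
    assert (D2 : rder (fun p : R => Cexp (w * - RtoC (sqrt 2 * exp p))) p ((w * - RtoC (sqrt 2 * exp p)) * Cexp (w * - RtoC (sqrt 2 * exp p)))).
    { apply rder_Cexp, rder_scal, rder_opp, rder_R. auto_derive; auto. ring. }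
    refine (rder_eq _ _ _ _ _ (rder_mult _ _ _ _ _ D1 D2)).
    replace ((la + 1) * p - Ci * RtoC (exp (2 * p) / 2)) with (RtoC p + (la * p - Ci * RtoC (exp (2 * p) / 2))) by ring.
    replace ((la + 2) * p - Ci * RtoC (exp (2 * p) / 2)) with (RtoC (2 * p) + (la * p - Ci * RtoC (exp (2 * p) / 2))) by (rewrite RtoC_mult; ring).
    rewrite !(Cexp_plus (RtoC _)), !Cexp_R, RtoC_mult. ring.
  - apply (proj2 (Mf_quad la w H Hw)).
Qed.

(** At the angle PI/4 - d the quadratic term of the exponent decays like sin d cos d e^(2p), and
    the part of the linear term that has no sign carries the same factor sin d. Completing the
    square absorbs it uniformly in d, although the quadratic decay is lost at d = 0. *)
Lemma mf_rot (la xi : C) : (0 < Re la)%R -> (0 < Re xi)%R -> mf la ((1 - Ci) * xi) = Cexp (Ci * RtoC (PI / 4) * la) * Mf la xi.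
Proof.
  intros H Hx. assert (PP := PI_RGT_0). assert (S2 := sqrt2_pos). assert (SS := sqrt2_sq). assert (S1 := sqrt2_ge1).
  set (x := (1 - Ci) * xi). set (f := fun z : C => Cexp (la * z - Cexp (2 * z) / 2 - x * Cexp z)).
  set (a := Re xi) in *. set (b := Im xi).
  assert (E0 : forall p : R, f (p, 0)%R = mker la x p).
  { intros p. unfold f, mker. change ((p, 0)%R : C) with (RtoC p). rewrite <- (RtoC_mult 2), !Cexp_R. rewrite <- Cexp_plus. f_equal. rewrite RtoC_div by lra. unfold Cdiv. ring. }
  assert (E8 : Cexp (Ci * RtoC (PI / 4)) = RtoC (/ sqrt 2) * (1 + Ci)).
  { rewrite Cexp_Ci, cos_PI4, sin_PI4. c_field; lra. }
  assert (E1 : forall p : R, f (p, PI / 4)%R = Cexp (Ci * RtoC (PI / 4) * la) * Mker la xi p).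
  { intros p. unfold f, Mker, x. rewrite <- !Cexp_plus. f_equal.
    replace (2 * (p, (PI / 4)%R)) with (RtoC (2 * p) + Ci * RtoC (PI / 2)) by (c_field).
    replace ((p, (PI / 4)%R) : C) with (RtoC p + Ci * RtoC (PI / 4)) by (c_ring).
    rewrite !Cexp_plus, !Cexp_R, E8, Cexp_Ci, cos_PI2, sin_PI2. replace ((0, 1)%R : C) with Ci by reflexivity.
    replace (RtoC (sqrt 2 * exp p)) with (RtoC (/ sqrt 2) * 2 * RtoC (exp p)). 2:{ rewrite <- !RtoC_mult. f_equal. rewrite <- sqrt2_sq at 2. field. lra. }
    rewrite (RtoC_div (exp (2 * p))) by lra.
    replace ((1 - Ci) * xi * (RtoC (exp p) * (RtoC (/ sqrt 2) * (1 + Ci)))) with (xi * (RtoC (exp p) * RtoC (/ sqrt 2)) * (1 - Ci * Ci)) by ring. rewrite Ci_sq. field. }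
  unfold mf. fold x. rewrite <- (LI_ext _ _ E0).
  rewrite <- (LI_scal _ _ _ (Mf_quad la xi H Hx)). fold (Mf la xi). rewrite <- (LI_ext _ _ E1).
  apply (LI_cauchy f (fun z => (la - Cexp (2 * z) - x * Cexp z) * f z) (exp (Rabs (Im la) * PI + b ^ 2) * Mdexp (Re la) a)). lra.
  - intros p t Ht. split; [|unfold f; ct]. unfold f.
    apply (cder_Cexp (fun z => la * z - Cexp (2 * z) / 2 - x * Cexp z)).
    apply (cder_minus (fun z => la * z - Cexp (2 * z) / 2) (fun z => x * Cexp z)). apply (cder_minus (fun z => la * z) (fun z => Cexp (2 * z) / 2)). apply cder_lin.
    apply (cder_ext (fun z => / 2 * Cexp (2 * z))). intros; unfold Cdiv; ring. apply (cder_eq _ _ (/ 2 * (2 * Cexp (2 * (p, t))))). field.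
    apply (cder_scal (/ 2) (fun z => Cexp (2 * z))), (cder_Cexp (fun z => 2 * z)), cder_lin. apply (cder_scal x Cexp), cder_Cexp0.
  - intros p t Ht. unfold f. rewrite Cmod_Cexp. set (E := exp p). assert (EP : (0 < E)%R) by apply exp_pos.
    set (d := (PI / 4 - t)%R). assert (Hd : (0 <= d <= PI / 4)%R) by (unfold d; lra).
    assert (Sd : (0 <= sin d <= 1)%R) by (split; [apply sin_ge_0; lra | apply SIN_bound]).
    assert (Cd : (/ sqrt 2 <= cos d)%R). { replace (/ sqrt 2)%R with (cos (PI / 4)) by (rewrite cos_PI4; field; lra). apply cos_decr_1; lra. }
    assert (C1 : (1 <= sqrt 2 * cos d)%R). { apply Rmult_le_compat_l with (r := sqrt 2) in Cd; [|lra]. rewrite Rinv_r in Cd by lra. lra. }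
    assert (Cp : (0 < cos d)%R) by (apply cos_gt_0; lra).
    assert (ER : Re (la * (p, t) - Cexp (2 * (p, t)) / 2 - x * Cexp (p, t)) = (Re la * p - Im la * t - (sin d * cos d * (E * E) + sqrt 2 * (a * cos d + b * sin d) * E))%R).
    { replace (2 * (p, t)) with ((2 * p, 2 * t)%R : C) by (c_ring).
      assert (T2 : cos (2 * t) = (2 * sin d * cos d)%R). { replace (2 * t)%R with (PI / 2 - 2 * d)%R by (unfold d; field). rewrite <- sin_shift. replace (PI / 2 - (PI / 2 - 2 * d))%R with (2 * d)%R by ring. apply sin_2a. }
      assert (Ct : (cos t + sin t = sqrt 2 * cos d)%R). { unfold d. rewrite cos_minus, cos_PI4, sin_PI4. field. lra. }
      assert (St : (cos t - sin t = sqrt 2 * sin d)%R). { unfold d. rewrite sin_minus, cos_PI4, sin_PI4. field. lra. }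
      transitivity (Re la * p - Im la * t - (exp (2 * p) * cos (2 * t) / 2 + E * (a * (cos t + sin t) + b * (cos t - sin t))))%R.
      unfold x, a, b, E, Cexp, Re, Im; simpl. field.
      rewrite T2, Ct, St. replace (2 * p)%R with (p + p)%R by ring. rewrite exp_plus. fold E. field. }
    rewrite ER. apply Rle_trans with (exp (Rabs (Im la) * PI + b ^ 2) * exp (Re la * p - a * E))%R.
    + rewrite <- exp_plus. apply exp_le.
      assert (B1 : (- (Im la * t) <= Rabs (Im la) * PI)%R). { eapply Rle_trans; [apply Rle_abs|]. rewrite Rabs_Ropp, Rabs_mult. apply Rmult_le_compat_l. apply Rabs_pos. apply Rabs_le_between. lra. }
      assert (B2 : (a * E <= sqrt 2 * a * cos d * E)%R). { rewrite <- (Rmult_1_l (a * E)). replace (sqrt 2 * a * cos d * E)%R with ((sqrt 2 * cos d) * (a * E))%R by ring. apply Rmult_le_compat_r; auto. apply Rmult_le_pos; lra. }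
      assert (B3 : (- (sin d * (cos d * (E * E) + sqrt 2 * b * E)) <= b ^ 2)%R).
      { assert (cos d * (cos d * (E * E) + sqrt 2 * b * E) >= - (b ^ 2 / 2))%R. { assert (0 <= (cos d * E + sqrt 2 * b / 2) ^ 2)%R by apply pow2_ge_0. replace ((cos d * E + sqrt 2 * b / 2) ^ 2)%R with (cos d * (cos d * (E * E) + sqrt 2 * b * E) + (sqrt 2 * sqrt 2) * b ^ 2 / 4)%R in H0 by field. rewrite SS in H0. lra. }
        assert (Cd2 : (1 / 2 <= cos d)%R). { assert (sqrt 2 <= 2)%R by nra. nra. }
        assert (- (b ^ 2) <= cos d * (E * E) + sqrt 2 * b * E)%R. { set (Y := (cos d * (E * E) + sqrt 2 * b * E)%R) in *. assert (0 <= b ^ 2)%R by apply pow2_ge_0. destruct (Rle_dec 0 Y); nra. }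
        assert (0 <= b ^ 2)%R by apply pow2_ge_0. nra. }
      lra.
    + unfold Rdiv. rewrite Rmult_assoc. apply Rmult_le_compat_l. left; apply exp_pos. apply dexp_den; auto; lra.
Qed.
Lemma Mf_le (r : R) (w : C) : (0 < r)%R -> (0 < Re w)%R -> (Cmod (Mf r w) <= Re (Ga r) * exp (- r * ln (Re w)))%R.
Proof.
  intros Hr Hw. assert (S2 := sqrt2_ge1). set (c := (sqrt 2 * Re w)%R). assert (Hc : (0 < c)%R) by (unfold c; nra).
  assert (D := Ga_dilate r c ltac:(rewrite re_RtoC; auto) Hc).
  assert (Ec : forall x : R, Cexp (r * x - (c * exp x)%R) = RtoC (exp (r * x - c * exp x))). { intros x. rewrite <- RtoC_mult, <- RtoC_minus. apply Cexp_R. }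
  rewrite (LI_ext _ _ Ec) in D.
  assert (Q : quad (1 * Mdexp r c) (fun x : R => RtoC (exp (r * x - c * exp x)))). { apply quad_dexp; auto. intros x; ct. intros x. rewrite Cmod_R, Rabs_pos_eq by (left; apply exp_pos). lra. }
  destruct (LI_mono _ (Mker r w) _ (ct_Mker r w) Q) as [_ L]. { intros p. rewrite Mker_mod, re_RtoC. unfold c. lra. }
  unfold Mf. eapply Rle_trans; [exact L|]. rewrite D. rewrite <- RtoC_opp, <- RtoC_mult, Cexp_R, re_scal_l, Rmult_comm. apply Rmult_le_compat_l. left; apply Ga_real_pos; auto.
  apply exp_le. apply Ropp_le_cancel. rewrite <- !Ropp_mult_distr_l, !Ropp_involutive. apply Rmult_le_compat_l. lra.
  unfold c. rewrite ln_mult by lra. assert (0 <= ln (sqrt 2))%R. { rewrite <- ln_1. destruct S2 as [G|G]. left; apply ln_increasing; lra. rewrite <- G; lra. } lra.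
Qed.

(** The principal square root where Re z > 0. *)
Definition csq (z : C) : C := let r := sqrt ((Cmod z + Re z) / 2) in (r, Im z / (2 * r))%R.
Lemma csq_re z : (0 < Re z)%R -> (0 < Re (csq z))%R.
Proof. intros H. unfold csq. simpl. apply sqrt_lt_R0. generalize (Cmod_ge_0 z); lra. Qed.
Lemma csq_sq z : (0 < Re z)%R -> csq z * csq z = z.
Proof.
  intros H. set (r := sqrt ((Cmod z + Re z) / 2)).
  assert (Hr : (0 < r)%R) by (apply sqrt_lt_R0; generalize (Cmod_ge_0 z); lra).
  assert (E : (r * r = (Cmod z + Re z) / 2)%R) by (apply sqrt_sqrt; generalize (Cmod_ge_0 z); lra).
  assert (M := Cmod2_alt z).
  assert (A : Re (csq z) = r) by reflexivity. assert (B : Im (csq z) = (Im z / (2 * r))%R) by reflexivity.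
  apply C_ext. rewrite re_mult, A, B. 2: rewrite im_mult, A, B; field; lra.
  replace (Im z / (2 * r) * (Im z / (2 * r)))%R with (Im z ^ 2 / (4 * (r * r)))%R by (field; lra).
  replace (Im z ^ 2)%R with (Cmod z ^ 2 - Re z ^ 2)%R by lra. rewrite E. assert (P := Cmod_ge_0 z). field. lra.
Qed.
Lemma csq_nz z : (0 < Re z)%R -> csq z <> 0.
Proof. intros H E. assert (A := csq_re z H). rewrite E in A. simpl in A. lra. Qed.
Lemma ct_csq {U : UniformSpace} (f : U -> C) x : continuous f x -> (0 < Re (f x))%R -> continuous (fun y => csq (f y)) x.
Proof.
  intros Hf H. assert (R0 := csq_re _ H). unfold csq in R0; simpl in R0. unfold csq.
  assert (Cr : continuous (fun y => sqrt ((Cmod (f y) + Re (f y)) / 2)) x) by ct.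
  apply ct_pair; auto. apply ct_Rdiv. ct. apply ct_Rmult. ct. auto. lra.
Qed.
Lemma loc_re_pos (z : C) : (0 < Re z)%R -> locally z (fun w : C => (0 < Re w)%R).
Proof. intros H. apply locally_Cmod. exists (Re z). split; auto. intros w Hw. assert (A := re_le_Cmod (w - z)). unfold Cminus in A. rewrite re_plus, re_opp in A. apply Rabs_le_between in A. unfold Cminus in Hw. lra. Qed.
Lemma cder_csq z : (0 < Re z)%R -> cder csq z (/ (2 * csq z)).
Proof.
  intros H. exists (fun w => / (csq w + csq z)). assert (A := csq_re z H). split; [|split].
  - apply ct_inv. apply ct_plus. apply (ct_csq (fun w => w)); auto. ct. ct. intro E. apply (f_equal Re) in E. rewrite re_plus, re_RtoC in E. lra.
  - f_equal. ring.
  - generalize (loc_re_pos z H). apply filter_imp. intros w Hw. assert (B := csq_re w Hw).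
    assert (N : csq w + csq z <> 0). { intro E. apply (f_equal Re) in E. rewrite re_plus, re_RtoC in E. lra. }
    assert (W := csq_sq w Hw). assert (Z := csq_sq z H).
    assert (D : w - z = (csq w - csq z) * (csq w + csq z)). { transitivity (csq w * csq w - csq z * csq z). rewrite W, Z; reflexivity. cring. }
    rewrite D. assert (@eq C (csq w - csq z) (/ (csq w + csq z) * ((csq w - csq z) * (csq w + csq z)))) by (field; auto). exact H0.
Qed.
Lemma csq_R (x : R) : (0 < x)%R -> csq x = RtoC (sqrt x).
Proof. intros H. unfold csq. rewrite Cmod_R, Rabs_pos_eq by lra. apply C_ext; simpl. f_equal. unfold Re; simpl. field. unfold Re, Im; simpl. unfold Rdiv. ring. Qed.

(** * The amplitude in the strip |Im z| < PI/2 *)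

Lemma re_div_pos (u q : C) : (Rabs (Im u) < Re u)%R -> (Rabs (Im q) < Re q)%R -> (0 < Re (u / q))%R.
Proof.
  intros Hu Hq. assert (E : Re (u / q) = ((Re u * Re q + Im u * Im q) / (Re q ^ 2 + Im q ^ 2))%R).
  { unfold Cdiv. rewrite Cinv_re_im, re_mult. unfold Re at 2, Im at 2; simpl. unfold Rdiv. ring. }
  assert (P : (0 < Re q)%R) by (generalize (Rabs_pos (Im q)); lra).
  rewrite E. apply Rdiv_lt_0_compat. 2: nra.
  assert (- (Im u * Im q) <= Rabs (Im u) * Rabs (Im q))%R. { rewrite <- Rabs_mult, <- Rabs_Ropp. apply Rle_abs. }
  assert (A := Rabs_pos (Im u)). assert (B := Rabs_pos (Im q)). nra.
Qed.
Lemma csq_im z : (0 < Re z)%R -> (Rabs (Im (csq z)) < Re (csq z))%R.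
Proof.
  intros H. assert (E := f_equal Re (csq_sq z H)). rewrite re_mult in E. assert (P := csq_re z H).
  assert (U : (Im (csq z) * Im (csq z) = Rabs (Im (csq z)) * Rabs (Im (csq z)))%R). { rewrite <- Rabs_mult. rewrite Rabs_pos_eq; auto. apply Rle_0_sqr. }
  assert (A := Rabs_pos (Im (csq z))). nra.
Qed.

(** The imaginary part of the equation gives Re c |Im c| = Re s |Im s|. So if |Im c| exceeded Re
    s, then |Im s| would exceed Re c, and the real part would be negative. *)
Lemma circle_parts (c s : C) : c * c + s * s = 1 -> (0 < Re c)%R -> (0 < Re s)%R -> (Rabs (Im c) <= Re s /\ Rabs (Im s) <= Re c)%R.
Proof.
  intros E Hc Hs. assert (E1 := f_equal Re E). assert (E2 := f_equal Im E). rewrite re_plus, !re_mult, re_RtoC in E1. rewrite im_plus, !im_mult, im_RtoC in E2.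
  set (c1 := Re c) in *. set (c2 := Im c) in *. set (s1 := Re s) in *. set (s2 := Im s) in *.
  assert (X : (c1 * Rabs c2 = s1 * Rabs s2)%R). { rewrite <- (Rabs_pos_eq c1), <- (Rabs_pos_eq s1) by lra. rewrite <- !Rabs_mult. replace (c1 * c2)%R with (- (s1 * s2))%R by lra. apply Rabs_Ropp. }
  assert (U : (c2 * c2 = Rabs c2 * Rabs c2)%R). { rewrite <- Rabs_mult. rewrite Rabs_pos_eq; auto. apply Rle_0_sqr. }
  assert (V : (s2 * s2 = Rabs s2 * Rabs s2)%R). { rewrite <- Rabs_mult. rewrite Rabs_pos_eq; auto. apply Rle_0_sqr. }
  rewrite U, V in E1. assert (A := Rabs_pos c2). assert (B := Rabs_pos s2). set (p := Rabs c2) in *. set (q := Rabs s2) in *.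
  split; apply Rnot_lt_le; intro G.
  - assert (c1 < q)%R. { apply Rmult_lt_reg_l with s1; auto. rewrite <- X. nra. } nra.
  - assert (s1 < p)%R. { apply Rmult_lt_reg_l with c1; auto. rewrite X. nra. } nra.
Qed.

(** 2 cosh z. *)
Definition cc (z : C) : C := Cexp z + Cexp (- z).
Definition cs (z : C) : C := Cexp z - Cexp (- z).

(** The continuation of [Nr] to the strip. *)
Definition Nc (z : C) : C := / csq (cc z).
Lemma cc_re (x t : R) : Re (cc (x, t)) = ((exp x + exp (- x)) * cos t)%R.
Proof. unfold cc. rewrite re_plus. unfold Cexp, Re, Im; simpl. rewrite cos_neg. ring. Qed.
Lemma cc_pos (x t : R) : (Rabs t < PI / 2)%R -> (0 < Re (cc (x, t)))%R.
Proof. intros H. rewrite cc_re. apply Rmult_lt_0_compat. apply eX_pos. apply Rabs_def2 in H. apply cos_gt_0; lra. Qed.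
Lemma Nc_sq (x t : R) : (Rabs t < PI / 2)%R -> Nc (x, t) * Nc (x, t) * cc (x, t) = 1.
Proof. intros H. assert (P := cc_pos x t H). unfold Nc. rewrite <- (csq_sq _ P) at 3. field. apply csq_nz; auto. Qed.
Lemma half_exp_parts (x t : R) (s : R) : (s = 1 \/ s = -1)%R -> (Rabs t < PI / 2)%R -> (Rabs (Im (Cexp (s * ((x, t) / 2)))) < Re (Cexp (s * ((x, t) / 2))))%R.
Proof.
  intros Hs H. replace (s * ((x, t) / 2)) with ((s * x / 2, s * t / 2)%R : C) by (c_field).
  unfold Cexp, Re, Im; simpl. rewrite Rabs_mult, Rabs_pos_eq by (left; apply exp_pos). apply Rmult_lt_compat_l. apply exp_pos.
  assert (PP := PI_RGT_0). apply Rabs_def2 in H. set (u := (s * t / 2)%R). assert (Hu : (- (PI / 4) < u < PI / 4)%R) by (unfold u; destruct Hs; subst s; lra).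
  assert (Cu : (cos (PI / 4) < cos u)%R). { destruct (Rle_dec 0 u). apply cos_decreasing_1; lra. rewrite <- (cos_neg u). apply cos_decreasing_1; lra. }
  assert (Su : (Rabs (sin u) < sin (PI / 4))%R). { apply Rabs_def1. apply sin_increasing_1; lra. rewrite <- sin_neg. apply sin_increasing_1; lra. }
  rewrite cos_PI4, sin_PI4 in *. lra.
Qed.

Section Strip.
Variables xi eta : C.
Variable m : R.
Hypothesis Hm : (0 < m)%R.
Hypothesis H1 : (m + Rabs (Im eta) <= Re xi)%R.
Hypothesis H2 : (m + Rabs (Im xi) <= Re eta)%R.

(** In the coordinates X = q - p and x = (p + q)/2 the exponent of the product of the two
    integrands has the linear term - sqrt 2 e^x kap X. *)
Definition kap (z : C) : C := xi * Cexp (- (z / 2)) + eta * Cexp (z / 2).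
Definition kap1 (z : C) : C := / 2 * (eta * Cexp (z / 2) - xi * Cexp (- (z / 2))).

(** With c = N e^(-z/2) and s = N e^(z/2), N kap z = xi c + eta s and c^2 + s^2 = 1. Then |Im c|
    <= Re s and |Im s| <= Re c by [circle_parts], and the conditions on xi and eta bound the real
    part below by m (Re c + Re s). *)
Lemma kap_lower (x t : R) : (Rabs t < PI / 2)%R -> (0 < Cmod (Nc (x, t)))%R /\ (m * (Cmod (Nc (x, t)) * exp (Rabs x / 2)) <= Re (Nc (x, t) * kap (x, t)))%R.
Proof.
  intros Ht. assert (P := cc_pos x t Ht). set (z := ((x, t) : C)) in *. set (N := Nc z).
  assert (NN : (0 < Cmod N)%R). { apply Cmod_gt_0. unfold N, Nc. intro E. assert (X := csq_nz _ P). apply (f_equal (Cmult (csq (cc z)))) in E. rewrite Cinv_r, Cmult_0_r in E by auto. apply RtoC_inj in E; lra. }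
  split. exact NN.
  set (c := N * Cexp (- (z / 2))). set (s := N * Cexp (z / 2)).
  assert (Ecs : c * c + s * s = 1).
  { rewrite <- (Nc_sq x t Ht). fold z. fold N. unfold c, s, cc. replace (Cexp (- z)) with (Cexp (- (z / 2)) * Cexp (- (z / 2))) by (rewrite <- Cexp_plus; f_equal; field).
    replace (Cexp z) with (Cexp (z / 2) * Cexp (z / 2)) by (rewrite <- Cexp_plus; f_equal; field). ring. }
  assert (Rc : (0 < Re c)%R). { replace c with (Cexp ((-1)%R * (z / 2)) / csq (cc z)). apply re_div_pos. apply half_exp_parts; auto. apply csq_im; auto.
    unfold c, N, Nc, Cdiv. rewrite Cmult_comm. do 2 f_equal. c_ring. }
  assert (Rs : (0 < Re s)%R). { replace s with (Cexp (1%R * (z / 2)) / csq (cc z)). apply re_div_pos. apply half_exp_parts; auto. apply csq_im; auto.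
    unfold s, N, Nc, Cdiv. rewrite Cmult_comm. do 2 f_equal. c_ring. }
  destruct (circle_parts c s Ecs Rc Rs) as [B1 B2].
  assert (L : (m * (Re c + Re s) <= Re (N * kap z))%R).
  { replace (N * kap z) with (xi * c + eta * s) by (unfold kap, c, s; ring). rewrite re_plus, !re_mult.
    assert (Im xi * Im c <= Rabs (Im xi) * Re s)%R. { eapply Rle_trans; [apply Rle_abs|]. rewrite Rabs_mult. apply Rmult_le_compat_l; auto. apply Rabs_pos. }
    assert (Im eta * Im s <= Rabs (Im eta) * Re c)%R. { eapply Rle_trans; [apply Rle_abs|]. rewrite Rabs_mult. apply Rmult_le_compat_l; auto. apply Rabs_pos. }
    assert ((m + Rabs (Im eta)) * Re c <= Re xi * Re c)%R by (apply Rmult_le_compat_r; lra).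
    assert ((m + Rabs (Im xi)) * Re s <= Re eta * Re s)%R by (apply Rmult_le_compat_r; lra). lra. }
  eapply Rle_trans; [|exact L]. apply Rmult_le_compat_l. lra.
  destruct (Rle_dec 0 x).
  - rewrite (Rabs_pos_eq x) by auto. replace (Cmod N * exp (x / 2))%R with (Cmod s).
    eapply Rle_trans; [apply Cmod_le_re_im|]. rewrite (Rabs_pos_eq (Re s)); lra.
    unfold s. rewrite Cmod_mult, Cmod_Cexp. f_equal. f_equal. unfold z, Re; simpl; field.
  - rewrite (Rabs_left x) by lra. replace (Cmod N * exp (- x / 2))%R with (Cmod c).
    eapply Rle_trans; [apply Cmod_le_re_im|]. rewrite (Rabs_pos_eq (Re c)); lra.
    unfold c. rewrite Cmod_mult, Cmod_Cexp. f_equal. f_equal. unfold z, Re; simpl; field.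
Qed.
Lemma kap_pos (x t : R) : (Rabs t < PI / 2)%R -> (0 < Re (Nc (x, t) * kap (x, t)))%R.
Proof. intros H. destruct (kap_lower x t H) as [A B]. eapply Rlt_le_trans; [|exact B]. apply Rmult_lt_0_compat; auto. apply Rmult_lt_0_compat; auto. apply exp_pos. Qed.

(** A family closed under differentiation up to the factors kap1 and cs; k = 1 is the amplitude. *)
Definition Wf (k : nat) (z : C) : C := Nc z ^ k * Mf (INR k) (Nc z * kap z).
Lemma Wf_bound (k : nat) (x t : R) : (0 < k)%nat -> (Rabs t < PI / 2)%R ->
  (Cmod (Wf k (x, t)) <= Re (Ga (INR k)) * exp (- INR k * ln m) * exp (- (INR k / 2) * Rabs x))%R.
Proof.
  intros Hk Ht. destruct (kap_lower x t Ht) as [A B]. assert (P := kap_pos x t Ht). assert (Hk' : (0 < INR k)%R) by (apply lt_0_INR; auto).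
  unfold Wf. rewrite Cmod_mult, Cmod_pow. set (n := Cmod (Nc (x, t))) in *.
  assert (En : (n ^ k = exp (INR k * ln n))%R). { rewrite <- (exp_ln n A) at 1. clear. induction k. simpl. rewrite Rmult_0_l, exp_0; auto. rewrite S_INR. simpl pow. rewrite IHk, <- exp_plus. f_equal. ring. }
  eapply Rle_trans. apply Rmult_le_compat_l. apply pow_le; lra. apply Mf_le; auto.
  rewrite En. rewrite <- Rmult_assoc, (Rmult_comm (exp _)), !Rmult_assoc. apply Rmult_le_compat_l. left; apply Ga_real_pos; auto.
  rewrite <- !exp_plus. apply exp_le.
  assert (L : (ln m + (ln n + Rabs x / 2) <= ln (Re (Nc (x, t) * kap (x, t))))%R).
  { rewrite <- (ln_exp (Rabs x / 2)) at 1. assert (E := exp_pos (Rabs x / 2)). rewrite <- ln_mult by auto. rewrite <- ln_mult by (auto; apply Rmult_lt_0_compat; auto).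
    destruct B as [B|B]. left; apply ln_increasing; auto. apply Rmult_lt_0_compat; auto. apply Rmult_lt_0_compat; auto. rewrite B; lra. }
  apply Rmult_le_compat_l with (r := INR k) in L; [|lra]. lra.
Qed.
Lemma cder_cc z : cder cc z (cs z).
Proof. unfold cc. apply (cder_eq _ _ (Cexp z + - (1) * Cexp (- z))). unfold cs. ring. apply (cder_plus Cexp (fun z => Cexp (- z))). apply cder_Cexp0. apply (cder_Cexp (fun z => - z)), cder_opp, cder_id. Qed.
Lemma cder_cs z : cder cs z (cc z).
Proof. unfold cs. apply (cder_eq _ _ (Cexp z - - (1) * Cexp (- z))). unfold cc. ring. apply (cder_minus Cexp (fun z => Cexp (- z))). apply cder_Cexp0. apply (cder_Cexp (fun z => - z)), cder_opp, cder_id. Qed.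
Lemma cder_kap z : cder kap z (kap1 z).
Proof.
  unfold kap. apply (cder_eq _ _ (xi * (- / 2 * Cexp (- (z / 2))) + eta * (/ 2 * Cexp (z / 2)))). unfold kap1. ring.
  apply (cder_plus (fun z => xi * Cexp (- (z / 2))) (fun z => eta * Cexp (z / 2))).
  apply (cder_scal xi (fun z => Cexp (- (z / 2)))), (cder_Cexp (fun z => - (z / 2))), cder_opp, cder_half.
  apply (cder_scal eta (fun z => Cexp (z / 2))), (cder_Cexp (fun z => z / 2)), cder_half.
Qed.
Lemma cder_kap1 z : cder kap1 z (/ 4 * kap z).
Proof.
  unfold kap1. apply (cder_eq _ _ (/ 2 * (eta * (/ 2 * Cexp (z / 2)) - xi * (- / 2 * Cexp (- (z / 2)))))). unfold kap. field.
  apply (cder_scal (/ 2) (fun z => eta * Cexp (z / 2) - xi * Cexp (- (z / 2)))), (cder_minus (fun z => eta * Cexp (z / 2)) (fun z => xi * Cexp (- (z / 2)))).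
  apply (cder_scal eta (fun z => Cexp (z / 2))), (cder_Cexp (fun z => z / 2)), cder_half.
  apply (cder_scal xi (fun z => Cexp (- (z / 2)))), (cder_Cexp (fun z => - (z / 2))), cder_opp, cder_half.
Qed.
Lemma cder_Nc (x t : R) : (Rabs t < PI / 2)%R -> cder Nc (x, t) (- / 2 * cs (x, t) * (Nc (x, t) * Nc (x, t) * Nc (x, t))).
Proof.
  intros H. assert (P := cc_pos x t H). assert (N := csq_nz _ P). unfold Nc.
  refine (cder_eq _ _ _ _ _ (cder_inv (fun z => csq (cc z)) (x, t) _ (cder_comp csq cc (x, t) _ _ (cder_csq _ P) (cder_cc _)) N)). field. auto.
Qed.
Lemma cder_pow (f : C -> C) z a (n : nat) : cder f z a -> cder (fun w => f w ^ S n) z (INR (S n) * f z ^ n * a).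
Proof.
  intros H. induction n.
  - simpl. apply (cder_ext f). intros; ring. apply (cder_eq _ _ a); auto. ring.
  - apply (cder_eq _ _ (a * f z ^ S n + f z * (INR (S n) * f z ^ n * a))). rewrite (S_INR (S n)), RtoC_plus. simpl Cpow. ring.
    apply (cder_mult f (fun w => f w ^ S n)); auto.
Qed.
Lemma cder_Wf (n : nat) (x t : R) : (Rabs t < PI / 2)%R ->
  cder (Wf (S n)) (x, t) (- RtoC (sqrt 2) * kap1 (x, t) * Wf (S (S n)) (x, t) - Ci / 2 * cs (x, t) * Wf (S (S (S n))) (x, t)).
Proof.
  intros H. assert (P := kap_pos x t H). assert (Hn : (0 < Re (INR (S n)))%R). { rewrite re_RtoC. apply lt_0_INR. lia. }
  assert (D1 := cder_pow Nc (x, t) _ n (cder_Nc x t H)).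
  assert (D2 := cder_comp (Mf (INR (S n))) (fun z => Nc z * kap z) (x, t) _ _ (Mf_cder _ _ Hn P) (cder_mult _ _ _ _ _ (cder_Nc x t H) (cder_kap (x, t)))).
  refine (cder_eq _ _ _ _ _ (cder_mult _ _ _ _ _ D1 D2)).
  assert (R := Mf_rec (INR (S n)) _ Hn P). unfold Wf.
  replace (RtoC (INR (S (S n)))) with (RtoC (INR (S n)) + 1) by (rewrite (S_INR (S n)), RtoC_plus; reflexivity).
  replace (RtoC (INR (S (S (S n))))) with (RtoC (INR (S n)) + 2) by (rewrite (S_INR (S (S n))), (S_INR (S n)), !RtoC_plus; ring).
  set (N := Nc (x, t)) in *. set (w := N * kap (x, t)) in *. set (k := RtoC (INR (S n))) in *.
  set (F0 := Mf k w) in *. set (F1 := Mf (k + 1) w) in *. set (F2 := Mf (k + 2) w) in *.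
  replace (k * N ^ n * (- / 2 * cs (x, t) * (N * N * N)) * F0) with (N ^ n * (- / 2 * cs (x, t) * (N * N * N)) * (k * F0)) by ring. rewrite R. unfold w. simpl Cpow. field.
Qed.

(** Growth of at most K e^(r |x|), uniformly in the strip. *)
Definition bnd (r : R) (f : C -> C) := exists K, (0 <= K)%R /\ forall x t : R, (Rabs t < PI / 2)%R -> (Cmod (f (x, t)) <= K * exp (r * Rabs x))%R.
Lemma bnd_mult r1 r2 r f g : (r = r1 + r2)%R -> bnd r1 f -> bnd r2 g -> bnd r (fun z => f z * g z).
Proof.
  intros -> [K [HK A]] [L [HL B]]. exists (K * L)%R. split. apply Rmult_le_pos; auto. intros x t Ht. rewrite Cmod_mult.
  eapply Rle_trans. apply Rmult_le_compat. apply Cmod_ge_0. apply Cmod_ge_0. apply A; auto. apply B; auto. right.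
  rewrite Rmult_plus_distr_r, exp_plus. ring.
Qed.
Lemma bnd_plus r f g : bnd r f -> bnd r g -> bnd r (fun z => f z + g z).
Proof.
  intros [K [HK A]] [L [HL B]]. exists (K + L)%R. split. lra. intros x t Ht. triangle. specialize (A x t Ht). specialize (B x t Ht). lra.
Qed.
Lemma bnd_scal c r f : bnd r f -> bnd r (fun z => c * f z).
Proof. intros [K [HK A]]. exists (Cmod c * K)%R. split. apply Rmult_le_pos; auto. apply Cmod_ge_0. intros x t Ht. rewrite Cmod_mult, Rmult_assoc. apply Rmult_le_compat_l. apply Cmod_ge_0. auto. Qed.
Lemma bnd_ext r f g : (forall z, f z = g z) -> bnd r f -> bnd r g.
Proof. intros E [K [HK A]]. exists K. split; auto. intros. rewrite <- E; auto. Qed.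
Lemma bnd_exp s : (s = 1 \/ s = -1)%R -> bnd (/ 2) (fun z => Cexp (s * (z / 2))).
Proof.
  intros Hs. exists 1%R. split. lra. intros x t _. rewrite Cmod_Cexp, Rmult_1_l. apply exp_le. replace (Re (s * ((x, t) / 2))) with (s * x / 2)%R by (unfold Re; simpl; field).
  generalize (Rle_abs x) (Rle_abs (- x)). rewrite Rabs_Ropp. destruct Hs; subst s; lra.
Qed.
Lemma bnd_half : bnd (/ 2) (fun z => Cexp (z / 2)) /\ bnd (/ 2) (fun z => Cexp (- (z / 2))).
Proof.
  split. apply (bnd_ext _ (fun z => Cexp (1%R * (z / 2)))). intros; f_equal; ring. apply bnd_exp; auto.
  apply (bnd_ext _ (fun z => Cexp ((-1)%R * (z / 2)))). intros; f_equal; c_ring. apply bnd_exp; auto.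
Qed.
Lemma bnd_kap : bnd (/ 2) kap.
Proof. destruct bnd_half. apply bnd_plus; apply bnd_scal; auto. Qed.
Lemma bnd_kap1 : bnd (/ 2) kap1.
Proof. destruct bnd_half. apply bnd_scal. apply (bnd_ext _ (fun z => eta * Cexp (z / 2) + (- xi) * Cexp (- (z / 2)))). intros; ring. apply bnd_plus; apply bnd_scal; auto. Qed.
Lemma bnd_cc : bnd 1 cc.
Proof.
  destruct bnd_half. apply (bnd_ext _ (fun z => Cexp (z / 2) * Cexp (z / 2) + Cexp (- (z / 2)) * Cexp (- (z / 2)))).
  intros; unfold cc; rewrite <- !Cexp_plus; f_equal; f_equal; field. apply bnd_plus; apply (bnd_mult (/ 2) (/ 2)); auto; lra.
Qed.
Lemma bnd_cs : bnd 1 cs.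
Proof.
  destruct bnd_half. apply (bnd_ext _ (fun z => Cexp (z / 2) * Cexp (z / 2) + (- (1)) * (Cexp (- (z / 2)) * Cexp (- (z / 2))))).
  intros. unfold cs. rewrite <- !Cexp_plus. replace (z / 2 + z / 2) with z by field. replace (- (z / 2) + - (z / 2)) with (- z) by field. ring.
  apply bnd_plus; [|apply bnd_scal]; apply (bnd_mult (/ 2) (/ 2)); auto; lra.
Qed.
Lemma bnd_W (k : nat) r : (0 < k)%nat -> (r = - (INR k / 2))%R -> bnd r (Wf k).
Proof.
  intros Hk ->. exists (Re (Ga (INR k)) * exp (- INR k * ln m))%R. split. apply Rmult_le_pos. left; apply Ga_real_pos, lt_0_INR; auto. left; apply exp_pos.
  intros x t Ht. apply Wf_bound; auto.
Qed.

(** The integral in x of the product of the two integrands at fixed X = q - p, without the factor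
    e^(S X); see [inner_int]. *)
Definition Amp := Wf 1.
Definition Amp1 (z : C) : C := - RtoC (sqrt 2) * (kap1 z * Wf 2 z) + - (Ci / 2) * (cs z * Wf 3 z).
Definition Amp2 (z : C) : C :=
  - RtoC (sqrt 2) * (/ 4 * (kap z * Wf 2 z) + (- RtoC (sqrt 2) * (kap1 z * (kap1 z * Wf 3 z)) + - (Ci / 2) * (kap1 z * (cs z * Wf 4 z))))
  + - (Ci / 2) * (cc z * Wf 3 z + (- RtoC (sqrt 2) * (cs z * (kap1 z * Wf 4 z)) + - (Ci / 2) * (cs z * (cs z * Wf 5 z)))).
Lemma cder_Amp (x t : R) : (Rabs t < PI / 2)%R -> cder Amp (x, t) (Amp1 (x, t)).
Proof. intros H. refine (cder_eq _ _ _ _ _ (cder_Wf 0 x t H)). unfold Amp1. ring. Qed.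
Lemma cder_Amp1 (x t : R) : (Rabs t < PI / 2)%R -> cder Amp1 (x, t) (Amp2 (x, t)).
Proof.
  intros H. unfold Amp1.
  assert (D2 := cder_mult _ _ _ _ _ (cder_kap1 (x, t)) (cder_Wf 1 x t H)). assert (D3 := cder_mult _ _ _ _ _ (cder_cs (x, t)) (cder_Wf 2 x t H)).
  refine (cder_eq _ _ _ _ _ (cder_plus _ _ _ _ _ (cder_scal (- RtoC (sqrt 2)) _ _ _ D2) (cder_scal (- (Ci / 2)) _ _ _ D3))). unfold Amp2. ring.
Qed.
Lemma bnd_Amp : bnd (- / 2) Amp.
Proof. apply bnd_W. lia. simpl. field. Qed.
Ltac wb := apply bnd_W; [lia | simpl; field].
Lemma bnd_Amp1 : bnd (- / 2) Amp1.
Proof.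
  apply bnd_plus; apply bnd_scal.
  apply (bnd_mult (/ 2) (-1)). field. apply bnd_kap1. wb.
  apply (bnd_mult 1 (- (3 / 2))). field. apply bnd_cs. wb.
Qed.
Lemma bnd_Amp2 : bnd (- / 2) Amp2.
Proof.
  apply bnd_plus; apply bnd_scal.
  - apply bnd_plus. apply bnd_scal, (bnd_mult (/ 2) (-1)). field. apply bnd_kap. wb.
    apply bnd_plus; apply bnd_scal.
    apply (bnd_mult (/ 2) (-1)). field. apply bnd_kap1. apply (bnd_mult (/ 2) (- (3 / 2))). field. apply bnd_kap1. wb.
    apply (bnd_mult (/ 2) (-1)). field. apply bnd_kap1. apply (bnd_mult 1 (-2)). field. apply bnd_cs. wb.
  - apply bnd_plus. apply (bnd_mult 1 (- (3 / 2))). field. apply bnd_cc. wb.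
    apply bnd_plus; apply bnd_scal.
    apply (bnd_mult 1 (- (3 / 2))). field. apply bnd_cs. apply (bnd_mult (/ 2) (-2)). field. apply bnd_kap1. wb.
    apply (bnd_mult 1 (- (3 / 2))). field. apply bnd_cs. apply (bnd_mult 1 (- (5 / 2))). field. apply bnd_cs. wb.
Qed.
End Strip.

(** * Fourier inversion *)

Lemma LI_atan : quad 1 (fun x => RtoC (1 / (1 + x ^ 2))) /\ LI (fun x => RtoC (1 / (1 + x ^ 2))) = RtoC PI.
Proof.
  assert (Q : quad 1 (fun x => RtoC (1 / (1 + x ^ 2)))).
  { split. intros x. apply ct_R, ct_den. intros x. assert (D := den_pos x). rewrite Cmod_R, Rabs_pos_eq. lra. left; apply Rdiv_lt_0_compat; lra. }
  split; auto. rewrite (LI_FTC 1 (fun x => RtoC (atan x)) _ (RtoC (PI / 2)) (RtoC (- (PI / 2))) Q).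
  - rewrite <- RtoC_minus. f_equal. field.
  - intros x. apply rder_R. apply is_derive_Reals. replace (1 / (1 + x ^ 2))%R with (/ (1 + x ^ 2))%R by (field; nra). apply derivable_pt_lim_atan.
  - apply atan_inf.
  - apply lim_opp. intros e He. destruct (atan_inf e He) as [N HN]. exists N. intros x Hx. specialize (HN x Hx).
    rewrite atan_opp. rewrite <- RtoC_minus, Cmod_R in *. rewrite <- Rabs_Ropp. replace (- (- atan x - - (PI / 2)))%R with (atan x - PI / 2)%R by ring. auto.
Qed.

(** The damping e^(-e |v|) turns the divergent Fourier integral of 1 into the Poisson kernel. *)
Lemma laplace_kernel (e x : R) : (0 < e)%R ->
  quad (1 * Mexp e) (fun v => Cexp (Ci * (v * x)%R - (e * Rabs v)%R)) /\
  LI (fun v => Cexp (Ci * (v * x)%R - (e * Rabs v)%R)) = RtoC (2 * e / (e ^ 2 + x ^ 2)).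
Proof.
  intros He. set (f := fun v => Cexp (Ci * (v * x)%R - (e * Rabs v)%R)).
  assert (Mf : forall v, Cmod (f v) = exp (- e * Rabs v)). { intros v. unfold f. rewrite Cmod_Cexp. f_equal. unfold Re; simpl; ring. }
  assert (Q : quad (1 * Mexp e) f).
  { apply quad_exp; auto. intros v. unfold f. apply ct_Cexp, ct_minus. ct. apply ct_R, ct_Rmult. ct. apply continuous_Rabs. intros v. rewrite Mf. lra. }
  split; auto. assert (D : (0 < e ^ 2 + x ^ 2)%R) by nra.
  set (a := (e, x)%R : C). set (b := ((- e)%R, x) : C).
  assert (Na : a <> 0). { intro E. apply (f_equal fst) in E. simpl in E. lra. }
  assert (Nb : b <> 0). { intro E. apply (f_equal fst) in E. simpl in E. lra. }
  assert (Hd : forall (c : C) (v : R), c <> 0 -> rder (fun v : R => Cexp (c * v) / c) v (Cexp (c * v))).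
  { intros c v Hc. apply (rder_ext (fun v : R => / c * Cexp (c * v))). intros; unfold Cdiv; ring. apply (rder_eq _ _ (/ c * (c * 1 * Cexp (c * v)))). field; auto.
    apply rder_scal, rder_Cexp, rder_scal, rder_id. }
  apply (LI_unique _ _ _ Q). intros d Hd0.
  destruct (quad_lim_p _ f (proj2 Q) (d * e / 2)%R ltac:(apply Rmult_lt_0_compat; [apply Rmult_lt_0_compat|]; lra)) as [N HN]. exists (Rmax N 0). intros n Hn.
  assert (n > 0)%R by (generalize (Rmax_r N 0); lra). assert (n > N)%R by (generalize (Rmax_l N 0); lra).
  assert (I1 : CInt f (- n) 0 = (1 - Cexp (a * (- n)%R)) / a).
  { transitivity (CInt (fun v : R => Cexp (a * v)) (- n) 0).
    - apply (RInt_ext (V := C_R_CompleteNormedModule)). intros v Hv. rewrite Rmin_left, Rmax_right in Hv by lra. unfold f, a. rewrite (Rabs_left v) by lra. f_equal. c_ring.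
    - rewrite (ci_FTC (fun v : R => Cexp (a * v) / a)). rewrite Cmult_0_r, Cexp_0. field; auto. intros; apply Hd; auto. intros v; ct. }
  assert (I0 : CInt f 0 n = (Cexp (b * n) - 1) / b).
  { transitivity (CInt (fun v : R => Cexp (b * v)) 0 n).
    - apply (RInt_ext (V := C_R_CompleteNormedModule)). intros v Hv. rewrite Rmin_left, Rmax_right in Hv by lra. unfold f, b. rewrite (Rabs_pos_eq v) by lra. f_equal. c_ring.
    - rewrite (ci_FTC (fun v : R => Cexp (b * v) / b)). rewrite Cmult_0_r, Cexp_0. field; auto. intros; apply Hd; auto. intros v; ct. }
  rewrite <- (ci_Chasles f (- n) 0 n (proj1 Q)), I1, I0.
  replace (_ - _) with (Cexp (b * n) / b - Cexp (a * (- n)%R) / a).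
  2:{ assert (E : RtoC (2 * e / (e ^ 2 + x ^ 2)) = 1 / a - 1 / b). { unfold Cdiv. rewrite !Cinv_re_im. unfold a, b. c_field; nra. }
      rewrite E. field; auto. }
  assert (L : forall c : C, (Rabs (Re c) = e)%R -> (Cmod (/ c) <= / e)%R).
  { intros c Hc. assert (X := re_le_Cmod c). rewrite Cmod_inv. apply Rinv_le_contravar; lra. intro E. subst c. simpl in Hc. rewrite Rabs_R0 in Hc. lra. }
  assert (Hn1 := HN n ltac:(lra)). replace (f n - 0) with (f n) in Hn1 by ring; rewrite Mf, (Rabs_pos_eq n) in Hn1 by lra.
  unfold Cdiv. triangle. rewrite Cmod_opp, !Cmod_mult, !Cmod_Cexp.
  replace (Re (b * n)) with (- e * n)%R by (unfold b, Re; simpl; ring). replace (Re (a * (- n)%R)) with (- e * n)%R by (unfold a, Re; simpl; ring).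
  assert (Lb := L b ltac:(unfold b; simpl; rewrite Rabs_Ropp, Rabs_pos_eq; lra)). assert (La := L a ltac:(unfold a; simpl; rewrite Rabs_pos_eq; lra)).
  assert (P := exp_pos (- e * n)). replace d with (d * e / 2 * / e + d * e / 2 * / e)%R by (field; lra).
  apply Rplus_le_compat; apply Rmult_le_compat; try lra; apply Cmod_ge_0.
Qed.

(** Abel summation: the damped integral is the mean of g against the Poisson kernel of width e, by
    Fubini; then e tends to 0 on both sides. *)
Lemma fourier_inversion M N (g : R -> C) : quad M g -> quad N (fun v => LI (fun x => Cexp (Ci * (v * x)%R) * g x)) ->
  LI (fun v => LI (fun x => Cexp (Ci * (v * x)%R) * g x)) = RtoC (2 * PI) * g 0.
Proof.
  intros Qg QF. set (F := fun v => LI (fun x => Cexp (Ci * (v * x)%R) * g x)) in *. assert (HM := quad_M _ _ Qg). assert (HN := quad_M _ _ QF).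
  assert (Ug : forall x, (Cmod (g x) <= M)%R).
  { intros x. eapply Rle_trans; [apply Qg|]. unfold Rdiv. rewrite <- (Rmult_1_r M) at 2. apply Rmult_le_compat_l; auto. rewrite <- Rinv_1. apply Rinv_le_contravar; nra. }
  (* The damped integral; the substitution x = e u makes the kernel independent of e. *)
  assert (E1 : forall e, (0 < e)%R -> LI (fun v => RtoC (exp (- e * Rabs v)) * F v) = LI (fun u => RtoC (2 * (1 / (1 + u ^ 2))) * g (e * u)%R)).
  { intros e He.
    assert (Q2 : quad2 (M * Mexp e) (fun x v => Cexp (Ci * (v * x)%R - (e * Rabs v)%R) * g x)).
    { split. intros q. apply ct_mult. apply ct_Cexp, ct_minus. ct. apply ct_R, ct_Rmult. ct. apply (ct_Rcomp Rabs). ct. apply continuous_Rabs.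
      apply (continuous_comp (fun q : R * R => fst q) g). ct. apply Qg.
      intros x v. destruct (laplace_kernel e x He) as [[_ B] _]. specialize (B v). rewrite Cmod_mult, Rmult_comm.
      replace (M * Mexp e / (1 + x ^ 2) / (1 + v ^ 2))%R with (M / (1 + x ^ 2) * (1 * Mexp e / (1 + v ^ 2)))%R by (field; generalize (den_pos x) (den_pos v); lra).
      apply Rmult_le_compat; try apply Cmod_ge_0; auto. apply Qg. }
    transitivity (LI (fun v => LI (fun x => Cexp (Ci * (v * x)%R - (e * Rabs v)%R) * g x))).
    { apply LI_ext. intros v. unfold F. symmetry. rewrite <- (LI_scal M). apply LI_ext. intros x. rewrite <- Cexp_R, Cmult_assoc, <- Cexp_plus. do 2 f_equal. rewrite !RtoC_mult, RtoC_opp. ring.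
      split. intros x. apply ct_mult. ct. apply Qg. intros x. rewrite Cmod_mult, Cexp_Ci. replace (Cmod (cos (v * x), sin (v * x))) with 1%R. rewrite Rmult_1_l. apply Qg.
      unfold Cmod; simpl. rewrite !Rmult_1_r. generalize (sin2_cos2 (v * x)). unfold Rsqr. intros E. rewrite Rplus_comm, E, sqrt_1. auto. }
    rewrite (LI_Fubini _ _ Q2).
    assert (K1 : forall x, LI (fun v => Cexp (Ci * (v * x)%R - (e * Rabs v)%R) * g x) = RtoC (2 * e / (e ^ 2 + x ^ 2)) * g x).
    { intros x. destruct (laplace_kernel e x He) as [B1 B2]. rewrite <- B2, Cmult_comm, <- (LI_scal _ _ _ B1). apply LI_ext. intros; apply Cmult_comm. }
    assert (Q3 := quad2_inner _ _ (quad2_swap _ _ Q2)). apply (quad_ext _ _ _ K1) in Q3. rewrite (LI_ext _ _ K1).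
    rewrite <- (LI_scale _ _ e He Q3). assert (Q4 := quad_scale _ _ e He Q3). cbv beta in Q4. rewrite <- (LI_scal _ _ _ Q4). apply LI_ext. intros u. rewrite Cmult_assoc, <- RtoC_mult. do 2 f_equal. field. nra. }
  assert (Qu : forall e, (0 < e)%R -> quad (2 * M) (fun u => RtoC (2 * (1 / (1 + u ^ 2))) * g (e * u)%R)).
  { intros e He. split. intros u. apply ct_mult. apply ct_R, ct_Rmult. ct. apply ct_den. apply (continuous_comp (fun u => (e * u)%R) g). ct. apply Qg.
    intros u. rewrite Cmod_mult, Cmod_R, Rabs_pos_eq. 2:{ assert (D := den_pos u). apply Rmult_le_pos. lra. left; apply Rdiv_lt_0_compat; lra. }
    replace (2 * M / (1 + u ^ 2))%R with (2 * (1 / (1 + u ^ 2)) * M)%R by (field; generalize (den_pos u); lra). apply Rmult_le_compat_l; auto. assert (D := den_pos u). apply Rmult_le_pos. lra. left; apply Rdiv_lt_0_compat; lra. }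
  assert (E2 : LI (fun u => RtoC (2 * (1 / (1 + u ^ 2))) * g 0) = RtoC (2 * PI) * g 0).
  { destruct LI_atan as [A B]. rewrite RtoC_mult, <- B, (Cmult_comm 2), <- Cmult_assoc, (Cmult_comm (LI _)), <- (LI_scal _ _ _ A). apply LI_ext. intros u. rewrite RtoC_mult. ring. }
  rewrite <- E2. apply C_eq_small. intros d Hd.
  assert (Q0 : quad (2 * M) (fun u => RtoC (2 * (1 / (1 + u ^ 2))) * g 0)).
  { split. intros u. apply ct_mult. apply ct_R, ct_Rmult. ct. apply ct_den. apply continuous_const. intros u.
    rewrite Cmod_mult, Cmod_R, Rabs_pos_eq. 2:{ assert (D := den_pos u). apply Rmult_le_pos. lra. left; apply Rdiv_lt_0_compat; lra. }
    replace (2 * M / (1 + u ^ 2))%R with (2 * (1 / (1 + u ^ 2)) * M)%R by (field; generalize (den_pos u); lra). apply Rmult_le_compat_l; auto. assert (D := den_pos u). apply Rmult_le_pos. lra. left; apply Rdiv_lt_0_compat; lra. }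
  destruct (LI_DCT _ (fun e u => RtoC (2 * (1 / (1 + u ^ 2))) * g (e * u)%R) _ Qu Q0) with (d := (d / 2)%R) as [e1 [He1 D1]].
  { intros K b Hb. destruct (proj1 (ct_eps g 0%R) (proj1 Qg 0%R) (b / 2)%R) as [r [Hr Hg]]. lra.
    exists (r / (Rabs K + 1))%R. split. apply Rdiv_lt_0_compat; auto. generalize (Rabs_pos K); lra. intros e x He Hx.
    replace (RtoC (2 * (1 / (1 + x ^ 2))) * g (e * x)%R - RtoC (2 * (1 / (1 + x ^ 2))) * g 0) with (RtoC (2 * (1 / (1 + x ^ 2))) * (g (e * x)%R - g 0)) by ring.
    rewrite Cmod_mult, Cmod_R, Rabs_pos_eq. 2:{ assert (D := den_pos x). apply Rmult_le_pos. lra. left; apply Rdiv_lt_0_compat; lra. }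
    assert (G : (Cmod (g (e * x)%R - g 0) < b / 2)%R). { apply Hg. rewrite Rminus_0_r, Rabs_mult, (Rabs_pos_eq e) by lra.
      apply Rle_lt_trans with (e * Rabs K)%R. apply Rmult_le_compat_l. lra. unfold Rabs. destruct (Rcase_abs x), (Rcase_abs K); lra.
      apply Rlt_le_trans with (e * (Rabs K + 1))%R. apply Rmult_lt_compat_l; lra. destruct He as [_ He]. apply Rmult_lt_compat_r with (r := (Rabs K + 1)%R) in He. unfold Rdiv in He. rewrite Rmult_assoc, Rinv_l in He. lra. generalize (Rabs_pos K); lra. generalize (Rabs_pos K); lra. }
    assert (1 / (1 + x ^ 2) <= 1)%R. { apply Rmult_le_reg_r with (1 + x ^ 2)%R. apply den_pos. unfold Rdiv. rewrite Rmult_assoc, Rinv_l by (apply Rgt_not_eq, den_pos). nra. }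
    assert (0 < 1 / (1 + x ^ 2))%R by (apply Rdiv_lt_0_compat; [lra | apply den_pos]). assert (Z := Cmod_ge_0 (g (e * x)%R - g 0)). nra. }
  { lra. }
  assert (Qe : forall e, (0 < e)%R -> quad N (fun v => RtoC (exp (- e * Rabs v)) * F v)).
  { intros e He. split. intros v. apply ct_mult. apply ct_R, ct_exp, ct_Rmult. ct. apply continuous_Rabs. apply QF.
    intros v. rewrite Cmod_mult, Cmod_R, Rabs_pos_eq by (left; apply exp_pos). eapply Rle_trans; [|apply QF]. rewrite <- (Rmult_1_l (Cmod (F v))) at 2. apply Rmult_le_compat_r. apply Cmod_ge_0.
    rewrite <- exp_0. apply exp_le. generalize (Rabs_pos v); nra. }
  destruct (LI_DCT _ (fun e v => RtoC (exp (- e * Rabs v)) * F v) _ Qe QF) with (d := (d / 2)%R) as [e2 [He2 D2]].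
  { intros K b Hb. set (KK := ((Rabs K + 1) * (N + 1))%R). assert (HK : (0 < KK)%R) by (unfold KK; generalize (Rabs_pos K); nra).
    exists (b / KK)%R. split. apply Rdiv_lt_0_compat; auto. intros e v He Hv.
    replace (RtoC (exp (- e * Rabs v)) * F v - F v) with ((RtoC (exp (- e * Rabs v)) - 1) * F v) by ring.
    rewrite Cmod_mult, <- RtoC_minus, Cmod_R. assert (A := exp_ineq1_le (- e * Rabs v)). assert (Av := Rabs_pos v).
    assert (exp (- e * Rabs v) <= 1)%R. { rewrite <- exp_0. apply exp_le. nra. }
    rewrite Rabs_left1 by lra.
    assert (H0 : (Cmod (F v) <= N)%R). { eapply Rle_trans; [apply QF|]. unfold Rdiv. rewrite <- (Rmult_1_r N) at 2. apply Rmult_le_compat_l; auto. rewrite <- Rinv_1. apply Rinv_le_contravar; nra. }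
    assert (Bv : (Rabs v <= Rabs K + 1)%R). { unfold Rabs. destruct (Rcase_abs v), (Rcase_abs K); lra. }
    apply Rle_trans with (e * (Rabs K + 1) * (N + 1))%R. apply Rmult_le_compat; try lra. apply Cmod_ge_0. apply Rle_trans with (e * Rabs v)%R. lra. apply Rmult_le_compat_l; lra.
    rewrite Rmult_assoc. fold KK. destruct He as [_ He]. apply Rmult_lt_compat_r with (r := KK) in He; auto. unfold Rdiv in He. rewrite Rmult_assoc, Rinv_l in He; lra. }
  { lra. }
  set (e := (Rmin e1 e2 / 2)%R). assert (He : (0 < e < e1 /\ e < e2)%R). { assert (A := Rmin_glb_lt _ _ _ He1 He2). generalize (Rmin_l e1 e2) (Rmin_r e1 e2). unfold e; lra. }
  specialize (D1 e ltac:(lra)). specialize (D2 e ltac:(lra)). rewrite (E1 e) in D2 by lra.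
  rewrite Cmod_minus_sym in D2. replace (LI F - _) with ((LI F - LI (fun u => RtoC (2 * (1 / (1 + u ^ 2))) * g (e * u)%R)) + (LI (fun u => RtoC (2 * (1 / (1 + u ^ 2))) * g (e * u)%R) - LI (fun u => RtoC (2 * (1 / (1 + u ^ 2))) * g 0))) by ring.
  triangle. lra.
Qed.

(** * The product of two cylinder functions as a Laplace transform *)

Lemma Nc_R (X : R) : Nc X = RtoC (Nr X).
Proof.
  unfold Nc, Nr, cc. replace (- RtoC X) with (RtoC (- X)) by apply RtoC_opp. rewrite !Cexp_R, <- RtoC_plus. rewrite csq_R by apply eX_pos.
  rewrite RtoC_inv. reflexivity. apply Rgt_not_eq, sqrt_lt_R0, eX_pos.
Qed.

(** A translation in x by - ln N. *)
Lemma inner_int (N : R) (k : C) : (0 < N)%R -> (0 < Re k)%R ->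
  (exists M, quad M (fun x : R => Cexp (RtoC x - Ci * RtoC (exp (2 * x) / (2 * (N * N))) - RtoC (sqrt 2) * k * RtoC (exp x)))) /\
  LI (fun x => Cexp (RtoC x - Ci * RtoC (exp (2 * x) / (2 * (N * N))) - RtoC (sqrt 2) * k * RtoC (exp x))) = N * Mf 1 (N * k).
Proof.
  intros HN Hk. assert (Hw : (0 < Re (N * k))%R) by (rewrite re_scal_l; apply Rmult_lt_0_compat; auto).
  assert (H1 : (0 < Re 1)%R) by (simpl; lra).
  assert (Q := Mf_quad 1 (N * k) H1 Hw). assert (Qs := quad_shift _ _ (- ln N) Q).
  assert (E : forall x : R, N * Mker 1 (N * k) (x + - ln N)%R = Cexp (RtoC x - Ci * RtoC (exp (2 * x) / (2 * (N * N))) - RtoC (sqrt 2) * k * RtoC (exp x))).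
  { intros x. transitivity (Cexp (ln N) * Mker 1 (N * k) (x + - ln N)%R). rewrite Cexp_ln; auto. unfold Mker. rewrite <- !Cexp_plus. f_equal.
    replace (exp (2 * (x + - ln N)))%R with (exp (2 * x) / (N * N))%R. replace (exp (x + - ln N)) with (exp x / N)%R.
    rewrite !RtoC_mult, !RtoC_div, !RtoC_mult, RtoC_plus, RtoC_opp by nra. field. apply RtoC_nz; lra.
    rewrite exp_plus, exp_Ropp, exp_ln by auto. reflexivity.
    replace (2 * (x + - ln N))%R with (2 * x + - (ln N + ln N))%R by ring. rewrite exp_plus, exp_Ropp, exp_plus, exp_ln by auto. reflexivity. }
  split. exists (Cmod N * (MMf 1 (N * k) * (2 * (1 + (- ln N) ^ 2))))%R. apply (quad_ext _ _ _ E). apply quad_scal, Qs.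
  rewrite <- (LI_ext _ _ E), (LI_scal _ _ _ Qs), (LI_shift _ _ _ Q). reflexivity.
Qed.

Section Prod.
Variables xi eta : C.
Variable m : R.
Hypothesis Hm : (0 < m)%R.
Hypothesis H1 : (m + Rabs (Im eta) <= Re xi)%R.
Hypothesis H2 : (m + Rabs (Im xi) <= Re eta)%R.
Let re_xi : (m <= Re xi)%R. Proof. generalize (Rabs_pos (Im eta)); lra. Qed.
Let re_eta : (m <= Re eta)%R. Proof. generalize (Rabs_pos (Im xi)); lra. Qed.
Lemma Mker_le la w p : (m <= Re w)%R -> (Cmod (Mker la w p) <= exp (Re la * p - m * exp p))%R.
Proof. intros Hw. rewrite Mker_mod. apply exp_le. assert (E := exp_pos p). assert (S := sqrt2_ge1). assert (m * exp p <= sqrt 2 * Re w * exp p)%R. apply Rmult_le_compat_r. lra. nra. lra. Qed.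

Lemma Mf_prod (S : C) : (Rabs (Re S) < 1 / 2)%R -> Mf (1 / 2 - S) xi * Mf (1 / 2 + S) eta = LI (fun X : R => Cexp (S * X) * Amp xi eta X).
Proof.
  intros HS. destruct (half_pos S HS) as [Ha Hb].
  set (f := fun p q : R => Mker (1 / 2 - S) xi p * Mker (1 / 2 + S) eta q).
  assert (Hf : cont2 f). { intros q. unfold f, Mker. ct. }
  destruct (LI_diff_mid f 1 (Re (1 / 2 - S)) (Re (1 / 2 + S)) m Ha Hb Hm Hf) as [_ E].
  { intros p q. unfold f. rewrite Cmod_mult, Rmult_1_l. apply Rmult_le_compat; try apply Cmod_ge_0; apply Mker_le; auto. }
  assert (Qa := Mf_quad _ xi Ha ltac:(lra)). assert (Qb := Mf_quad _ eta Hb ltac:(lra)).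
  transitivity (LI (fun p => LI (fun q => f p q))).
  { symmetry. unfold f. rewrite (LI_ext _ (fun p => Mf (1 / 2 + S) eta * Mker (1 / 2 - S) xi p)). rewrite (LI_scal _ _ _ Qa). apply Cmult_comm.
    intros p. rewrite (LI_scal _ _ _ Qb). apply Cmult_comm. }
  rewrite E. apply LI_ext. intros X.
  assert (HX := Nr_pos X). assert (NN : (Nr X * Nr X * (exp X + exp (- X)) = 1)%R).
  { unfold Nr. assert (P := eX_pos X). assert (S0 := sqrt_lt_R0 _ P). rewrite <- (sqrt_sqrt (exp X + exp (- X))) at 3 by lra. field. lra. }
  assert (Hk : (0 < Re (kap xi eta X))%R).
  { unfold kap. replace (- (RtoC X / 2)) with (RtoC (- (X / 2))) by (rewrite RtoC_opp, RtoC_div by lra; reflexivity). replace (RtoC X / 2) with (RtoC (X / 2)) by (rewrite RtoC_div by lra; reflexivity).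
    rewrite !Cexp_R, re_plus, !re_scal_r. assert (P1 := exp_pos (- (X / 2))). assert (P2 := exp_pos (X / 2)). nra. }
  destruct (inner_int (Nr X) (kap xi eta X) HX Hk) as [[M Q] EI].
  transitivity (Cexp (S * X) * (Nr X * Mf 1 (Nr X * kap xi eta X))).
  2:{ unfold Amp, Wf. rewrite Nc_R. simpl INR. simpl Cpow. f_equal. rewrite Cmult_1_r. reflexivity. }
  rewrite <- EI, <- (LI_scal _ _ _ Q). apply LI_ext. intros x. unfold f, Mker. rewrite <- !Cexp_plus. f_equal.
  replace (exp (2 * x) / (2 * (Nr X * Nr X)))%R with (exp (2 * x) * (exp X + exp (- X)) / 2)%R.
  2:{ replace (exp (2 * x) / (2 * (Nr X * Nr X)))%R with (exp (2 * x) * (Nr X * Nr X * (exp X + exp (- X))) / (2 * (Nr X * Nr X)))%R by (rewrite NN; field; lra). field; lra. }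
  replace (2 * (x - X / 2))%R with (2 * x + - X)%R by field. replace (2 * (x + X / 2))%R with (2 * x + X)%R by field.
  replace (x - X / 2)%R with (x + - (X / 2))%R by ring. rewrite !(exp_plus x), !(exp_plus (2 * x)).
  unfold kap. replace (- (RtoC X / 2)) with (RtoC (- (X / 2))) by (rewrite RtoC_opp, RtoC_div by lra; reflexivity). replace (RtoC X / 2) with (RtoC (X / 2)) by (rewrite RtoC_div by lra; reflexivity).
  rewrite !Cexp_R. rewrite !RtoC_div, !RtoC_mult, !RtoC_plus, RtoC_opp, !RtoC_div by lra. field.
Qed.

(** What a line shift and an integration by parts need of G0 and its derivative G1. *)
Definition bd2 (G0 G1 : C -> C) := bnd (- / 2) G0 /\ bnd (- / 2) G1 /\ (forall x t : R, (Rabs t < PI / 2)%R -> cder G0 (x, t) (G1 (x, t)) /\ continuous G1 ((x, t) : C)).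
Lemma bd2_01 : bd2 (Amp xi eta) (Amp1 xi eta).
Proof.
  repeat split. apply (bnd_Amp xi eta m); auto. apply (bnd_Amp1 xi eta m); auto. apply (cder_Amp xi eta m); auto. eapply cder_cont, (cder_Amp1 xi eta m); auto.
Qed.
Lemma bd2_12 : bd2 (Amp1 xi eta) (Amp2 xi eta).
Proof.
  repeat split. apply (bnd_Amp1 xi eta m); auto. apply (bnd_Amp2 xi eta m); auto. apply (cder_Amp1 xi eta m); auto.
  assert (CW : forall n, continuous (Wf xi eta (Datatypes.S n)) ((x, t) : C)) by (intros n; eapply cder_cont, (cder_Wf xi eta m); auto).
  assert (Ck : continuous (kap xi eta) ((x, t) : C)) by (eapply cder_cont, cder_kap).
  assert (Ck1 : continuous (kap1 xi eta) ((x, t) : C)) by (eapply cder_cont, cder_kap1).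
  assert (Cc : continuous cc ((x, t) : C)) by (eapply cder_cont, cder_cc).
  assert (Cs : continuous cs ((x, t) : C)) by (eapply cder_cont, cder_cs).
  assert (W2 := CW 1%nat). assert (W3 := CW 2%nat). assert (W4 := CW 3%nat). assert (W5 := CW 4%nat). clear CW.
  unfold Amp2. ct.
Qed.
Lemma line_cont (G : C -> C) (t : R) : (forall x : R, continuous G ((x, t) : C)) -> rcont (fun x : R => G (x, t)).
Proof. intros H x. apply (continuous_comp (fun x : R => ((x, t) : C)) G); auto. apply ct_pair. apply continuous_id. apply continuous_const. Qed.
Lemma strip_le (S : C) (K : R) (g : C) (x t : R) : (0 <= K)%R -> (Rabs t < PI / 2)%R -> (Rabs (Re S) < 1 / 2)%R -> (Cmod g <= K * exp (- / 2 * Rabs x))%R ->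
  (Cmod (Cexp (S * (x, t)) * g) <= exp (- (Im S * t)) * K * exp (- (1 / 2 - Rabs (Re S)) * Rabs x))%R.
Proof.
  intros HK Ht HS B. rewrite Cmod_mult, Cmod_Cexp. replace (Re (S * (x, t))) with (Re S * x - Im S * t)%R by (unfold Re, Im; simpl; ring).
  eapply Rle_trans. apply Rmult_le_compat_l; [left; apply exp_pos | apply B]. rewrite <- Rmult_assoc, (Rmult_comm (exp _)), (Rmult_comm (exp (- (Im S * t)))), !Rmult_assoc. apply Rmult_le_compat_l; auto. rewrite <- !exp_plus. apply exp_le. generalize (Re_mul_abs S x). lra.
Qed.
Lemma line_quad (S : C) (K : R) (G : C -> C) (t : R) : (0 <= K)%R -> (Rabs t < PI / 2)%R -> (Rabs (Re S) < 1 / 2)%R -> (forall x : R, continuous G ((x, t) : C)) ->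
  (forall x : R, (Cmod (G (x, t)) <= K * exp (- / 2 * Rabs x))%R) ->
  quad (exp (- (Im S * t)) * K * Mexp (1 / 2 - Rabs (Re S))) (fun x : R => Cexp (S * (x, t)) * G (x, t)).
Proof.
  intros HK Ht HS C B. apply quad_exp. lra. intros x. apply ct_mult. apply ct_Cexp, ct_mult. apply continuous_const. apply ct_pair. apply continuous_id. apply continuous_const. apply line_cont; auto.
  intros x. apply strip_le; auto.
Qed.
Lemma strip_shift (S : C) (G0 G1 : C -> C) (t : R) : (Rabs (Re S) < 1 / 2)%R -> (Rabs t < PI / 2)%R -> bd2 G0 G1 ->
  LI (fun x : R => Cexp (S * x) * G0 x) = LI (fun x : R => Cexp (S * (x, t)) * G0 (x, t)).
Proof.
  intros HS Ht [[K [HK B0]] [B1 D]]. assert (PP := PI_RGT_0).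
  apply (LI_cauchy2 (fun z => Cexp (S * z) * G0 z) (fun z => S * Cexp (S * z) * G0 z + Cexp (S * z) * G1 z) (exp (PI / 2 * Rabs (Im S)) * K * Mexp (1 / 2 - Rabs (Re S))) (Rabs t) 0 t). rewrite Rabs_R0; apply Rabs_pos. lra.
  - intros x u Hu. destruct (D x u ltac:(lra)) as [D0 C1]. assert (C0 := cder_cont _ _ _ D0). split.
    apply (cder_mult (fun z => Cexp (S * z)) G0); auto. apply (cder_Cexp (fun z => S * z)), cder_lin.
    ct.
  - intros x u Hu. assert (Hu' : (Rabs u < PI / 2)%R) by lra. eapply Rle_trans. apply (strip_le S K); auto.
    eapply Rle_trans. apply expabs_den_scal. apply Rmult_le_pos; auto. left; apply exp_pos. lra. unfold Rdiv. apply Rmult_le_compat_r. left; apply Rinv_0_lt_compat, den_pos.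
    apply Rmult_le_compat_r. left; apply Mexp_pos; lra. apply Rmult_le_compat_r; auto. apply exp_le.
    eapply Rle_trans. apply Rle_abs. rewrite Rabs_Ropp, Rabs_mult, Rmult_comm. apply Rmult_le_compat_r. apply Rabs_pos. lra.
Qed.
Lemma strip_parts (S : C) (G0 G1 : C -> C) (t : R) : (Rabs (Re S) < 1 / 2)%R -> (Rabs t < PI / 2)%R -> bd2 G0 G1 ->
  LI (fun x : R => Cexp (S * (x, t)) * G1 (x, t)) = - S * LI (fun x : R => Cexp (S * (x, t)) * G0 (x, t)).
Proof.
  intros HS Ht [[K [HK B0]] [[K1 [HK1 B1]] D]].
  assert (Q0 := line_quad S K G0 t HK Ht HS (fun x => cder_cont _ _ _ (proj1 (D x t Ht))) (fun x => B0 x t Ht)).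
  assert (Q1 := line_quad S K1 G1 t HK1 Ht HS (fun x => proj2 (D x t Ht)) (fun x => B1 x t Ht)).
  assert (E : LI (fun x : R => S * (Cexp (S * (x, t)) * G0 (x, t)) + Cexp (S * (x, t)) * G1 (x, t)) = 0).
  { apply (LI_FTC0 _ (exp (- (Im S * t)) * K * Mexp (1 / 2 - Rabs (Re S))) (fun x : R => Cexp (S * (x, t)) * G0 (x, t)) _ (quad_plus _ _ _ _ (quad_scal _ S _ Q0) Q1)).
    2: apply Q0. intros x. apply (rder_ext (fun u : R => (fun z => Cexp (S * z) * G0 z) ((0, t)%R + u * 1))).
    { intros u. cbv beta. replace ((0, t)%R + RtoC u * 1) with ((u, t) : C) by (c_ring). reflexivity. }
    apply (rder_eq _ _ (1 * (S * Cexp (S * (x, t)) * G0 (x, t) + Cexp (S * (x, t)) * G1 (x, t)))). ring.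
    apply (cder_rder (fun z => Cexp (S * z) * G0 z)). replace ((0, t)%R + RtoC x * 1) with ((x, t) : C) by (c_ring).
    apply (cder_mult (fun z => Cexp (S * z)) G0). apply (cder_Cexp (fun z => S * z)), cder_lin. apply D; auto. }
  rewrite (LI_plus _ _ _ _ (quad_scal _ S _ Q0) Q1), (LI_scal _ _ _ Q0) in E.
  set (a := LI _) in E at 1. set (b := LI _) in E at 1. fold a. fold b. replace b with (S * a + b - S * a) by ring. rewrite E. ring.
Qed.
Definition Ah (S : C) : C := LI (fun X : R => Cexp (S * X) * Amp xi eta X).
Lemma Ah_shift S t : (Rabs (Re S) < 1 / 2)%R -> (Rabs t < PI / 2)%R -> Ah S = LI (fun x : R => Cexp (S * (x, t)) * Amp xi eta (x, t)).
Proof. intros HS Ht. exact (strip_shift S (Amp xi eta) (Amp1 xi eta) t HS Ht bd2_01). Qed.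

(** The path can be moved up to any distance d from the edge of the strip, with a constant
    independent of d. *)
Lemma limit_exp (a K tau c : R) : (0 <= a)%R -> (0 <= tau)%R -> (forall d, (0 < d < 1)%R -> (a <= K * exp (d * tau - c))%R) -> (a <= K * exp (- c))%R.
Proof.
  intros Ha Ht H. apply le_epsilon. intros e He. set (d := Rmin (1 / 2) (e / (a * tau + 1))).
  assert (Hat : (0 <= a * tau)%R) by (apply Rmult_le_pos; auto).
  assert (Hd : (0 < d <= 1 / 2)%R). { unfold d. split. apply Rmin_glb_lt. lra. apply Rdiv_lt_0_compat; lra. apply Rmin_l. }
  assert (Hd2 : (d * (a * tau) <= e)%R). { apply Rle_trans with (e / (a * tau + 1) * (a * tau))%R. apply Rmult_le_compat_r; auto. apply Rmin_r. apply Rmult_le_reg_r with (a * tau + 1)%R. lra.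
    replace (e / (a * tau + 1) * (a * tau) * (a * tau + 1))%R with (e * (a * tau))%R by (field; lra). nra. }
  specialize (H d ltac:(lra)). unfold Rminus in H. rewrite exp_plus in H.
  (* The inequality exp (- d tau) >= 1 - d tau turns the factor exp (d tau) into an error of order d. *)
  assert (G := exp_ineq1_le (- (d * tau))). assert (P := exp_pos (- (d * tau))).
  apply Rmult_le_compat_r with (r := exp (- (d * tau))) in H; [|lra].
  replace (K * (exp (d * tau) * exp (- c)) * exp (- (d * tau)))%R with (K * exp (- c) * (exp (d * tau) * exp (- (d * tau))))%R in H by ring.
  rewrite <- exp_plus, Rplus_opp_r, exp_0 in H. nra.
Qed.

(** At height t close to PI/2 on the side of Im S, the factor Cexp (S z) gains e^(-(PI/2 - d)|Im
    S|); two integrations by parts gain the factor 1 / |S|^2. *)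
Lemma Ah_bound (r : R) : (0 <= r < 1 / 2)%R -> exists K, (0 <= K)%R /\ forall S : C, (Rabs (Re S) <= r)%R -> (Cmod (Ah S) <= K * exp (- (PI / 2 * Rabs (Im S))) / (1 + Im S ^ 2))%R.
Proof.
  intros Hr. assert (PP := PI_RGT_0).
  destruct bd2_01 as [[K0 [HK0 X0]] [_ D0]]. destruct bd2_12 as [_ [[K2 [HK2 X2]] D1]].
  set (Q := (PI * Mexp (1 / 2 - r))%R). assert (HQ : (0 <= Q)%R) by (unfold Q; apply Rmult_le_pos; [lra | left; apply Mexp_pos; lra]).
  exists ((K0 + K2) * Q)%R. split. apply Rmult_le_pos; lra. intros S HS.
  assert (HS2 : (Rabs (Re S) < 1 / 2)%R) by lra.
  assert (ME : (Mexp (1 / 2 - Rabs (Re S)) <= Mexp (1 / 2 - r))%R).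
  { unfold Mexp. apply Rplus_le_compat_l. unfold Rdiv. apply Rmult_le_compat_l. lra. apply Rinv_le_contravar. nra. apply pow_incr. lra. }
  assert (DD : (0 < 1 + Im S ^ 2)%R) by apply den_pos.
  replace ((K0 + K2) * Q * exp (- (PI / 2 * Rabs (Im S))) / (1 + Im S ^ 2))%R with ((K0 + K2) * Q * / (1 + Im S ^ 2) * exp (- (PI / 2 * Rabs (Im S))))%R by (field; lra).
  apply (limit_exp (Cmod (Ah S)) _ (Rabs (Im S)) _ (Cmod_ge_0 _) (Rabs_pos _)). intros d Hd.
  set (t := if Rle_dec 0 (Im S) then (PI / 2 - d)%R else (- (PI / 2 - d))%R).
  assert (PI2 : (1 < PI / 2)%R) by (generalize PI2_1; lra).
  assert (Ht : (Rabs t < PI / 2)%R) by (unfold t; destruct Rle_dec; rewrite ?Rabs_Ropp, Rabs_pos_eq; lra).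
  assert (Et : (- (Im S * t) = d * Rabs (Im S) - PI / 2 * Rabs (Im S))%R) by (unfold t; destruct Rle_dec; [rewrite Rabs_pos_eq by lra | rewrite Rabs_left by lra]; field).
  assert (Q0 := line_quad S K0 _ t HK0 Ht HS2 (fun x => cder_cont _ _ _ (proj1 (D0 x t Ht))) (fun x => X0 x t Ht)).
  assert (Q2 := line_quad S K2 _ t HK2 Ht HS2 (fun x => proj2 (D1 x t Ht)) (fun x => X2 x t Ht)).
  apply LI_bound in Q0. rewrite <- Ah_shift in Q0 by auto. apply LI_bound in Q2.
  rewrite (strip_parts S _ _ t HS2 Ht bd2_12), (strip_parts S _ _ t HS2 Ht bd2_01), <- Ah_shift, Cmult_assoc in Q2 by auto.
  replace (- S * - S) with (S * S) in Q2 by ring. rewrite !Cmod_mult in Q2. rewrite Et in Q0, Q2.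
  set (E := exp (d * Rabs (Im S) - PI / 2 * Rabs (Im S))) in *. assert (EP : (0 < E)%R) by apply exp_pos.
  assert (V := im_le_Cmod S). assert (V2 : (Im S ^ 2 <= Cmod S * Cmod S)%R). { replace (Im S ^ 2)%R with (Rabs (Im S) * Rabs (Im S))%R. assert (W := Rabs_pos (Im S)). nra. rewrite <- Rabs_mult, Rabs_pos_eq. ring. apply Rle_0_sqr. }
  apply Rmult_le_reg_r with (1 + Im S ^ 2)%R; auto. replace ((K0 + K2) * Q * / (1 + Im S ^ 2) * E * (1 + Im S ^ 2))%R with ((K0 + K2) * Q * E)%R by (field; lra).
  assert (A := Cmod_ge_0 (Ah S)).
  apply Rle_trans with (Cmod (Ah S) + Cmod S * Cmod S * Cmod (Ah S))%R. nra.
  apply Rle_trans with (PI * (E * K0 * Mexp (1 / 2 - Rabs (Re S))) + PI * (E * K2 * Mexp (1 / 2 - Rabs (Re S))))%R. lra.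
  unfold Q. replace ((K0 + K2) * (PI * Mexp (1 / 2 - r)) * E)%R with (PI * (E * K0 * Mexp (1 / 2 - r)) + PI * (E * K2 * Mexp (1 / 2 - r)))%R by ring.
  apply Rplus_le_compat; apply Rmult_le_compat_l; try lra; apply Rmult_le_compat_l; auto; apply Rmult_le_pos; lra.
Qed.
End Prod.

(** * Logarithms, and integrals along a hyperbola *)

Lemma Carg_atan (z : C) : (0 < Re z)%R -> Carg z = atan (Im z / Re z).
Proof.
  intros Hz. assert (A := re_le_Cmod z). rewrite Rabs_pos_eq in A by lra. set (r := Cmod z) in *. assert (E2 := Cmod2_alt z). fold r in E2.
  assert (E : acos (Re z / r) = atan (Rabs (Im z) / Re z)).
  { rewrite acos_atan by (apply Rdiv_lt_0_compat; lra). f_equal. replace (1 - (Re z / r)²)%R with ((Im z / r)²)%R.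
    rewrite sqrt_Rsqr_abs, Rabs_div, (Rabs_pos_eq r) by lra. field. lra.
    unfold Rsqr. replace (Im z / r * (Im z / r))%R with (Im z ^ 2 / r ^ 2)%R by (field; lra). replace (Im z ^ 2)%R with (r ^ 2 - Re z ^ 2)%R by lra. field. lra. }
  unfold Carg. fold r. rewrite E. destruct (Rle_dec 0 (Im z)). rewrite Rabs_pos_eq by auto; reflexivity.
  rewrite Rabs_left by lra. replace (- Im z / Re z)%R with (- (Im z / Re z))%R by (field; lra). rewrite atan_opp. ring.
Qed.
Lemma re_nz (z : C) : (0 < Re z)%R -> z <> 0.
Proof. intros H E. rewrite E in H. simpl in H. lra. Qed.
Lemma Clog_im (z : C) : (0 < Re z)%R -> (Rabs (Im (Clog z)) < PI / 2)%R.
Proof. intros H. change (Im (Clog z)) with (Carg z). rewrite (Carg_atan z H). assert (A := atan_bound (Im z / Re z)). apply Rabs_def1; lra. Qed.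
Lemma ct_Clog {U : UniformSpace} (f : U -> C) x : continuous f x -> (0 < Re (f x))%R -> continuous (fun y => Clog (f y)) x.
Proof.
  intros Hf H. assert (L := loc_re_pos (f x) H). apply Hf in L. unfold filtermap in L.
  apply (continuous_ext_loc _ (fun y => ((ln (Cmod (f y)), atan (Im (f y) / Re (f y))%R) : C))).
  - revert L. apply filter_imp. intros y Hy. unfold Clog. rewrite Carg_atan; auto.
  - apply ct_pair. apply (ct_Rcomp ln). ct. apply (ex_derive_continuous (V := R_NormedModule)). exists (/ Cmod (f x))%R. apply is_derive_ln. apply Cmod_gt_0, re_nz; auto.
    apply ct_atan. apply ct_Rdiv; try ct. lra.
Qed.
Lemma Clog_Cexp (w : C) : (Rabs (Im w) < PI / 2)%R -> Clog (Cexp w) = w.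
Proof.
  intros H. apply Rabs_def2 in H. assert (P : (0 < cos (Im w))%R) by (apply cos_gt_0; lra). assert (E := exp_pos (Re w)).
  unfold Clog. rewrite Carg_atan, Cmod_Cexp, ln_exp. 2: unfold Cexp, Re at 1; simpl; apply Rmult_lt_0_compat; auto.
  replace (Im (Cexp w) / Re (Cexp w))%R with (tan (Im w)) by (unfold Cexp, tan, Re, Im; simpl; unfold Re, Im in *; field; lra).
  rewrite atan_tan by lra. destruct w; reflexivity.
Qed.

(** The logarithm inverts a function with nonzero derivative. *)
Lemma cder_Clog (z : C) : (0 < Re z)%R -> cder Clog z (/ z).
Proof.
  intros H. assert (Nz := re_nz z H). destruct (cder_Cexp0 (Clog z)) as [psi [Cp [Ep Lp]]]. rewrite Cexp_Clog in Ep by auto.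
  assert (CL : continuous Clog z) by (apply (ct_Clog (fun w => w)); auto; ct; apply continuous_id).
  assert (Cq : continuous (fun w => psi (Clog w)) z) by (apply (continuous_comp Clog psi); auto).
  exists (fun w => / psi (Clog w)). split; [|split].
  - apply ct_inv; auto. rewrite Ep; auto.
  - rewrite Ep; auto.
  - assert (N := cont_nz (fun w => psi (Clog w)) z Cq ltac:(cbv beta; rewrite Ep; auto)).
    assert (L2 := CL _ Lp). unfold filtermap in L2. assert (L3 := loc_re_pos z H). generalize (filter_and _ _ N (filter_and _ _ L2 L3)). apply filter_imp.
    intros w [A [B D]]. rewrite !Cexp_Clog in B by (auto; apply re_nz; auto). cbv beta in A, B.
    transitivity (/ psi (Clog w) * (psi (Clog w) * (Clog w - Clog z))). field; auto. f_equal. symmetry. exact B.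
Qed.

(** Both are square roots with positive real part. *)
Lemma csq_Clog (z : C) : (0 < Re z)%R -> csq z = Cexp (Clog z / 2).
Proof.
  intros H. assert (A := csq_re z H). assert (B := Clog_im z H). assert (Nz := re_nz z H).
  set (u := csq z) in *. set (v := Cexp (Clog z / 2)).
  assert (E : (u - v) * (u + v) = 0). { transitivity (u * u - v * v). ring. unfold u, v. rewrite csq_sq, <- Cexp_plus by auto. replace (Clog z / 2 + Clog z / 2) with (Clog z) by field. rewrite Cexp_Clog by auto. ring. }
  assert (Rv : (0 < Re v)%R). { change (Re v) with (exp (Re (Clog z / 2)) * cos (Im (Clog z / 2)))%R. apply Rmult_lt_0_compat. apply exp_pos. assert (PP := PI_RGT_0).
    replace (Im (Clog z / 2)) with (Im (Clog z) / 2)%R by (generalize (Clog z); intros; unfold Im, Re; simpl; field). apply Rabs_def2 in B. apply cos_gt_0; lra. }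
  assert (N : u + v <> 0). { intro G. apply (f_equal Re) in G. rewrite re_plus, re_RtoC in G. lra. }
  replace u with ((u - v) * (u + v) / (u + v) + v) by (field; auto). rewrite E. field. auto.
Qed.

(** Euler's integral along the ray arg t = Im (Clog c). *)
Lemma Ga_complex (la c : C) : (0 < Re la)%R -> (0 < Re c)%R ->
  (exists M, quad M (fun x : R => Cexp (la * x - c * RtoC (exp x)))) /\ LI (fun x : R => Cexp (la * x - c * RtoC (exp x))) = Cexp (- la * Clog c) * Ga la.
Proof.
  intros Hl Hc. assert (B := Clog_im c Hc). assert (Nc := re_nz c Hc). assert (Pc : (0 < Cmod c)%R) by (apply Cmod_gt_0; auto).
  assert (Q : quad (1 * Mdexp (Re la) (Re c)) (fun x : R => Cexp (la * x - c * RtoC (exp x)))).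
  { apply quad_dexp; auto. intros x; ct. intros x. rewrite Cmod_Cexp, Rmult_1_l. right. f_equal. unfold Re; simpl. ring. }
  split. eauto. rewrite <- (Ga_rot la (Im (Clog c)) Hl B).
  rewrite <- (LI_shift _ _ (- ln (Cmod c)) Q).
  assert (E : forall x : R, Cexp (la * (x, Im (Clog c)) - Cexp (x, Im (Clog c))) = Cexp (la * Clog c) * Cexp (la * (x + - ln (Cmod c))%R - c * RtoC (exp (x + - ln (Cmod c))%R))).
  { intros x. rewrite <- Cexp_plus. f_equal.
    replace (c * RtoC (exp (x + - ln (Cmod c))%R)) with (Cexp (x, Im (Clog c))).
    rewrite RtoC_plus, RtoC_opp. replace ((x, Im (Clog c)) : C) with (RtoC x - RtoC (ln (Cmod c)) + Clog c) by (apply C_ext; unfold Clog, Re, Im; simpl; ring). ring.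
    rewrite <- (Cexp_Clog c Nc) at 2. rewrite <- Cexp_R, <- Cexp_plus. f_equal. apply C_ext; unfold Clog, Re, Im; simpl; ring. }
  rewrite (LI_ext _ _ E). assert (Qs := quad_shift _ _ (- ln (Cmod c)) Q). cbv beta in Qs.
  rewrite (LI_scal _ _ _ Qs), Cmult_assoc, <- Cexp_plus. replace (- la * Clog c + la * Clog c) with (RtoC 0) by ring. rewrite Cexp_0. ring.
Qed.

(** For real z = y a branch of a hyperbola in C, with asymptotes along g and h. *)
Definition hyp (g h z : C) : C := g * Cexp z + h * Cexp (- z).
Lemma hyp_re (g h : C) (c y t : R) : (c <= Re (g * Cexp (Ci * t)))%R -> (c <= Re (h * Cexp (- (Ci * t))))%R -> (0 < c)%R -> (c * exp (Rabs y) <= Re (hyp g h (y, t)))%R.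
Proof.
  intros A B Hc. unfold hyp. replace ((y, t) : C) with (RtoC y + Ci * t) by (c_ring).
  replace (- (RtoC y + Ci * t)) with (RtoC (- y) + - (Ci * t)) by (rewrite RtoC_opp; ring). rewrite !Cexp_plus, !Cexp_R.
  replace (g * (RtoC (exp y) * Cexp (Ci * t)) + h * (RtoC (exp (- y)) * Cexp (- (Ci * t)))) with (RtoC (exp y) * (g * Cexp (Ci * t)) + RtoC (exp (- y)) * (h * Cexp (- (Ci * t)))) by ring.
  rewrite re_plus, !re_scal_l. assert (P1 := exp_pos y). assert (P2 := exp_pos (- y)). unfold Rabs. destruct (Rcase_abs y); nra.
Qed.
Lemma Mf1_bound (w : C) (c : R) (y : R) : (0 < c)%R -> (c * exp (Rabs y) <= Re w)%R -> (Cmod (Mf 1 w) <= / c * exp (- (1) * Rabs y))%R.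
Proof.
  intros Hc Hw. assert (E := exp_pos (Rabs y)). assert (P : (0 < c * exp (Rabs y))%R) by (apply Rmult_lt_0_compat; auto).
  eapply Rle_trans. apply (Mf_le 1); lra. rewrite Ga_1. replace (Re 1) with 1%R by reflexivity. rewrite Rmult_1_l.
  replace (- (1) * ln (Re w))%R with (- ln (Re w))%R by ring. rewrite exp_Ropp, exp_ln by lra.
  replace (- (1) * Rabs y)%R with (- Rabs y)%R by ring. rewrite exp_Ropp, <- Rinv_mult. apply Rinv_le_contravar; auto.
Qed.
Lemma cder_hyp g h z : cder (hyp g h) z (g * Cexp z - h * Cexp (- z)).
Proof.
  unfold hyp. apply (cder_eq _ _ (g * Cexp z + h * (- (1) * Cexp (- z)))). ring. apply (cder_plus (fun z => g * Cexp z) (fun z => h * Cexp (- z))). apply cder_scal, cder_Cexp0.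
  apply (cder_scal h (fun z => Cexp (- z))), (cder_Cexp (fun z => - z)), cder_opp, cder_id.
Qed.
Lemma one_re : (0 < Re 1)%R. Proof. simpl; lra. Qed.
Lemma ct_Mf {U : UniformSpace} la (f : U -> C) x : (0 < Re la)%R -> continuous f x -> (0 < Re (f x))%R -> continuous (fun y => Mf la (f y)) x.
Proof. intros. apply (continuous_comp f (Mf la)); auto. eapply cder_cont, Mf_cder; auto. Qed.
Lemma hyp_line (g h : C) (c t : R) : (c <= Re (g * Cexp (Ci * t)))%R -> (c <= Re (h * Cexp (- (Ci * t))))%R -> (0 < c)%R ->
  quad (/ c * Mexp 1) (fun y => Mf 1 (hyp g h (y, t))).
Proof.
  intros A B Hc. apply quad_exp. lra. intros y. assert (E := exp_pos (Rabs y)). apply ct_Mf. apply one_re. unfold hyp. assert (continuous (fun y : R => ((y, t) : C)) y) by (apply ct_pair; ct). ct.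
  assert (X := hyp_re g h c y t A B Hc). nra. intros y. apply Mf1_bound; auto. apply hyp_re; auto.
Qed.
Lemma hyp_shift (g h : C) (c t1 t2 : R) : (t1 <= t2)%R -> (0 < c)%R ->
  (forall t, (t1 <= t <= t2)%R -> (c <= Re (g * Cexp (Ci * t)))%R /\ (c <= Re (h * Cexp (- (Ci * t))))%R) ->
  LI (fun y => Mf 1 (hyp g h (y, t1))) = LI (fun y => Mf 1 (hyp g h (y, t2))).
Proof.
  intros Ht Hc H. apply (LI_cauchy (fun z => Mf 1 (hyp g h z)) (fun z => - RtoC (sqrt 2) * Mf (1 + 1) (hyp g h z) * (g * Cexp z - h * Cexp (- z))) (/ c * Mexp 1)); auto.
  - intros y t Hyt. destruct (H t Hyt) as [A B]. assert (X := hyp_re g h c y t A B Hc). assert (E := exp_pos (Rabs y)). assert (P : (0 < Re (hyp g h (y, t)))%R) by nra. split.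
    apply (cder_comp (Mf 1) (hyp g h)). apply Mf_cder; auto. apply one_re. apply cder_hyp.
    assert (continuous (fun z => Mf (1 + 1) (hyp g h z)) ((y, t) : C)). { apply ct_Mf; auto. rewrite re_plus; simpl; lra. eapply cder_cont, cder_hyp. } ct.
  - intros y t Hyt. destruct (H t Hyt) as [A B]. apply (hyp_line g h c t A B Hc).
Qed.

(** sin b Re (h e^(is)) = Re h sin (b - s) + Re (h e^(ib)) sin s, and sin (b - s) + sin s >= sin
    b. *)
Lemma rot_min (h : C) (b s c : R) : (Rabs b < PI / 2)%R -> (0 <= s <= b \/ b <= s <= 0)%R -> (c <= Re h)%R -> (c <= Re (h * Cexp (Ci * b)))%R -> (0 < c)%R -> (c <= Re (h * Cexp (Ci * s)))%R.
Proof.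
  assert (K : forall (h : C) (b s : R), (0 < b < PI / 2)%R -> (0 <= s <= b)%R -> (c <= Re h)%R -> (c <= Re (h * Cexp (Ci * b)))%R -> (0 < c)%R -> (c <= Re (h * Cexp (Ci * s)))%R).
  { clear. intros h b s Hb Hs A B Hc. rewrite Cexp_Ci in *. rewrite re_mult in *. unfold Re at 2, Im at 2 in B; simpl in B. unfold Re at 2, Im at 2; simpl.
    assert (Sb : (0 < sin b)%R) by (apply sin_gt_0; lra). assert (S1 : (0 <= sin s)%R) by (apply sin_ge_0; lra). assert (S2 : (0 <= sin (b - s))%R) by (apply sin_ge_0; lra).
    assert (E : ((Re h * cos s - Im h * sin s) * sin b = Re h * sin (b - s) + (Re h * cos b - Im h * sin b) * sin s)%R) by (rewrite sin_minus; ring).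
    assert (G : (sin b <= sin (b - s) + sin s)%R). { replace b with ((b - s) + s)%R at 1 by ring. rewrite sin_plus. assert (C1 := COS_bound s). assert (C2 := COS_bound (b - s)). nra. }
    apply Rmult_le_reg_r with (sin b); auto. rewrite E. nra. }
  intros Hb Hs A B Hc. apply Rabs_def2 in Hb. destruct (Req_dec b 0) as [E0|N0].
  - assert (s = 0)%R by lra. subst s. rewrite Cmult_0_r, Cexp_0, Cmult_1_r. auto.
  - destruct Hs as [Hs|Hs]. apply (K h b s); auto; lra.
    assert (X := K (Cconj h) (- b)%R (- s)%R ltac:(lra) ltac:(lra)).
    assert (EE : forall u : R, Re (Cconj h * Cexp (Ci * (- u)%R)) = Re (h * Cexp (Ci * u))). { intros u. rewrite !Cexp_Ci, cos_neg, sin_neg. unfold Re; simpl. ring. }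
    rewrite !EE in X. apply X; auto.
Qed.
Lemma hyp_quad (g h : C) : (0 < Re g)%R -> (0 < Re h)%R -> exists M, quad M (fun y : R => Mf 1 (hyp g h y)).
Proof.
  intros Hg Hh. set (c := Rmin (Re g) (Re h)). assert (Hc : (0 < c)%R) by (apply Rmin_glb_lt; auto). eexists. apply (hyp_line g h c 0%R); auto; rewrite ?Cmult_0_r, ?Copp_0, ?Cexp_0, ?Cmult_1_r. apply Rmin_l.
  apply Rmin_r.
Qed.

(** The substitution y -> y + w for complex w replaces g and h by g e^w and h e^(-w), leaving
    their product fixed. The imaginary part of w, chosen to make g e^w positive, is a change of
    the line of integration. *)
Lemma hyp_normal (g h : C) (b : R) : (0 < Re g)%R -> (0 < Re h)%R -> (0 < Re (g * h))%R -> (0 < b)%R ->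
  LI (fun y : R => Mf 1 (hyp g h y)) = LI (fun y : R => Mf 1 (hyp b (g * h / b) y)).
Proof.
  intros Hg Hh Hgh Hb. assert (Bg := Clog_im g Hg). assert (Ng := re_nz g Hg). set (be := Im (Clog g)) in *. assert (Pg : (0 < Cmod g)%R) by (apply Cmod_gt_0; auto).
  assert (Eg : g = RtoC (Cmod g) * Cexp (Ci * be)). { rewrite <- (Cexp_Clog g Ng) at 1. rewrite <- (Cexp_ln (Cmod g)) by auto. rewrite <- Cexp_plus. f_equal. unfold be. apply C_ext; unfold Clog, Re, Im; simpl; ring. }
  assert (Einv : Cexp (Ci * be) * Cexp (Ci * (- be)%R) = 1). { rewrite <- Cexp_plus, RtoC_opp. replace (Ci * be + Ci * - RtoC be) with (RtoC 0) by ring. apply Cexp_0. }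
  assert (Eg2 : g * Cexp (Ci * (- be)%R) = RtoC (Cmod g)). { rewrite Eg at 1. rewrite <- Cmult_assoc, Einv. ring. }
  assert (Eh2 : h * Cexp (- (Ci * (- be)%R)) = g * h / Cmod g).
  { replace (- (Ci * (- be)%R)) with (Ci * be) by (rewrite RtoC_opp; ring). rewrite Eg at 1. field. apply RtoC_nz; lra. }
  assert (Rh2 : (0 < Re (g * h / Cmod g))%R). { unfold Cdiv. rewrite <- RtoC_inv by lra. rewrite re_scal_r. apply Rmult_lt_0_compat; auto. apply Rinv_0_lt_compat; auto. }
  set (c := Rmin (Rmin (Re g) (Cmod g)) (Rmin (Re h) (Re (g * h / Cmod g)))).
  assert (Hc : (0 < c)%R) by (repeat apply Rmin_glb_lt; auto).
  assert (c1 : (c <= Re g)%R) by (eapply Rle_trans; [apply Rmin_l | apply Rmin_l]). assert (c2 : (c <= Cmod g)%R) by (eapply Rle_trans; [apply Rmin_l | apply Rmin_r]).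
  assert (c3 : (c <= Re h)%R) by (eapply Rle_trans; [apply Rmin_r | apply Rmin_l]). assert (c4 : (c <= Re (g * h / Cmod g))%R) by (eapply Rle_trans; [apply Rmin_r | apply Rmin_r]).
  assert (St : forall t : R, (0 <= t <= - be \/ - be <= t <= 0)%R -> (c <= Re (g * Cexp (Ci * t)))%R /\ (c <= Re (h * Cexp (- (Ci * t))))%R).
  { intros t Ht. split. apply (rot_min g (- be)); auto. rewrite Rabs_Ropp; auto. rewrite Eg2, re_RtoC; auto.
    replace (- (Ci * t)) with (Ci * (- t)%R) by (rewrite RtoC_opp; ring). apply (rot_min h be); auto. lra. replace (Ci * be) with (- (Ci * (- be)%R)) by (rewrite RtoC_opp; ring). rewrite Eh2; auto. }
  transitivity (LI (fun y : R => Mf 1 (hyp g h (y, (- be)%R)))).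
  { destruct (Rle_dec 0 (- be)). apply (hyp_shift g h c 0 (- be)); auto. symmetry. apply (hyp_shift g h c (- be) 0); auto. lra. }
  destruct (hyp_quad b (g * h / b)) as [M Q]. rewrite re_RtoC; auto. unfold Cdiv. rewrite <- RtoC_inv by lra. rewrite re_scal_r. apply Rmult_lt_0_compat; auto. apply Rinv_0_lt_compat; auto.
  (* A real translation adjusts the modulus of g. *)
  rewrite <- (LI_shift _ _ (ln (Cmod g / b)) Q). apply LI_ext. intros y. f_equal. unfold hyp.
  assert (P0 : (0 < Cmod g / b)%R) by (apply Rdiv_lt_0_compat; auto).
  replace ((y, (- be)%R) : C) with (RtoC y + Ci * (- be)%R) by (c_ring).
  replace (- (RtoC y + Ci * (- be)%R)) with (- RtoC y + - (Ci * (- be)%R)) by ring. rewrite RtoC_plus, Copp_plus_distr.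
  rewrite !Cexp_plus. rewrite (Cexp_opp (RtoC (ln _))), Cexp_ln by auto. rewrite (Cmult_comm (Cexp y)), (Cmult_comm (Cexp (- RtoC y))), !Cmult_assoc, Eg2, Eh2.
  rewrite RtoC_div by lra. field. split; apply RtoC_nz; lra.
Qed.

(** * The integral along the vertical line *)

Section Vertical.
Variables xi eta : C.
Variable m : R.
Hypothesis Hm : (0 < m)%R.
Hypothesis H1 : (m + Rabs (Im eta) <= Re xi)%R.
Hypothesis H2 : (m + Rabs (Im xi) <= Re eta)%R.

Lemma ct_Ah (rho : R) : (Rabs rho < 1 / 2)%R -> rcont (fun v : R => Ah xi eta (rho, v)).
Proof.
  intros Hr. destruct (bd2_01 xi eta m Hm H1 H2) as [[K [HK B]] [_ D]]. assert (P2 := PI2_1).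
  assert (Z : (Rabs 0 < PI / 2)%R) by (rewrite Rabs_R0; lra).
  assert (C0 : forall x : R, continuous (Amp xi eta) ((x, 0%R) : C)) by (intros x; exact (cder_cont _ _ _ (proj1 (D x 0%R Z)))).
  unfold Ah. apply (LI_cont (fun x v : R => Cexp (((rho, v) : C) * x) * Amp xi eta x) (fun _ => (K * Mexp (1 / 2 - Rabs rho))%R)).
  - intros q. apply ct_mult. apply ct_Cexp, ct_mult. apply ct_pair. apply continuous_const. ct. ct.
    apply (continuous_comp (fun q : R * R => RtoC (fst q)) (Amp xi eta)). ct. apply C0.
  - intros x v. assert (Q := line_quad ((rho, v) : C) K (Amp xi eta) 0 HK Z Hr C0 (fun x => B x 0%R Z)).
    destruct Q as [_ Q]. specialize (Q x). replace (- (Im (rho, v) * 0))%R with 0%R in Q by ring. rewrite exp_0, Rmult_1_l in Q. exact Q.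
  - intros y. exists (K * Mexp (1 / 2 - Rabs rho))%R, 1%R. split; intros; lra.
Qed.

(** The factor e^(i S th y) of [kint] grows like e^(PI/2 |Im S|) and this growth is compensated
    exactly by [Ah_bound]; after exchanging the integrals, it is absorbed in [Ah] by moving the
    line to height - th y, and the integral in v is evaluated at x = 0 by [fourier_inversion]. *)
Lemma kint_Ah (rho : R) : (Rabs rho < 1 / 2)%R ->
  (exists M, quad M (fun v : R => kint (rho, v) * Ah xi eta (rho, v))) /\
  LI (fun v : R => kint (rho, v) * Ah xi eta (rho, v)) = RtoC (2 * PI) * LI (fun y => RtoC (/ sqrt (Dn y)) * Amp xi eta (0, (- th y)%R)).
Proof.
  intros Hr. assert (P2 := PI2_1). assert (PP := PI_RGT_0). destruct (Ah_bound xi eta m Hm H1 H2 (Rabs rho)) as [K [HK BA]]. split; [apply Rabs_pos | auto].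
  destruct (bd2_01 xi eta m Hm H1 H2) as [[K0 [HK0 B0]] [_ D0]].
  assert (CA := ct_Ah rho Hr).
  set (f := fun y v : R => Cexp (Ci * (rho, v) * th y) * RtoC (/ sqrt (Dn y)) * Ah xi eta (rho, v)).
  assert (BA' : forall v : R, (Cmod (Ah xi eta (rho, v)) <= K * exp (- (PI / 2 * Rabs v)) / (1 + v ^ 2))%R). { intros v. apply (BA (rho, v)). apply Rle_refl. }
  assert (E1 : forall y v : R, (Cmod (Cexp (Ci * (rho, v) * th y)) <= exp (PI / 2 * Rabs v))%R).
  { intros y v. rewrite Cmod_Cexp. apply exp_le. replace (Re (Ci * (rho, v) * th y)) with (- (v * th y))%R by (unfold Re; simpl; ring).
    eapply Rle_trans. apply Rle_abs. rewrite Rabs_Ropp, Rabs_mult, Rmult_comm. apply Rmult_le_compat_r. apply Rabs_pos. apply th_bound. }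
  assert (Q2 : quad2 (2 * Mexp 1 * K) f).
  { split.
    - intros q. unfold f. assert (Cp : continuous (fun q : R * R => ((rho, snd q) : C)) q) by (apply ct_pair; ct). apply ct_mult. ct. apply Rgt_not_eq, sqDn_pos.
      apply (continuous_comp (fun q : R * R => snd q) (fun v : R => Ah xi eta (rho, v))). ct. apply CA.
    - intros y v. unfold f. rewrite !Cmod_mult, Cmod_R, Rabs_pos_eq by (left; apply Rinv_0_lt_compat, sqDn_pos).
      assert (I := invDn_le y). assert (X := expabs_den_scal 2 1 y ltac:(lra) ltac:(lra)). assert (I0 : (0 < / sqrt (Dn y))%R) by apply Rinv_0_lt_compat, sqDn_pos.
      replace (2 * Mexp 1 * K / (1 + y ^ 2) / (1 + v ^ 2))%R with (2 * Mexp 1 / (1 + y ^ 2) * (K / (1 + v ^ 2)))%R by (field; generalize (den_pos y) (den_pos v); lra).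
      replace (Cmod (Cexp (Ci * (rho, v) * th y)) * / sqrt (Dn y) * Cmod (Ah xi eta (rho, v)))%R with (/ sqrt (Dn y) * (Cmod (Cexp (Ci * (rho, v) * th y)) * Cmod (Ah xi eta (rho, v))))%R by ring.
      apply Rmult_le_compat. lra. apply Rmult_le_pos; apply Cmod_ge_0. lra.
      eapply Rle_trans. apply Rmult_le_compat; [apply Cmod_ge_0 | apply Cmod_ge_0 | apply E1 | apply BA']. right.
      replace (exp (- (PI / 2 * Rabs v))) with (/ exp (PI / 2 * Rabs v))%R by (rewrite exp_Ropp; reflexivity). field. split. apply Rgt_not_eq, den_pos. apply Rgt_not_eq, exp_pos. }
  assert (E2 : forall v : R, LI (fun y => f y v) = kint (rho, v) * Ah xi eta (rho, v)).
  { intros v. unfold f, kint. rewrite (Cmult_comm _ (Ah xi eta (rho, v))). rewrite <- (LI_scal _ _ _ (kint_quad (rho, v))). apply LI_ext. intros; apply Cmult_comm. }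
  assert (Qi := quad2_inner _ _ Q2). apply (quad_ext _ _ _ E2) in Qi. split. exists (PI * (2 * Mexp 1 * K))%R. exact Qi.
  rewrite <- (LI_ext _ _ E2), (LI_Fubini _ _ Q2).
  assert (E3 : forall y, LI (fun v => f y v) = RtoC (2 * PI) * (RtoC (/ sqrt (Dn y)) * Amp xi eta (0, (- th y)%R))).
  { intros y. assert (TB := th_bound_strict y). assert (TB' : (Rabs (- th y) < PI / 2)%R) by (rewrite Rabs_Ropp; auto).
    set (t := (- th y)%R) in *. set (g := fun x : R => Cexp (RtoC (rho * x)) * Amp xi eta (x, t)).
    assert (Qg : exists M, quad M g).
    { destruct (line_quad (RtoC rho) K0 (Amp xi eta) t HK0 TB' Hr (fun x => cder_cont _ _ _ (proj1 (D0 x t TB'))) (fun x => B0 x t TB')) as [CQ BQ].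
      eexists. apply (quad_ext _ (fun x : R => Cexp (- (Ci * RtoC (rho * t))) * (Cexp (RtoC rho * (x, t)) * Amp xi eta (x, t)))).
      intros x. unfold g. rewrite Cmult_assoc, <- Cexp_plus. do 2 f_equal. c_ring. apply quad_scal. split; eauto. }
    destruct Qg as [Mg Qg].
    assert (E4 : forall v : R, Cexp (Ci * (rho, v) * th y) * Ah xi eta (rho, v) = LI (fun x => Cexp (Ci * (v * x)%R) * g x)).
    { intros v. rewrite (Ah_shift xi eta m Hm H1 H2 (rho, v) t Hr TB').
      assert (Q := line_quad ((rho, v) : C) K0 (Amp xi eta) t HK0 TB' Hr (fun x => cder_cont _ _ _ (proj1 (D0 x t TB'))) (fun x => B0 x t TB')).
      rewrite <- (LI_scal _ _ _ Q). apply LI_ext. intros x. unfold g. rewrite !Cmult_assoc, <- !Cexp_plus. do 2 f_equal. unfold t. c_ring. }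
    assert (QF : quad K (fun v => LI (fun x => Cexp (Ci * (v * x)%R) * g x))).
    { apply (quad_ext _ _ _ E4). split. intros v. apply ct_mult. apply ct_Cexp, ct_mult; [apply ct_mult|]. ct. apply ct_pair; ct. ct. apply CA.
      intros v. rewrite Cmod_mult. eapply Rle_trans. apply Rmult_le_compat; [apply Cmod_ge_0 | apply Cmod_ge_0 | apply E1 | apply BA']. right.
      replace (exp (- (PI / 2 * Rabs v))) with (/ exp (PI / 2 * Rabs v))%R by (rewrite exp_Ropp; reflexivity). field. split. apply Rgt_not_eq, den_pos. apply Rgt_not_eq, exp_pos. }
    rewrite (LI_ext _ (fun v => RtoC (/ sqrt (Dn y)) * LI (fun x => Cexp (Ci * (v * x)%R) * g x))).
    2:{ intros v. rewrite <- E4. unfold f. ring. }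
    rewrite (LI_scal _ _ _ QF), (fourier_inversion _ _ g Qg QF). unfold g. rewrite Rmult_0_r, Cexp_0. ring. }
  assert (Qj := quad2_inner _ _ (quad2_swap _ _ Q2)). cbv beta in Qj.
  rewrite (LI_ext _ _ E3). apply (quad_ext _ _ _ E3) in Qj.
  assert (N : RtoC (2 * PI) <> 0) by (apply RtoC_nz; lra).
  assert (Qk := quad_scal _ (/ RtoC (2 * PI)) _ Qj). cbv beta in Qk.
  assert (E5 : forall y, / RtoC (2 * PI) * (RtoC (2 * PI) * (RtoC (/ sqrt (Dn y)) * Amp xi eta (0, (- th y)%R))) = RtoC (/ sqrt (Dn y)) * Amp xi eta (0, (- th y)%R)).
  { intros y. rewrite Cmult_assoc, Cinv_l by auto. ring. }
  apply (quad_ext _ _ _ E5) in Qk. apply (LI_scal _ _ _ Qk).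
Qed.

(** The argument of Mf 1 in [Amp] at the point - i th y, up to the factors that cancel. *)
Definition harg (y : R) : C := RtoC (/ sqrt 2) * (xi * (RtoC (cosh y) + Ci * sinh y) + eta * (RtoC (cosh y) - Ci * sinh y)).
Lemma Amp_im (y : R) : RtoC (/ sqrt (Dn y)) * Amp xi eta (0, (- th y)%R) = RtoC (/ sqrt 2) * Mf 1 (harg y).
Proof.
  assert (SD := sqDn_pos y). assert (DD := Dn_ge y). assert (S2 := sqrt2_pos).
  assert (E2 : (sqrt (Dn y) * sqrt (Dn y) = Dn y)%R) by (apply sqrt_sqrt; lra).
  set (u := (RtoC (cosh y) + Ci * sinh y) / RtoC (sqrt (Dn y))). set (u' := (RtoC (cosh y) - Ci * sinh y) / RtoC (sqrt (Dn y))).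
  assert (N : RtoC (sqrt (Dn y)) <> 0) by (apply RtoC_nz; lra).
  assert (Eu : Cexp (Ci * (th y / 2)%R) = u) by apply Cexp_th2.
  assert (Eu' : Cexp (- (Ci * (th y / 2)%R)) = u').
  { replace (- (Ci * (th y / 2)%R)) with (Cconj (Ci * (th y / 2)%R)) by (c_ring). rewrite Cexp_conj, Eu. unfold u, u'. rewrite Cdiv_conj by auto.
    f_equal. c_ring. f_equal; c_ring. }
  assert (Ec : cc (0, (- th y)%R) = RtoC (2 / Dn y)).
  { unfold cc. replace ((0, (- th y)%R) : C) with (- (Ci * (th y / 2)%R) + - (Ci * (th y / 2)%R)) by (c_field).
    replace (- (- (Ci * (th y / 2)%R) + - (Ci * (th y / 2)%R))) with (Ci * (th y / 2)%R + Ci * (th y / 2)%R) by ring. rewrite !Cexp_plus, Eu, Eu'.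
    assert (CS := cosh_sinh y). unfold u, u'.
    replace (2 / Dn y)%R with (2 * (cosh y ^ 2 - sinh y ^ 2) / (sqrt (Dn y) * sqrt (Dn y)))%R by (rewrite CS, E2; field; lra).
    rewrite RtoC_div, !RtoC_mult, RtoC_minus by nra. simpl pow. rewrite !RtoC_mult.
    transitivity ((2 * (RtoC (cosh y) * RtoC (cosh y)) + 2 * (Ci * Ci) * (RtoC (sinh y) * RtoC (sinh y))) / (RtoC (sqrt (Dn y)) * RtoC (sqrt (Dn y)))). field; auto. rewrite Ci_sq. field. auto. }
  assert (EN : Nc (0, (- th y)%R) = RtoC (sqrt (Dn y) / sqrt 2)).
  { unfold Nc. rewrite Ec, csq_R, sqrt_div by (try apply Rdiv_lt_0_compat; lra). rewrite <- RtoC_inv. f_equal. field. lra. apply Rgt_not_eq, Rdiv_lt_0_compat; lra. }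
  assert (Ek : kap xi eta (0, (- th y)%R) = xi * u + eta * u').
  { unfold kap. rewrite <- Eu, <- Eu'. f_equal; f_equal; f_equal; c_field. }
  unfold Amp, Wf. rewrite EN, Ek. simpl Cpow. simpl INR. rewrite Cmult_1_r, Cmult_assoc, <- RtoC_mult. f_equal. f_equal. field. lra.
  f_equal. unfold harg, u, u'. rewrite RtoC_div, RtoC_inv by lra. field. split; auto. apply RtoC_nz; lra.
Qed.

Definition zeta : C := (xi * xi + eta * eta) / 2.

(** The coefficients of e^y and e^(-y) in [harg]. *)
Definition hg : C := RtoC (/ (2 * sqrt 2)) * (xi * (1 + Ci) + eta * (1 - Ci)).
Definition hh : C := RtoC (/ (2 * sqrt 2)) * (xi * (1 - Ci) + eta * (1 + Ci)).
Lemma harg_hyp (y : R) : harg y = hyp hg hh y.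
Proof.
  assert (S2 := sqrt2_pos). unfold harg, hyp, hg, hh. replace (- RtoC y) with (RtoC (- y)) by apply RtoC_opp. rewrite !Cexp_R. unfold cosh, sinh.
  rewrite !RtoC_div, RtoC_plus, RtoC_minus, !RtoC_inv, RtoC_mult by lra. field. apply RtoC_nz; lra.
Qed.
Lemma zeta_re : (0 < Re zeta)%R.
Proof.
  assert (A := Rabs_pos (Im xi)). assert (B := Rabs_pos (Im eta)).
  replace (Re zeta) with ((Re xi * Re xi - Im xi * Im xi + Re eta * Re eta - Im eta * Im eta) / 2)%R by (unfold zeta, Re, Im; simpl; field).
  assert (E1 : (Im xi * Im xi = Rabs (Im xi) * Rabs (Im xi))%R) by (rewrite <- Rabs_mult, Rabs_pos_eq; auto; apply Rle_0_sqr).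
  assert (E2 : (Im eta * Im eta = Rabs (Im eta) * Rabs (Im eta))%R) by (rewrite <- Rabs_mult, Rabs_pos_eq; auto; apply Rle_0_sqr).
  rewrite E1, E2. nra.
Qed.
Lemma hyp_gh : (0 < Re hg)%R /\ (0 < Re hh)%R /\ hg * hh = zeta / 2.
Proof.
  assert (S2 := sqrt2_pos). assert (SS := sqrt2_sq). assert (P : (0 < / (2 * sqrt 2))%R) by (apply Rinv_0_lt_compat; lra).
  assert (A := Rabs_pos (Im xi)). assert (B := Rabs_pos (Im eta)). assert (A1 := Rle_abs (Im xi)). assert (B1 := Rle_abs (Im eta)). assert (A2 := Rle_abs (- Im xi)). assert (B2 := Rle_abs (- Im eta)). rewrite Rabs_Ropp in A2, B2.
  repeat split.
  - unfold hg. rewrite re_scal_l. apply Rmult_lt_0_compat; auto. replace (Re (xi * (1 + Ci) + eta * (1 - Ci))) with (Re xi - Im xi + Re eta + Im eta)%R by (unfold Re, Im; simpl; ring). lra.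
  - unfold hh. rewrite re_scal_l. apply Rmult_lt_0_compat; auto. replace (Re (xi * (1 - Ci) + eta * (1 + Ci))) with (Re xi + Im xi + Re eta - Im eta)%R by (unfold Re, Im; simpl; ring). lra.
  - unfold hg, hh, zeta.
    transitivity (RtoC (/ (2 * sqrt 2) * / (2 * sqrt 2)) * ((xi * xi + eta * eta) * (1 - Ci * Ci) + xi * eta * (2 + 2 * (Ci * Ci)))). rewrite RtoC_mult. ring.
    replace (/ (2 * sqrt 2) * / (2 * sqrt 2))%R with (/ 8)%R. rewrite Ci_sq, RtoC_inv by lra. field. replace 8%R with (2 * sqrt 2 * (2 * sqrt 2))%R by nra. field. lra.
Qed.
Definition term_minus (s : C) : C := Gamma (1 / 4 - s) * Gamma (1 / 4 + s) * (parabolic_cylinder (2 * s - 1 / 2) ((1 - Ci) * xi) * parabolic_cylinder (- 2 * s - 1 / 2) ((1 - Ci) * eta)).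
Lemma term_minus_eq (s : C) : (Rabs (Re s) < 1 / 4)%R -> term_minus s = RtoC (2 * sqrt 2 / sqrt PI) * Cexp (Ci * zeta) * Cexp (Ci * RtoC (PI / 4)) * (kint (2 * s) * Ah xi eta (2 * s)).
Proof.
  intros Hs. assert (A := Rabs_pos (Im xi)). assert (B := Rabs_pos (Im eta)).
  assert (HS : (Rabs (Re (2 * s)) < 1 / 2)%R). { rewrite re_2a, Rabs_mult, (Rabs_pos_eq 2); lra. }
  destruct (half_pos (2 * s) HS) as [P1 P2].
  assert (E1 : - (2 * s - 1 / 2) = 1 / 2 - 2 * s) by ring. assert (E2 : - (- 2 * s - 1 / 2) = 1 / 2 + 2 * s) by ring.
  assert (Hs2 := Rabs_def2 _ _ Hs).
  assert (N : forall z : C, (0 < Re z)%R -> (1 - Ci) * z <> 0).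
  { intros z Hz. apply Cmult_neq_0. intro E. apply (f_equal Im) in E. simpl in E. lra. intro E. rewrite E in Hz. simpl in Hz. lra. }
  assert (Q : forall z : C, - ((1 - Ci) * z * ((1 - Ci) * z) / 4) = Ci * (z * z / 2)). { intros z.
    transitivity (- ((1 - 2 * Ci + Ci * Ci) * (z * z) / 4)). field. rewrite Ci_sq. field. }
  unfold term_minus. rewrite (gamma_ratio s Hs), !cylinder_eq, E1, E2, !Q by (try apply N; try lra; rewrite ?E1, ?E2; unfold Re in *; simpl in *; lra).
  rewrite !mf_rot by lra. unfold Ah. rewrite <- (Mf_prod xi eta m Hm H1 H2 (2 * s) HS).
  assert (G1 := Ga_nz _ P1). assert (G2 := Ga_nz _ P2).
  replace (Cexp (Ci * zeta)) with (Cexp (Ci * (xi * xi / 2)) * Cexp (Ci * (eta * eta / 2))) by (rewrite <- Cexp_plus; f_equal; unfold zeta; field).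
  replace (Cexp (Ci * RtoC (PI / 4))) with (Cexp (Ci * RtoC (PI / 4) * (1 / 2 - 2 * s)) * Cexp (Ci * RtoC (PI / 4) * (1 / 2 + 2 * s))) by (rewrite <- Cexp_plus; f_equal; field).
  field. split; auto.
Qed.
Lemma term_minus_int (sigma : C) : (Rabs (Re sigma) < 1 / 4)%R ->
  (exists M, quad M (fun t : R => term_minus (sigma + Ci * t))) /\
  LI (fun t : R => term_minus (sigma + Ci * t)) = RtoC (2 * sqrt PI) * Cexp (Ci * zeta) * Cexp (Ci * RtoC (PI / 4)) * LI (fun y => Mf 1 (harg y)).
Proof.
  intros Hs. set (rho := (2 * Re sigma)%R). assert (Hr : (Rabs rho < 1 / 2)%R). { unfold rho. rewrite Rabs_mult, (Rabs_pos_eq 2); lra. }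
  destruct (kint_Ah rho Hr) as [[M Q] E]. assert (S2 := sqrt2_pos). assert (SS := sqrt2_sq). assert (PP := PI_RGT_0). assert (SP := sqrt_lt_R0 _ PP). assert (SPP := sqrt_sqrt PI (Rlt_le _ _ PP)).
  set (c := RtoC (2 * sqrt 2 / sqrt PI) * Cexp (Ci * zeta) * Cexp (Ci * RtoC (PI / 4))).
  set (k := fun v : R => kint (rho, v) * Ah xi eta (rho, v)) in *.
  assert (Ef : forall t : R, c * k (2 * (t + Im sigma))%R = term_minus (sigma + Ci * t)).
  { intros t. rewrite term_minus_eq. unfold c, k. replace ((rho, (2 * (t + Im sigma))%R) : C) with (2 * (sigma + Ci * t)) by (apply C_ext; unfold rho, Re, Im; simpl; ring). reflexivity.
    replace (Re (sigma + Ci * t)) with (Re sigma) by (unfold Re; simpl; ring). auto. }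
  assert (Q1 := quad_scale _ _ 2 ltac:(lra) Q). assert (Q2 := quad_shift _ _ (Im sigma) Q1). cbv beta in Q2.
  split. eexists. apply (quad_ext _ _ _ Ef). apply quad_scal. exact Q2.
  rewrite <- (LI_ext _ _ Ef), (LI_scal _ _ _ Q2), (LI_shift _ (fun x => k (2 * x)%R) _ Q1).
  replace (LI (fun x => k (2 * x)%R)) with (/ 2 * LI k). 2:{ rewrite <- (LI_scale _ _ 2 ltac:(lra) Q). field. }
  rewrite E, (LI_ext _ _ Amp_im).
  assert (QM : exists M, quad M (fun y => Mf 1 (harg y))).
  { destruct hyp_gh as [A [B _]]. destruct (hyp_quad _ _ A B) as [M2 Q3]. exists M2. apply (quad_ext _ _ _ (fun y => f_equal (Mf 1) (eq_sym (harg_hyp y))) Q3). }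
  destruct QM as [M2 QM]. rewrite (LI_scal _ _ _ QM). unfold c.
  replace (RtoC (2 * sqrt PI)) with (RtoC (2 * sqrt 2 / sqrt PI) * (/ 2 * (RtoC (2 * PI) * RtoC (/ sqrt 2)))). ring.
  rewrite <- SPP at 2. rewrite RtoC_div, !RtoC_mult, RtoC_inv by lra. field. split; apply RtoC_nz; lra.
Qed.
End Vertical.

(** * A Laplace integral in one variable *)

Lemma csq_scale (k : R) (z : C) : (0 < k)%R -> (0 < Re z)%R -> csq (k * z) = RtoC (sqrt k) * csq z.
Proof.
  intros Hk Hz. assert (Sk := sqrt_lt_R0 k Hk). assert (C0 := Cmod_ge_0 z). unfold csq. rewrite Cmod_mult, Cmod_R, (Rabs_pos_eq k), re_scal_l, im_scal_l by lra.
  replace ((k * Cmod z + k * Re z) / 2)%R with (k * ((Cmod z + Re z) / 2))%R by field.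
  set (P := ((Cmod z + Re z) / 2)%R). assert (HP : (0 < P)%R) by (unfold P; lra). rewrite sqrt_mult by lra. assert (Sp := sqrt_lt_R0 _ HP).
  generalize (Im z). intros zi. apply C_ext; unfold Re, Im; simpl. ring. replace (k * zi)%R with (sqrt k * sqrt k * zi)%R by (rewrite sqrt_sqrt; lra). field. lra.
Qed.
Definition sq1 (q : R) : C := csq (1 + Ci * RtoC (exp q)).
Definition wq (q : R) : C := RtoC (exp (q / 2)) / sq1 q.

(** The exponent c (i - 2 e^q) of the Laplace integral; the oscillation e^(ic) is kept inside,
    since then [Phi_ode] is Bessel's equation. *)
Definition ph (q : R) : C := Ci - 2 * RtoC (exp q).

(** The n-th derivative of Phi 0, where Phi 0 c = (PI/2) i e^(-i PI/4) (J_0 c + i Y_0 c), as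
    [Phi_value] and [BesselY_0] show. *)
Definition Phi (n : nat) (c : C) : C := LI (fun q => wq q * ph q ^ n * Cexp (c * ph q)).
Lemma sq1_arg (q : R) : Re (1 + Ci * RtoC (exp q)) = 1%R.
Proof. unfold Re; simpl; ring. Qed.
Lemma sq1_sq q : sq1 q * sq1 q = 1 + Ci * RtoC (exp q).
Proof. apply csq_sq. rewrite sq1_arg. lra. Qed.
Lemma sq1_re q : (0 < Re (sq1 q))%R.
Proof. apply csq_re. rewrite sq1_arg. lra. Qed.
Lemma sq1_nz q : sq1 q <> 0. Proof. apply re_nz, sq1_re. Qed.
Lemma sq1_ge q : (1 <= Cmod (sq1 q))%R.
Proof.
  assert (E := f_equal Cmod (sq1_sq q)). rewrite Cmod_mult in E. assert (A := re_le_Cmod (1 + Ci * RtoC (exp q))). rewrite sq1_arg, Rabs_R1 in A.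
  assert (C0 := Cmod_ge_0 (sq1 q)). apply Rnot_lt_le. intro G. nra.
Qed.
Lemma ct_sq1 : rcont sq1.
Proof. intros q. unfold sq1. apply ct_csq. ct. rewrite sq1_arg. lra. Qed.
Lemma ct_wq : rcont wq.
Proof. intros q. unfold wq. apply ct_div. ct. apply ct_sq1. apply sq1_nz. Qed.
Lemma wq_le q : (Cmod (wq q) <= exp (q / 2))%R.
Proof.
  unfold wq. unfold Cdiv. rewrite Cmod_mult, Cmod_R, Rabs_pos_eq, Cmod_inv by (try (left; apply exp_pos); apply sq1_nz).
  assert (A := sq1_ge q). rewrite <- (Rmult_1_r (exp (q / 2))) at 2. apply Rmult_le_compat_l. left; apply exp_pos. rewrite <- Rinv_1. apply Rinv_le_contravar; lra.
Qed.
Lemma ph_le (d q : R) : (0 < d <= 1)%R -> (Cmod (ph q) <= / d * exp (2 * d * exp q))%R.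
Proof.
  intros Hd. assert (E := exp_pos q). unfold ph. triangle. rewrite Cmod_opp, Cmod_mult, !Cmod_R, !Rabs_pos_eq, Cmod_Ci by lra.
  assert (G := exp_ineq1_le (2 * d * exp q)). assert (0 < / d)%R by (apply Rinv_0_lt_compat; lra). assert (1 <= / d)%R by (rewrite <- Rinv_1; apply Rinv_le_contravar; lra).
  apply Rle_trans with (/ d * (1 + 2 * d * exp q))%R. replace (/ d * (1 + 2 * d * exp q))%R with (/ d + 2 * exp q)%R by (field; lra). lra. apply Rmult_le_compat_l; lra.
Qed.
Lemma Phi_bound (n : nat) (c : C) : (n <= 3)%nat -> (0 < Re c)%R -> exists d K, (0 < d)%R /\ (0 <= K)%R /\
  forall q, (Cmod (wq q) * Cmod (ph q) ^ n * (Cmod (Cexp (c * ph q)) * exp (d * Cmod (ph q))) <= K * exp (/ 2 * q - Re c * exp q))%R.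
Proof.
  intros Hn Hc. set (d := Rmin 1 (Re c / 8)). assert (Hd : (0 < d <= 1)%R) by (split; [apply Rmin_glb_lt; lra | apply Rmin_l]). assert (Hd2 : (d <= Re c / 8)%R) by apply Rmin_r.
  assert (P : (0 < / d ^ 3)%R) by (apply Rinv_0_lt_compat, pow_lt; lra).
  exists d, (/ d ^ 3 * exp (Rabs (Im c) + 1))%R. split; [lra|]. split. apply Rmult_le_pos; [lra | left; apply exp_pos].
  intros q. assert (E := exp_pos q). set (e := exp (2 * d * exp q)). assert (He : (1 <= e)%R). { unfold e. rewrite <- exp_0. apply exp_le. apply Rmult_le_pos; lra. }
  assert (D1 : (1 <= / d)%R) by (rewrite <- Rinv_1; apply Rinv_le_contravar; lra).
  assert (Bp : (Cmod (ph q) ^ n <= / d ^ 3 * (e * e * e))%R).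
  { apply Rle_trans with ((/ d * e) ^ n)%R. apply pow_incr. split. apply Cmod_ge_0. apply ph_le; auto.
    replace (/ d ^ 3 * (e * e * e))%R with ((/ d * e) ^ 3)%R by (field; lra). apply Rle_pow; auto. nra. }
  assert (Ec : (Cmod (Cexp (c * ph q)) = exp (- (2 * Re c * exp q) - Im c))%R). { rewrite Cmod_Cexp. f_equal. unfold ph, Re, Im; simpl; ring. }
  assert (Ed : (exp (d * Cmod (ph q)) <= exp (1 + 2 * d * exp q))%R).
  { apply exp_le. assert (X : (Cmod (ph q) <= 1 + 2 * exp q)%R). { unfold ph. triangle. rewrite Cmod_opp, Cmod_mult, !Cmod_R, !Rabs_pos_eq, Cmod_Ci; lra. } apply Rmult_le_compat_l with (r := d) in X; lra. }
  rewrite Ec. eapply Rle_trans. apply Rmult_le_compat. apply Rmult_le_pos. apply Cmod_ge_0. apply pow_le, Cmod_ge_0. apply Rmult_le_pos; left; apply exp_pos.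
  apply Rmult_le_compat. apply Cmod_ge_0. apply pow_le, Cmod_ge_0. apply wq_le. apply Bp. apply Rmult_le_compat_l; [left; apply exp_pos | apply Ed].
  unfold e. replace (exp (q / 2) * (/ d ^ 3 * (exp (2 * d * exp q) * exp (2 * d * exp q) * exp (2 * d * exp q))) * (exp (- (2 * Re c * exp q) - Im c) * exp (1 + 2 * d * exp q)))%R with
   (/ d ^ 3 * (exp (q / 2) * (exp (2 * d * exp q) * exp (2 * d * exp q) * exp (2 * d * exp q)) * (exp (- (2 * Re c * exp q) - Im c) * exp (1 + 2 * d * exp q))))%R by ring.
  rewrite (Rmult_assoc (/ d ^ 3) (exp (Rabs (Im c) + 1))). apply Rmult_le_compat_l. lra. rewrite <- !exp_plus. apply exp_le. assert (A := Rle_abs (- Im c)). rewrite Rabs_Ropp in A. assert (8 * d * exp q <= Re c * exp q)%R. apply Rmult_le_compat_r; lra. lra.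
Qed.
Lemma ct_ph : rcont ph. Proof. intros q. unfold ph. ct. Qed.
Lemma ct_phn n : rcont (fun q => ph q ^ n).
Proof. induction n; intros q; simpl. ct. apply ct_mult. apply ct_ph. apply IHn. Qed.
Lemma Phi_quad (n : nat) (c : C) : (n <= 3)%nat -> (0 < Re c)%R -> exists M, quad M (fun q => wq q * ph q ^ n * Cexp (c * ph q)).
Proof.
  intros Hn Hc. destruct (Phi_bound n c Hn Hc) as [d [K [Hd [HK B]]]]. exists (K * Mdexp (/ 2) (Re c))%R. apply quad_dexp; auto. lra.
  intros q. apply ct_mult. apply ct_mult. apply ct_wq. apply ct_phn. apply ct_Cexp, ct_mult. ct. apply ct_ph.
  intros q. eapply Rle_trans; [|apply B]. rewrite !Cmod_mult, Cmod_pow. apply Rmult_le_compat_l. apply Rmult_le_pos. apply Cmod_ge_0. apply pow_le, Cmod_ge_0.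
  rewrite <- (Rmult_1_r (Cmod (Cexp _))) at 1. apply Rmult_le_compat_l. apply Cmod_ge_0. rewrite <- exp_0. apply exp_le. apply Rmult_le_pos. lra. apply Cmod_ge_0.
Qed.
Lemma cder_Phi (n : nat) (c : C) : (n <= 1)%nat -> (0 < Re c)%R -> cder (Phi n) c (Phi (S n) c).
Proof.
  intros Hn Hc. destruct (Phi_quad n c ltac:(lia) Hc) as [M1 Q1]. destruct (Phi_quad (S n) c ltac:(lia) Hc) as [M2 Q2].
  destruct (Phi_bound (S (S n)) c ltac:(lia) Hc) as [d [K [Hd [HK B]]]].
  assert (E : forall q, wq q * ph q ^ S n * Cexp (c * ph q) = wq q * ph q ^ n * ph q * Cexp (c * ph q)) by (intros; simpl; ring).
  unfold Phi at 2. rewrite (LI_ext _ _ E). apply (LI_cder (fun q => wq q * ph q ^ n) ph c d (K * Mdexp (/ 2) (Re c)) M1 M2); auto.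
  - intros q. apply ct_mult. apply ct_wq. apply ct_phn.
  - apply ct_ph.
  - apply (quad_ext _ _ _ E Q2).
  - intros q. apply Rle_trans with (K * exp (/ 2 * q - Re c * exp q))%R.
    + eapply Rle_trans; [|apply B]. right. rewrite Cmod_mult, Cmod_pow. simpl. ring.
    + unfold Rdiv. rewrite Rmult_assoc. apply Rmult_le_compat_l; auto. apply dexp_den; auto; lra.
Qed.
Lemma rder_sq1 q : rder sq1 q (Ci * RtoC (exp q) / (2 * sq1 q)).
Proof.
  apply (rder_eq _ _ (RtoC (exp q) * (Ci * / (2 * sq1 q)))). unfold Cdiv. ring.
  apply (rder_ext (fun t => (fun u : R => csq (1 + u * Ci)) (exp t))). intros t. unfold sq1. f_equal. ring.
  apply (rder_R_comp (fun u : R => csq (1 + u * Ci)) exp). 2: auto_derive; auto; ring.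
  apply cder_rder. unfold sq1. replace (Ci * RtoC (exp q)) with (RtoC (exp q) * Ci) by ring. apply cder_csq. replace (RtoC (exp q) * Ci) with (Ci * RtoC (exp q)) by ring. rewrite sq1_arg. lra.
Qed.

(** The integrand of the left side is the derivative of 2 i c e^(q/2) sq1 q Cexp (c ph q). *)
Lemma Phi_ode (c : C) : (0 < Re c)%R -> c * c * (Phi 2 c + Phi 0 c) + c * Phi 1 c = 0.
Proof.
  intros Hc. destruct (Phi_quad 0 c ltac:(lia) Hc) as [M0 Q0]. destruct (Phi_quad 1 c ltac:(lia) Hc) as [M1 Q1]. destruct (Phi_quad 2 c ltac:(lia) Hc) as [M2 Q2].
  destruct (LI_lin3 _ _ _ _ _ _ (c * c) (c * c) c Q2 Q0 Q1) as [[M Q] E].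
  replace (c * c * (Phi 2 c + Phi 0 c) + c * Phi 1 c) with (c * c * Phi 2 c + c * c * Phi 0 c + c * Phi 1 c) by ring. unfold Phi. rewrite <- E.
  destruct (Phi_bound 0 c ltac:(lia) Hc) as [d [K [Hd [HK B]]]].
  assert (BF : exists N, forall q, (Cmod (2 * Ci * c * (RtoC (exp (q / 2)) * sq1 q * Cexp (c * ph q))) <= N / (1 + q ^ 2))%R).
  { set (a := Re c). exists (Cmod (2 * Ci * c) * (exp (- Im c) * 2 * Mdexp (/ 2) a * (1 + / a)))%R. intros q. assert (E0 := exp_pos q). fold a in Hc.
    assert (Sb : (Cmod (sq1 q) <= 1 + exp q)%R). { assert (X := f_equal Cmod (sq1_sq q)). rewrite Cmod_mult in X. assert (Y := Cmod_triangle 1 (Ci * RtoC (exp q))). rewrite Cmod_1, Cmod_mult, Cmod_Ci, Cmod_R, Rabs_pos_eq in Y by lra. assert (Z := sq1_ge q). nra. }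
    set (B1 := (exp (- Im c) * 2 * Mdexp (/ 2) a * (1 + / a))%R). replace (Cmod (2 * Ci * c) * B1 / (1 + q ^ 2))%R with (Cmod (2 * Ci * c) * (B1 * / (1 + q ^ 2)))%R by (unfold Rdiv; ring). unfold B1.
    rewrite (Cmod_mult (2 * Ci * c)). apply Rmult_le_compat_l. apply Cmod_ge_0. rewrite !Cmod_mult, Cmod_R, Rabs_pos_eq by (left; apply exp_pos).
    replace (Cmod (Cexp (c * ph q))) with (exp (- Im c) * exp (- (2 * a * exp q)))%R by (rewrite Cmod_Cexp, <- exp_plus; f_equal; unfold ph, a, Re, Im; simpl; ring).
    assert (Ia : (0 < / a)%R) by (apply Rinv_0_lt_compat; auto).
    assert (G : (1 + exp q <= (1 + / a) * exp (a * exp q))%R). { assert (X := exp_ineq1_le (a * exp q)). assert (0 <= a * exp q)%R by (apply Rmult_le_pos; lra). assert (exp q = / a * (a * exp q))%R by (field; lra). nra. }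
    apply Rle_trans with (exp (- Im c) * (1 + / a) * exp (/ 2 * q - a * exp q))%R.
    - replace (exp (/ 2 * q - a * exp q)) with (exp (q / 2) * exp (a * exp q) * exp (- (2 * a * exp q)))%R by (rewrite <- !exp_plus; f_equal; field).
      replace (exp (q / 2) * Cmod (sq1 q) * (exp (- Im c) * exp (- (2 * a * exp q))))%R with (Cmod (sq1 q) * (exp (- Im c) * exp (q / 2) * exp (- (2 * a * exp q))))%R by ring.
      replace (exp (- Im c) * (1 + / a) * (exp (q / 2) * exp (a * exp q) * exp (- (2 * a * exp q))))%R with ((1 + / a) * exp (a * exp q) * (exp (- Im c) * exp (q / 2) * exp (- (2 * a * exp q))))%R by ring.
      apply Rmult_le_compat_r. repeat apply Rmult_le_pos; left; apply exp_pos. lra.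
    - replace (exp (- Im c) * 2 * Mdexp (/ 2) a * (1 + / a) * / (1 + q ^ 2))%R with (exp (- Im c) * (1 + / a) * (2 * Mdexp (/ 2) a * / (1 + q ^ 2)))%R by ring.
      apply Rmult_le_compat_l. apply Rmult_le_pos. left; apply exp_pos. lra. apply Rle_trans with (Mdexp (/ 2) a * / (1 + q ^ 2))%R.
      apply dexp_den; auto; lra.
      assert (0 < Mdexp (/ 2) a)%R. { unfold Mdexp. apply Rmult_lt_0_compat. apply exp_pos. apply Mexp_pos; lra. } assert (0 < / (1 + q ^ 2))%R by (apply Rinv_0_lt_compat, den_pos). nra. }
  destruct BF as [N BF].
  apply (LI_FTC0 M N (fun q => 2 * Ci * c * (RtoC (exp (q / 2)) * sq1 q * Cexp (c * ph q)))); auto.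
  intros q.
  assert (D1 : rder (fun q => RtoC (exp (q / 2))) q (RtoC (/ 2 * exp (q / 2)))) by (apply rder_R; auto_derive; auto; unfold Rdiv; ring).
  assert (D3 : rder (fun q => Cexp (c * ph q)) q (c * (0 - 2 * RtoC (exp q)) * Cexp (c * ph q))).
  { apply rder_Cexp, rder_scal. unfold ph. apply rder_minus. apply rder_const. apply rder_scal, rder_exp. }
  refine (rder_eq _ _ _ _ _ (rder_scal (2 * Ci * c) _ _ _ (rder_mult _ _ _ _ _ (rder_mult _ _ _ _ _ D1 (rder_sq1 q)) D3))).
  assert (Nz := sq1_nz q). assert (SS := sq1_sq q). unfold wq, ph. set (s := sq1 q) in *. set (E2 := RtoC (exp (q / 2))). set (Z := Cexp _).
  set (u := RtoC (exp q)) in *. rewrite RtoC_mult, RtoC_inv by lra. fold E2.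
  transitivity (Ci * c * (E2 * Z / s) * (s * s + Ci * u - 4 * c * u * (s * s))). field; auto.
  rewrite SS. simpl Cpow. transitivity (c * (E2 * Z / s) * (Ci + 2 * (Ci * Ci) * u - 4 * Ci * c * u - 4 * (Ci * Ci) * c * u * u)). ring. rewrite Ci_sq.
  transitivity (c * (E2 * Z / s) * (c * (Ci * Ci - 4 * Ci * u + 4 * u * u + 1) + Ci - 2 * u)). rewrite Ci_sq. ring. field. auto.
Qed.

(** The definition of Mf 1 makes the left side a double integral in x and y = X/2. In the
    coordinates p = x - X/2 and q = x + X/2 the integral in q is a Gamma (1/2) integral, by
    [Ga_complex], and leaves the factor (1 + i e^p)^(-1/2). *)
Lemma hyp_Phi (ze : C) : (0 < Re ze)%R ->
  LI (fun y : R => Mf 1 (hyp (RtoC (/ (2 * sqrt 2))) (ze / 2 / RtoC (/ (2 * sqrt 2))) y)) = RtoC (sqrt PI * sqrt 2 / 2) * Cexp (- Ci * ze) * Phi 0 ze.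
Proof.
  intros Hz. assert (S2 := sqrt2_pos). assert (SS := sqrt2_sq). set (b := (/ (2 * sqrt 2))%R). assert (Hb : (0 < b)%R) by (apply Rinv_0_lt_compat; lra).
  assert (Eb : (sqrt 2 * b = / 2)%R) by (unfold b; field; lra). set (h := ze / 2 / RtoC b).
  assert (Eh : RtoC (sqrt 2) * h = 2 * ze). { unfold h. transitivity (RtoC (sqrt 2 * sqrt 2) * ze). rewrite RtoC_mult. unfold b. rewrite RtoC_inv, RtoC_mult by lra. field. apply RtoC_nz; lra. rewrite SS. ring. }
  assert (Rh : (0 < Re h)%R). { replace (Re h) with (Re ze / (2 * b))%R. apply Rdiv_lt_0_compat; lra. unfold h, Cdiv. rewrite <- RtoC_inv, <- Cmult_assoc, <- !RtoC_inv, <- RtoC_mult, re_scal_r by lra. field. lra. }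
  set (f := fun p q : R => Cexp (RtoC (p / 2) - 2 * ze * RtoC (exp p)) * Cexp (RtoC (q / 2) - (1 + Ci * RtoC (exp p)) / 2 * RtoC (exp q))).
  assert (Hf : cont2 f). { intros q. unfold f. ct. }
  set (k := Rmin (2 * Re ze) (/ 2)). assert (Hk : (0 < k)%R) by (apply Rmin_glb_lt; lra). assert (k1 := Rmin_l (2 * Re ze) (/ 2)). assert (k2 := Rmin_r (2 * Re ze) (/ 2)). fold k in k1, k2.
  destruct (LI_diff_mid f 1 (/ 2) (/ 2) k ltac:(lra) ltac:(lra) Hk Hf) as [[M Q] E].
  { intros p q. unfold f. rewrite Cmod_mult, !Cmod_Cexp, Rmult_1_l. assert (Ep := exp_pos p). assert (Eq := exp_pos q). apply Rmult_le_compat; try (left; apply exp_pos); apply exp_le.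
    replace (Re (RtoC (p / 2) - 2 * ze * RtoC (exp p))) with (/ 2 * p - 2 * Re ze * exp p)%R by (unfold Re; simpl; field). assert (k * exp p <= 2 * Re ze * exp p)%R by (apply Rmult_le_compat_r; lra). lra.
    replace (Re (RtoC (q / 2) - (1 + Ci * RtoC (exp p)) / 2 * RtoC (exp q))) with (/ 2 * q - / 2 * exp q)%R by (unfold Re; simpl; field). assert (k * exp q <= / 2 * exp q)%R by (apply Rmult_le_compat_r; lra). lra. }
  assert (EX : forall X : R, LI (fun x => f (x - X / 2) (x + X / 2))%R = Mf 1 (hyp b h (X / 2)%R)).
  { intros X. unfold Mf. apply LI_ext. intros x. unfold f, Mker. rewrite <- !Cexp_plus. f_equal. unfold hyp.
    replace (- RtoC (X / 2)) with (RtoC (- (X / 2))) by apply RtoC_opp. rewrite !Cexp_R.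
    replace (x - X / 2)%R with (x + - (X / 2))%R by ring. replace (2 * x)%R with (x + - (X / 2) + (x + X / 2))%R by ring. rewrite !exp_plus.
    rewrite (RtoC_mult (sqrt 2) (exp x)).
    replace ((b * RtoC (exp (X / 2)) + h * RtoC (exp (- (X / 2)))) * - (RtoC (sqrt 2) * RtoC (exp x))) with (- (RtoC (sqrt 2) * b * RtoC (exp (X / 2)) * RtoC (exp x)) - RtoC (sqrt 2) * h * RtoC (exp (- (X / 2))) * RtoC (exp x)) by ring.
    rewrite Eh, <- (RtoC_mult (sqrt 2) b), Eb. rewrite !RtoC_div, !RtoC_plus, !RtoC_mult, RtoC_inv by lra. rewrite RtoC_opp. field. }
  rewrite (LI_ext _ _ EX) in E. apply (quad_ext _ _ _ EX) in Q.
  rewrite <- (LI_scale _ _ 2 ltac:(lra) Q) in E.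
  rewrite (LI_ext (fun x : R => Mf 1 (hyp b h (2 * x / 2)%R)) (fun y : R => Mf 1 (hyp b h y))) in E by (intros x; do 3 f_equal; field).
  assert (EI : forall p : R, LI (fun q => f p q) = RtoC (sqrt PI * sqrt 2) * Cexp (- Ci * ze) * (wq p * ph p ^ 0 * Cexp (ze * ph p))).
  { intros p. assert (Rc : Re ((1 + Ci * RtoC (exp p)) / 2) = (/ 2)%R) by (unfold Re; simpl; field). assert (Nz := sq1_nz p).
    assert (H1 : (0 < Re (1 / 2))%R) by (unfold Re; simpl; lra).
    destruct (Ga_complex (1 / 2) ((1 + Ci * RtoC (exp p)) / 2) H1 ltac:(rewrite Rc; lra)) as [[M1 Q1] E1].
    assert (Ef : forall q : R, f p q = Cexp (RtoC (p / 2) - 2 * ze * RtoC (exp p)) * Cexp (1 / 2 * q - (1 + Ci * RtoC (exp p)) / 2 * RtoC (exp q))).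
    { intros q. unfold f. do 3 f_equal. rewrite RtoC_div by lra. field. }
    etransitivity. exact (LI_ext _ _ Ef). rewrite (LI_scal _ _ _ Q1), E1, Ga_half.
    replace (- (1 / 2) * Clog ((1 + Ci * RtoC (exp p)) / 2)) with (- (Clog ((1 + Ci * RtoC (exp p)) / 2) / 2)) by field.
    rewrite Cexp_opp, <- csq_Clog by (rewrite Rc; lra).
    replace ((1 + Ci * RtoC (exp p)) / 2) with (RtoC (/ 2) * (1 + Ci * RtoC (exp p))) by (rewrite RtoC_inv by lra; field).
    rewrite csq_scale by (rewrite ?sq1_arg; lra). fold (sq1 p). rewrite sqrt_inv.
    simpl Cpow. unfold wq, ph. replace (ze * (Ci - 2 * RtoC (exp p))) with (Ci * ze + - (2 * ze * RtoC (exp p))) by ring.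
    unfold Cminus. rewrite !Cexp_plus, Cexp_R. replace (- Ci * ze) with (- (Ci * ze)) by ring. rewrite !Cexp_opp, !RtoC_mult, ?RtoC_inv by lra. field. repeat split; auto; try apply Cexp_nz. apply RtoC_nz; lra. }
  rewrite (LI_ext _ _ EI) in E. destruct (Phi_quad 0 ze ltac:(lia) Hz) as [M0 Q0]. rewrite (LI_scal _ _ _ Q0) in E. fold (Phi 0 ze) in E.
  replace (LI (fun y : R => Mf 1 (hyp b h y))) with (/ 2 * (2 * LI (fun y : R => Mf 1 (hyp b h y)))) by field. rewrite <- E. rewrite RtoC_div by lra. field.
Qed.
Section TermMinus.
Variables xi eta : C.
Variable m : R.
Hypothesis Hm : (0 < m)%R.
Hypothesis H1 : (m + Rabs (Im eta) <= Re xi)%R.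
Hypothesis H2 : (m + Rabs (Im xi) <= Re eta)%R.
Lemma term_minus_Phi (sigma : C) : (Rabs (Re sigma) < 1 / 4)%R ->
  (exists M, quad M (fun t : R => term_minus xi eta (sigma + Ci * t))) /\
  LI (fun t : R => term_minus xi eta (sigma + Ci * t)) = RtoC (PI * sqrt 2) * Cexp (Ci * RtoC (PI / 4)) * Phi 0 (zeta xi eta).
Proof.
  intros Hs. destruct (term_minus_int xi eta m Hm H1 H2 sigma Hs) as [Q E]. split; auto. rewrite E.
  assert (Z := zeta_re xi eta m Hm H1 H2). destruct (hyp_gh xi eta m Hm H1 H2) as [A [B G]]. assert (S2 := sqrt2_pos). assert (PP := PI_RGT_0).
  assert (Hb : (0 < / (2 * sqrt 2))%R) by (apply Rinv_0_lt_compat; lra).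
  assert (Rz : (0 < Re (hg xi eta * hh xi eta))%R). { rewrite G. unfold Cdiv. rewrite <- RtoC_inv, re_scal_r by lra. apply Rmult_lt_0_compat; lra. }
  rewrite (LI_ext _ _ (fun y => f_equal (Mf 1) (harg_hyp xi eta y))), (hyp_normal _ _ _ A B Rz Hb), G, (hyp_Phi _ Z).
  replace (- Ci * zeta xi eta) with (- (Ci * zeta xi eta)) by ring. rewrite Cexp_opp.
  replace (RtoC (PI * sqrt 2)) with (RtoC (2 * sqrt PI) * RtoC (sqrt PI * sqrt 2 / 2)). field. apply Cexp_nz.
  rewrite <- RtoC_mult. f_equal. rewrite <- (sqrt_sqrt PI) at 3 by lra. field.
Qed.
End TermMinus.

(** * Exponential bounds obtained by integration *)

Lemma RInt_kexp (A k a b : R) : (0 < k)%R -> RInt (fun s => A * exp (k * s))%R a b = (A / k * (exp (k * b) - exp (k * a)))%R.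
Proof.
  intros Hk. apply is_RInt_unique. replace (A / k * (exp (k * b) - exp (k * a)))%R with (minus (A / k * exp (k * b)) (A / k * exp (k * a)))%R by (unfold minus, plus, opp; simpl; ring).
  apply (is_RInt_derive (fun s => A / k * exp (k * s))%R).
  intros x _. auto_derive; auto. field. lra. intros x _. apply (ex_derive_continuous (V := R_NormedModule)). auto_derive; auto.
Qed.
Lemma exp_growth (G g : R -> C) (A k b : R) : (0 < k)%R -> (0 <= A)%R -> (forall x, rder G x (g x)) -> rcont g ->
  (forall x, (x <= b)%R -> (Cmod (g x) <= A * exp (k * x))%R) -> forall x y, (y <= x)%R -> (x <= b)%R -> (Cmod (G x - G y) <= A / k * exp (k * x))%R.
Proof.
  intros Hk HA D Cg B x y Hxy Hx. rewrite <- (ci_FTC G g y x); auto.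
  eapply Rle_trans. apply (ci_norm g (fun s => A * exp (k * s))%R); auto. intros s. apply (ex_derive_continuous (V := R_NormedModule)). auto_derive; auto. intros s Hs. apply B. lra.
  rewrite RInt_kexp by auto. assert (P := exp_pos (k * y)). assert (0 <= A / k)%R by (apply Rdiv_le_0_compat; lra). nra.
Qed.
Lemma exp_decay_m (G g : R -> C) (A k b : R) : (0 < k)%R -> (0 <= A)%R -> (forall x, rder G x (g x)) -> rcont g ->
  (forall x, (x <= b)%R -> (Cmod (g x) <= A * exp (k * x))%R) -> lim_m G 0 -> forall x, (x <= b)%R -> (Cmod (G x) <= A / k * exp (k * x))%R.
Proof.
  intros Hk HA D Cg B L x Hx. apply le_epsilon. intros e He. destruct (L e He) as [N HN].
  set (y := (Rmin x N - 1)%R). assert (Hy : (y < N /\ y <= x)%R) by (unfold y; generalize (Rmin_l x N) (Rmin_r x N); lra).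
  assert (X := exp_growth G g A k b Hk HA D Cg B x y (proj2 Hy) Hx). specialize (HN y (proj1 Hy)). replace (G y - 0) with (G y) in HN by ring.
  replace (G x) with ((G x - G y) + G y) by ring. triangle. lra.
Qed.
Lemma exp_decay_p (G g : R -> C) (A k : R) : (0 < k)%R -> (0 <= A)%R -> (forall x, rder G x (g x)) -> rcont g ->
  (forall x, (Cmod (g x) <= A * exp (- k * x))%R) -> lim_p G 0 -> forall x, (Cmod (G x) <= A / k * exp (- k * x))%R.
Proof.
  intros Hk HA D Cg B L x.
  assert (X := exp_decay_m (fun t => G (- t)%R) (fun t => - g (- t)%R) A k (- x)%R Hk HA). replace (G x) with (G (- - x)%R) by (f_equal; ring).
  replace (- k * x)%R with (k * - x)%R by ring. apply X; try lra.
  - intros t. apply rder_neg, D.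
  - intros t. apply ct_opp. apply (continuous_comp Ropp g). ct. apply Cg.
  - intros t _. rewrite Cmod_opp. replace (k * t)%R with (- k * - t)%R by ring. apply B.
  - intros e He. destruct (L e He) as [N HN]. exists (- N)%R. intros t Ht. apply HN. lra.
Qed.

(** The first derivative at x is compared with its mean over [x - h, x], which tends to 0 like 1/h
    because G is bounded; then both derivatives are integrated from minus infinity. *)
Lemma exp_decay2 (G g g2 : R -> C) (A k b : R) : (0 < k)%R -> (0 <= A)%R -> (forall x, rder G x (g x)) -> (forall x, rder g x (g2 x)) -> rcont g -> rcont g2 ->
  (forall x, (x <= b)%R -> (Cmod (g2 x) <= A * exp (k * x))%R) -> lim_m G 0 -> forall x, (x <= b)%R -> (Cmod (G x) <= A / (k * k) * exp (k * x))%R.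
Proof.
  intros Hk HA D D2 Cg Cg2 B L.
  assert (B1 : forall x, (x <= b)%R -> (Cmod (g x) <= A / k * exp (k * x))%R).
  { intros x Hx. apply le_epsilon. intros e He. destruct (L 1%R ltac:(lra)) as [N HN]. assert (G0 := Cmod_ge_0 (G x)).
    set (h := Rmax (x - N + 1) ((Cmod (G x) + 1) / e)%R). assert (h1 := Rmax_l (x - N + 1) ((Cmod (G x) + 1) / e)%R). assert (h2 := Rmax_r (x - N + 1) ((Cmod (G x) + 1) / e)%R). fold h in h1, h2.
    assert (Hh : (0 < h)%R). { assert (0 < (Cmod (G x) + 1) / e)%R by (apply Rdiv_lt_0_compat; lra). lra. }
    specialize (HN (x - h)%R ltac:(lra)). replace (G (x - h)%R - 0) with (G (x - h)%R) in HN by ring.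
    assert (I : Cmod (CInt (fun s => g s - g x) (x - h) x) <= RInt (fun _ => A / k * exp (k * x))%R (x - h) x).
    { apply ci_norm. lra. intros s; apply ct_minus; auto. apply continuous_const. intros s. apply continuous_const. intros s Hs. rewrite Cmod_minus_sym. apply (exp_growth g g2 A k b); auto. lra. }
    rewrite (ci_minus g (fun _ => g x)), (ci_FTC G g), ci_const, RInt_const in I; auto. 2: intros s; apply continuous_const.
    unfold scal in I; simpl in I; unfold mult in I; simpl in I. replace (x - (x - h))%R with h in I by ring.
    assert (T : (h * Cmod (g x) <= Cmod (G x) + 1 + h * (A / k * exp (k * x)))%R).
    { replace (h * Cmod (g x))%R with (Cmod (RtoC h * g x)) by (rewrite Cmod_mult, Cmod_R, Rabs_pos_eq; lra).
      replace (RtoC h * g x) with (G x - G (x - h)%R - (G x - G (x - h)%R - RtoC h * g x)) by ring.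
      triangle. rewrite Cmod_opp. apply Rplus_le_compat; auto. triangle. rewrite Cmod_opp. lra. }
    apply Rmult_le_reg_l with h; auto. assert (Cmod (G x) + 1 <= e * h)%R. { apply Rmult_le_compat_l with (r := e) in h2; [|lra]. replace (e * ((Cmod (G x) + 1) / e))%R with (Cmod (G x) + 1)%R in h2 by (field; lra). lra. } lra. }
  intros x Hx. replace (A / (k * k))%R with (A / k / k)%R by (field; lra). apply (exp_decay_m G g (A / k) k b); auto. apply Rdiv_le_0_compat; lra.
Qed.

(** * The antiderivative of the weight *)

(** sqrt i e^(q/2), so that sq1 q^2 - tq q^2 = 1. *)
Definition tq (q : R) : C := Cexp (q / 2, PI / 4)%R.
Definition e4 : C := Cexp (- (Ci * RtoC (PI / 4))).
Lemma tq_sq q : tq q * tq q = Ci * RtoC (exp q).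
Proof. unfold tq. rewrite <- Cexp_plus. replace ((q / 2, PI / 4)%R + (q / 2, PI / 4)%R) with (RtoC q + Ci * RtoC (PI / 2)) by (c_field). rewrite Cexp_plus, Cexp_R, Cexp_Ci, cos_PI2, sin_PI2. change ((0, 1)%R : C) with Ci. ring. Qed.
Lemma tq_e4 q : e4 * tq q = RtoC (exp (q / 2)).
Proof. unfold e4, tq. rewrite <- Cexp_plus, <- Cexp_R. f_equal. c_field. Qed.
Lemma tq_re q : (Re (tq q) = exp (q / 2) / sqrt 2)%R.
Proof. unfold tq, Cexp, Re, Im; simpl. rewrite cos_PI4. field. generalize sqrt2_pos; lra. Qed.
Lemma tq_pos q : (0 < Re (tq q))%R.
Proof. rewrite tq_re. apply Rdiv_lt_0_compat. apply exp_pos. apply sqrt2_pos. Qed.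
Lemma tq_mod q : Cmod (tq q) = exp (q / 2).
Proof. unfold tq. rewrite Cmod_Cexp. reflexivity. Qed.
Lemma rder_tq q : rder tq q (/ 2 * tq q).
Proof.
  unfold tq. apply (rder_ext (fun q => Cexp (/ 2 * RtoC q + Ci * RtoC (PI / 4)))). intros t. f_equal. c_field.
  apply (rder_eq _ _ ((/ 2 * 1 + 0) * Cexp (/ 2 * RtoC q + Ci * RtoC (PI / 4)))). replace ((q / 2, PI / 4)%R : C) with (/ 2 * RtoC q + Ci * RtoC (PI / 4)) by (c_field). ring.
  apply rder_Cexp, rder_plus. apply rder_scal, rder_id. apply rder_const.
Qed.
Lemma st_pos q : (0 < Re (sq1 q + tq q))%R.
Proof. rewrite re_plus. generalize (sq1_re q) (tq_pos q); lra. Qed.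
Lemma wq_tq q : wq q = e4 * tq q / sq1 q.
Proof. unfold wq. rewrite tq_e4. reflexivity. Qed.

(** The antiderivative of [wq] that vanishes at minus infinity; s and t being cosh and sinh of one
    argument, it is 2 e^(-i PI/4) times that argument. *)
Definition Vq (q : R) : C := 2 * e4 * Clog (sq1 q + tq q).
Lemma rder_Vq q : rder Vq q (wq q).
Proof.
  assert (P := st_pos q). assert (N := re_nz _ P). assert (Ns := sq1_nz q). unfold Vq.
  assert (D := rder_plus _ _ _ _ _ (rder_sq1 q) (rder_tq q)).
  refine (rder_eq _ _ _ _ _ (rder_scal (2 * e4) _ _ _ (rder_comp Clog (fun q => sq1 q + tq q) q _ _ (cder_Clog _ P) D))).
  rewrite wq_tq, <- tq_sq. field. auto.
Qed.
Lemma Clog_near1 e : (0 < e)%R -> exists d, (0 < d)%R /\ forall z, (Cmod (z - 1) < d)%R -> (Cmod (Clog z) < e)%R.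
Proof.
  intros He. assert (C1 : continuous Clog (RtoC 1)) by (apply (ct_Clog (fun w => w)); [ct; apply continuous_id | simpl; lra]).
  assert (L1 : Clog 1 = 0). { rewrite Clog_R, ln_1 by lra. reflexivity. }
  destruct (proj1 (ct_epsC Clog (RtoC 1)) C1 e He) as [d [Hd H]]. exists d. split; auto. intros z Hz. specialize (H z Hz). rewrite L1 in H. replace (Clog z - 0) with (Clog z) in H by ring. auto.
Qed.
Lemma Vq_lim_m : lim_m Vq 0.
Proof.
  intros e He. assert (E4 : Cmod e4 = 1%R). { unfold e4. rewrite Cmod_Cexp. replace (Re (- (Ci * RtoC (PI / 4)))) with 0%R by (unfold Re; simpl; ring). apply exp_0. }
  destruct (Clog_near1 (e / 2)) as [d [Hd H]]. lra. set (k := Rmin d 1). assert (Hk : (0 < k)%R) by (apply Rmin_glb_lt; lra). assert (k1 := Rmin_l d 1). assert (k2 := Rmin_r d 1). fold k in k1, k2.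
  exists (2 * ln (k / 3))%R. intros x Hx. replace (Vq x - 0) with (Vq x) by ring. unfold Vq. rewrite !Cmod_mult, E4, Cmod_R, Rabs_pos_eq, Rmult_1_r by lra.
  assert (X : (exp (x / 2) < k / 3)%R). { rewrite <- (exp_ln (k / 3)) by (apply Rdiv_lt_0_compat; lra). apply exp_increasing. lra. }
  assert (Y : (exp x = exp (x / 2) * exp (x / 2))%R) by (rewrite <- exp_plus; f_equal; field). assert (P := exp_pos (x / 2)).
  assert (S1 : (Cmod (sq1 x - 1) <= exp x)%R).
  { assert (N : (1 <= Cmod (sq1 x + 1))%R). { eapply Rle_trans; [|apply (re_le_Cmod (sq1 x + 1))]. rewrite Re_S. generalize (sq1_re x); intros. rewrite Rabs_pos_eq; lra. }
    assert (F : (sq1 x - 1) * (sq1 x + 1) = Ci * RtoC (exp x)). { transitivity (sq1 x * sq1 x - 1). ring. rewrite sq1_sq. ring. }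
    apply (f_equal Cmod) in F. rewrite !Cmod_mult, Cmod_Ci, Cmod_R, Rabs_pos_eq in F by (left; apply exp_pos). assert (A := Cmod_ge_0 (sq1 x - 1)). nra. }
  assert (T : (Cmod (sq1 x + tq x - 1) < d)%R). { replace (sq1 x + tq x - 1) with (sq1 x - 1 + tq x) by ring. eapply Rle_lt_trans; [apply Cmod_triangle|]. rewrite tq_mod. nra. }
  specialize (H _ T). lra.
Qed.
Lemma e4_mod : Cmod e4 = 1%R.
Proof. unfold e4. rewrite Cmod_Cexp. replace (Re (- (Ci * RtoC (PI / 4)))) with 0%R by (unfold Re; simpl; ring). apply exp_0. Qed.
Lemma Vq_le q : (Cmod (Vq q) <= 2 * exp (q / 2))%R.
Proof.
  replace (2 * exp (q / 2))%R with (1 / (/ 2) * exp (/ 2 * q))%R by (replace (/ 2 * q)%R with (q / 2)%R by field; field).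
  apply (exp_decay_m Vq wq 1 (/ 2) q); try lra. apply rder_Vq. apply ct_wq. intros x _. replace (1 * exp (/ 2 * x))%R with (exp (x / 2)) by (rewrite Rmult_1_l; f_equal; field). apply wq_le. apply Vq_lim_m.
Qed.

(** The deviation of [Vq] from its asymptote at plus infinity. *)
Definition rhoq (q : R) : C := Vq q - e4 * (RtoC q + (2 * RtoC (ln 2) + Ci * RtoC (PI / 2))).
Lemma rder_rhoq q : rder rhoq q (wq q - e4).
Proof. unfold rhoq. apply rder_minus. apply rder_Vq. apply (rder_eq _ _ (e4 * (1 + 0))). ring. apply rder_scal, rder_plus. apply rder_id. apply rder_const. Qed.
Lemma wq_e4 q : (Cmod (wq q - e4) <= 2 * exp (- (/ 2) * q))%R.
Proof.
  assert (Ns := sq1_nz q). assert (P := st_pos q). assert (N := re_nz _ P). assert (G := sq1_ge q).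
  assert (E : wq q - e4 = - (e4 / (sq1 q * (sq1 q + tq q)))).
  { rewrite wq_tq. replace (e4 * tq q / sq1 q - e4) with (- (e4 * (sq1 q * sq1 q - tq q * tq q) / (sq1 q * (sq1 q + tq q)))) by (field; auto). rewrite sq1_sq, tq_sq. f_equal. unfold Cdiv. f_equal. ring. }
  rewrite E, Cmod_opp. unfold Cdiv. rewrite Cmod_mult, e4_mod, Rmult_1_l, Cmod_inv by (apply Cmult_neq_0; auto). rewrite Cmod_mult.
  assert (T := re_le_Cmod (sq1 q + tq q)). rewrite Rabs_pos_eq in T by lra. rewrite re_plus, tq_re in T. assert (Z := sq1_re q). assert (E0 := exp_pos (q / 2)).
  assert (S2 := sqrt2_pos). assert (SS := sqrt2_sq). assert (S3 : (sqrt 2 <= 2)%R) by nra.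
  assert (W : (exp (q / 2) / 2 <= exp (q / 2) / sqrt 2)%R) by (apply Rmult_le_compat_l; [lra | apply Rinv_le_contravar; lra]).
  replace (2 * exp (- (/ 2) * q))%R with (/ (exp (q / 2) / 2))%R. apply Rinv_le_contravar. lra. nra.
  replace (- / 2 * q)%R with (- (q / 2))%R by field. rewrite exp_Ropp. field. lra.
Qed.
Lemma rhoq_lim_p : lim_p rhoq 0.
Proof.
  intros e He. destruct (Clog_near1 (Rmin (e / 2) (PI / 4))) as [d [Hd H]]. apply Rmin_glb_lt. lra. generalize PI_RGT_0; lra.
  assert (e1 := Rmin_l (e / 2) (PI / 4)). assert (e2 := Rmin_r (e / 2) (PI / 4)).
  exists (- ln (d / 2))%R. intros x Hx. assert (P := st_pos x). assert (Pt := tq_pos x). assert (Nt := re_nz _ Pt). assert (N := re_nz _ P).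
  set (z := (sq1 x + tq x) / (2 * tq x)).
  assert (Ez : z - 1 = 1 / ((sq1 x + tq x) * (2 * tq x))).
  { unfold z. transitivity ((sq1 x * sq1 x - tq x * tq x) / ((sq1 x + tq x) * (2 * tq x))). field. auto. rewrite sq1_sq, tq_sq. unfold Cdiv. f_equal. ring. }
  assert (Hz : (Cmod (z - 1) < d)%R).
  { rewrite Ez. unfold Cdiv. rewrite Cmod_mult, Cmod_1, Rmult_1_l, Cmod_inv by (repeat apply Cmult_neq_0; auto; apply RtoC_nz; lra).
    rewrite !Cmod_mult, Cmod_R, tq_mod, (Rabs_pos_eq 2) by lra. assert (T := re_le_Cmod (sq1 x + tq x)). rewrite Rabs_pos_eq in T by lra. rewrite re_plus, tq_re in T. assert (Z := sq1_re x). assert (E0 := exp_pos (x / 2)).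
    assert (S2 := sqrt2_pos). assert (SS := sqrt2_sq). assert (S3 : (sqrt 2 <= 2)%R) by nra.
    assert (W : (exp (x / 2) / 2 <= exp (x / 2) / sqrt 2)%R) by (apply Rmult_le_compat_l; [lra | apply Rinv_le_contravar; lra]).
    assert (EX : (2 / d < exp x)%R). { replace (2 / d)%R with (exp (- ln (d / 2))). apply exp_increasing; auto. rewrite exp_Ropp, exp_ln by lra. field. lra. }
    assert (Y : (exp x = exp (x / 2) * exp (x / 2))%R) by (rewrite <- exp_plus; f_equal; field).
    assert (D2 : (0 < 2 / d)%R) by (apply Rdiv_lt_0_compat; lra).
    apply Rle_lt_trans with (/ exp x)%R. apply Rinv_le_contravar. apply exp_pos. nra.
    apply Rlt_trans with (/ (2 / d))%R. apply Rinv_lt_contravar; auto. apply Rmult_lt_0_compat; auto. apply exp_pos. replace (/ (2 / d))%R with (d / 2)%R by (field; lra). lra. }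
  specialize (H z Hz).
  assert (Hz0 : z <> 0). { unfold z, Cdiv. apply Cmult_neq_0; auto. intro A. assert (B : 2 * tq x * / (2 * tq x) = 1) by (apply Cinv_r, Cmult_neq_0; auto; apply RtoC_nz; lra). rewrite A, Cmult_0_r in B. apply RtoC_inj in B. lra. }
  assert (El : Clog (sq1 x + tq x) = Clog z + (x / 2 + ln 2, PI / 4)%R).
  { transitivity (Clog (Cexp (Clog z + (x / 2 + ln 2, PI / 4)%R))).
    - f_equal. rewrite Cexp_plus, Cexp_Clog by auto. replace ((x / 2 + ln 2, PI / 4)%R : C) with (RtoC (ln 2) + (x / 2, PI / 4)%R) by (c_ring).
      rewrite Cexp_plus, Cexp_ln by lra. fold (tq x). unfold z. field. auto.
    - apply Clog_Cexp. rewrite im_plus. replace (Im (x / 2 + ln 2, PI / 4)%R) with (PI / 4)%R by reflexivity. assert (A := im_le_Cmod (Clog z)). assert (B : (Rabs (Im (Clog z)) < PI / 4)%R) by lra. apply Rabs_def2 in B. generalize PI_RGT_0; intros. apply Rabs_def1; lra. }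
  replace (rhoq x - 0) with (2 * e4 * Clog z).
  rewrite !Cmod_mult, e4_mod, Cmod_R, Rabs_pos_eq by lra. lra.
  unfold rhoq, Vq. rewrite El. replace ((x / 2 + ln 2, PI / 4)%R : C) with (RtoC x / 2 + RtoC (ln 2) + Ci * RtoC (PI / 2) / 2) by (c_field). field.
Qed.
Lemma rhoq_le q : (Cmod (rhoq q) <= 4 * exp (- (q / 2)))%R.
Proof.
  replace (4 * exp (- (q / 2)))%R with (2 / (/ 2) * exp (- (/ 2) * q))%R by (replace (- (/ 2) * q)%R with (- (q / 2))%R by field; field).
  apply (exp_decay_p rhoq (fun q => wq q - e4) 2 (/ 2)); try lra. apply rder_rhoq. intros x; apply ct_minus. apply ct_wq. apply continuous_const. apply wq_e4. apply rhoq_lim_p.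
Qed.

(** * The Laplace integral at the origin *)

Lemma cder_unique (f : C -> C) (z a b : C) : cder f z a -> cder f z b -> a = b.
Proof. intros A B. apply is_derive_cder in A, B. rewrite <- (is_C_derive_unique _ _ _ A). apply is_C_derive_unique; auto. Qed.

(** |p|^2 is absorbed by a fraction of the decay in both directions. *)
Lemma moment_bound (a p : R) : (0 < a)%R -> (Rabs p * Rabs p * exp (/ 4 * Rabs p) * exp (1 * p - a * exp p) <= 64 * (Mdexp (3 / 2) a + Mdexp (/ 2) a) / (1 + p ^ 2))%R.
Proof.
  intros Ha. assert (A := Rabs_pos p). set (y := (Rabs p / 4)%R).
  assert (S := exp_sq y ltac:(unfold y; lra)).
  assert (P2 : (Rabs p * Rabs p <= 64 * exp y)%R). { replace (Rabs p * Rabs p)%R with (16 * y ^ 2)%R by (unfold y; field). assert (0 <= y)%R by (unfold y; lra). nra. }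
  assert (E2 : (exp y * exp (/ 4 * Rabs p) <= exp (p / 2) + exp (- (p / 2)))%R).
  { rewrite <- exp_plus. replace (y + / 4 * Rabs p)%R with (Rabs p / 2)%R by (unfold y; field). assert (Z1 := exp_pos (p / 2)). assert (Z2 := exp_pos (- (p / 2))). unfold Rabs. destruct (Rcase_abs p). replace (- p / 2)%R with (- (p / 2))%R by field. lra. lra. }
  set (G := exp (1 * p - a * exp p)). assert (HG : (0 < G)%R) by apply exp_pos.
  apply Rle_trans with (64 * (exp (3 / 2 * p - a * exp p) + exp (/ 2 * p - a * exp p)))%R.
  - replace (exp (3 / 2 * p - a * exp p)) with (exp (p / 2) * G)%R by (unfold G; rewrite <- exp_plus; f_equal; field).
    replace (exp (/ 2 * p - a * exp p)) with (exp (- (p / 2)) * G)%R by (unfold G; rewrite <- exp_plus; f_equal; field).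
    apply Rle_trans with (64 * exp y * exp (/ 4 * Rabs p) * G)%R. apply Rmult_le_compat_r. lra. apply Rmult_le_compat_r. left; apply exp_pos. auto.
    replace (64 * (exp (p / 2) * G + exp (- (p / 2)) * G))%R with (64 * (exp (p / 2) + exp (- (p / 2))) * G)%R by ring. apply Rmult_le_compat_r. lra. rewrite Rmult_assoc. apply Rmult_le_compat_l; lra.
  - replace (64 * (Mdexp (3 / 2) a + Mdexp (/ 2) a) / (1 + p ^ 2))%R with (64 * (Mdexp (3 / 2) a / (1 + p ^ 2) + Mdexp (/ 2) a / (1 + p ^ 2)))%R by (field; generalize (den_pos p); lra).
    apply Rmult_le_compat_l. lra. apply Rplus_le_compat; apply dexp_den; lra.
Qed.
Lemma moment_quad (c : C) : (0 < Re c)%R -> exists M, quad M (fun x : R => RtoC x * Cexp (RtoC x - c * RtoC (exp x))).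
Proof.
  intros Hc. exists (64 * (Mdexp (3 / 2) (Re c) + Mdexp (/ 2) (Re c)) + 1 * Mdexp 1 (Re c))%R. split. intros x; ct. intros x.
  assert (B := moment_bound (Re c) x Hc). assert (A := Rabs_pos x).
  assert (Q : (exp (1 * x - Re c * exp x) <= 1 * Mdexp 1 (Re c) / (1 + x ^ 2))%R). { rewrite (Rmult_1_l (Mdexp _ _)). apply dexp_den; lra. }
  rewrite Cmod_mult, Cmod_R, Cmod_Cexp. replace (Re (RtoC x - c * RtoC (exp x))) with (1 * x - Re c * exp x)%R by (unfold Re; simpl; ring).
  set (G := exp (1 * x - Re c * exp x)) in *. assert (HG : (0 < G)%R) by apply exp_pos.
  unfold Rdiv. rewrite Rmult_plus_distr_r. fold (Rdiv (64 * (Mdexp (3 / 2) (Re c) + Mdexp (/ 2) (Re c))) (1 + x ^ 2)). fold (Rdiv (1 * Mdexp 1 (Re c)) (1 + x ^ 2)).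
  apply Rle_trans with (Rabs x * Rabs x * exp (/ 4 * Rabs x) * G + G)%R; [|lra].
  assert (1 <= exp (/ 4 * Rabs x))%R. { rewrite <- exp_0. apply exp_le. lra. }
  assert (Rabs x <= Rabs x * Rabs x * exp (/ 4 * Rabs x) + 1)%R. { assert (0 <= (Rabs x - 1) ^ 2)%R by apply pow2_ge_0. assert (Rabs x * Rabs x * 1 <= Rabs x * Rabs x * exp (/ 4 * Rabs x))%R by (apply Rmult_le_compat_l; nra). nra. }
  nra.
Qed.
Lemma cder_moment (c : C) : (0 < Re c)%R -> cder (fun la => LI (fun x : R => Cexp (la * x - c * RtoC (exp x)))) 1 (LI (fun x : R => RtoC x * Cexp (RtoC x - c * RtoC (exp x)))).
Proof.
  intros Hc. destruct (moment_quad c Hc) as [M2 Q2]. destruct (Ga_complex 1 c one_re Hc) as [[M1 Q1] _].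
  assert (E1 : forall (la : C) (x : R), Cexp (- (c * RtoC (exp x))) * Cexp (la * x) = Cexp (la * x - c * RtoC (exp x))) by (intros; rewrite <- Cexp_plus; f_equal; ring).
  assert (E2 : forall x : R, Cexp (- (c * RtoC (exp x))) * x * Cexp (1 * x) = RtoC x * Cexp (RtoC x - c * RtoC (exp x))). { intros x. rewrite (Cmult_comm _ (RtoC x)), <- Cmult_assoc, <- Cexp_plus. do 2 f_equal. ring. }
  rewrite <- (LI_ext _ _ E2). apply (cder_ext (fun la => LI (fun x : R => Cexp (- (c * RtoC (exp x))) * Cexp (la * x)))). intros w. apply LI_ext. apply E1.
  apply (LI_cder (fun x : R => Cexp (- (c * RtoC (exp x)))) (fun x : R => RtoC x) 1 (/ 4) (64 * (Mdexp (3 / 2) (Re c) + Mdexp (/ 2) (Re c))) M1 M2). lra.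
  intros x; ct. intros x; ct. apply (quad_ext _ _ _ (fun x => eq_sym (E1 1 x)) Q1). apply (quad_ext _ _ _ (fun x => eq_sym (E2 x)) Q2).
  intros p. eapply Rle_trans; [|apply moment_bound; auto]. right. rewrite Cmod_R, !Cmod_Cexp.
  replace (exp (1 * p - Re c * exp p)) with (exp (Re (- (c * RtoC (exp p)))) * exp (Re (1 * p)))%R. ring. rewrite <- exp_plus. f_equal. unfold Re; simpl; ring.
Qed.

(** The derivative of Gamma at 1, that is, minus Euler's constant. *)
Definition dGamma1 : C := LI (fun x : R => RtoC x * Cexp (RtoC x - RtoC (exp x))).
Lemma dGamma1_eq : LI (fun x : R => RtoC x * Cexp (RtoC x - 1 * RtoC (exp x))) = dGamma1.
Proof. apply LI_ext. intros x. do 3 f_equal. ring. Qed.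
Lemma cder_Ga : cder Ga 1 dGamma1.
Proof.
  rewrite <- dGamma1_eq. apply (cder_ext (fun la => LI (fun x : R => Cexp (la * x - 1 * RtoC (exp x))))). intros w. apply LI_ext. intros; f_equal; ring. apply cder_moment, one_re.
Qed.

(** Differentiation of [Ga_complex] in la at la = 1. *)
Lemma log_moment (c : C) : (0 < Re c)%R -> LI (fun x : R => RtoC x * Cexp (RtoC x - c * RtoC (exp x))) = / c * (dGamma1 - Clog c).
Proof.
  intros Hc. apply (cder_unique _ _ _ _ (cder_moment c Hc)).
  assert (D : cder (fun la => Cexp (- Clog c * la) * Ga la) 1 (- Clog c * Cexp (- Clog c * 1) * Ga 1 + Cexp (- Clog c * 1) * dGamma1)).
  { apply (cder_mult (fun la => Cexp (- Clog c * la)) Ga). apply (cder_Cexp (fun la => - Clog c * la)), cder_lin. apply cder_Ga. }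
  apply (cder_eq _ _ (- Clog c * Cexp (- Clog c * 1) * Ga 1 + Cexp (- Clog c * 1) * dGamma1)).
  replace (- Clog c * 1) with (- Clog c) by ring. rewrite Ga_1, Cexp_opp, Cexp_Clog by (apply re_nz; auto). ring.
  destruct D as [phi [A [B L]]]. exists phi. split; [|split]; auto.
  generalize (filter_and _ _ L (loc_re_pos 1 one_re)). apply filter_imp. intros w [Hw Pw].
  destruct (Ga_complex w c Pw Hc) as [_ E]. destruct (Ga_complex 1 c one_re Hc) as [_ E']. rewrite E, E'. replace (- w * Clog c) with (- Clog c * w) by ring. replace (- RtoC 1 * Clog c) with (- Clog c * 1) by ring. exact Hw.
Qed.
Lemma Clog_scale (k : R) (z : C) : (0 < k)%R -> (0 < Re z)%R -> Clog (k * z) = RtoC (ln k) + Clog z.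
Proof.
  intros Hk Hz. rewrite <- (Clog_Cexp (RtoC (ln k) + Clog z)). rewrite Cexp_plus, Cexp_ln, Cexp_Clog by (auto; apply re_nz; auto). reflexivity.
  rewrite im_plus, im_RtoC, Rplus_0_l. apply Clog_im; auto.
Qed.

(** A complex weight of total mass 1; multiplying ze by e^p translates it by - p. *)
Definition kq (ze : C) (q : R) : C := 2 * ze * Cexp (RtoC q - 2 * ze * RtoC (exp q)).
Section Asym.
Variable ze : C.
Hypothesis Hz : (0 < Re ze)%R.
Let H2z : (0 < Re (2 * ze))%R. Proof. rewrite re_2a; lra. Qed.
Let Nz : ze <> 0. Proof. apply re_nz; auto. Qed.
Lemma kq_mod q : Cmod (kq ze q) = (Cmod (2 * ze) * exp (1 * q - 2 * Re ze * exp q))%R.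
Proof. unfold kq. rewrite Cmod_mult, Cmod_Cexp. do 2 f_equal. unfold Re; simpl; ring. Qed.
Lemma kq_quad : exists M, quad M (kq ze).
Proof. eexists. apply (quad_dexp (Cmod (2 * ze)) 1 (2 * Re ze)); try lra. intros q; unfold kq; ct. intros q. rewrite kq_mod. lra. Qed.
Lemma LI_kq : LI (kq ze) = 1.
Proof.
  destruct (Ga_complex 1 (2 * ze) one_re H2z) as [[M Q] E]. transitivity (2 * ze * LI (fun x : R => Cexp (1 * x - 2 * ze * RtoC (exp x)))).
  rewrite <- (LI_scal _ _ _ Q). apply LI_ext. intros x. unfold kq. do 2 f_equal. ring.
  rewrite E, Ga_1. replace (- (1) * Clog (2 * ze)) with (- Clog (2 * ze)) by ring. rewrite Cexp_opp, Cexp_Clog by (apply re_nz; auto). field. auto.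
Qed.
Lemma LI_qkq : (exists M, quad M (fun q => RtoC q * kq ze q)) /\ LI (fun q => RtoC q * kq ze q) = dGamma1 - (RtoC (ln 2) + Clog ze).
Proof.
  destruct (moment_quad (2 * ze) H2z) as [M Q]. assert (E : forall q : R, 2 * ze * (RtoC q * Cexp (RtoC q - 2 * ze * RtoC (exp q))) = RtoC q * kq ze q) by (intros; unfold kq; ring).
  split. eexists. apply (quad_ext _ _ _ E), quad_scal, Q. rewrite <- (LI_ext _ _ E), (LI_scal _ _ _ Q), log_moment, Clog_scale by (auto; lra). field. auto.
Qed.
Lemma rho_kq (p : R) : (exists M, quad M (fun q => rhoq (q - p) * kq ze q)) /\ (Cmod (LI (fun q => rhoq (q - p) * kq ze q)%C) <= PI * (4 * Cmod (2 * ze) * exp (p / 2) * Mdexp (/ 2) (2 * Re ze)))%R.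
Proof.
  assert (Q : quad (4 * Cmod (2 * ze) * exp (p / 2) * Mdexp (/ 2) (2 * Re ze)) (fun q => rhoq (q - p) * kq ze q)).
  { apply quad_dexp; try lra. intros q. apply ct_mult. apply (continuous_comp (fun q => (q - p)%R) rhoq). ct. eapply rder_cont, rder_rhoq. unfold kq; ct.
    intros q. rewrite Cmod_mult, kq_mod. assert (R := rhoq_le (q - p)%R). assert (C0 := Cmod_ge_0 (2 * ze)). assert (E := exp_pos (1 * q - 2 * Re ze * exp q)).
    replace (4 * Cmod (2 * ze) * exp (p / 2) * exp (/ 2 * q - 2 * Re ze * exp q))%R with (4 * exp (- ((q - p) / 2)) * (Cmod (2 * ze) * exp (1 * q - 2 * Re ze * exp q)))%R.
    apply Rmult_le_compat_r; auto. apply Rmult_le_pos; lra.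
    transitivity (4 * Cmod (2 * ze) * (exp (- ((q - p) / 2)) * exp (1 * q - 2 * Re ze * exp q)))%R. ring. rewrite (Rmult_assoc (4 * Cmod (2 * ze))), <- !exp_plus. do 2 f_equal. field. }
  split. eauto. apply LI_bound; auto.
Qed.

(** Integration by parts moves the derivative from [Vq] to e^(-2 c e^q). *)
Lemma Phi_parts (c : C) : (0 < Re c)%R -> LI (fun q => wq q * Cexp (- (2 * c * RtoC (exp q)))) = LI (fun q => Vq q * kq c q).
Proof.
  clear Hz H2z Nz. intros Hc.
  assert (CV : rcont Vq) by (intros q; eapply rder_cont, rder_Vq).
  assert (Q1 : quad (1 * Mdexp (/ 2) (2 * Re c)) (fun q => wq q * Cexp (- (2 * c * RtoC (exp q))))).
  { apply quad_dexp; try lra. intros q. apply ct_mult. apply ct_wq. ct. intros q. rewrite Cmod_mult, Cmod_Cexp. replace (Re (- (2 * c * RtoC (exp q)))) with (- (2 * Re c * exp q))%R by (unfold Re; simpl; ring).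
    replace (1 * exp (/ 2 * q - 2 * Re c * exp q))%R with (exp (q / 2) * exp (- (2 * Re c * exp q)))%R by (rewrite <- exp_plus, Rmult_1_l; f_equal; field). apply Rmult_le_compat_r. left; apply exp_pos. apply wq_le. }
  assert (Q2 : quad (2 * Cmod (2 * c) * Mdexp (3 / 2) (2 * Re c)) (fun q => Vq q * kq c q)).
  { apply quad_dexp; try lra. intros q. apply ct_mult. apply CV. unfold kq; ct. intros q. unfold kq. rewrite !Cmod_mult, Cmod_Cexp, Cmod_R, (Rabs_pos_eq 2) by lra.
    replace (Re (RtoC q - 2 * c * RtoC (exp q))) with (q - 2 * Re c * exp q)%R by (unfold Re; simpl; ring). assert (V := Vq_le q). assert (C0 := Cmod_ge_0 c). assert (E := exp_pos (q - 2 * Re c * exp q)).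
    replace (2 * (2 * Cmod c) * exp (3 / 2 * q - 2 * Re c * exp q))%R with (2 * exp (q / 2) * (2 * Cmod c * exp (q - 2 * Re c * exp q)))%R.
    apply Rmult_le_compat_r; auto. apply Rmult_le_pos; lra. transitivity (2 * (2 * Cmod c) * (exp (q / 2) * exp (q - 2 * Re c * exp q)))%R. ring. rewrite <- exp_plus. do 2 f_equal. field. }
  assert (E : LI (fun q => wq q * Cexp (- (2 * c * RtoC (exp q))) - Vq q * kq c q) = 0).
  { apply (LI_FTC0 _ (2 * Mdexp (/ 2) (2 * Re c)) (fun q => Vq q * Cexp (- (2 * c * RtoC (exp q)))) _ (quad_minus _ _ _ _ Q1 Q2)).
    - intros q. assert (D : rder (fun q => Cexp (- (2 * c * RtoC (exp q)))) q (- (2 * c * RtoC (exp q)) * Cexp (- (2 * c * RtoC (exp q))))). { apply rder_Cexp, rder_opp, rder_scal, rder_exp. }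
      refine (rder_eq _ _ _ _ _ (rder_mult _ _ _ _ _ (rder_Vq q) D)). unfold kq. unfold Cminus at 2. rewrite Cexp_plus, Cexp_R. ring.
    - apply (quad_dexp 2 (/ 2) (2 * Re c)); try lra. intros q. apply ct_mult. apply CV. ct. intros q. rewrite Cmod_mult, Cmod_Cexp. replace (Re (- (2 * c * RtoC (exp q)))) with (- (2 * Re c * exp q))%R by (unfold Re; simpl; ring).
      replace (2 * exp (/ 2 * q - 2 * Re c * exp q))%R with (2 * exp (q / 2) * exp (- (2 * Re c * exp q)))%R by (rewrite Rmult_assoc, <- exp_plus; do 2 f_equal; field). apply Rmult_le_compat_r. left; apply exp_pos. apply Vq_le. }
  rewrite (LI_minus _ _ _ _ Q1 Q2) in E. rewrite <- (Cplus_0_r (LI (fun q => Vq q * kq c q))), <- E. ring.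
Qed.

(** The constant term of the asymptote of Phi 0 at the origin, up to the factor [e4]. *)
Definition b0 : C := Ci * RtoC (PI / 2) - (Clog ze - RtoC (ln 2)) + dGamma1.

(** After the translation q -> q - p the density is fixed and Vq (q - p) is replaced by its
    asymptote e4 (q - p + ...), whose mean is computed by [LI_kq] and [LI_qkq]; the deviation
    costs e^(p/2) by [rho_kq]. *)
Lemma J_asym (p : R) : (Cmod (LI (fun q => wq q * Cexp (- (2 * (RtoC (exp p) * ze) * RtoC (exp q))))%C - e4 * (b0 - RtoC p)) <= PI * (4 * Cmod (2 * ze) * exp (p / 2) * Mdexp (/ 2) (2 * Re ze)))%R.
Proof.
  assert (Ep := exp_pos p). assert (Hc : (0 < Re (RtoC (exp p) * ze))%R) by (rewrite re_scal_l; apply Rmult_lt_0_compat; auto).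
  rewrite Phi_parts by auto. set (c := RtoC (exp p) * ze) in *.
  assert (Q : exists M, quad M (fun q => Vq q * kq c q)).
  { eexists. apply (quad_dexp (2 * Cmod (2 * c)) (3 / 2) (2 * Re c)); try lra. intros q. apply ct_mult. eapply rder_cont, rder_Vq. unfold kq; ct. intros q. unfold kq. rewrite !Cmod_mult, Cmod_Cexp, Cmod_R, (Rabs_pos_eq 2) by lra.
    replace (Re (RtoC q - 2 * c * RtoC (exp q))) with (q - 2 * Re c * exp q)%R by (unfold Re; simpl; ring). assert (V := Vq_le q). assert (C0 := Cmod_ge_0 c). assert (E := exp_pos (q - 2 * Re c * exp q)).
    replace (2 * (2 * Cmod c) * exp (3 / 2 * q - 2 * Re c * exp q))%R with (2 * exp (q / 2) * (2 * Cmod c * exp (q - 2 * Re c * exp q)))%R.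
    apply Rmult_le_compat_r; auto. apply Rmult_le_pos; lra. transitivity (2 * (2 * Cmod c) * (exp (q / 2) * exp (q - 2 * Re c * exp q)))%R. ring. rewrite <- exp_plus. do 2 f_equal. field. }
  destruct Q as [M Q]. rewrite <- (LI_shift _ _ (- p) Q).
  destruct (rho_kq p) as [[M1 Q1] B1]. destruct kq_quad as [M2 Q2]. destruct LI_qkq as [[M3 Q3] E3].
  set (ka := - RtoC p + (2 * RtoC (ln 2) + Ci * RtoC (PI / 2))).
  destruct (LI_lin3 _ _ _ _ _ _ e4 (e4 * ka) 1 Q3 Q2 Q1) as [_ E].
  rewrite (LI_ext _ (fun q => e4 * (RtoC q * kq ze q) + e4 * ka * kq ze q + 1 * (rhoq (q - p) * kq ze q))).
  2:{ intros q. replace (kq c (q + - p)%R) with (kq ze q). replace (q + - p)%R with (q - p)%R by ring. unfold rhoq, ka. rewrite RtoC_minus. ring.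
      unfold kq, c. rewrite exp_plus, RtoC_mult. replace (RtoC (q + - p)) with (RtoC q + - RtoC p) by (rewrite RtoC_plus, RtoC_opp; reflexivity).
      assert (X : RtoC (exp p) * RtoC (exp (- p)) = 1). { rewrite <- RtoC_mult, <- exp_plus, Rplus_opp_r, exp_0. reflexivity. }
      replace (2 * (RtoC (exp p) * ze) * (RtoC (exp q) * RtoC (exp (- p)))) with (2 * ze * RtoC (exp q) * (RtoC (exp p) * RtoC (exp (- p)))) by ring. rewrite X.
      replace (RtoC q + - RtoC p - 2 * ze * RtoC (exp q) * 1) with (- RtoC p + (RtoC q - 2 * ze * RtoC (exp q))) by ring. rewrite (Cexp_plus (- RtoC p)). rewrite <- RtoC_opp, Cexp_R.
      transitivity (2 * ze * (RtoC (exp p) * RtoC (exp (- p))) * Cexp (RtoC q - 2 * ze * RtoC (exp q))). rewrite X. ring. ring. }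
  rewrite E, E3, LI_kq.
  replace (_ - _) with (LI (fun q => rhoq (q - p) * kq ze q)). auto. unfold b0, ka. ring.
Qed.
Lemma Phi_asym : exists K, (0 <= K)%R /\ forall p, (p <= 0)%R -> (Cmod (Phi 0 (RtoC (exp p) * ze) - e4 * (b0 - RtoC p)) <= K * exp (/ 2 * p))%R.
Proof.
  set (K1 := (PI * (4 * Cmod (2 * ze) * Mdexp (/ 2) (2 * Re ze)))%R). assert (HM : (0 < Mdexp (/ 2) (2 * Re ze))%R) by (unfold Mdexp; apply Rmult_lt_0_compat; [apply exp_pos | apply Mexp_pos; lra]).
  assert (PP := PI_RGT_0). assert (Z2 := Cmod_ge_0 (2 * ze)). assert (Z1 := Cmod_ge_0 ze). assert (Hb := Cmod_ge_0 b0). assert (HK1 : (0 <= K1)%R) by (unfold K1; apply Rmult_le_pos; [lra|]; apply Rmult_le_pos; lra).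
  set (K2 := (Cmod ze * exp (Cmod ze))%R). assert (HK2 : (0 <= K2)%R) by (unfold K2; apply Rmult_le_pos; auto; left; apply exp_pos).
  exists (K2 * (Cmod b0 + 2 + K1) + K1)%R. split. apply Rplus_le_le_0_compat; auto. apply Rmult_le_pos; lra.
  intros p Hp. set (J := LI (fun q => wq q * Cexp (- (2 * (RtoC (exp p) * ze) * RtoC (exp q))))).
  assert (BJ := J_asym p). fold J in BJ. set (A := e4 * (b0 - RtoC p)) in *. set (x := exp (p / 2)). assert (Hx : (0 < x <= 1)%R). { unfold x. split. apply exp_pos. rewrite <- exp_0. apply exp_le. lra. }
  replace (PI * (4 * Cmod (2 * ze) * exp (p / 2) * Mdexp (/ 2) (2 * Re ze)))%R with (K1 * x)%R in BJ by (unfold K1, x; ring).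
  replace (exp (/ 2 * p)) with x by (unfold x; f_equal; field). assert (Ex : (exp p = x * x)%R) by (unfold x; rewrite <- exp_plus; f_equal; field).
  set (c := RtoC (exp p) * ze) in *.
  assert (EP : Phi 0 c = Cexp (Ci * c) * J).
  { unfold J. assert (Q1 : quad (1 * Mdexp (/ 2) (2 * Re c)) (fun q => wq q * Cexp (- (2 * c * RtoC (exp q))))).
    { assert (Hc : (0 < Re c)%R). { unfold c. rewrite re_scal_l. apply Rmult_lt_0_compat; auto. apply exp_pos. } apply quad_dexp; try lra. intros q. apply ct_mult. apply ct_wq. ct. intros q. rewrite Cmod_mult, Cmod_Cexp. replace (Re (- (2 * c * RtoC (exp q)))) with (- (2 * Re c * exp q))%R by (unfold Re; simpl; ring).
      replace (1 * exp (/ 2 * q - 2 * Re c * exp q))%R with (exp (q / 2) * exp (- (2 * Re c * exp q)))%R by (rewrite <- exp_plus, Rmult_1_l; f_equal; field). apply Rmult_le_compat_r. left; apply exp_pos. apply wq_le. }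
    rewrite <- (LI_scal _ _ _ Q1). unfold Phi. apply LI_ext. intros q. simpl Cpow. unfold ph. replace (c * (Ci - 2 * RtoC (exp q))) with (Ci * c + - (2 * c * RtoC (exp q))) by ring. rewrite Cexp_plus. ring. }
  assert (Ec : (Cmod (Cexp (Ci * c) - 1) <= K2 * (x * x))%R).
  { eapply Rle_trans. apply Cexp_taylor0. rewrite Cmod_mult, Cmod_Ci, Rmult_1_l. unfold c. rewrite Cmod_mult, Cmod_R, Rabs_pos_eq, Ex by (left; apply exp_pos).
    unfold K2. replace (Cmod ze * exp (Cmod ze) * (x * x))%R with (x * x * Cmod ze * exp (Cmod ze))%R by ring. apply Rmult_le_compat_l. apply Rmult_le_pos; nra. apply exp_le. rewrite <- (Rmult_1_l (Cmod ze)) at 2. apply Rmult_le_compat_r; nra. }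
  assert (Px : (Rabs p * x <= 2)%R).
  { rewrite Rabs_left1 by lra. assert (G := exp_ineq1_le (- (p / 2))). assert (x * exp (- (p / 2)) = 1)%R. unfold x. rewrite <- exp_plus, Rplus_opp_r. apply exp_0. nra. }
  assert (BA : (Cmod A * x <= Cmod b0 + 2)%R).
  { unfold A. rewrite Cmod_mult, e4_mod, Rmult_1_l. assert (T := Cmod_triangle b0 (- RtoC p)). rewrite Cmod_opp, Cmod_R in T. unfold Cminus. nra. }
  assert (BJ2 : (Cmod J * x <= Cmod b0 + 2 + K1)%R).
  { replace J with (A + (J - A)) by ring. assert (T := Cmod_triangle A (J - A)). assert (X2 : (x * x <= 1)%R) by nra. assert (KX : (K1 * (x * x) <= K1 * 1)%R) by (apply Rmult_le_compat_l; auto).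
    apply Rle_trans with ((Cmod A + K1 * x) * x)%R. apply Rmult_le_compat_r; lra. lra. }
  rewrite EP. replace (Cexp (Ci * c) * J - A) with ((Cexp (Ci * c) - 1) * J + (J - A)) by ring.
  triangle. rewrite Cmod_mult.
  apply Rle_trans with (K2 * (x * x) * Cmod J + K1 * x)%R. apply Rplus_le_compat; auto. apply Rmult_le_compat_r; auto. apply Cmod_ge_0.
  replace (K2 * (x * x) * Cmod J)%R with (K2 * x * (Cmod J * x))%R by ring. replace ((K2 * (Cmod b0 + 2 + K1) + K1) * x)%R with (K2 * x * (Cmod b0 + 2 + K1) + K1 * x)%R by ring.
  apply Rplus_le_compat_r. apply Rmult_le_compat_l; auto. apply Rmult_le_pos; lra.
Qed.
End Asym.

(** * Picard iteration from minus infinity *)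

Fixpoint csum (u : nat -> C) (n : nat) : C := match n with O => u O | S k => csum u k + u (S k) end.
Definition cser (u : nat -> C) (l : C) := forall e, (0 < e)%R -> exists n0, forall n, (n0 <= n)%nat -> (Cmod (csum u n - l) <= e)%R.
Lemma csum_re u n : Re (csum u n) = sum_n (fun k => Re (u k)) n.
Proof. induction n. rewrite sum_O. reflexivity. rewrite sum_Sn. simpl csum. rewrite re_plus, IHn. reflexivity. Qed.
Lemma csum_im u n : Im (csum u n) = sum_n (fun k => Im (u k)) n.
Proof. induction n. rewrite sum_O. reflexivity. rewrite sum_Sn. simpl csum. rewrite im_plus, IHn. reflexivity. Qed.
Lemma series_eps (v : nat -> R) (l : R) : (forall e, 0 < e -> exists n0, forall n, (n0 <= n)%nat -> Rabs (sum_n v n - l) <= e)%R -> Series v = l.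
Proof.
  intros H. apply is_series_unique. assert (X : is_lim_seq (sum_n v) (Finite l)); [|exact X]. apply is_lim_seq_spec. intros [e He]. simpl. destruct (H (e / 2)%R ltac:(lra)) as [n0 H0]. exists n0. intros n Hn. specialize (H0 n Hn). lra.
Qed.
Lemma cser_CSeries u l : cser u l -> CSeries u = l.
Proof.
  intros H. unfold CSeries. apply C_ext; simpl.
  - apply series_eps. intros e He. destruct (H e He) as [n0 H0]. exists n0. intros n Hn. eapply Rle_trans; [|apply (H0 n Hn)]. rewrite <- csum_re.
    eapply Rle_trans; [|apply re_le_Cmod]. right. f_equal.
  - apply series_eps. intros e He. destruct (H e He) as [n0 H0]. exists n0. intros n Hn. eapply Rle_trans; [|apply (H0 n Hn)]. rewrite <- csum_im.
    eapply Rle_trans; [|apply im_le_Cmod]. right. f_equal.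
Qed.
Lemma cser_unique u l l' : cser u l -> cser u l' -> l = l'.
Proof. intros A B. rewrite <- (cser_CSeries _ _ A). apply cser_CSeries; auto. Qed.
Lemma csum_lin (a b : C) u v n : csum (fun k => a * u k + b * v k) n = a * csum u n + b * csum v n.
Proof. induction n; simpl. reflexivity. rewrite IHn. ring. Qed.
Lemma cser_ext u v l : (forall k, u k = v k) -> cser u l -> cser v l.
Proof. intros E H e He. destruct (H e He) as [n0 H0]. exists n0. intros n Hn. replace (csum v n) with (csum u n); auto. clear - E. induction n; simpl; rewrite ?IHn, E; auto. Qed.
Lemma cser_lin (a b : C) u v l m : cser u l -> cser v m -> cser (fun k => a * u k + b * v k) (a * l + b * m).
Proof.
  intros H1 H2 e He. assert (A := Cmod_ge_0 a). assert (B := Cmod_ge_0 b). set (d := (e / (Cmod a + Cmod b + 1))%R). assert (Hd : (0 < d)%R) by (apply Rdiv_lt_0_compat; lra).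
  destruct (H1 d Hd) as [n1 K1]. destruct (H2 d Hd) as [n2 K2]. exists (max n1 n2). intros n Hn. specialize (K1 n ltac:(lia)). specialize (K2 n ltac:(lia)).
  rewrite csum_lin. replace (_ - _) with (a * (csum u n - l) + b * (csum v n - m)) by ring. triangle. rewrite !Cmod_mult.
  assert (E : ((Cmod a + Cmod b + 1) * d = e)%R) by (unfold d; field; lra). nra.
Qed.
Lemma cser_conj u l : cser u l -> cser (fun k => Cconj (u k)) (Cconj l).
Proof.
  intros H e He. destruct (H e He) as [n0 H0]. exists n0. intros n Hn. specialize (H0 n Hn).
  replace (csum (fun k => Cconj (u k)) n) with (Cconj (csum u n)). rewrite <- Cminus_conj, Cmod_conj. auto.
  clear. induction n; simpl; auto. rewrite <- IHn. apply Cplus_conj.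
Qed.
Lemma pow_fact_sum (r : R) (n : nat) : (0 <= r)%R -> (sum_n (fun k => r ^ k / INR (fact k)) n <= exp r)%R.
Proof.
  intros Hr. assert (E := is_exp_Reals r). apply is_pseries_R in E.
  assert (X : is_series (fun k => r ^ k / INR (fact k))%R (exp r)). { eapply is_series_ext; [|exact E]. intros k. simpl. unfold Rdiv. ring. }
  apply (is_lim_seq_incr_compare (sum_n (fun k => r ^ k / INR (fact k))%R)). exact X.
  intros k. rewrite sum_Sn. unfold plus; simpl. assert (0 <= r ^ S k / INR (fact (S k)))%R. { apply Rdiv_le_0_compat. apply pow_le; auto. apply INR_fact_lt_0. } simpl in H. lra.
Qed.

(** Comparison with the exponential series. *)
Lemma cser_bounded (u : nat -> C) (r K : R) : (0 <= r)%R -> (0 <= K)%R -> (forall k, (Cmod (u k) <= K * (r ^ k / INR (fact k)))%R) -> exists l, cser u l /\ (Cmod l <= K * exp r)%R.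
Proof.
  intros Hr HK B.
  assert (E := is_exp_Reals r). apply is_pseries_R in E.
  assert (X : ex_series (fun k => K * (r ^ k / INR (fact k)))%R). { apply (ex_series_scal K (fun k => r ^ k / INR (fact k))%R). exists (exp r). eapply is_series_ext; [|exact E]. intros k. simpl. unfold Rdiv. ring. }
  assert (Xr : ex_series (fun k => Re (u k))). { apply (ex_series_le (K := R_AbsRing) (V := R_CompleteNormedModule) _ (fun k => K * (r ^ k / INR (fact k)))%R); auto. intros k. eapply Rle_trans; [|apply B]. apply re_le_Cmod. }
  assert (Xi : ex_series (fun k => Im (u k))). { apply (ex_series_le (K := R_AbsRing) (V := R_CompleteNormedModule) _ (fun k => K * (r ^ k / INR (fact k)))%R); auto. intros k. eapply Rle_trans; [|apply B]. apply im_le_Cmod. }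
  destruct Xr as [lr Hlr]. destruct Xi as [li Hli]. set (l := ((lr, li) : C)).
  assert (S : cser u l).
  { intros e He. assert (Lr : is_lim_seq (sum_n (fun k => Re (u k))) (Finite lr)) by exact Hlr. assert (Li : is_lim_seq (sum_n (fun k => Im (u k))) (Finite li)) by exact Hli. clear Hlr Hli. apply is_lim_seq_spec in Lr. apply is_lim_seq_spec in Li. assert (He2 : (0 < e / 2)%R) by lra.
    destruct (Lr (mkposreal _ He2)) as [n1 K1]. destruct (Li (mkposreal _ He2)) as [n2 K2]. exists (max n1 n2). intros n Hn.
    specialize (K1 n ltac:(lia)). specialize (K2 n ltac:(lia)). simpl in K1, K2. rewrite <- csum_re in K1. rewrite <- csum_im in K2.
    eapply Rle_trans; [apply Cmod_le_re_im|]. change (Re (csum u n - l)) with (Re (csum u n) + - lr)%R. change (Im (csum u n - l)) with (Im (csum u n) + - li)%R. unfold Rminus in *. lra. }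
  exists l. split; auto.
  assert (P : forall n, (Cmod (csum u n) <= K * exp r)%R).
  { intros n. apply Rle_trans with (K * sum_n (fun k => r ^ k / INR (fact k)) n)%R. 2: apply Rmult_le_compat_l; auto; apply pow_fact_sum; auto.
    induction n. rewrite sum_O. apply B. rewrite sum_Sn. simpl csum. triangle. unfold plus; simpl plus. rewrite Rmult_plus_distr_l. apply Rplus_le_compat; auto. }
  apply le_epsilon. intros e He. destruct (S e He) as [n0 H0]. specialize (H0 n0 (Nat.le_refl _)). specialize (P n0).
  replace l with (csum u n0 - (csum u n0 - l)) by ring. triangle. rewrite Cmod_opp. lra.
Qed.

Fixpoint harmonic (n : nat) : R := match n with O => 0%R | S k => (harmonic k + / INR (S k))%R end.

(** The terms of J_0 (z) with x = - z^2/4. *)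
Definition J0_term (x : C) (k : nat) : C := x ^ k / RtoC (INR (fact k) * INR (fact k)).
Lemma fact_nz k : RtoC (INR (fact k)) <> 0. Proof. apply RtoC_nz, INR_fact_neq_0. Qed.
Lemma INRS_nz k : RtoC (INR (S k)) <> 0. Proof. apply RtoC_nz, not_0_INR. lia. Qed.
Lemma J0_term_S x k : J0_term x (S k) * (RtoC (INR (S k)) * RtoC (INR (S k))) = x * J0_term x k.
Proof.
  unfold J0_term. rewrite fact_simpl, mult_INR, !RtoC_mult. assert (A := fact_nz k). assert (B := INRS_nz k). simpl Cpow. field. auto.
Qed.
Lemma J0_term_0 x : J0_term x 0 = 1.
Proof. unfold J0_term. simpl. rewrite RtoC_mult. field. Qed.
Lemma J0_term_mod x k : Cmod (J0_term x k) = (Cmod x ^ k / (INR (fact k) * INR (fact k)))%R.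
Proof.
  assert (F := INR_fact_lt_0 k). unfold J0_term, Cdiv. rewrite <- RtoC_inv by nra. rewrite Cmod_mult, Cmod_pow, Cmod_R, Rabs_pos_eq. reflexivity. left; apply Rinv_0_lt_compat; nra.
Qed.

(** A solution of f'' = 4 x e^(2p) f that is asymptotic to a p + b at minus infinity is the sum of
    the iterates of a p + b under double integration from minus infinity against 4 x e^(2p). *)
Section Picard.
Variables f f1 : R -> C.
Variables a b x : C.
Variable K : R.
Hypothesis HK : (0 <= K)%R.
Hypothesis Df : forall p, rder f p (f1 p).
Hypothesis Df1 : forall p, rder f1 p (4 * x * RtoC (exp (2 * p)) * f p).
Hypothesis As : forall p, (p <= 0)%R -> (Cmod (f p - (a * p + b)) <= K * exp (/ 2 * p))%R.

(** The k-th iterate; the harmonic number comes from integrating p e^(2kp) twice. *)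
Definition picard_term (k : nat) (p : R) : C := (a * (RtoC p - harmonic k) + b) * J0_term x k * RtoC (exp (2 * INR k * p)).
Definition picard_term1 (k : nat) (p : R) : C := (a + 2 * INR k * (a * (RtoC p - harmonic k) + b)) * J0_term x k * RtoC (exp (2 * INR k * p)).
Lemma rder_kexp k p : rder (fun p => RtoC (exp (2 * INR k * p))) p (2 * INR k * RtoC (exp (2 * INR k * p))).
Proof. apply (rder_eq _ _ (RtoC (2 * INR k * exp (2 * INR k * p)))). rewrite !RtoC_mult. reflexivity. apply rder_R. auto_derive; auto. ring. Qed.
Lemma rder_lin (c d : C) (p : R) : rder (fun p => c * (RtoC p - d)) p c.
Proof. apply (rder_eq _ _ (c * (1 - 0))). ring. apply rder_scal, rder_minus. apply rder_id. apply rder_const. Qed.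
Lemma rder_picard_term k p : rder (picard_term k) p (picard_term1 k p).
Proof.
  unfold picard_term. refine (rder_eq _ _ _ _ _ (rder_mult _ _ _ _ _ (rder_mult _ _ _ _ _ (rder_plus _ _ _ _ _ (rder_lin a (harmonic k) p) (rder_const b p)) (rder_const (J0_term x k) p)) (rder_kexp k p))). unfold picard_term1. ring.
Qed.
Lemma rder_picard_term1 k p : rder (picard_term1 k) p ((4 * INR k * a + 4 * INR k * INR k * (a * (RtoC p - harmonic k) + b)) * J0_term x k * RtoC (exp (2 * INR k * p))).
Proof.
  unfold picard_term1. refine (rder_eq _ _ _ _ _ (rder_mult _ _ _ _ _ (rder_mult _ _ _ _ _ (rder_plus _ _ _ _ _ (rder_const a p) (rder_scal (2 * INR k) _ _ _ (rder_plus _ _ _ _ _ (rder_lin a (harmonic k) p) (rder_const b p)))) (rder_const (J0_term x k) p)) (rder_kexp k p))). ring.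
Qed.
Lemma rder_picard_term1_S n p : rder (picard_term1 (S n)) p (4 * x * RtoC (exp (2 * p)) * picard_term n p).
Proof.
  refine (rder_eq _ _ _ _ _ (rder_picard_term1 (S n) p)). unfold picard_term.
  replace (2 * INR (S n) * p)%R with (2 * p + 2 * INR n * p)%R by (rewrite S_INR; ring). rewrite exp_plus, RtoC_mult.
  change (harmonic (S n)) with (harmonic n + / INR (S n))%R. rewrite RtoC_plus, RtoC_inv by (apply not_0_INR; lia). assert (N := INRS_nz n).
  transitivity (4 * (a * (RtoC p - harmonic n) + b) * (J0_term x (S n) * (RtoC (INR (S n)) * RtoC (INR (S n)))) * (RtoC (exp (2 * p)) * RtoC (exp (2 * INR n * p)))). field; auto. rewrite J0_term_S. ring.
Qed.
Fixpoint picard_rem (n : nat) (p : R) : C := match n with O => f p - picard_term 0 p | S k => picard_rem k p - picard_term (S k) p end.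
Fixpoint picard_rem1 (n : nat) (p : R) : C := match n with O => f1 p - picard_term1 0 p | S k => picard_rem1 k p - picard_term1 (S k) p end.
Lemma rder_picard_rem n p : rder (picard_rem n) p (picard_rem1 n p).
Proof. induction n; simpl; apply rder_minus; auto; apply rder_picard_term. Qed.
Lemma rder_picard_rem1 n p : rder (picard_rem1 (S n)) p (4 * x * RtoC (exp (2 * p)) * picard_rem n p).
Proof.
  induction n.
  - apply (rder_ext (fun p => f1 p - picard_term1 0 p - picard_term1 1 p)). reflexivity. simpl picard_rem.
    refine (rder_eq _ _ _ _ _ (rder_minus _ _ _ _ _ (rder_minus _ _ _ _ _ (Df1 p) (rder_picard_term1 0 p)) (rder_picard_term1_S 0 p))). simpl INR. ring.
  - apply (rder_ext (fun p => picard_rem1 (S n) p - picard_term1 (S (S n)) p)). reflexivity. simpl picard_rem at 1.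
    refine (rder_eq _ _ _ _ _ (rder_minus _ _ _ _ _ IHn (rder_picard_term1_S (S n) p))). simpl picard_rem. ring.
Qed.
Lemma picard_term_lim k : lim_m (picard_term (S k)) 0.
Proof.
  assert (B : forall p, (p <= 0)%R -> (Cmod (picard_term (S k) p) <= (Cmod a * (1 + Rabs (harmonic (S k))) + Cmod b) * Cmod (J0_term x (S k)) * exp p)%R).
  { intros p Hp. unfold picard_term. rewrite !Cmod_mult, Cmod_R, Rabs_pos_eq by (left; apply exp_pos).
    assert (A1 := Cmod_ge_0 a). assert (A2 := Cmod_ge_0 b). assert (A3 := Cmod_ge_0 (J0_term x (S k))). assert (A4 := Rabs_pos (harmonic (S k))).
    assert (T : (Cmod (a * (RtoC p - harmonic (S k)) + b) <= Cmod a * (- p + Rabs (harmonic (S k))) + Cmod b)%R).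
    { triangle. apply Rplus_le_compat_r. rewrite Cmod_mult. apply Rmult_le_compat_l; auto. triangle. rewrite Cmod_opp, !Cmod_R, (Rabs_left1 p) by auto. lra. }
    assert (E : (exp (2 * INR (S k) * p) <= exp p * exp p)%R). { rewrite <- exp_plus. apply exp_le. assert (1 <= INR (S k))%R by (rewrite S_INR; generalize (pos_INR k); lra). nra. }
    assert (G : (- p * exp p <= 1)%R). { assert (X := exp_ineq1_le (- p)). assert (Y : (exp p * exp (- p) = 1)%R) by (rewrite <- exp_plus, Rplus_opp_r; apply exp_0). assert (Z := exp_pos p). nra. }
    assert (P := exp_pos p). assert (P1 : (exp p <= 1)%R) by (rewrite <- exp_0; apply exp_le; auto).
    apply Rle_trans with ((Cmod a * (- p + Rabs (harmonic (S k))) + Cmod b) * Cmod (J0_term x (S k)) * (exp p * exp p))%R.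
    apply Rmult_le_compat; auto. apply Rmult_le_pos; auto. apply Cmod_ge_0. left; apply exp_pos. apply Rmult_le_compat_r; auto.
    replace ((Cmod a * (- p + Rabs (harmonic (S k))) + Cmod b) * Cmod (J0_term x (S k)) * (exp p * exp p))%R with ((Cmod a * (- p * exp p + Rabs (harmonic (S k)) * exp p) + Cmod b * exp p) * Cmod (J0_term x (S k)) * exp p)%R by ring.
    apply Rmult_le_compat_r. lra. apply Rmult_le_compat_r; auto. apply Rplus_le_compat. apply Rmult_le_compat_l; auto. apply Rplus_le_compat; auto. nra. nra. }
  intros e He. set (Q := ((Cmod a * (1 + Rabs (harmonic (S k))) + Cmod b) * Cmod (J0_term x (S k)))%R) in *.
  assert (HQ : (0 <= Q)%R). { unfold Q. apply Rmult_le_pos; [|apply Cmod_ge_0]. apply Rplus_le_le_0_compat; [|apply Cmod_ge_0]. apply Rmult_le_pos. apply Cmod_ge_0. generalize (Rabs_pos (harmonic (S k))); lra. }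
  exists (Rmin 0 (ln (e / (Q + 1)))). intros p Hp. assert (L1 := Rmin_l 0 (ln (e / (Q + 1)))). assert (L2 := Rmin_r 0 (ln (e / (Q + 1)))).
  replace (picard_term (S k) p - 0) with (picard_term (S k) p) by ring. eapply Rle_trans. apply B. lra.
  assert (X : (exp p <= e / (Q + 1))%R). { rewrite <- (exp_ln (e / (Q + 1))) by (apply Rdiv_lt_0_compat; lra). apply exp_le. lra. }
  apply Rle_trans with (Q * (e / (Q + 1)))%R. apply Rmult_le_compat_l; auto. apply Rmult_le_reg_r with (Q + 1)%R. lra. replace (Q * (e / (Q + 1)) * (Q + 1))%R with (Q * e)%R by (field; lra). nra.
Qed.

(** Each remainder is the double integral of the preceding one, and integrating e^(2(n+1)p) twice
    divides by (2(n+1))^2. That remainders tend to 0 at minus infinity fixes the constants of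
    integration. *)
Lemma picard_rem_bound n : lim_m (picard_rem n) 0 /\ forall p, (p <= 0)%R -> (Cmod (picard_rem n p) <= K * (Cmod x ^ n / (INR (fact n) * INR (fact n))) * exp (2 * INR n * p))%R.
Proof.
  assert (X0 := Cmod_ge_0 x). induction n as [|n [L B]].
  - assert (E : forall p, picard_rem 0 p = f p - (a * p + b)). { intros p. unfold picard_rem, picard_term. rewrite J0_term_0. simpl harmonic. simpl INR. replace (2 * 0 * p)%R with 0%R by ring. rewrite exp_0. ring. }
    split.
    + intros e He. exists (Rmin 0 (2 * ln (e / (K + 1)))). intros p Hp. assert (L1 := Rmin_l 0 (2 * ln (e / (K + 1)))). assert (L2 := Rmin_r 0 (2 * ln (e / (K + 1)))).
      replace (picard_rem 0 p - 0) with (picard_rem 0 p) by ring. rewrite E. eapply Rle_trans. apply As. lra.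
      assert (X : (exp (/ 2 * p) <= e / (K + 1))%R). { rewrite <- (exp_ln (e / (K + 1))) by (apply Rdiv_lt_0_compat; lra). apply exp_le. lra. }
      apply Rle_trans with (K * (e / (K + 1)))%R. apply Rmult_le_compat_l; auto. apply Rmult_le_reg_r with (K + 1)%R. lra. replace (K * (e / (K + 1)) * (K + 1))%R with (K * e)%R by (field; lra). nra.
    + intros p Hp. rewrite E. eapply Rle_trans. apply As; auto. simpl. replace (2 * 0 * p)%R with 0%R by ring. rewrite exp_0. replace (K * (1 / (1 * 1)) * 1)%R with (K * 1)%R by field. apply Rmult_le_compat_l; auto. rewrite <- exp_0. apply exp_le. lra.
  - assert (L' : lim_m (picard_rem (S n)) 0).
    { intros e He. destruct (L (e / 2)%R ltac:(lra)) as [N1 H1]. destruct (picard_term_lim n (e / 2)%R ltac:(lra)) as [N2 H2]. exists (Rmin N1 N2). intros p Hp.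
      specialize (H1 p ltac:(generalize (Rmin_l N1 N2); lra)). specialize (H2 p ltac:(generalize (Rmin_r N1 N2); lra)). simpl picard_rem. replace (picard_rem n p - picard_term (S n) p - 0) with ((picard_rem n p - 0) - (picard_term (S n) p - 0)) by ring.
      triangle. rewrite Cmod_opp. lra. }
    split; auto. assert (F := INR_fact_lt_0 n). assert (NS : (0 < INR (S n))%R) by (apply lt_0_INR; lia).
    set (A := (4 * Cmod x * (K * (Cmod x ^ n / (INR (fact n) * INR (fact n)))))%R).
    assert (HA : (0 <= A)%R). { unfold A. apply Rmult_le_pos. lra. apply Rmult_le_pos; auto. apply Rdiv_le_0_compat. apply pow_le; auto. nra. }
    intros p Hp.
    assert (C1 : rcont (picard_rem1 (S n))) by (intros q; eapply rder_cont, rder_picard_rem1).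
    assert (C0 : rcont (picard_rem n)) by (intros q; eapply rder_cont, rder_picard_rem).
    assert (G := exp_decay2 (picard_rem (S n)) (picard_rem1 (S n)) (fun p => 4 * x * RtoC (exp (2 * p)) * picard_rem n p) A (2 * INR (S n)) 0 ltac:(lra) HA (rder_picard_rem (S n)) (rder_picard_rem1 n) C1).
    eapply Rle_trans. apply G; auto.
    + intros q. apply ct_mult; [ct | apply C0].
    + intros q Hq. rewrite !Cmod_mult, !Cmod_R, (Rabs_pos_eq 4), (Rabs_pos_eq (exp _)) by (try lra; left; apply exp_pos).
      specialize (B q Hq). replace (2 * INR (S n) * q)%R with (2 * q + 2 * INR n * q)%R by (rewrite S_INR; ring). rewrite exp_plus. unfold A.
      replace (4 * Cmod x * (K * (Cmod x ^ n / (INR (fact n) * INR (fact n)))) * (exp (2 * q) * exp (2 * INR n * q)))%R with (4 * Cmod x * exp (2 * q) * (K * (Cmod x ^ n / (INR (fact n) * INR (fact n))) * exp (2 * INR n * q)))%R by ring.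
      apply Rmult_le_compat_l; auto. apply Rmult_le_pos. lra. left; apply exp_pos.
    + right. f_equal. unfold A. rewrite fact_simpl, mult_INR. simpl pow. field. split; lra.
Qed.
Lemma csum_picard_rem n p : picard_rem n p = f p - csum (fun k => picard_term k p) n.
Proof. induction n; simpl. reflexivity. rewrite IHn. ring. Qed.
Lemma picard_series : cser (fun k => (b - a * harmonic k) * J0_term x k) (f 0).
Proof.
  intros e He. assert (X0 := Cmod_ge_0 x). destruct (cv_speed_pow_fact (Cmod x) (e / (K + 1))%R) as [n0 H0]. apply Rdiv_lt_0_compat; lra.
  exists n0. intros n Hn. specialize (H0 n Hn). unfold R_dist in H0. rewrite Rminus_0_r in H0. assert (F := INR_fact_lt_0 n).
  assert (F1 : (1 <= INR (fact n))%R). { replace 1%R with (INR 1) by reflexivity. apply le_INR. apply lt_O_fact. }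
  assert (P : (0 <= Cmod x ^ n / INR (fact n))%R) by (apply Rdiv_le_0_compat; [apply pow_le; auto | lra]). rewrite Rabs_pos_eq in H0 by auto.
  destruct (picard_rem_bound n) as [_ B]. specialize (B 0%R ltac:(lra)). rewrite csum_picard_rem, Rmult_0_r, exp_0, Rmult_1_r in B.
  assert (E : csum (fun k => picard_term k 0) n = csum (fun k => (b - a * harmonic k) * J0_term x k) n).
  { clear. assert (T : forall k, picard_term k 0 = (b - a * harmonic k) * J0_term x k). { intros k. unfold picard_term. rewrite Rmult_0_r, exp_0. ring. } induction n; simpl; rewrite ?IHn, T; reflexivity. }
  rewrite E, Cmod_minus_sym in B. eapply Rle_trans. exact B.
  replace (K * (Cmod x ^ n / (INR (fact n) * INR (fact n))))%R with (K * (Cmod x ^ n / INR (fact n)) * / INR (fact n))%R by (field; lra).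
  assert (I : (0 < / INR (fact n) <= 1)%R). { split. apply Rinv_0_lt_compat; lra. rewrite <- Rinv_1. apply Rinv_le_contravar; lra. }
  apply Rle_trans with (K * (e / (K + 1)))%R. apply Rle_trans with (K * (Cmod x ^ n / INR (fact n)) * 1)%R. apply Rmult_le_compat_l. apply Rmult_le_pos; auto. lra. rewrite Rmult_1_r. apply Rmult_le_compat_l; lra.
  apply Rmult_le_reg_r with (K + 1)%R. lra. replace (K * (e / (K + 1)) * (K + 1))%R with (K * e)%R by (field; lra). nra.
Qed.
End Picard.

Lemma Phi_series (ze : C) : (0 < Re ze)%R -> cser (fun k => e4 * ((b0 ze + harmonic k) * J0_term (- (ze * ze / 4)) k)) (Phi 0 ze).
Proof.
  intros Hz. destruct (Phi_asym ze Hz) as [K [HK B]]. assert (Hp : forall p : R, (0 < Re (RtoC (exp p) * ze))%R) by (intros p; rewrite re_scal_l; apply Rmult_lt_0_compat; auto; apply exp_pos).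
  assert (D : forall (n : nat) (p : R), (n <= 1)%nat -> rder (fun p : R => Phi n (RtoC (exp p) * ze)) p (RtoC (exp p) * ze * Phi (S n) (RtoC (exp p) * ze))).
  { intros n p Hn. apply (rder_eq _ _ (Phi (S n) (RtoC (exp p) * ze) * (RtoC (exp p) * ze))). ring. apply (rder_comp (Phi n) (fun p => RtoC (exp p) * ze)). apply cder_Phi; auto.
    apply (rder_ext (fun p => ze * RtoC (exp p))). intros; ring. apply (rder_eq _ _ (ze * RtoC (exp p))). ring. apply rder_scal, rder_exp. }
  assert (P := picard_series (fun p => Phi 0 (RtoC (exp p) * ze)) (fun p => RtoC (exp p) * ze * Phi 1 (RtoC (exp p) * ze)) (- e4) (e4 * b0 ze) (- (ze * ze / 4)) K HK).
  cbv beta in P. rewrite exp_0, Cmult_1_l in P. apply (cser_ext (fun k => (e4 * b0 ze - - e4 * harmonic k) * J0_term (- (ze * ze / 4)) k)). intros k; ring. apply P.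
  - intros p. apply (D 0%nat); lia.
  - intros p. assert (X : rder (fun p => RtoC (exp p) * ze) p (RtoC (exp p) * ze)). { apply (rder_ext (fun p => ze * RtoC (exp p))). intros; ring. apply (rder_eq _ _ (ze * RtoC (exp p))). ring. apply rder_scal, rder_exp. }
    refine (rder_eq _ _ _ _ _ (rder_mult _ _ _ _ _ X (D 1%nat p ltac:(lia)))).
    assert (O := Phi_ode _ (Hp p)). set (c := RtoC (exp p) * ze) in *.
    replace (4 * - (ze * ze / 4) * RtoC (exp (2 * p)) * Phi 0 c) with (- (c * c) * Phi 0 c).
    2:{ unfold c. replace (2 * p)%R with (p + p)%R by ring. rewrite exp_plus, RtoC_mult. field. }
    transitivity (c * c * (Phi 2 c + Phi 0 c) + c * Phi 1 c - c * c * Phi 0 c). ring. rewrite O. ring.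
  - intros p Hp0. replace (- e4 * p + e4 * b0 ze) with (e4 * (b0 ze - RtoC p)) by ring. apply B; auto.
Qed.

(** * The Bessel function of the second kind *)

Lemma C_lim_eq (f : C -> C) (g : R -> C) (d : R) : (0 < d)%R -> continuous g 0%R -> (forall x : R, (x <> 0)%R -> (Rabs x < d)%R -> f x = g x) -> C_lim f 0 = g 0%R.
Proof.
  intros Hd Hg E.
  assert (G : forall h : C -> R, continuous (fun x => h (g x)) 0%R -> Lim (fun x : R => h (f x)) 0%R = Finite (h (g 0%R))).
  { intros h Hh. apply is_lim_unique. apply (is_lim_ext_loc (fun x => h (g x))).
    - exists (mkposreal d Hd). intros y Hy Ny. rewrite E; auto. unfold ball in Hy; simpl in Hy; unfold AbsRing_ball, abs, minus, plus, opp in Hy; simpl in Hy. rewrite Ropp_0, Rplus_0_r in Hy. auto.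
    - intros P HP. apply Hh in HP. unfold filtermap in *. destruct HP as [r Hr]. exists r. intros y Hy _. apply Hr; auto. }
  change (C_lim f 0) with ((real (Lim (fun x : R => fst (f (RtoC x))) 0%R), real (Lim (fun x : R => snd (f (RtoC x))) 0%R)) : C). rewrite (G fst), (G snd). destruct (g 0%R); reflexivity. apply (ct_im g); auto. apply (ct_re g); auto.
Qed.
Lemma rder_carath (N : R -> C) (x : R) (n : C) : rder N x n -> exists h : R -> C, continuous h x /\ h x = n /\ forall y, N y - N x = h y * RtoC (y - x).
Proof.
  intros [A B]. destruct (derive_carath _ _ _ A) as [h1 [C1 [E1 L1]]]. destruct (derive_carath _ _ _ B) as [h2 [C2 [E2 L2]]].
  exists (fun y => (h1 y, h2 y)). split; [|split]. apply ct_pair; auto. rewrite E1, E2. destruct n; reflexivity.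
  intros y. apply C_ext; [specialize (L1 y) | specialize (L2 y)]; unfold Re, Im in *; simpl; lra.
Qed.

(** L'Hopital's rule at 0. *)
Lemma C_lim_quot (f : C -> C) (N D : R -> C) (n dd : C) (d : R) : (0 < d)%R -> rder N 0 n -> rder D 0 dd -> N 0%R = 0 -> D 0%R = 0 -> dd <> 0 ->
  (forall x : R, (x <> 0)%R -> (Rabs x < d)%R -> f x = N x / D x) -> C_lim f 0 = n / dd.
Proof.
  intros Hd HN HD N0 D0 Nd E. destruct (rder_carath _ _ _ HN) as [h [Ch [Eh Lh]]]. destruct (rder_carath _ _ _ HD) as [k [Ck [Ek Lk]]].
  assert (Cg : continuous (fun x => h x / k x) 0%R) by (apply ct_div; auto; rewrite Ek; auto).
  destruct (proj1 (ct_eps k 0%R) Ck (Cmod dd)) as [r [Hr Hk]]. apply Cmod_gt_0; auto.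
  rewrite (C_lim_eq f (fun x => h x / k x) (Rmin d r)); auto. rewrite Eh, Ek; auto. apply Rmin_glb_lt; auto.
  intros x Nx Hx. rewrite E; [| exact Nx | eapply Rlt_le_trans; [exact Hx | apply Rmin_l]].
  assert (Kx : k x <> 0). { intro A. specialize (Hk x). rewrite Rminus_0_r, A, Ek in Hk. replace (0 - dd) with (- dd) in Hk by ring. rewrite Cmod_opp in Hk. assert (Rabs x < r)%R by (eapply Rlt_le_trans; [exact Hx | apply Rmin_r]). specialize (Hk H). lra. }
  specialize (Lh x). specialize (Lk x). rewrite N0, Rminus_0_r in Lh. rewrite D0, Rminus_0_r in Lk. replace (N x) with (h x * x) by (rewrite <- Lh; ring). replace (D x) with (k x * x) by (rewrite <- Lk; ring). field. split; auto. apply RtoC_nz; auto.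
Qed.

(** k! / ((1 + mu) ... (k + mu)). *)
Fixpoint inv_poch (k : nat) (mu : R) : R := match k with O => 1%R | S n => (inv_poch n mu * (INR (S n) / (INR (S n) + mu)))%R end.
Lemma harmonic_bound k : (0 <= harmonic k <= INR k)%R.
Proof.
  induction k. simpl; lra. change (harmonic (S k)) with (harmonic k + / INR (S k))%R. assert (A : (1 <= INR (S k))%R) by (rewrite S_INR; generalize (pos_INR k); lra).
  assert (/ INR (S k) <= 1)%R by (rewrite <- Rinv_1; apply Rinv_le_contravar; lra). assert (0 < / INR (S k))%R by (apply Rinv_0_lt_compat; lra). rewrite S_INR in *. lra.
Qed.
Lemma INR_le_2pow k : (INR k <= 2 ^ k)%R.
Proof. induction k. simpl; lra. rewrite S_INR. simpl pow. assert (1 <= 2 ^ k)%R by (apply pow_R1_Rle; lra). lra. Qed.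
Lemma inv_poch_bound k mu : (Rabs mu <= 1 / 2)%R -> (0 <= inv_poch k mu <= 2 ^ k)%R.
Proof.
  intros Hm. apply Rabs_le_between in Hm. induction k. simpl; lra. simpl inv_poch. simpl pow. fold (INR (S k)).
  assert (A : (1 <= INR (S k))%R) by (rewrite S_INR; generalize (pos_INR k); lra). change (match k with 0%nat => 1%R | S _ => (INR k + 1)%R end) with (INR (S k)).
  assert (B : (0 <= INR (S k) / (INR (S k) + mu) <= 2)%R). { split. apply Rdiv_le_0_compat; lra. apply Rmult_le_reg_r with (INR (S k) + mu)%R. lra. unfold Rdiv. rewrite Rmult_assoc, Rinv_l; lra. }
  split. apply Rmult_le_pos; lra. rewrite (Rmult_comm 2). apply Rmult_le_compat; lra.
Qed.

(** The first derivative of the product at mu = 0 is - harmonic k. The crude growth 4^k of the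
    second order term is harmless against the factorials. *)
Lemma inv_poch_taylor k mu : (Rabs mu <= 1 / 2)%R -> (Rabs (inv_poch k mu - 1 + mu * harmonic k) <= mu ^ 2 * 4 ^ k)%R.
Proof.
  intros Hm. assert (Hm2 := Hm). apply Rabs_le_between in Hm2. induction k.
  - simpl. replace (1 - 1 + mu * 0)%R with 0%R by ring. rewrite Rabs_R0. nra.
  - assert (A : (1 <= INR (S k))%R) by (rewrite S_INR; generalize (pos_INR k); lra). set (n := INR (S k)) in *.
    assert (Q := inv_poch_bound k mu Hm). assert (H := harmonic_bound k). assert (P := INR_le_2pow k).
    set (u := (mu / n)%R). set (e := (inv_poch k mu - 1 + mu * harmonic k)%R) in *.
    assert (I : (0 < / n <= 1)%R). { split. apply Rinv_0_lt_compat; lra. rewrite <- Rinv_1. apply Rinv_le_contravar; lra. }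
    assert (Hu : (Rabs u <= Rabs mu)%R). { unfold u, Rdiv. rewrite Rabs_mult, (Rabs_pos_eq (/ n)) by lra. rewrite <- (Rmult_1_r (Rabs mu)) at 2. apply Rmult_le_compat_l. apply Rabs_pos. lra. }
    assert (Hu2 : (1 / 2 <= 1 + u)%R). { assert (X := Rabs_le_between u (1 / 2)). destruct X as [X _]. specialize (X ltac:(lra)). lra. }
    assert (Eq : (inv_poch (S k) mu - 1 + mu * harmonic (S k) = e + u * (mu * harmonic k - e) + u * u * inv_poch k mu / (1 + u))%R).
    { change (inv_poch (S k) mu) with (inv_poch k mu * (n / (n + mu)))%R. change (harmonic (S k)) with (harmonic k + / n)%R. unfold e. unfold u in *.
      assert (N2 : (n + mu <> 0)%R) by lra. field. split; lra. }
    rewrite Eq. assert (M0 := Rabs_pos mu). assert (U0 := Rabs_pos u).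
    assert (M2 : (Rabs mu * Rabs mu = mu ^ 2)%R) by (rewrite <- Rabs_mult, Rabs_pos_eq; [ring | apply Rle_0_sqr]).
    assert (T1 : (Rabs (u * (mu * harmonic k - e)) <= mu ^ 2 * INR k + mu ^ 2 * 4 ^ k * / 2)%R).
    { rewrite Rabs_mult. assert (X : (Rabs (mu * harmonic k - e) <= Rabs mu * INR k + mu ^ 2 * 4 ^ k)%R).
      { eapply Rle_trans; [apply Rabs_triang|]. rewrite Rabs_Ropp, Rabs_mult, (Rabs_pos_eq (harmonic k)) by lra. apply Rplus_le_compat; auto. apply Rmult_le_compat_l; lra. }
      apply Rle_trans with (Rabs mu * (Rabs mu * INR k) + / 2 * (mu ^ 2 * 4 ^ k))%R.
      assert (Y : (0 <= mu ^ 2 * 4 ^ k)%R) by (apply Rmult_le_pos; [apply pow2_ge_0 | apply pow_le; lra]). assert (Z : (0 <= Rabs mu * INR k)%R) by (apply Rmult_le_pos; auto; apply pos_INR).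
      apply Rle_trans with (Rabs u * (Rabs mu * INR k + mu ^ 2 * 4 ^ k))%R. apply Rmult_le_compat_l; auto. nra. rewrite <- Rmult_assoc, M2. lra. }
    assert (T2 : (Rabs (u * u * inv_poch k mu / (1 + u)) <= mu ^ 2 * (2 * 2 ^ k))%R).
    { unfold Rdiv. rewrite !Rabs_mult, (Rabs_pos_eq (inv_poch k mu)), (Rabs_pos_eq (/ (1 + u))) by (try lra; left; apply Rinv_0_lt_compat; lra).
      assert (V : (0 < / (1 + u) <= 2)%R). { split. apply Rinv_0_lt_compat; lra. replace 2%R with (/ (1 / 2))%R by field. apply Rinv_le_contravar; lra. }
      rewrite Rmult_assoc. apply Rmult_le_compat. apply Rmult_le_pos; auto. apply Rmult_le_pos; lra. rewrite <- M2. apply Rmult_le_compat; lra. rewrite (Rmult_comm 2). apply Rmult_le_compat; lra. }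
    eapply Rle_trans; [apply Rabs_triang|]. eapply Rle_trans; [apply Rplus_le_compat_r, Rabs_triang|].
    assert (B2 : (2 ^ k <= 4 ^ k)%R) by (apply pow_incr; lra). assert (S2 := pow2_ge_0 mu). simpl (4 ^ S k)%R. set (g := (4 ^ k)%R) in *. set (h := (2 ^ k)%R) in *.
    apply Rle_trans with (mu ^ 2 * (g + INR k + g * / 2 + 2 * h))%R. lra. apply Rmult_le_compat_l; auto.
    destruct k. simpl in *. unfold g, h. simpl. lra. assert (2 * h <= g)%R. { unfold g, h. simpl pow. assert (2 ^ k <= 4 ^ k)%R by (apply pow_incr; lra). lra. } lra.
Qed.
Lemma Ga_inv_poch (mu : R) (k : nat) : (Rabs mu <= 1 / 2)%R -> RtoC (inv_poch k mu) * Ga (mu + INR k + 1) = RtoC (INR (fact k)) * Ga (mu + 1).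
Proof.
  intros Hm. apply Rabs_le_between in Hm. induction k.
  - simpl. replace (RtoC mu + 0 + 1) with (RtoC mu + 1) by ring. reflexivity.
  - assert (A : (1 <= INR (S k))%R) by (rewrite S_INR; generalize (pos_INR k); lra). change (inv_poch (S k) mu) with (inv_poch k mu * (INR (S k) / (INR (S k) + mu)))%R.
    assert (X : (0 < Re (mu + INR k + 1))%R). { rewrite S_INR in A. unfold Re; simpl. lra. }
    replace (mu + INR (S k) + 1) with (mu + INR k + 1 + 1) by (rewrite S_INR, RtoC_plus; ring). rewrite Ga_fe by auto.
    replace (mu + INR k + 1) with (RtoC (INR (S k) + mu)) at 1 by (rewrite S_INR, !RtoC_plus; ring).
    rewrite fact_simpl, mult_INR, !RtoC_mult, RtoC_div by lra.
    transitivity (RtoC (INR (S k)) * (RtoC (INR (fact k)) * Ga (mu + 1))); [|ring]. rewrite <- IHk. field. apply RtoC_nz; lra.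
Qed.

Section Bessel.
Variable ze : C.
Hypothesis Hz : (0 < Re ze)%R.
Let x : C := - (ze * ze / 4).
Let r : R := (4 * Cmod x)%R.
Let Hr : (0 <= r)%R. Proof. unfold r. generalize (Cmod_ge_0 x); lra. Qed.
Lemma J0_term_pow (c : R) k : (0 <= c <= 4)%R -> (Cmod (J0_term x k) * c ^ k <= r ^ k / INR (fact k))%R.
Proof.
  intros Hc. assert (F1 : (1 <= INR (fact k))%R). { replace 1%R with (INR 1) by reflexivity. apply le_INR. apply lt_O_fact. }
  rewrite J0_term_mod. replace (Cmod x ^ k / (INR (fact k) * INR (fact k)) * c ^ k)%R with ((c * Cmod x) ^ k / INR (fact k) * / INR (fact k))%R by (rewrite Rpow_mult_distr; field; lra).
  assert (A := Cmod_ge_0 x). assert (P : (0 <= (c * Cmod x) ^ k / INR (fact k))%R) by (apply Rdiv_le_0_compat; [apply pow_le, Rmult_le_pos; lra | lra]).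
  assert (I : (0 < / INR (fact k) <= 1)%R). { split. apply Rinv_0_lt_compat; lra. rewrite <- Rinv_1. apply Rinv_le_contravar; lra. }
  apply Rle_trans with ((c * Cmod x) ^ k / INR (fact k))%R. nra. unfold Rdiv. apply Rmult_le_compat_r. lra. apply pow_incr. split. apply Rmult_le_pos; lra. unfold r. apply Rmult_le_compat_r; lra.
Qed.
Lemma ser_J : exists l, cser (J0_term x) l.
Proof. destruct (cser_bounded (J0_term x) r 1 Hr ltac:(lra)) as [l [H _]]; eauto. intros k. rewrite Rmult_1_l. generalize (J0_term_pow 1 k ltac:(lra)). rewrite pow1. lra. Qed.
Lemma ser_H : exists l, cser (fun k => harmonic k * J0_term x k) l.
Proof.
  destruct (cser_bounded (fun k => harmonic k * J0_term x k) r 1 Hr ltac:(lra)) as [l [H _]]; eauto. intros k. rewrite Rmult_1_l, Cmod_mult, Cmod_R. assert (A := harmonic_bound k). rewrite Rabs_pos_eq by lra.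
  eapply Rle_trans; [|apply (J0_term_pow 2 k); lra]. rewrite Rmult_comm. apply Rmult_le_compat_l. apply Cmod_ge_0. generalize (INR_le_2pow k); lra.
Qed.

(** Gamma (1 + mu) (z/2)^(-mu) J_mu (z): the part of the Bessel function given by the series. *)
Definition J_factor (mu : R) : C := CSeries (fun k => J0_term x k * inv_poch k mu).
Lemma J_factor_series mu : (Rabs mu <= 1 / 2)%R -> cser (fun k => J0_term x k * inv_poch k mu) (J_factor mu).
Proof.
  intros Hm. destruct (cser_bounded (fun k => J0_term x k * inv_poch k mu) r 1 Hr ltac:(lra)) as [l [H _]].
  { intros k. rewrite Rmult_1_l, Cmod_mult, Cmod_R. assert (A := inv_poch_bound k mu Hm). rewrite Rabs_pos_eq by lra. eapply Rle_trans; [|apply (J0_term_pow 2 k); lra]. apply Rmult_le_compat_l. apply Cmod_ge_0. lra. }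
  unfold J_factor. rewrite (cser_CSeries _ _ H). auto.
Qed.
Lemma J_factor_taylor (J S1 : C) mu : cser (J0_term x) J -> cser (fun k => harmonic k * J0_term x k) S1 -> (Rabs mu <= 1 / 2)%R -> (Cmod (J_factor mu - J + mu * S1) <= mu ^ 2 * exp r)%R.
Proof.
  intros HJ HS Hm. assert (A := cser_lin 1 1 _ _ _ _ (J_factor_series mu Hm) (cser_lin (- (1)) mu _ _ _ _ HJ HS)).
  destruct (cser_bounded (fun k => 1 * (J0_term x k * inv_poch k mu) + 1 * (- (1) * J0_term x k + mu * (harmonic k * J0_term x k))) r (mu ^ 2) Hr (pow2_ge_0 mu)) as [l [B1 B2]].
  { intros k. replace (1 * (J0_term x k * inv_poch k mu) + 1 * (- (1) * J0_term x k + mu * (harmonic k * J0_term x k))) with (J0_term x k * RtoC (inv_poch k mu - 1 + mu * harmonic k)) by (rewrite RtoC_plus, RtoC_minus, RtoC_mult; ring).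
    rewrite Cmod_mult, Cmod_R. apply Rle_trans with (Cmod (J0_term x k) * (mu ^ 2 * 4 ^ k))%R. apply Rmult_le_compat_l. apply Cmod_ge_0. apply inv_poch_taylor; auto.
    replace (Cmod (J0_term x k) * (mu ^ 2 * 4 ^ k))%R with (mu ^ 2 * (Cmod (J0_term x k) * 4 ^ k))%R by ring. apply Rmult_le_compat_l. apply pow2_ge_0. apply J0_term_pow. lra. }
  rewrite <- (cser_unique _ _ _ A B1) in B2. replace (J_factor mu - J + mu * S1) with (1 * J_factor mu + 1 * (- (1) * J + mu * S1)) by ring. auto.
Qed.
Lemma rder_quad (f : R -> C) (l : C) (K d : R) : (0 < d)%R -> (0 <= K)%R -> (forall h, (Rabs h <= d)%R -> (Cmod (f h - f 0%R - l * h) <= K * h ^ 2)%R) -> rder f 0 l.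
Proof.
  clear. intros Hd HK B.
  assert (G : forall p : C -> R, (forall z w : C, p (z - w) = (p z - p w)%R) -> (forall (z : C) (k : R), p (z * k) = (p z * k)%R) -> (forall z, (Rabs (p z) <= Cmod z)%R) -> is_derive (fun t => p (f t)) 0%R (p l)).
  { intros p Pm Ps Pb. apply is_derive_Reals. intros e He. assert (Hm : (0 < Rmin d (e / (K + 1)))%R) by (apply Rmin_glb_lt; auto; apply Rdiv_lt_0_compat; lra).
    exists (mkposreal _ Hm). simpl. intros h Nh Hh. rewrite Rplus_0_l. assert (h1 := Rmin_l d (e / (K + 1))). assert (h2 := Rmin_r d (e / (K + 1))). assert (Ph := Rabs_pos_lt h Nh).
    specialize (B h ltac:(lra)). assert (X := Pb (f h - f 0%R - l * h)). rewrite !Pm, Ps in X.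
    replace ((p (f h) - p (f 0)) / h - p l)%R with ((p (f h) - p (f 0%R) - p l * h) / h)%R by (field; auto). rewrite Rabs_div by auto.
    apply Rle_lt_trans with (K * Rabs h)%R. apply Rmult_le_reg_r with (Rabs h); auto. unfold Rdiv. rewrite Rmult_assoc, Rinv_l by lra. replace (K * Rabs h * Rabs h)%R with (K * h ^ 2)%R. lra.
    rewrite Rmult_assoc, <- Rabs_mult, Rabs_pos_eq. ring. apply Rle_0_sqr.
    apply Rle_lt_trans with ((K + 1) * Rabs h - Rabs h)%R. lra. assert ((K + 1) * Rabs h < e)%R. { apply Rlt_le_trans with ((K + 1) * (e / (K + 1)))%R. apply Rmult_lt_compat_l; lra. right; field; lra. } lra. }
  split. apply (G Re). intros; unfold Re; simpl; ring. intros; unfold Re; simpl; ring. apply re_le_Cmod. apply (G Im). intros; unfold Im; simpl; ring. intros; unfold Im; simpl; ring. apply im_le_Cmod.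
Qed.

(** J_mu (ze) as a function of a real order near 0, in the form in which it is differentiated. *)
Definition BesselJ_real (mu : R) : C := Cexp (mu * Clog (ze / 2)) * (/ Ga (mu + 1) * J_factor mu).
Lemma BesselJ_real_eq mu : (Rabs mu <= 1 / 2)%R -> BesselJ mu ze = BesselJ_real mu.
Proof.
  intros Hm. assert (Hm2 := Hm). apply Rabs_le_between in Hm2. unfold BesselJ, BesselJ_real, Cpower. f_equal. apply cser_CSeries.
  assert (P0 : (0 < Re (mu + 1))%R) by (unfold Re; simpl; lra). assert (N0 := Ga_nz _ P0).
  apply (cser_ext (fun k => / Ga (mu + 1) * (J0_term x k * inv_poch k mu) + 0 * (J0_term x k * inv_poch k mu))).
  2:{ replace (/ Ga (mu + 1) * J_factor mu) with (/ Ga (mu + 1) * J_factor mu + 0 * J_factor mu) by ring. apply cser_lin; apply J_factor_series; auto. }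
  intros k. assert (P : (0 < Re (mu + INR k + 1))%R) by (unfold Re; simpl; generalize (pos_INR k); lra). rewrite Gamma_Ga by auto. assert (N := Ga_nz _ P).
  assert (E := Ga_inv_poch mu k Hm). assert (F := fact_nz k). unfold J0_term. fold x. rewrite RtoC_mult.
  replace (RtoC (inv_poch k mu)) with (RtoC (INR (fact k)) * Ga (mu + 1) / Ga (mu + INR k + 1)) by (rewrite <- E; field; auto). field. auto.
Qed.

(** The three contributions come from (z/2)^mu, from 1 / Gamma (1 + mu) and from
    [J_factor_taylor]. *)
Lemma rder_BesselJ_real (J S1 : C) : cser (J0_term x) J -> cser (fun k => harmonic k * J0_term x k) S1 -> BesselJ_real 0%R = J /\ rder BesselJ_real 0 ((Clog (ze / 2) - dGamma1) * J - S1).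
Proof.
  intros HJ HS. assert (Q0 : J_factor 0%R = J). { assert (B := J_factor_taylor J S1 0%R HJ HS ltac:(rewrite Rabs_R0; lra)). replace (0 ^ 2 * exp r)%R with 0%R in B by ring.
    assert (Z : J_factor 0%R - J + 0 * S1 = 0). { apply Cmod_eq_0. apply Rle_antisym; auto. apply Cmod_ge_0. } rewrite <- (Cplus_0_l J), <- Z. ring. }
  split. unfold BesselJ_real. rewrite Q0, Cmult_0_l, Cexp_0, Cplus_0_l, Ga_1. field.
  assert (DQ : rder J_factor 0 (- S1)).
  { apply (rder_quad J_factor (- S1) (exp r) (1 / 2)). lra. left; apply exp_pos. intros h Hh. rewrite Q0. replace (J_factor h - J - - S1 * h) with (J_factor h - J + h * S1) by ring. rewrite Rmult_comm. apply J_factor_taylor; auto. }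
  assert (DG : rder (fun mu : R => / Ga (mu + 1)) 0 (- dGamma1)).
  { assert (G1 : Ga 1 <> 0) by (rewrite Ga_1; apply RtoC_nz; lra). assert (D := cder_inv Ga 1 dGamma1 cder_Ga G1). rewrite Ga_1 in D.
    apply (rder_eq _ _ (- dGamma1 / (1 * 1) * (1 + 0))). field. apply (rder_comp (fun z => / Ga z) (fun mu : R => mu + 1)). replace (0 + 1) with (RtoC 1) by ring. exact D.
    apply rder_plus. apply rder_id. apply rder_const. }
  assert (DE : rder (fun mu : R => Cexp (mu * Clog (ze / 2))) 0 (Clog (ze / 2) * Cexp (0 * Clog (ze / 2)))) by apply rder_Cexp_line.
  refine (rder_eq _ _ _ _ _ (rder_mult _ _ _ _ _ DE (rder_mult _ _ _ _ _ DG DQ))). rewrite Q0, Cmult_0_l, Cexp_0, Cplus_0_l, Ga_1. field.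
Qed.
Lemma Csin_R (y : R) : Csin y = RtoC (sin y).
Proof. unfold Csin. replace (- Ci * RtoC y) with (Ci * RtoC (- y)) by (rewrite RtoC_opp; ring). rewrite !Cexp_Ci, cos_neg, sin_neg. assert (N : Ci <> 0) by (intro E; apply (f_equal Im) in E; simpl in E; lra).
  replace ((cos y, sin y) - (cos y, (- sin y)%R)) with (2 * Ci * RtoC (sin y)) by (c_ring). field. auto. Qed.

(** s = 1 and s = -1 give the two Hankel functions. Numerator and denominator vanish at mu = 0, so
    the limit is the quotient of their derivatives. *)
Lemma Hankel_lim (s : R) (J L : C) : (s = 1 \/ s = -1)%R -> BesselJ_real 0%R = J -> rder BesselJ_real 0 L ->
  C_lim (fun mu => (BesselJ (- mu) ze - Cexp (- s * Ci * PI * mu) * BesselJ mu ze) / (s * Ci * Csin (PI * mu))) 0 = J + 2 * s * Ci / PI * L.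
Proof.
  intros Hs HJ HL. assert (PP := PI_RGT_0). assert (NP : RtoC PI <> 0) by (apply RtoC_nz; lra). assert (Ns : RtoC s <> 0) by (apply RtoC_nz; destruct Hs; subst; lra).
  assert (Ni : Ci <> 0) by (intro E; apply (f_equal Im) in E; simpl in E; lra). assert (ss : RtoC s * RtoC s = 1) by (rewrite <- RtoC_mult; f_equal; destruct Hs; subst; ring).
  rewrite (C_lim_quot _ (fun mu : R => BesselJ_real (- mu)%R - Cexp (mu * (- s * Ci * PI)) * BesselJ_real mu) (fun mu : R => s * Ci * RtoC (sin (PI * mu))) (- L - (- s * Ci * PI * J + L)) (s * Ci * PI) (1 / 2)).
  - assert (E : 2 * s * Ci / PI * L = - (2) * L / (s * Ci * PI)).
    { transitivity (- (2) * L * ((RtoC s * RtoC s) * - (Ci * Ci)) / (s * Ci * PI)). field; auto. rewrite ss, Ci_sq. field; auto. }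
    rewrite E. field; auto.
  - lra.
  - apply rder_minus. apply rder_neg. rewrite Ropp_0. exact HL.
    assert (DE := rder_Cexp_line (- s * Ci * PI) 0). refine (rder_eq _ _ _ _ _ (rder_mult _ _ _ _ _ DE HL)). rewrite Cmult_0_l, Cexp_0, HJ. ring.
  - apply rder_scal, rder_R. auto_derive; auto. rewrite Rmult_0_r, cos_0. ring.
  - rewrite Ropp_0, Cmult_0_l, Cexp_0. ring.
  - rewrite Rmult_0_r, sin_0. ring.
  - repeat apply Cmult_neq_0; auto.
  - intros mu Nm Hm. rewrite <- RtoC_opp, !BesselJ_real_eq by (rewrite ?Rabs_Ropp; lra). rewrite <- RtoC_mult, Csin_R. do 4 f_equal. ring.
Qed.

(** The J_0 parts of the two Hankel functions cancel in their difference. *)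
Lemma BesselY_0 (J S1 : C) : cser (J0_term x) J -> cser (fun k => harmonic k * J0_term x k) S1 -> BesselY 0 ze = 2 / PI * ((Clog (ze / 2) - dGamma1) * J - S1).
Proof.
  intros HJ HS. destruct (rder_BesselJ_real J S1 HJ HS) as [F0 DF]. set (L := (Clog (ze / 2) - dGamma1) * J - S1) in *. assert (PP := PI_RGT_0). assert (NP : RtoC PI <> 0) by (apply RtoC_nz; lra).
  assert (A1 : Hankel1 0 ze = J + 2 * Ci / PI * L).
  { unfold Hankel1. transitivity (C_lim (fun mu => (BesselJ (- mu) ze - Cexp (- (1%R) * Ci * PI * mu) * BesselJ mu ze) / (1%R * Ci * Csin (PI * mu))) 0).
    f_equal. apply functional_extensionality. intros mu. f_equal. do 3 f_equal. ring. f_equal. ring. rewrite (Hankel_lim 1 J L); auto. field. auto. }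
  assert (A2 : Hankel2 0 ze = J - 2 * Ci / PI * L).
  { unfold Hankel2. transitivity (C_lim (fun mu => (BesselJ (- mu) ze - Cexp (- ((-1)%R) * Ci * PI * mu) * BesselJ mu ze) / ((-1)%R * Ci * Csin (PI * mu))) 0).
    f_equal. apply functional_extensionality. intros mu. f_equal. do 3 f_equal. c_ring. f_equal. c_ring. rewrite (Hankel_lim (-1) J L); auto. c_field; lra. }
  unfold BesselY. rewrite A1, A2. transitivity (- (2) * (Ci * Ci) / PI * L). field; auto. rewrite Ci_sq. field. auto.
Qed.
End Bessel.

(** * Conjugation and conclusion *)

Lemma re_conj (z : C) : Re (Cconj z) = Re z. Proof. reflexivity. Qed.
Lemma im_conj (z : C) : Im (Cconj z) = (- Im z)%R. Proof. reflexivity. Qed.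
Lemma quad_conj M f : quad M f -> quad M (fun x => Cconj (f x)).
Proof. intros [A B]. split. intros x. unfold Cconj. apply ct_pair. apply (ct_re f), A. apply ct_Ropp, (ct_im f), A. intros x. rewrite Cmod_conj. apply B. Qed.
Lemma LI_conj M f : quad M f -> LI (fun x => Cconj (f x)) = Cconj (LI f).
Proof.
  intros Q. apply (LI_unique _ _ _ (quad_conj _ _ Q)). intros e He. destruct (LI_approx _ _ Q e He) as [N [HN H]]. exists N. intros n Hn.
  assert (E : CInt (fun x => Cconj (f x)) (- n) n = Cconj (CInt f (- n) n)).
  { assert (Cc : rcont (fun x => Cconj (f x))) by apply (quad_conj _ _ Q). assert (Cf : rcont f) by apply Q. apply C_ext.
    - rewrite re_conj, !ci_re by auto. reflexivity.
    - rewrite im_conj, !ci_im by auto. apply (RInt_opp (V := R_CompleteNormedModule)). apply (ex_RInt_continuous (V := R_CompleteNormedModule)). intros z _. apply (ct_im f), Cf. }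
  rewrite E, <- Cminus_conj, Cmod_conj, Cmod_minus_sym. apply H; lra.
Qed.
Lemma Ga_conj (z : C) : (0 < Re z)%R -> Ga (Cconj z) = Cconj (Ga z).
Proof.
  intros H. unfold Ga. rewrite <- (LI_conj _ _ (Ga_quad z H)). apply LI_ext. intros x. rewrite <- Cexp_conj. f_equal. c_ring.
Qed.
Lemma mf_conj (la x : C) : (0 < Re la)%R -> mf (Cconj la) (Cconj x) = Cconj (mf la x).
Proof.
  intros H. unfold mf. rewrite <- (LI_conj _ _ (mf_quad la x H)). apply LI_ext. intros p. unfold mker. rewrite Cmult_conj, <- !Cexp_conj. f_equal; f_equal; c_ring.
Qed.
Lemma cylinder_conj (nu z : C) : (0 < Re (- nu) < 1)%R -> z <> 0 -> parabolic_cylinder (Cconj nu) (Cconj z) = Cconj (parabolic_cylinder nu z).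
Proof.
  intros H Hz. assert (Hz' : Cconj z <> 0). { intro E. apply Hz. transitivity (Cconj (Cconj z)). c_ring. rewrite E. c_ring. }
  assert (En : - Cconj nu = Cconj (- nu)) by (c_ring).
  rewrite !cylinder_eq by (rewrite ?En, ?re_conj; auto). rewrite En, mf_conj, Ga_conj by lra.
  rewrite Cdiv_conj by (apply Ga_nz; lra). rewrite Cmult_conj, <- Cexp_conj. do 3 f_equal. rewrite Copp_conj, Cdiv_conj, Cmult_conj by (apply RtoC_nz; lra). f_equal. f_equal. c_ring.
Qed.
Lemma Gamma_conj (z : C) : (0 < Re z)%R -> Gamma (Cconj z) = Cconj (Gamma z).
Proof. intros H. rewrite !Gamma_Ga by (rewrite ?re_conj; auto). apply Ga_conj; auto. Qed.
Lemma Clog_conj (z : C) : (0 < Re z)%R -> Clog (Cconj z) = Cconj (Clog z).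
Proof.
  intros H. rewrite <- (Clog_Cexp (Cconj (Clog z))). rewrite Cexp_conj, Cexp_Clog by (apply re_nz; auto). reflexivity. rewrite im_conj, Rabs_Ropp. apply Clog_im; auto.
Qed.
Lemma dGamma1_conj : Cconj dGamma1 = dGamma1.
Proof.
  destruct (moment_quad 1 one_re) as [M Q]. rewrite <- dGamma1_eq, <- (LI_conj _ _ Q). apply LI_ext. intros x. rewrite Cmult_conj, <- Cexp_conj. f_equal; f_equal; c_ring.
Qed.

Definition term_plus (xi eta s : C) : C := Gamma (1 / 4 - s) * Gamma (1 / 4 + s) * (parabolic_cylinder (2 * s - 1 / 2) ((1 + Ci) * xi) * parabolic_cylinder (- 2 * s - 1 / 2) ((1 + Ci) * eta)).

(** Conjugation exchanges 1 + i and 1 - i, and commutes with Gamma and with the cylinder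
    functions. *)
Lemma term_plus_conj (xi eta s : C) : (0 < Re xi)%R -> (0 < Re eta)%R -> (Rabs (Re s) < 1 / 4)%R -> term_plus xi eta s = Cconj (term_minus (Cconj xi) (Cconj eta) (Cconj s)).
Proof.
  intros Hx He Hs. apply Rabs_def2 in Hs.
  assert (N : forall z : C, (0 < Re z)%R -> (1 - Ci) * Cconj z <> 0).
  { intros z Hz. apply Cmult_neq_0. intro E. apply (f_equal Im) in E. simpl in E. lra. apply re_nz. rewrite re_conj; auto. }
  unfold term_minus. rewrite !Cmult_conj, <- !cylinder_conj, <- !Gamma_conj by (try apply N; auto; unfold Re in *; simpl; lra). unfold term_plus.
  f_equal; f_equal; f_equal; c_field.
Qed.

Section Value.
Variable ze : C.
Hypothesis Hz : (0 < Re ze)%R.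
Variables J S1 : C.
Hypothesis HJ : cser (J0_term (- (ze * ze / 4))) J.
Hypothesis HS : cser (fun k => harmonic k * J0_term (- (ze * ze / 4)) k) S1.

(** J and S1 are the sums of the series of J_0 (ze) and of the same series with harmonic numbers. *)
Lemma Phi_value : Phi 0 ze = e4 * (Ci * RtoC (PI / 2) * J - ((Clog (ze / 2) - dGamma1) * J - S1)).
Proof.
  assert (P := Phi_series ze Hz). assert (L := cser_lin (e4 * b0 ze) e4 _ _ _ _ HJ HS).
  assert (E : cser (fun k => e4 * ((b0 ze + harmonic k) * J0_term (- (ze * ze / 4)) k)) (e4 * b0 ze * J + e4 * S1)).
  { eapply cser_ext; [|exact L]. intros k. cbv beta. ring. }
  rewrite (cser_unique _ _ _ P E).
  unfold b0. replace (Clog (ze / 2)) with (Clog ze - RtoC (ln 2)). ring.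
  replace (ze / 2) with (RtoC (/ 2) * ze) by (rewrite RtoC_inv by lra; field). rewrite Clog_scale by lra. rewrite ln_Rinv, RtoC_opp by lra. ring.
Qed.
End Value.
Lemma Cpow_Cconj (x : C) k : Cconj (x ^ k) = Cconj x ^ k.
Proof. induction k; simpl. c_ring. rewrite Cmult_conj, IHk. reflexivity. Qed.
Lemma J0_term_conj (x : C) k : J0_term (Cconj x) k = Cconj (J0_term x k).
Proof.
  unfold J0_term. rewrite Cdiv_conj, Cpow_Cconj. f_equal. c_ring. apply RtoC_nz. assert (A := INR_fact_neq_0 k). nra.
Qed.

Theorem corollary8 (xi eta sigma : C)
  (hxi : (Rabs (Im eta) < Re xi)%R)
  (heta : (Rabs (Im xi) < Re eta)%R)
  (hsigma : (Rabs (Re sigma) < 1 / 4)%R) :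
  exists I : C,
    is_vertical_integral
      (fun s : C =>
         Gamma (1 / 4 - s) * Gamma (1 / 4 + s) *
         (parabolic_cylinder (2 * s - 1 / 2) ((1 - Ci) * xi) *
          parabolic_cylinder (- 2 * s - 1 / 2) ((1 - Ci) * eta) +
          parabolic_cylinder (2 * s - 1 / 2) ((1 + Ci) * xi) *
          parabolic_cylinder (- 2 * s - 1 / 2) ((1 + Ci) * eta)))%C
      sigma I /\
    BesselY 0 (1 / 2 * (xi * xi + eta * eta))%C
    = (Ci / (sqrt 2 * (PI * PI)) * I)%C.
Proof.
  (* A margin in the two hypotheses; it controls the decay of all integrands. *)
  set (m := Rmin (Re xi - Rabs (Im eta)) (Re eta - Rabs (Im xi))). assert (Hm : (0 < m)%R) by (apply Rmin_glb_lt; lra).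
  assert (m1 := Rmin_l (Re xi - Rabs (Im eta)) (Re eta - Rabs (Im xi))). assert (m2 := Rmin_r (Re xi - Rabs (Im eta)) (Re eta - Rabs (Im xi))). fold m in m1, m2.
  assert (H1 : (m + Rabs (Im eta) <= Re xi)%R) by lra. assert (H2 : (m + Rabs (Im xi) <= Re eta)%R) by lra.
  assert (H1' : (m + Rabs (Im (Cconj eta)) <= Re (Cconj xi))%R) by (rewrite im_conj, Rabs_Ropp, re_conj; auto). assert (H2' : (m + Rabs (Im (Cconj xi)) <= Re (Cconj eta))%R) by (rewrite im_conj, Rabs_Ropp, re_conj; auto).
  assert (X0 : (0 < Re xi)%R) by (generalize (Rabs_pos (Im eta)); lra). assert (E0 : (0 < Re eta)%R) by (generalize (Rabs_pos (Im xi)); lra).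
  set (ze := zeta xi eta). assert (Hz : (0 < Re ze)%R) by (apply (zeta_re xi eta m); auto).
  assert (Ez : zeta (Cconj xi) (Cconj eta) = Cconj ze) by (unfold ze, zeta; c_field).
  assert (Hz' : (0 < Re (Cconj ze))%R) by (rewrite re_conj; auto).
  assert (PP := PI_RGT_0). assert (S2 := sqrt2_pos). assert (SS := sqrt2_sq).
  destruct (ser_J ze) as [J HJ]. destruct (ser_H ze) as [S1 HS].
  assert (Ex : - (Cconj ze * Cconj ze / 4) = Cconj (- (ze * ze / 4))) by (c_field).
  assert (HJ' : cser (J0_term (- (Cconj ze * Cconj ze / 4))) (Cconj J)) by (rewrite Ex; apply (cser_ext (fun k => Cconj (J0_term (- (ze * ze / 4)) k))); [intros k; rewrite J0_term_conj; auto | apply cser_conj; auto]).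
  assert (HS' : cser (fun k => harmonic k * J0_term (- (Cconj ze * Cconj ze / 4)) k) (Cconj S1)).
  { rewrite Ex. apply (cser_ext (fun k => Cconj (harmonic k * J0_term (- (ze * ze / 4)) k))). intros k; rewrite Cmult_conj, J0_term_conj. f_equal. c_ring. apply cser_conj; auto. }
  destruct (term_minus_Phi xi eta m Hm H1 H2 sigma hsigma) as [[M1 Q1] E1].
  destruct (term_minus_Phi (Cconj xi) (Cconj eta) m Hm H1' H2' (Cconj sigma)) as [[M2 Q2] E2]. rewrite re_conj; auto.
  assert (Q3 := quad_conj _ _ (quad_opp_arg _ _ Q2)). cbv beta in Q3.
  (* Conjugation reverses the direction of the vertical line. *)
  assert (ET : forall t : R, Cconj (term_minus (Cconj xi) (Cconj eta) (Cconj sigma + Ci * (- t)%R)) = term_plus xi eta (sigma + Ci * t)).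
  { intros t. rewrite term_plus_conj; auto. do 2 f_equal. c_ring. replace (Re (sigma + Ci * t)) with (Re sigma) by (unfold Re; simpl; ring). auto. }
  assert (E3 : LI (fun t : R => term_plus xi eta (sigma + Ci * t)) = Cconj (RtoC (PI * sqrt 2) * Cexp (Ci * RtoC (PI / 4)) * Phi 0 (Cconj ze))).
  { rewrite <- (LI_ext _ _ ET), (LI_conj _ _ (quad_opp_arg _ _ Q2)), (LI_opp _ _ Q2), E2, Ez. reflexivity. }
  apply (quad_ext _ _ _ ET) in Q3.
  set (y := (Clog (ze / 2) - dGamma1) * J - S1).
  (* The factor in front of Phi cancels the phase of [Phi_value]. *)
  assert (N4 : Cexp (Ci * RtoC (PI / 4)) * e4 = 1). { unfold e4. rewrite <- Cexp_plus. replace (Ci * RtoC (PI / 4) + - (Ci * RtoC (PI / 4))) with (RtoC 0) by ring. apply Cexp_0. }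
  assert (V1 : LI (fun t : R => term_minus xi eta (sigma + Ci * t)) = RtoC (PI * sqrt 2) * (Ci * RtoC (PI / 2) * J - y)).
  { rewrite E1. fold ze. rewrite (Phi_value ze Hz J S1 HJ HS). fold y. transitivity (RtoC (PI * sqrt 2) * (Cexp (Ci * RtoC (PI / 4)) * e4) * (Ci * RtoC (PI / 2) * J - y)). ring. rewrite N4. ring. }
  assert (V2 : LI (fun t : R => term_plus xi eta (sigma + Ci * t)) = RtoC (PI * sqrt 2) * (- Ci * RtoC (PI / 2) * J - y)).
  { rewrite E3, (Phi_value (Cconj ze) Hz' (Cconj J) (Cconj S1) HJ' HS').
    replace (RtoC (PI * sqrt 2) * Cexp (Ci * RtoC (PI / 4)) * (e4 * (Ci * RtoC (PI / 2) * Cconj J - ((Clog (Cconj ze / 2) - dGamma1) * Cconj J - Cconj S1)))) with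
      (RtoC (PI * sqrt 2) * (Cexp (Ci * RtoC (PI / 4)) * e4) * (Ci * RtoC (PI / 2) * Cconj J - ((Clog (Cconj ze / 2) - dGamma1) * Cconj J - Cconj S1))) by ring. rewrite N4.
    replace (Cconj ze / 2) with (Cconj (ze / 2)) by (c_field).
    rewrite Clog_conj. 2:{ unfold Cdiv. rewrite <- RtoC_inv, re_scal_r by lra. apply Rmult_lt_0_compat; lra. }
    rewrite <- dGamma1_conj at 1. unfold y. generalize (Clog (ze / 2)) dGamma1. intros l g. c_field. }
  set (F := fun t : R => Ci * (1 * term_minus xi eta (sigma + Ci * t) + 1 * term_plus xi eta (sigma + Ci * t))).
  assert (QF := quad_scal _ Ci _ (quad_plus _ _ _ _ (quad_scal _ 1 _ Q1) (quad_scal _ 1 _ Q3))). cbv beta in QF. fold F in QF.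
  exists (LI F). split.
  - unfold is_vertical_integral. assert (L := LI_is _ _ QF). unfold is_LI in L.
    replace (fun t : R => _) with F. exact L. apply functional_extensionality. intros t. unfold F, term_minus, term_plus. ring.
  - replace (1 / 2 * (xi * xi + eta * eta)) with ze by (unfold ze, zeta; field). rewrite (BesselY_0 ze J S1 HJ HS). fold y.
    unfold F. rewrite (LI_scal _ Ci _ (quad_plus _ _ _ _ (quad_scal _ 1 _ Q1) (quad_scal _ 1 _ Q3))), (LI_plus _ _ _ _ (quad_scal _ 1 _ Q1) (quad_scal _ 1 _ Q3)), (LI_scal _ 1 _ Q1), (LI_scal _ 1 _ Q3), V1, V2.
    rewrite RtoC_mult.
    assert (NP : RtoC PI <> 0) by (apply RtoC_nz; lra). assert (Ns : RtoC (sqrt 2) <> 0) by (apply RtoC_nz; lra).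
    transitivity (- (Ci * Ci) * (2 * y / PI)). rewrite Ci_sq. field; auto. field; auto.
Qed.
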